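(* Let $\rho$ be a measure on $(\mathbb{R},\mathcal{B}(\mathbb{R}))$ (finite or $\sigma$-finite) with all moments finite and $\rho(\{0\})=0$, let $\sigma$ be a non-atomic Radon measure on $\mathbb{R}^d$, and let $d\widehat\sigma(s,x)=d\rho(s)\,d\sigma(x)$ on $\mathbb{R}^{d+1}=\mathbb{R}\times\mathbb{R}^d$. Let $\widehat\varphi\in\mathcal{D}(\mathbb{R}^{d+1})$ and let $g\in L^2(\Omega,\mu_{CP})$ be such that $U_\Sigma g\in\mathrm{Dom}(I_{\widehat\sigma}a^+(\widehat\varphi)I_{\widehat\sigma}^{-1})$. Then the operator $U_\Sigma^{-1}(\nabla^{P}_{\widehat\varphi})^*U_\Sigma$ has the following representation, where $\widehat\gamma=\Sigma^{-1}\omega$: $$\big(U_\Sigma^{-1}(\nabla^{P}_{\widehat\varphi})^*U_\Sigma g\big)(\omega)=\int_{\mathbb{R}^{d+1}}g(\omega-s\varepsilon_x)\,\widehat\varphi(s,x)\,d\widehat\gamma(s,x)-g(\omega)\,\langle\widehat\varphi\rangle_{\widehat\sigma},\qquad \langle\widehat\varphi\rangle_{\widehat\sigma}=\int_{\mathbb{R}^{d+1}}\widehat\varphi\,d\widehat\sigma.$$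
   Context: $\mathcal{D}(\mathbb{R}^k)=C_0^\infty(\mathbb{R}^k)$, $\mathcal{D}=\mathcal{D}(\mathbb{R}^d)$, $\mathcal{D}'$ is the dual of $\mathcal{D}$, $\langle\cdot,\cdot\rangle$ is the dual pairing, and $\varepsilon_x$ is the Dirac measure at $x$. Moments of $\rho$ are the integrals of $|s|^n$, $n\ge1$. Configurations: $\Gamma_{\mathbb{R}^{d+1}}$ is the set of all locally finite subsets $\widehat\gamma$ of $\mathbb{R}^{d+1}$ (finite intersection with every compact set), each identified with the measure $\sum_{\widehat x\in\widehat\gamma}\varepsilon_{\widehat x}$; write $\widehat x=(s,x)\in\mathbb{R}\times\mathbb{R}^d$. $\pi_{\widehat\sigma}$ is the Poisson measure on $\Gamma_{\mathbb{R}^{d+1}}$ with intensity $\widehat\sigma$, with Laplace transform $\int e^{\langle\widehat\gamma,\widehat\psi\rangle}\,d\pi_{\widehat\sigma}(\widehat\gamma)=\exp\big(\int_{\mathbb{R}^{d+1}}(e^{\widehat\psi(\widehat x)}-1)\,d\widehat\sigma(\widehat x)\big)$, $\widehat\psi\in\mathcal{D}(\mathbb{R}^{d+1})$. It is concentrated on $\widehat\Gamma$, the set of those $\widehat\gamma=\sum_i\varepsilon_{(s_i,x_i)}\in\Gamma_{\mathbb{R}^{d+1}}$ with $x_i\ne x_j$ for $i\ne j$. Compound Poisson space: $\mu_{CP}$ is the measure on $\mathcal{D}'$ with Laplace transform $\int e^{\langle\omega,\varphi\rangle}\,d\mu_{CP}(\omega)=\exp\big(\int_{\mathbb{R}^d}\int_{\mathbb{R}}(e^{s\varphi(x)}-1)\,d\rho(s)\,d\sigma(x)\big)$,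 $\varphi\in\mathcal{D}$. It has full measure on $\Omega$, the set of those $\sum_{x\in\gamma}s_x\varepsilon_x\in\mathcal{D}'$ with $s_x\in\mathrm{supp}\,\rho$, where $\gamma\subset\mathbb{R}^d$ is locally finite if $\rho(\mathbb{R})<\infty$ and locally countable if $\rho(\mathbb{R})=\infty$. It is the image of $\pi_{\widehat\sigma}$ under the map $\Sigma:\widehat\Gamma\to\Sigma\widehat\Gamma=\Omega\subset\mathcal{D}'$, $\Sigma\widehat\gamma=\sum_{(s_i,x_i)\in\widehat\gamma}s_i\varepsilon_{x_i}$, which has an inverse $\Sigma^{-1}:\Omega\to\widehat\Gamma$. The map $U_\Sigma:L^2(\Omega,\mu_{CP})\to L^2(\widehat\Gamma,\pi_{\widehat\sigma})$, $U_\Sigma h=h\circ\Sigma$, is unitary with inverse $U_\Sigma^{-1}\widehat f=\widehat f\circ\Sigma^{-1}$. Poisson-space operators: $(\nabla^{P}_{\widehat\varphi}\widehat f)(\widehat\gamma)=\int_{\mathbb{R}^{d+1}}(\widehat f(\widehat\gamma+\varepsilon_{\widehat x})-\widehat f(\widehat\gamma))\widehat\varphi(\widehat x)\,d\widehat\sigma(\widehat x)$ on smooth cylinder functions $\widehat f(\widehat\gamma)=F(\langle\widehat\gamma,\widehat\varphi_1\rangle,\dots,\langle\widehat\gamma,\widehat\varphi_N\rangle)$, with $\widehat\varphi_i\in\mathcal{D}(\mathbb{R}^{d+1})$ and $F$ a $C^\infty$-function on $\mathbb{R}^N$ with bounded derivatives; $(\nabla^{P}_{\widehat\varphi})^*$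 is its adjoint in $L^2(\pi_{\widehat\sigma})$, the creation operator on Poisson space. Fock space: $\mathrm{Exp}L^2(\widehat\sigma)=\bigoplus_{n\ge0}L^2(\widehat\sigma)_{\mathbb{C}}^{\widehat\otimes n}$ (symmetric tensor powers, the $0$-th being $\mathbb{C}$) with squared norm $\sum_n n!\,|f^{(n)}|^2_{L^2(\widehat\sigma^{\otimes n})}$. The unitary isomorphism $I_{\widehat\sigma}:\mathrm{Exp}L^2(\widehat\sigma)\to L^2(\pi_{\widehat\sigma})$ maps $(f^{(n)})_n$ to $\sum_n\langle C_n^{\widehat\sigma}(\cdot),f^{(n)}\rangle$, where the generalized Charlier kernels $C_n^{\widehat\sigma}$ are defined by $\exp(\langle\widehat\gamma,\log(1+\widehat\psi)\rangle-\langle\widehat\psi\rangle_{\widehat\sigma})=\sum_n\frac1{n!}\langle C_n^{\widehat\sigma}(\widehat\gamma),\widehat\psi^{\otimes n}\rangle$ for $\widehat\psi\in\mathcal{D}(\mathbb{R}^{d+1})$ near $0$, and $\langle C_n^{\widehat\sigma}(\cdot),f^{(n)}\rangle$ is extended in the $L^2(\pi_{\widehat\sigma})$ sense. The creation operator $a^+(\widehat\varphi)$ is the adjoint in $\mathrm{Exp}L^2(\widehat\sigma)$ of the annihilation operator $a^-(\widehat\varphi)\,\widehat\otimes_{i=1}^nf_i=\sum_{j=1}^n\langle\widehat\varphi,f_j\rangle\,\widehat\otimes_{i\ne j}f_i$, where here $\langle\widehat\varphi,f_j\rangle=\int\widehat\varphi f_j\,d\widehat\sigma$, defined on sequences with finitely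 many nonzero entries; it acts as $a^+(\widehat\varphi)f^{(n)}=\widehat\varphi\,\widehat\otimes f^{(n)}$.
   Formalization: If ρ(ℝ)=∞, σ̂ is infinite on compact sets meeting {s=0}, so no Poisson measure exists on Γ over ℝ^{d+1}; there configurations and Poisson-space test functions live on (ℝ∖{0})×ℝ^d, and φ̂ is assumed σ̂-integrable so that ⟨φ̂⟩_σ̂ is defined. *)

(* Defs.v *)
(* R^d is 'rV[R]_d and R^{d+1} is R * 'rV[R]_d, a point
   being written z = (s, x).  Classes in L^2 are handled through
   representatives; L^2 spaces are complex, as the Fock space is. *)
From HB Require Import structures.
From mathcomp Require Import all_boot all_order all_algebra.
From mathcomp Require Import fingroup perm.
From mathcomp Require Import all_classical all_reals all_analysis.
From mathcomp Require Import complex.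

Set Implicit Arguments.
Unset Strict Implicit.
Unset Printing Implicit Defensive.
Import Order.TTheory GRing.Theory Num.Theory.
Import numFieldNormedType.Exports.
Local Open Scope classical_set_scope.
Local Open Scope ring_scope.
Local Open Scope complex_scope.

HB.instance Definition _ (R : realType) (d : nat) :=
  @isMeasurable.Build (sigma_display (@open 'rV[R]_d)) 'rV[R]_d
    <<s @open 'rV[R]_d >> (@sigma_algebra0 _ setT _) (@sigma_algebraC _ _)
    (@sigma_algebra_bigcup _ setT _).

Section ComplexL2.
Context {R : realType} {disp : measure_display} {T : measurableType disp}.
Variable mu : {measure set T -> \bar R}.
Implicit Types f g : T -> R[i].

Definition cmeasurable f : Prop :=
  measurable_fun setT (fun t => complex.Re (f t)) /\
  measurable_fun setT (fun t => complex.Im (f t)).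

Definition cintegrable f : Prop :=
  mu.-integrable setT (fun t => (complex.Re (f t))%:E) /\
  mu.-integrable setT (fun t => (complex.Im (f t))%:E).

Definition cint f : R[i] :=
  (\int[mu]_t complex.Re (f t))%R +i* (\int[mu]_t complex.Im (f t))%R.

Definition sqnormc (z : R[i]) : R := complex.Re z ^+ 2 + complex.Im z ^+ 2.

Definition sqnormL2 f : \bar R := (\int[mu]_t (sqnormc (f t))%:E)%E.

Definition inL2 f : Prop := cmeasurable f /\ (sqnormL2 f < +oo)%E.

Definition dotL2 f g : R[i] := cint (fun t => f t * conjc (g t)).

Definition cvgL2 (u : nat -> T -> R[i]) f : Prop :=
  (fun k => sqnormL2 (fun t => u k t - f t)) @ \oo --> 0%E.

Lemma cintegrableD f g : cintegrable f -> cintegrable g ->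
  cintegrable (fun t => f t + g t).
Proof.
move=> [f1 f2] [g1 g2]; split.
  apply: eq_integrable (integrableD measurableT f1 g1) => // t _ /=.
  by case: (f t) (g t) => ? ? [].
apply: eq_integrable (integrableD measurableT f2 g2) => // t _ /=.
by case: (f t) (g t) => ? ? [].
Qed.

Lemma cintD f g : cintegrable f -> cintegrable g ->
  cint (fun t => f t + g t) = cint f + cint g.
Proof.
move=> [f1 f2] [g1 g2]; rewrite /cint.
have addE (a b c e : R) : (a +i* b) + (c +i* e) = (a + c) +i* (b + e) by [].
rewrite addE -!RintegralD//.
by apply/eqP; rewrite eq_complex /=; apply/andP; split; apply/eqP;
  apply: eq_Rintegral => t _; case: (f t) (g t) => ? ? [].
Qed.

Lemma cintegrableZ (c : R[i]) f : cintegrable f ->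
  cintegrable (fun t => c * f t).
Proof.
case: c => a b [f1 f2]; split.
  apply: eq_integrable (integrableB measurableT (integrableZl measurableT a f1)
    (integrableZl measurableT b f2)) => // t _ /=.
  by case: (f t) => ? ?.
apply: eq_integrable (integrableD measurableT (integrableZl measurableT a f2)
  (integrableZl measurableT b f1)) => // t _ /=.
by case: (f t) => ? ?.
Qed.

Lemma cintZ (c : R[i]) f : cintegrable f ->
  cint (fun t => c * f t) = c * cint f.
Proof.
case: c => a b [f1 f2]; rewrite /cint.
have mulE (x y : R) :
  (a +i* b) * (x +i* y) = (a * x - b * y) +i* (a * y + b * x) by [].
rewrite mulE.
have rl (e : R) (h : T -> R) : mu.-integrable setT (EFin \o h) ->
    mu.-integrable setT (EFin \o (fun t => e * h t)).
  by move=> ih; apply: eq_integrable (integrableZl measurableT e ih).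
rewrite -!RintegralZl// -RintegralB//; [|exact: rl..].
rewrite -RintegralD//; [|exact: rl..].
by apply/eqP; rewrite eq_complex /=; apply/andP; split; apply/eqP;
  apply: eq_Rintegral => t _; case: (f t) => ? ?.
Qed.

Lemma cint_sum (I : Type) (r : seq I) (c : I -> R[i]) (F : I -> T -> R[i]) :
  (forall i, cintegrable (F i)) ->
  cintegrable (fun t => \sum_(i <- r) c i * F i t) /\
  cint (fun t => \sum_(i <- r) c i * F i t) = \sum_(i <- r) c i * cint (F i).
Proof.
move=> iF; elim: r => [|i r [IH1 IH2]].
  under eq_fun do rewrite big_nil.
  rewrite big_nil; split; last by rewrite /cint /Rintegral /= integral0.
  by split; exact: integrable0.
under eq_fun do rewrite big_cons.
rewrite big_cons; split; first exact/cintegrableD/IH1/cintegrableZ.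
by rewrite cintD ?cintZ ?IH2//; exact: cintegrableZ.
Qed.

End ComplexL2.

(* The library's product measure, with its sigma-finiteness recorded. *)
Section ProductMeasure.
Local Open Scope ereal_scope.
Context {R : realType} {d1 d2 : measure_display}.
Context {T1 : measurableType d1} {T2 : measurableType d2}.
Variables (m1 : {sigma_finite_measure set T1 -> \bar R}).
Variables (m2 : {sigma_finite_measure set T2 -> \bar R}).

Definition sprod : set (T1 * T2) -> \bar R := m1 \x m2.

Let sprod0 : sprod set0 = 0. Proof. exact: measure0. Qed.

Let sprod_ge0 A : 0 <= sprod A. Proof. exact: measure_ge0. Qed.

Let sprod_sigma_additive : semi_sigma_additive sprod.
Proof. exact: measure_semi_sigma_additive. Qed.

HB.instance Definition _ := isMeasure.Build _ _ _ sprod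
  sprod0 sprod_ge0 sprod_sigma_additive.

Let sprod_sigma_finite : sigma_finite setT sprod.
Proof.
have /sigma_finiteP[F [TF ndF Foo]] := sigma_finiteT m1.
have /sigma_finiteP[G [TG ndG Goo]] := sigma_finiteT m2.
exists (fun n => F n `*` G n) => [|k].
  rewrite -setXTT TF TG predeqE => -[x y]; split.
    move=> [/= [n _ Fnx] [k _ Gky]]; exists (maxn n k) => //; split.
    - by move: x Fnx; exact/subsetPset/ndF/leq_maxl.
    - by move: y Gky; exact/subsetPset/ndG/leq_maxr.
  by move=> [n _ []/= ? ?]; split; exists n.
have [mF Foo'] := Foo k; have [mG Goo'] := Goo k.
split; first exact: measurableX.
by rewrite /sprod product_measure1E// lte_mul_pinfty// ge0_fin_numE.
Qed.

HB.instance Definition _ := Measure_isSigmaFinite.Build _ _ _ sprod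
  sprod_sigma_finite.
End ProductMeasure.

Section PowerMeasure.
Local Open Scope ereal_scope.
Context {R : realType} {disp : measure_display} {T : measurableType disp}.
Variable mu : {sigma_finite_measure set T -> \bar R}.

Section Step.
Variables (n : nat) (nu : {sigma_finite_measure set (n.-tuple T) -> \bar R}).

Definition tcons (p : T * n.-tuple T) : n.+1.-tuple T :=
  [the n.+1.-tuple T of p.1 :: p.2].

Lemma measurable_tcons : measurable_fun setT tcons.
Proof. exact: (@measurable_cons _ _ _ _ fst n snd). Qed.

HB.instance Definition _ := @isMeasurableFun.Build _ _ _ _ tcons measurable_tcons.

Definition power_step : set (n.+1.-tuple T) -> \bar R :=
  pushforward (sprod mu nu) tcons.

Let power_step0 : power_step set0 = 0.
Proof. exact: measure0. Qed.

Let power_step_ge0 A : 0 <= power_step A.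
Proof. exact: measure_ge0. Qed.

Let power_step_sigma_additive : semi_sigma_additive power_step.
Proof. exact: measure_semi_sigma_additive. Qed.

HB.instance Definition _ := isMeasure.Build _ _ _ power_step
  power_step0 power_step_ge0 power_step_sigma_additive.

Let power_step_sigma_finite : sigma_finite setT power_step.
Proof.
have [F FT Foo] := sigma_finiteT (sprod mu nu).
pose uncons (t : n.+1.-tuple T) := (thead t, [tuple of behead t]).
have muncons : measurable_fun setT uncons.
  apply/measurable_fun_pairP; split; last exact: measurable_behead.
  exact: measurable_tnth.
have consK : cancel tcons uncons.
  by case=> x t; congr pair; apply: val_inj.
exists (fun i => uncons @^-1` F i) => [|i].
  by rewrite -preimage_bigcup -FT preimage_setT.
have [mF Fi] := Foo i; split; first by rewrite -[X in measurable X]setTI; exact: muncons.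
rewrite /power_step /pushforward -comp_preimage.
by rewrite (_ : uncons \o tcons = id)//; apply/funext => p /=; rewrite consK.
Qed.

HB.instance Definition _ := Measure_isSigmaFinite.Build _ _ _ power_step
  power_step_sigma_finite.
End Step.

Fixpoint power_measure n : {sigma_finite_measure set (n.-tuple T) -> \bar R} :=
  match n with
  | 0 => \d_([tuple] : 0.-tuple T)
  | m.+1 => power_step (power_measure m)
  end.

End PowerMeasure.

(* ExpL^2(mu): the n-th entry of a vector is a function of n-tuples, symmetric
   and square integrable for the n-th power of mu. *)
Section FockSpace.
Context {R : realType} {disp : measure_display} {T : measurableType disp}.
Variable mu : {sigma_finite_measure set T -> \bar R}.

Definition fock_seq : Type := forall n, n.-tuple T -> R[i].
Implicit Types u v : fock_seq.

Definition symmetric_fun n (f : n.-tuple T -> R[i]) : Prop :=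
  forall (p : 'S_n) (t : n.-tuple T), f [tuple tnth t (p i) | i < n] = f t.

Definition in_fock u : Prop :=
  (forall n, symmetric_fun (u n) /\ inL2 (power_measure mu n) (u n)) /\
  (\sum_(0 <= n <oo)
     n`!%:R%:E * sqnormL2 (power_measure mu n) (u n) < +oo)%E.

Definition fock_dot u v : R[i] :=
  let a n := n`!%:R * dotL2 (power_measure mu n) (u n) (v n) in
  limn (series (fun n => complex.Re (a n))) +i*
  limn (series (fun n => complex.Im (a n))).

Definition finite_particle u : Prop :=
  exists N, forall n (t : n.-tuple T), (N <= n)%N -> u n t = 0.

(* a^-(phi) from level n.+1 to level n, as an integral operator; on symmetric
   tensor products it is the usual formula, see annihilation_symprod. *)
Definition annihilation (phi : T -> R) n (f : n.+1.-tuple T -> R[i]) :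
    n.-tuple T -> R[i] :=
  fun t => n.+1%:R * cint mu (fun y => (phi y)%:C * f (tcons (y, t))).

Definition fock_annihilation (phi : T -> R) u : fock_seq :=
  fun n => annihilation phi (u n.+1).

(* f is in the domain of a^+(phi), the adjoint of a^-(phi), and
   a^+(phi) f = k. *)
Definition fock_creation (phi : T -> R) (f k : fock_seq) : Prop :=
  [/\ in_fock f, in_fock k &
    forall u, in_fock u -> finite_particle u ->
      fock_dot (fock_annihilation phi u) f = fock_dot u k].

Definition symprod n (f : 'I_n -> T -> R[i]) : n.-tuple T -> R[i] :=
  fun t => n`!%:R^-1 * \sum_(p : 'S_n) \prod_(i < n) f (p i) (tnth t i).

Lemma sum_lift_perm (M : nmodType) n (j : 'I_n.+1) (G : 'S_n.+1 -> M) :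
  \sum_(p : 'S_n.+1 | p ord0 == j) G p = \sum_(q : 'S_n) G (lift_perm ord0 j q).
Proof.
rewrite (reindex (lift_perm ord0 j)).
  by apply: eq_bigl => q; rewrite lift_perm_id eqxx.
pose ulsf i (s : 'S_n.+1) k := odflt k (unlift (s i) (s (lift i k))).
have ulsfK i (s : 'S_n.+1) k : lift (s i) (ulsf i s k) = s (lift i k).
  rewrite /ulsf; have := neq_lift i k.
  by rewrite -(can_eq (permK s)) => /unlift_some[] ? ? ->.
have inj_ulsf : injective (ulsf ord0 _).
  move=> s; apply: can_inj (ulsf (s ord0) s^-1%g) _ => k'.
  by rewrite {1}/ulsf ulsfK !permK liftK.
exists (fun s => perm (inj_ulsf s)) => [s _ | s].
  by apply/permP => k'; rewrite permE /ulsf lift_perm_lift lift_perm_id liftK.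
move/(_ s _ =P _) => si0; apply/permP => k.
case: (unliftP ord0 k) => [k'|] ->; rewrite ?lift_perm_id //.
by rewrite lift_perm_lift -si0 permE ulsfK.
Qed.

Lemma annihilation_symprod (phi : T -> R) n (f : 'I_n.+1 -> T -> R[i]) t :
  (forall j, cintegrable mu (fun y => (phi y)%:C * f j y)) ->
  annihilation phi (symprod f) t =
  \sum_(j < n.+1) cint mu (fun y => (phi y)%:C * f j y) *
    symprod (fun i => f (lift j i)) t.
Proof.
move=> iF; rewrite /annihilation.
pose c (p : 'S_n.+1) : R[i] := (n.+1)`!%:R^-1 *
  \prod_(i < n) f (p (lift ord0 i)) (tnth t i).
rewrite (_ : (fun y => _) = fun y =>
    \sum_(p : 'S_n.+1) c p * ((phi y)%:C * f (p ord0) y)); last first.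
  apply/funext => y; rewrite /symprod mulrCA mulr_sumr mulr_sumr.
  apply: eq_bigr => p _; rewrite big_ord_recl /c -!mulrA; congr (_ * _).
  rewrite [RHS]mulrC -!mulrA; congr (_ * (_ * _)).
  by apply: eq_bigr => i _; rewrite tnthS.
have [_ ->] := cint_sum (index_enum 'S_n.+1) c
  (F := fun p y => (phi y)%:C * f (p ord0) y) (fun p => iF (p ord0)).
rewrite (partition_big (fun p : 'S_n.+1 => p ord0) predT)//= mulr_sumr.
apply: eq_bigr => j _; rewrite sum_lift_perm.
rewrite /symprod mulrA mulr_sumr mulr_sumr; apply: eq_bigr => q _.
rewrite /c lift_perm_id (eq_bigr (fun i => f (lift j (q i)) (tnth t i))); last first.
  by move=> i _; rewrite lift_perm_lift.
rewrite factS natrM invfM !mulrA mulfV ?pnatr_eq0// mul1r.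
by rewrite [LHS]mulrC mulrA.
Qed.

End FockSpace.

Section Smooth.
Context {R : realType} {V : normedModType R}.
Implicit Types (f : V -> R) (vs : seq V).

Definition iterD vs f : V -> R := foldr (fun v g => 'D_v g) f vs.

(* For V finite dimensional this is C^oo. *)
Definition smooth f : Prop :=
  forall vs, continuous (iterD vs f) /\
    forall x v, derivable (iterD vs f) x v.

Definition smooth_bounded_derivatives f : Prop :=
  smooth f /\
  forall vs, (0 < size vs)%N -> exists M, forall x, `|iterD vs f x| <= M.

Definition tsupp f : set V := closure [set x | f x != 0].

(* f belongs to D(E), for E open in V. *)
Definition test_on (E : set V) f : Prop :=
  [/\ smooth f, compact (tsupp f) & tsupp f `<=` E].

End Smooth.

Section Distributions.
Context {R : realType} {V : normedModType R}.

Record testfun := Testfun {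
  testfun_fun :> V -> R;
  testfun_test : test_on setT testfun_fun }.

Definition distr_linear (w : testfun -> R) : Prop :=
  forall (a : R) (p q r : testfun), (forall x, r x = a * p x + q x) ->
    w r = a * w p + w q.

(* Continuity for the inductive limit topology of D, in terms of seminorms. *)
Definition distr_continuous (w : testfun -> R) : Prop :=
  forall K : set V, compact K -> exists (C : R) (S : seq (seq V)),
    forall (p : testfun) (M : R), tsupp p `<=` K ->
      (forall vs, vs \in S -> forall x, `|iterD vs p x| <= M) ->
      `|w p| <= C * M.

Record distribution := Distribution {
  distribution_fun :> testfun -> R;
  distribution_linear : distr_linear distribution_fun;
  distribution_continuous : distr_continuous distribution_fun }.

Lemma distr0_linear : distr_linear (fun=> 0).
Proof. by move=> a p q r _; rewrite mulr0 addr0. Qed.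

Lemma distr0_continuous : distr_continuous (fun=> 0).
Proof. by move=> K _; exists 0, [::] => p M _ _; rewrite normr0 mul0r. Qed.

Definition distr0 : distribution := Distribution distr0_linear distr0_continuous.

Lemma subdirac_linear (w : distribution) (s : R) (x : V) :
  distr_linear (fun p => w p - s * p x).
Proof.
move=> a p q r rE; rewrite (distribution_linear w rE) rE.
by rewrite mulrBr mulrDr opprD addrACA mulrCA.
Qed.

Lemma subdirac_continuous (w : distribution) (s : R) (x : V) :
  distr_continuous (fun p => w p - s * p x).
Proof.
move=> K /(distribution_continuous w)[C [S wS]].
exists (C + `|s|), ([::] :: S) => p M pK pM.
rewrite mulrDl (le_trans (ler_normB _ _))// lerD//.
  by apply: wS => // vs vsS; apply: pM; rewrite inE vsS orbT.
rewrite normrM ler_wpM2l//.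
by apply: (pM [::]); rewrite inE eqxx.
Qed.

Definition subdirac (w : distribution) (s : R) (x : V) : distribution :=
  Distribution (subdirac_linear w s x) (subdirac_continuous w s x).

HB.instance Definition _ := gen_eqMixin distribution.
HB.instance Definition _ := gen_choiceMixin distribution.
HB.instance Definition _ := isPointed.Build distribution distr0.

(* The sigma-algebra of D' is generated by the pairings with test functions. *)
Definition distr_cylinders : set (set distribution) :=
  [set A | exists (p : testfun) (B : set R),
     measurable B /\ A = [set w : distribution | B (w p)]].

Definition distr_space := g_sigma_algebraType distr_cylinders.

End Distributions.
Arguments testfun {R} V.
Arguments distribution {R} V.
Arguments distr_space {R} V.

(* Absolutely convergent sums over a set, i.e. integrals against the counting
   measure of that set. *)
Section SetSums.
Context {R : realType} {I : choiceType}.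
Implicit Types (A : set I).

Definition abs_summable A (f : I -> R) : Prop := summable A (EFin \o f).

Definition set_sum A (f : I -> R) : R :=
  fine (\esum_(z in A) (Num.max (f z) 0)%:E) -
  fine (\esum_(z in A) (Num.max (- f z) 0)%:E).

Definition set_csum A (f : I -> R[i]) : R[i] :=
  set_sum A (fun z => complex.Re (f z)) +i*
  set_sum A (fun z => complex.Im (f z)).

End SetSums.

Section Configurations.
Context {R : realType} {d : nat}.
Local Notation V := 'rV[R]_d.
Local Notation Z := (R * V)%type.

(* Locally finite subsets of the open set E. *)
Record config (E : set Z) := Config {
  config_set :> set Z;
  config_sub : config_set `<=` E;
  config_locally_finite : forall K, K `<=` E -> compact K ->
    finite_set (config_set `&` K) }.

Lemma config0_locally_finite (E : set Z) (K : set Z) :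
  K `<=` E -> compact K -> finite_set (set0 `&` K).
Proof. by move=> _ _; rewrite set0I. Qed.

Definition config0 (E : set Z) : config E :=
  Config (@sub0set _ E) (@config0_locally_finite E).

HB.instance Definition _ E := gen_eqMixin (config E).
HB.instance Definition _ E := gen_choiceMixin (config E).
HB.instance Definition _ E := isPointed.Build (config E) (config0 E).

(* The Borel sigma-algebra of the vague topology. *)
Definition config_cylinders (E : set Z) : set (set (config E)) :=
  [set A | exists (psi : Z -> R) (B : set R),
     [/\ test_on E psi, measurable B &
         A = [set gam : config E | B (set_sum gam psi)]]].

Definition config_space (E : set Z) := g_sigma_algebraType (@config_cylinders E).

Section Poisson.
Variables (E : set Z) (mu : {sigma_finite_measure set Z -> \bar R}).

Definition is_poisson (pi : probability (config_space E) R) : Prop :=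
  forall psi : Z -> R, test_on E psi ->
    (\int[pi]_gam (expR (set_sum gam psi))%:E =
     (expR (\int[mu]_z (expR (psi z) - 1))%R)%:E)%E.

Variable pi : probability (config_space E) R.
Implicit Types h k : config_space E -> R[i].

(* <C_n, psi^{(x) n}>: the n-th derivative at t = 0 of the generating function
   exp(<gam, log(1 + t psi)> - <t psi>_mu). *)
Definition charlier (n : nat) (psi : Z -> R) (gam : config_space E) : R :=
  derive1n n (fun t : R => expR (set_sum gam (fun z => ln (1 + t * psi z)) -
                                 t * (\int[mu]_z psi z)%R)) 0.

(* h = <C_n, f> for f a finite complex combination of powers psi^{(x) n}. *)
Definition chaos_elementary n (f : n.-tuple Z -> R[i]) h : Prop :=
  exists (m : nat) (c : 'I_m -> R[i]) (psi : 'I_m -> Z -> R),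
    [/\ forall j, test_on E (psi j),
        forall t, f t = \sum_(j < m) c j * (\prod_(i < n) psi j (tnth t i))%:C &
        forall gam, h gam = \sum_(j < m) c j * (charlier n (psi j) gam)%:C].

(* h = <C_n, f>, by extension in the L^2 sense. *)
Definition chaos n (f : n.-tuple Z -> R[i]) h : Prop :=
  inL2 pi h /\
  exists (u : nat -> n.-tuple Z -> R[i]) (v : nat -> config_space E -> R[i]),
    [/\ forall j, chaos_elementary (u j) (v j),
        cvgL2 (power_measure mu n) u f & cvgL2 pi v h].

(* h = I_mu f *)
Definition chaos_iso (f : fock_seq) h : Prop :=
  [/\ in_fock mu f, inL2 pi h &
    exists H : nat -> config_space E -> R[i],
      (forall n, chaos (f n) (H n)) /\
      cvgL2 pi (fun N gam => \sum_(n < N) H n gam) h].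

(* h is in the domain of I_mu a^+(phi) I_mu^{-1}. *)
Definition dom_chaos_creation (phi : Z -> R) h : Prop :=
  exists (f f' : fock_seq) (k : config_space E -> R[i]),
    [/\ chaos_iso f h, fock_creation mu phi f f' & chaos_iso f' k].

Section Cylinder.
Variables (N : nat) (psi : 'I_N -> Z -> R) (F : 'rV[R]_N -> R[i]).

Definition is_cylinder : Prop :=
  [/\ forall i, test_on E (psi i),
      smooth_bounded_derivatives (fun x => complex.Re (F x)) &
      smooth_bounded_derivatives (fun x => complex.Im (F x))].

Definition cylinder (gam : config_space E) : R[i] :=
  F (\row_i set_sum gam (psi i)).

(* <gam + delta_z, psi_i> = <gam, psi_i> + psi_i z *)
Definition poisson_grad (phi : Z -> R) (gam : config_space E) : R[i] :=
  cint mu (fun z =>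
    (F (\row_i (set_sum gam (psi i) + psi i z)) - cylinder gam) * (phi z)%:C).
End Cylinder.

(* h is in the domain of the adjoint of nabla^P_phi, with value k. *)
Definition poisson_creation (phi : Z -> R) h k : Prop :=
  [/\ inL2 pi h, inL2 pi k &
    forall (N : nat) (psi : 'I_N -> Z -> R) (F : 'rV[R]_N -> R[i]),
      is_cylinder psi F ->
      dotL2 pi (poisson_grad psi F phi) h = dotL2 pi (cylinder psi F) k].

End Poisson.

Section CompoundPoisson.
Variable E : set Z.

(* Simple spatial positions; points with s = 0, which do not contribute to
   Sigma, are excluded (they are negligible when rho {0} = 0). *)
Definition config_hat : set (config_space E) :=
  [set gam : config E |
     (forall z z' : Z, config_set gam z -> config_set gam z' -> z.2 = z'.2 -> z = z') /\
     (forall z : Z, config_set gam z -> z.1 != 0)].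

(* w = sum over (s, x) in gam of s * delta_x *)
Definition is_Sigma (gam : config_space E) (w : distribution V) : Prop :=
  forall p : testfun V,
    abs_summable gam (fun z : Z => z.1 * p z.2) /\
    w p = set_sum gam (fun z : Z => z.1 * p z.2).

(* The default value is taken only where the sum is not a distribution, which
   is a negligible event. *)
Definition Sigma (gam : config_space E) : distr_space V :=
  xget (distr0 : distribution V) [set w | is_Sigma gam w].

(* mu_CP is carried by Omega, the image of config_hat; outside of it the value
   of Sigma_inv is irrelevant. *)
Definition Sigma_inv (w : distr_space V) : config_space E :=
  xget (config0 E) [set gam | config_hat gam /\ is_Sigma gam w].

Definition U_Sigma (g : distr_space V -> R[i]) : config_space E -> R[i] :=
  g \o Sigma.

Definition U_Sigma_inv (h : config_space E -> R[i]) : distr_space V -> R[i] :=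
  h \o Sigma_inv.

Definition is_image_Sigma (pi : probability (config_space E) R)
    (mucp : probability (distr_space V) R) : Prop :=
  measurable_fun setT Sigma /\
  forall A, measurable A -> mucp A = pi (Sigma @^-1` A).

End CompoundPoisson.

(* The exponent may be +oo, as rho need not have exponential moments. *)
Definition cp_laplace (rho : {measure set R -> \bar R})
    (sigma : {measure set V -> \bar R})
    (mucp : probability (distr_space V) R) : Prop :=
  forall p : testfun V,
    (\int[mucp]_w (expR ((w : distribution V) p))%:E =
     expeR (\int[sigma]_x \int[rho]_s (expR (s * p x) - 1)%:E))%E.

(* All of R^{d+1} when rho is finite.  When rho is infinite with finite moments
   its mass accumulates at s = 0, so that rho (x) sigma is infinite on compact
   sets meeting {s = 0}; a Poisson configuration is then locally finite only
   in (R \ {0}) x R^d. *)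
Definition state_space (rho : {measure set R -> \bar R}) : set Z :=
  [set z | rho setT = +oo%E -> z.1 != 0].

Definition radon (sigma : {measure set V -> \bar R}) : Prop :=
  (forall K : set V, compact K -> (sigma K < +oo)%E) /\
  (forall A : set V, measurable A ->
     sigma A = ereal_sup [set sigma K | K in [set K | compact K /\ K `<=` A]]).

Definition nonatomic (sigma : {measure set V -> \bar R}) : Prop :=
  forall A : set V, measurable A -> (0 < sigma A)%E ->
    exists B : set V,
      [/\ measurable B, B `<=` A & (0 < sigma B < sigma A)%E].

Definition finite_moments (rho : {measure set R -> \bar R}) : Prop :=
  forall n, (1 <= n)%N -> (\int[rho]_s (`|s| ^+ n)%:E < +oo)%E.

End Configurations.

(* Main.v *)
(** Functional monotone class arguments starting from the Laplace transform give
    the Mecke formula for the Poisson measure.  It turns the adjoint of the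
    gradient into
      k' gam = sum_(z in gam) phi(z) h(gam \ z) - <phi> h(gam).
    Cosines of linear functionals of gam are total in L^2, so they determine the
    adjoint and it can only be k'.  On the Fock space side, the Charlier kernels satisfy
      C_(n+1) gam = sum_(z in gam) psi(z) C_n (gam \ z) - <psi> C_n gam;
    testing against the coherent states exp(<gam, log(1 + psi)> - <psi>) then
    identifies I a^+ I^-1 h with the same k'.  Finally Sigma is injective on
    configurations with distinct positions, and
    Sigma (gam \ (s, x)) = Sigma gam - s delta_x.  Passing from almost every gam
    to almost every omega is the delicate point, since images under Sigma of
    measurable sets need not be measurable a priori: by separability of the space
    of test functions, Lusin's theorem and vague compactness of sets of
    configurations, they contain measurable sets of nearly full measure. *)

Require Import Defs.
From mathcomp Require Import all_boot all_order all_algebra.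
From mathcomp Require Import fingroup perm.
From mathcomp Require Import all_classical all_reals all_analysis.
From mathcomp Require Import measurable_realfun complex zify ring lra.
Import Order.TTheory GRing.Theory Num.Theory.
Import numFieldNormedType.Exports.
Local Open Scope classical_set_scope.
Local Open Scope ring_scope.
Local Open Scope complex_scope.

Set Implicit Arguments.
Unset Strict Implicit.
Unset Printing Implicit Defensive.

(* ssrnat and the probability library shadow these two names. *)
Local Notation iterD := Defs.iterD.
Local Notation distribution := Defs.distribution.

(** * Smooth functions and test functions *)

(** Two families of test functions appear because the two operators are probed differently. The
    adjoint of the gradient may be tested only on cylinder functions with bounded derivatives, which
    admits cosines but not x |-> e^{-x}. The Fock side is computed on coherent states; for psi =
    e^{-chi} - 1 with chi >= 0 these are, up to a constant, the bounded functions e^{-<gam, chi>}.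
    Both families satisfy s s' = c (s1 + s2), which is what the monotone class argument asks for.
    The weight [phi] is not assumed to be supported in the state space, so for infinite rho its sum
    over a configuration may have infinitely many terms; this forces a Mecke formula for all
    integrable functions, with summability only almost sure. In the transfer to distributions, a
    limit of configurations may create double points and so leave the space of sets; the compactness
    argument therefore keeps around each point a neighbourhood in which most configurations have at
    most one point. Limits are taken along one fixed ultrafilter, which avoids subsequences and a
    metric on configurations. *)

Section SmoothFunctions.
Context {R : realType} {V : normedModType R}.
Implicit Types (f g p q : V -> R) (C : set (V -> R)).

(** Iterated derivatives never leave a class that is stable under directional derivatives. Each
    closure property of smooth functions thus amounts to finding a stable class that contains the
    function. *)
Lemma smooth_coind C :
  (forall f, C f -> continuous f /\
     forall v, C ('D_v f) /\ forall x, derivable f x v) ->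
  forall f, C f -> smooth f.
Proof.
move=> CP f Cf vs; have {Cf}: C (iterD vs f).
  by elim: vs => [//|v vs /CP [_ /(_ v)[]]].
by move=> /CP [cf df]; split=> // x v; have [_] := df v; exact.
Qed.

Lemma smooth_continuous f : smooth f -> continuous f.
Proof. by move=> /(_ [::])[]. Qed.

Lemma smooth_derivable f x v : smooth f -> derivable f x v.
Proof. by move=> /(_ [::])[_]; exact. Qed.

Lemma smooth_iterD f vs : smooth f -> smooth (iterD vs f).
Proof.
move=> sf ws; have -> : iterD ws (iterD vs f) = iterD (ws ++ vs) f.
  by rewrite /iterD foldr_cat.
exact: sf.
Qed.

Lemma smooth_derive f v : smooth f -> smooth ('D_v f).
Proof. exact: (@smooth_iterD f [:: v]). Qed.

Lemma smooth_cst (c : R) : smooth (cst c : V -> R).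
Proof.
apply: (smooth_coind (C := [set f | exists c, f = cst c])); last by exists c.
move=> _ [{}c ->]; split; first exact: cst_continuous.
move=> v; split; last by move=> x; exact: derivable_cst.
by exists 0; apply/funext => x; rewrite derive_cst.
Qed.

Lemma deriveDE f g v : smooth f -> smooth g ->
  'D_v (fun x => f x + g x) = fun x => 'D_v f x + 'D_v g x.
Proof.
move=> sf sg; apply/funext => x.
by rewrite (_ : (fun x => f x + g x) = f \+ g)// deriveD//;
  exact: smooth_derivable.
Qed.

Lemma deriveME f g v : smooth f -> smooth g ->
  'D_v (fun x => f x * g x) = fun x => f x * 'D_v g x + 'D_v f x * g x.
Proof.
move=> sf sg; apply/funext => x.
rewrite (_ : (fun x => f x * g x) = f \* g)// deriveM//;
  [|exact: smooth_derivable..].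
by rewrite /GRing.scale/= [g x * _]mulrC.
Qed.

(** Products alone are not stable under derivation: the Leibniz rule turns one product into a sum of
    two, hence the closure under sums. *)
Inductive sum_of_products : (V -> R) -> Prop :=
| SumOfProducts1 p q : smooth p -> smooth q -> sum_of_products (fun x => p x * q x)
| SumOfProductsD f g : sum_of_products f -> sum_of_products g ->
    sum_of_products (fun x => f x + g x).

Lemma sum_of_products_smooth f : sum_of_products f -> smooth f.
Proof.
apply: (smooth_coind (C := sum_of_products)) => {}f; elim.
- move=> p q sp sq; split.
    by move=> x; apply: cvgM; exact: smooth_continuous.
  move=> v; split.
    rewrite (deriveME v sp sq); apply: SumOfProductsD; apply: SumOfProducts1.
    - exact: sp.
    - exact: smooth_derive.
    - exact: smooth_derive.
    - exact: sq.
  by move=> x; apply: derivableM; exact: smooth_derivable.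
- move=> p q _ [cp dp] _ [cq dq]; split.
    by move=> x; apply: cvgD; [exact: cp|exact: cq].
  move=> v; have [Cp {}dp] := dp v; have [Cq {}dq] := dq v; split.
    rewrite (_ : 'D_v _ = fun x => 'D_v p x + 'D_v q x).
      exact: SumOfProductsD.
    by apply/funext => x; rewrite (_ : (fun x => p x + q x) = p \+ q)// deriveD.
  by move=> x; apply: derivableD.
Qed.

Lemma smoothM f g : smooth f -> smooth g -> smooth (fun x => f x * g x).
Proof. by move=> sf sg; apply: sum_of_products_smooth; exact: SumOfProducts1. Qed.

Lemma smoothZ (c : R) f : smooth f -> smooth (fun x => c * f x).
Proof. exact: (smoothM (smooth_cst c)). Qed.

Lemma smoothD f g : smooth f -> smooth g -> smooth (fun x => f x + g x).
Proof.
move=> sf sg; apply: sum_of_products_smooth.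
have one h : smooth h -> sum_of_products h.
  move=> sh; rewrite (_ : h = fun x => cst 1 x * h x).
    exact: (SumOfProducts1 (smooth_cst 1) sh).
  by apply/funext => x; rewrite mul1r.
by apply: SumOfProductsD; exact: one.
Qed.

Lemma smoothN f : smooth f -> smooth (fun x => - f x).
Proof.
by move=> /(smoothZ (-1)); congr smooth; apply/funext => x; rewrite mulN1r.
Qed.

Lemma smoothB f g : smooth f -> smooth g -> smooth (fun x => f x - g x).
Proof. by move=> sf /smoothN; exact: smoothD. Qed.

Lemma smooth_sum (I : Type) (r : seq I) (F : I -> V -> R) :
  (forall i, smooth (F i)) -> smooth (fun x => \sum_(i <- r) F i x).
Proof.
move=> sF; elim: r => [|i r IH].
  by under eq_fun do rewrite big_nil; exact: smooth_cst.
under eq_fun do rewrite big_cons.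
exact: (smoothD (sF i) IH).
Qed.

Lemma smooth_prod (I : Type) (r : seq I) (F : I -> V -> R) :
  (forall i, smooth (F i)) -> smooth (fun x => \prod_(i <- r) F i x).
Proof.
move=> sF; elim: r => [|i r IH].
  by under eq_fun do rewrite big_nil; exact: smooth_cst.
under eq_fun do rewrite big_cons.
exact: (smoothM (sF i) IH).
Qed.

End SmoothFunctions.

Lemma derive_line {R : realType} {V : normedModType R} (F : V -> R) (x v : V) :
  'D_v F x = 'D_1 (fun h : R => F (h *: v + x)) 0.
Proof.
rewrite /derive; apply: (congr1 (fun g : R -> R => lim (g @ 0^'))).
apply/funext => h /=; rewrite addr0 scale0r add0r.
by rewrite (_ : h *: (1 : R) = h)//; exact: mulr1.
Qed.

Section DirectionalChainRule.
Context {R : realType} {V W : normedModType R}.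

Lemma is_derive_line (f : R -> R) (A : V -> R) (x v : V) (a df : R) :
  (forall h : R, A (h *: v + x) = h * a + A x) ->
  is_derive (A x) 1 f df -> is_derive x v (f \o A) (a * df).
Proof.
move=> Av dfA.
have Fl : is_derive (0 : R) 1 (fun h : R => f (h * a + A x)) (df * a).
  have -> : (fun h : R => f (h * a + A x)) = f \o (fun h => h * a + A x) by [].
  have d1 : is_derive (0 : R) (1 : R) (fun h : R => h * a + A x) a.
    have -> : (fun h : R => h * a + A x) = (a \*: id) \+ cst (A x).
      by apply/funext => h /=; rewrite mulrC.
    by apply: is_derive_eq; rewrite addr0 /GRing.scale/= mulr1.
  have := @is_derive1_comp _ f (fun h => h * a + A x) 0 df a.
  by rewrite mul0r add0r; exact.
have E : (fun h : R => (f \o A) (h *: v + x)) = fun h => f (h * a + A x).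
  by apply/funext => h /=; rewrite Av.
have [D1 D2] := Fl; apply: DeriveDef.
  by apply/derivable1P; rewrite E.
by rewrite derive_line E D2 mulrC.
Qed.

(** The stable class consists of the multiples of h o A with h smooth: deriving along v replaces h
    by h' and multiplies the factor by [l v]. *)
Lemma smooth_comp_affine (f : R -> R) (A : V -> R) (l : V -> R) :
  smooth f -> continuous A ->
  (forall x v (h : R), A (h *: v + x) = h * l v + A x) ->
  smooth (f \o A).
Proof.
move=> sf cA Al.
apply: (smooth_coind (C := [set g | exists a h, smooth h /\
   g = (fun x => a * (h \o A) x)])); last first.
  by exists 1, f; split=> //; apply/funext => x; rewrite mul1r.
move=> _ [a [h [sh ->]]].
have D (x v : V) : is_derive x v (fun x => a * (h \o A) x)
    (a * (l v * 'D_1 h (A x))).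
  apply: (is_deriveZ a (f := h \o A)).
  apply: is_derive_line => //.
  exact/derivableP/smooth_derivable.
split.
  move=> x; apply: cvgM; first exact: cvg_cst.
  apply: (@continuous_comp _ _ _ A h); first exact: cA.
  exact: smooth_continuous.
move=> v; split; last by move=> x; have [] := D x v.
exists (a * l v), ('D_1 h); split; first exact: smooth_derive.
by apply/funext => x; have [_ ->] := D x v; rewrite mulrA.
Qed.

Lemma smooth_comp_linear (f : W -> R) (A : V -> W) :
  smooth f -> continuous A ->
  (forall x v (h : R), A (h *: v + x) = h *: A v + A x) ->
  smooth (f \o A).
Proof.
move=> sf cA Al.
apply: (smooth_coind (C := [set g | exists h, smooth h /\ g = h \o A])); last first.
  by exists f.
move=> _ [h [sh ->]]; split.
  by move=> x; apply: continuous_comp; [exact: cA|exact: smooth_continuous].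
have E (x v : V) : (fun t : R => (h \o A) (t *: v + x)) =
    fun t => h (t *: A v + A x).
  by apply/funext => t /=; rewrite Al.
move=> v; split.
  exists ('D_(A v) h); split; first exact: smooth_derive.
  by apply/funext => x /=; rewrite derive_line E -derive_line.
move=> x; apply/derivable1P; rewrite E.
have /derivable1P := @smooth_derivable _ _ h (A x) (A v) sh; exact.
Qed.

(** The stable class is e^f p with p smooth, whose derivative along v is e^f (D_v p + p D_v f). *)
Lemma smooth_exp (f : V -> R) : smooth f -> smooth (fun x => expR (f x)).
Proof.
move=> sf.
apply: (smooth_coind (C := [set g | exists p, smooth p /\
   g = (fun x => expR (f x) * p x)])); last first.
  exists (cst 1); split; first exact: smooth_cst.
  by apply/funext => x; rewrite mulr1.
move=> _ [p [sp ->]].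
have ce : continuous (fun x => expR (f x)).
  move=> x; apply: (@continuous_comp _ _ _ f expR).
    exact: smooth_continuous.
  exact: continuous_expR.
have De (x v : V) : is_derive x v (fun x => expR (f x)) ('D_v f x * expR (f x)).
  have [D1] := derivableP (@smooth_derivable _ _ f x v sf).
  have /derivable1P D0 := @smooth_derivable _ _ f x v sf.
  set u := fun h : R => f (h *: v + x) in D0.
  have du : is_derive (0 : R) 1 u ('D_v f x).
    by apply: DeriveDef => //; rewrite [RHS]derive_line.
  have := is_derive1_comp (is_derive_expR (u 0)) du.
  rewrite /u scale0r add0r => -[E1 E2] _; apply: DeriveDef.
    exact/derivable1P.
  by rewrite mulrC -E2 derive_line.
have D (x v : V) : is_derive x v (fun x => expR (f x) * p x)
    (expR (f x) * 'D_v p x + p x * ('D_v f x * expR (f x))).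
  apply: (is_deriveM (f := fun x => expR (f x)) (g := p)).
  exact/derivableP/smooth_derivable.
split.
  by move=> x; apply: cvgM; [exact: ce|exact: smooth_continuous].
move=> v; split; last by move=> x; have [] := D x v.
exists (fun x => 'D_v p x + p x * 'D_v f x); split.
  apply: smoothD; first exact: smooth_derive.
  exact: (smoothM sp (smooth_derive v sf)).
by apply/funext => x; have [_ ->] := D x v; ring.
Qed.

End DirectionalChainRule.

Section FlatFunctions.
Context {R : realType}.
Implicit Types (P : {poly R}) (x : R).

(** The factor P(1/x) in front of e^{-1/x} makes the family stable under derivation: the derivative
    replaces P by X^2 (P - P'). *)
Definition flat P x := if 0 < x then P.[x^-1] * expR (- x^-1) else 0.

(** From e^y >= y^(i+2) / (i+2)! at y = 1/x, the monomial of degree i contributes at most a multiple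
    of x^2. This decay makes the difference quotient at 0 tend to 0. *)
Lemma flat_bound P : exists2 C, 0 <= C & forall x, `|flat P x| <= C * x ^+ 2.
Proof.
pose C := \sum_(i < size P) `|P`_i| * (i.+2)`!%:R.
have C0 : 0 <= C by apply: sumr_ge0 => i _; rewrite mulr_ge0.
exists C => // x; rewrite /flat; case: ifPn => [x0|_]; last first.
  by rewrite normr0 mulr_ge0// sqr_ge0.
rewrite horner_coef mulr_suml (le_trans (ler_norm_sum _ _ _))// /C mulr_suml.
apply: ler_sum => i _; rewrite !normrM -!mulrA ler_wpM2l//.
rewrite (ger0_norm (expR_ge0 _)) normrX (@gtr0_norm _ x^-1) ?invr_gt0//.
have y0 : 0 <= x^-1 by rewrite invr_ge0 ltW.
have := expR_ge1Dxn i.+1 y0; set y := x^-1 in y0 *.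
rewrite expRN => le_e.
have {}le_e : y ^+ i.+2 <= (i.+2)`!%:R * expR y.
  rewrite -ler_pdivrMl ?ltr0n ?fact_gt0//; apply: le_trans le_e.
  by rewrite [leLHS]mulrC lerDr.
have -> : x ^+ 2 = y ^- 2 by rewrite exprVn invrK.
rewrite ler_pdivlMr ?exprn_gt0 ?invr_gt0// mulrAC -exprD addn2.
by rewrite ler_pdivrMr ?expR_gt0.
Qed.

Lemma is_derive_flat P x :
  is_derive x 1 (flat P) (flat ('X^2 * (P - P^`())) x).
Proof.
have [x0|x0|->] := ltgtP x 0.
- have -> : flat ('X^2 * (P - P^`())) x = 0 by rewrite /flat lt_gtF.
  apply: (near_eq_is_derive _ (is_derive_cst (0 : R) x (1 : R))).
  near=> y; rewrite /flat ifF//; apply/negbTE; rewrite -leNgt ltW//.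
  by near: y; exact: lt_nbhsl.
- have -> : flat ('X^2 * (P - P^`())) x =
      ('X^2 * (P - P^`())).[x^-1] * expR (- x^-1) by rewrite /flat x0.
  apply: (@near_eq_is_derive R R R (fun y : R => P.[y^-1] * expR (- y^-1))).
    by near=> y; rewrite /flat ifT//; near: y; exact: lt_nbhsr.
  have dV : is_derive x 1 (fun y : R => y^-1) (- x ^- 2).
    have := @is_deriveV R id x 1 1 (lt0r_neq0 x0) _.
    by rewrite /GRing.scale /= mulr1; apply.
  have dP : is_derive x^-1 1 (horner P) (P^`()).[x^-1].
    by rewrite derivE derive1E; exact/derivableP/derivable_horner.
  have d1 := is_derive1_comp dP dV.
  have dN : is_derive x 1 (fun y : R => - y^-1) (x ^- 2).
    by have := is_deriveN dV; rewrite opprK.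
  have d2 := is_derive1_comp (is_derive_expR _) dN.
  have := is_deriveM d1 d2.
  move=> D; apply: (is_derive_eq D); rewrite /GRing.scale /=.
  by rewrite hornerM hornerXn hornerD hornerN exprVn; ring.
- have flat0 Q : flat Q 0 = 0 by rewrite /flat ltxx.
  rewrite flat0; have [C C0 fC] := flat_bound P.
  have cv : (fun h : R => h^-1 *: ((flat P \o shift 0) (h *: (1 : R)) - flat P 0)) @ 0^' --> (0 : R).
    apply/cvgrPdist_le => e e0; near=> h.
    rewrite sub0r normrN /= addr0 flat0 subr0 normrM.
    rewrite (_ : h *: (1 : R) = h); last exact: mulr1.
    have h0 : h != 0 by near: h; exact: nbhs_dnbhs_neq.
    rewrite normfV ler_pdivrMl ?normr_gt0// (le_trans (fC _))//.
    rewrite -real_normK ?num_real// expr2 mulrA mulrC ler_wpM2l//.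
    have : `|h| <= e / (C + 1).
      by near: h; apply: dnbhs0_le; rewrite divr_gt0// ltr_wpDl.
    rewrite ler_pdivlMr ?ltr_wpDl//; apply: le_trans.
    by rewrite mulrC ler_wpM2l// lerDl.
  apply: DeriveDef; last exact: cvg_lim cv.
  by apply/cvg_ex; exists 0.
Unshelve. all: by end_near. Qed.

Lemma smooth_flat P : smooth (flat P : (R : normedModType R) -> R).
Proof.
apply: (smooth_coind (C := [set g | exists (a : R) P, g = (fun x => a * flat P x)]));
  last first.
  by exists 1, P; apply/funext => x; rewrite mul1r.
move=> _ [a [{}P ->]].
have D (x v : R) : is_derive x v (fun x => a * flat P x)
    (a * (v * flat ('X^2 * (P - P^`())) x)).
  have := @is_derive_line _ (R : normedModType R) (flat P) id x v v _ _ (is_derive_flat P x).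
  by move=> /(_ (fun=> erefl)) /(is_deriveZ a).
split.
  move=> x; have [/derivable1_diffP/differentiable_continuous //] := D x 1.
move=> v; split; last by move=> x; have [] := D x v.
exists (a * v), ('X^2 * (P - P^`())).
by apply/funext => x; have [_ ->] := D x v; rewrite mulrA.
Qed.

Lemma flat1_ge0 x : 0 <= flat 1 x.
Proof. by rewrite /flat; case: ifP => // _; rewrite hornerC mul1r expR_ge0. Qed.

Lemma flat1_gt0 x : (0 < flat 1 x) = (0 < x).
Proof. by rewrite /flat; case: ifP => // _; rewrite ?ltxx// hornerC mul1r expR_gt0. Qed.

End FlatFunctions.

Lemma compact_cover_seq (T : ptopologicalType) (I : choiceType)
    (K : set T) (U : I -> set T) : compact K -> (forall i, open (U i)) ->
  (forall x, K x -> exists i, U i x) ->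
  exists s : seq I, forall x, K x -> exists2 i, i \in s & U i x.
Proof.
rewrite compact_cover => cK oU KU.
case: (cK I setT U) => [i _ //|x /KU[i Ux]|D _ KD]; first by exists i.
exists (finmap.enum_fset D) => x /KD[i iD Ux].
by exists i => //; exact: (set_mem iD).
Qed.

Section TestFunctions.
Context {R : realType} {V : normedModType R}.
Implicit Types (E : set V) (f g : V -> R).

Lemma notin_tsupp f x : ~ tsupp f x -> f x = 0.
Proof. by apply: contra_notP => /eqP fx; exact: subset_closure. Qed.

Lemma tsupp_sub f (K : set V) : closed K -> (forall x, f x != 0 -> K x) ->
  tsupp f `<=` K.
Proof.
by move=> cK fK; rewrite (closure_id K).1//; exact: closure_subset.
Qed.

Lemma test_onS E E' f : E `<=` E' -> test_on E f -> test_on E' f.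
Proof. by move=> EE' [sf cf fE]; split=> //; exact: subset_trans EE'. Qed.

Lemma test_on_sub E f g : test_on E f -> smooth g ->
  (forall x, g x != 0 -> f x != 0) -> test_on E g.
Proof.
move=> [sf cf fE] sg gf.
have gfs : tsupp g `<=` tsupp f by apply: closure_subset => x; exact: gf.
split => //; last exact: subset_trans fE.
by apply: subclosed_compact cf gfs; exact: closed_closure.
Qed.

Lemma test_onMr E f g : test_on E f -> smooth g -> test_on E (fun x => f x * g x).
Proof.
move=> tf sg; have [sf _ _] := tf.
apply: (test_on_sub tf (smoothM sf sg)) => x.
by apply: contra_neq => ->; rewrite mul0r.
Qed.

Lemma test_onZ E f (a : R) : test_on E f -> test_on E (fun x => a * f x).
Proof.
move=> tf; have := test_onMr tf (smooth_cst a).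
by congr test_on; apply/funext => x; rewrite mulrC.
Qed.

Lemma test_onD E f g : test_on E f -> test_on E g -> test_on E (fun x => f x + g x).
Proof.
move=> [sf cf fE] [sg cg gE].
have sub : tsupp (fun x => f x + g x) `<=` tsupp f `|` tsupp g.
  apply: tsupp_sub; first by apply: closedU; exact: closed_closure.
  move=> x fgx; have [fx0|fx0] := eqVneq (f x) 0; last by left; exact: subset_closure.
  by right; apply: subset_closure; move: fgx; rewrite fx0 add0r.
split; first exact: smoothD.
- apply: subclosed_compact (compactU cf cg) sub; exact: closed_closure.
- by move=> x /sub []; [exact: fE|exact: gE].
Qed.

Lemma test_on0 E : test_on E (cst 0 : V -> R).
Proof.
have t0 : tsupp (cst 0 : V -> R) = set0.
  rewrite /tsupp (_ : [set x | _] = set0) ?closure0//.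
  by apply/seteqP; split=> x //=; rewrite eqxx.
by split; rewrite ?t0//; [exact: smooth_cst|exact: compact0].
Qed.

Lemma test_on_sum E (I : Type) (r : seq I) (F : I -> V -> R) :
  (forall i, test_on E (F i)) -> test_on E (fun x => \sum_(i <- r) F i x).
Proof.
move=> sF; elim: r => [|i r IH].
  by under eq_fun do rewrite big_nil; exact: test_on0.
under eq_fun do rewrite big_cons.
exact: (test_onD (sF i) IH).
Qed.

Lemma test_onN E f : test_on E f -> test_on E (fun x => - f x).
Proof.
by move=> /(test_onZ (-1)); congr test_on; apply/funext => x; rewrite mulN1r.
Qed.

Lemma test_onB E f g : test_on E f -> test_on E g -> test_on E (fun x => f x - g x).
Proof. by move=> tf /test_onN; exact: test_onD. Qed.

Lemma test_on_expR1 E f : test_on E f -> test_on E (fun x => expR (f x) - 1).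
Proof.
move=> tf; have [sf _ _] := tf.
apply: (test_on_sub tf).
  exact: (smoothB (smooth_exp sf) (smooth_cst 1)).
by move=> x; apply: contra_neq => ->; rewrite expR0 subrr.
Qed.

Lemma test_on_continuous E f : test_on E f -> continuous f.
Proof. by case=> /smooth_continuous. Qed.

Lemma test_on_bounded E f : test_on E f -> exists2 M, 0 <= M & forall x, `|f x| <= M.
Proof.
move=> tf; have [sf cf _] := tf; have kf := smooth_continuous sf.
have [[x0 fx0]|f0] := pselect (exists x, tsupp f x); last first.
  by exists 0 => // x; rewrite (notin_tsupp (f := f)) ?normr0// => fx; apply: f0; exists x.
have [||c _ cM] := @compact_EVT_max V R (fun x => `|f x|) (tsupp f) _ cf; last first.
- exists `|f c| => // x; have [fx|/notin_tsupp ->] := pselect (tsupp f x).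
    by apply: cM; exact: mem_set.
  by rewrite normr0.
- apply: continuous_subspaceT => x.
  by apply: continuous_comp; [exact: kf|exact: norm_continuous].
- by exists x0.
Qed.

End TestFunctions.

(* A stand-in for sup norm coordinates that covers R, R^d and R x R^d at once. *)
Record coordinates {R : realType} (V : normedModType R) := Coordinates {
  coord_index : finType;
  coord : coord_index -> V -> R;
  coord_continuous : forall i, continuous (coord i);
  coord_linear : forall i x v h,
    coord i (h *: v + x) = h * coord i v + coord i x;
  coord_norm : forall v r, 0 <= r ->
    (`|v| <= r <-> forall i, `|coord i v| <= r);
  coord_compact : forall q r, compact [set v : V | `|v - q| <= r];
  coord_dense : exists q : nat -> V,
    forall v e, 0 < e -> exists n, `|v - q n| < e }.

Arguments coord {R V} c i v.
Arguments coord_norm {R V} c v r.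
Arguments coord_compact {R V} c q r _ _ _.

Section Bumps.
Context {R : realType} {V : normedModType R} (c : coordinates V).

Lemma coordB i v q : coord c i (v - q) = coord c i v - coord c i q.
Proof.
by rewrite -scaleN1r addrC coord_linear mulN1r addrC.
Qed.

Lemma coord_norm_lt v r : 0 < r -> (`|v| < r <-> forall i, `|coord c i v| < r).
Proof.
move=> r0; split=> [vr i|vr].
  by apply: le_lt_trans vr; move: i; exact/coord_norm.
apply: (@le_lt_trans _ _ (\big[Num.max/0]_i `|coord c i v|)).
  apply/(coord_norm c); first exact: bigmax_ge_id.
  by move=> i; exact: le_bigmax.
by apply/bigmax_ltP; split.
Qed.

(** Each factor is positive exactly when the coordinate of v - q lies in ]-r, r[. Since the norm is
    the maximum of the coordinates, the product is positive exactly on the open ball. *)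
Definition bump q r v : R := \prod_i
  (flat 1 (r - coord c i (v - q)) * flat 1 (r + coord c i (v - q))).

Lemma smooth_bump q r : smooth (bump q r).
Proof.
rewrite /bump; apply: smooth_prod => i; apply: smoothM.
- have := @smooth_comp_affine R V (flat 1) (fun v => r - coord c i (v - q))
    (fun v => - coord c i v) (smooth_flat 1).
  apply.
    move=> x; apply: cvgB; first exact: cvg_cst.
    apply: (@continuous_comp _ _ _ (fun v => v - q) (coord c i)).
      by apply: cvgB; [exact: cvg_id|exact: cvg_cst].
    exact: coord_continuous.
  by move=> x v h; rewrite -addrA coord_linear; ring.
- have := @smooth_comp_affine R V (flat 1) (fun v => r + coord c i (v - q))
    (coord c i) (smooth_flat 1).
  apply.
    move=> x; apply: cvgD; first exact: cvg_cst.
    apply: (@continuous_comp _ _ _ (fun v => v - q) (coord c i)).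
      by apply: cvgB; [exact: cvg_id|exact: cvg_cst].
    exact: coord_continuous.
  by move=> x v h; rewrite -addrA coord_linear; ring.
Qed.

Lemma bump_ge0 q r v : 0 <= bump q r v.
Proof. by apply: prodr_ge0 => i _; rewrite mulr_ge0 ?flat1_ge0. Qed.

Lemma bump_gt0 q r v : 0 < r -> (0 < bump q r v) = (`|v - q| < r).
Proof.
move=> r0; apply/idP/idP => [b0|/(coord_norm_lt _ r0) vr]; last first.
  apply: prodr_gt0 => i _; move: (vr i); rewrite ltr_norml => /andP[v1 v2].
  by rewrite mulr_gt0// flat1_gt0; lra.
apply/(coord_norm_lt _ r0) => i; rewrite ltNge; apply/negP => ri; move: b0.
rewrite /bump (bigD1 i)//=; set t := coord c i _ in ri *.
suff -> : flat 1 (r - t) * flat 1 (r + t) = 0 by rewrite mul0r ltxx.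
move: ri; rewrite ler_normr => /orP[] rt.
  by rewrite /flat ifF ?mul0r//; apply/negbTE; rewrite -leNgt; lra.
by rewrite mulrC /flat ifF ?mul0r//; apply/negbTE; rewrite -leNgt; lra.
Qed.

(** Convexity of the inverse gives 1/(r-t) + 1/(r+t) >= 2/r. Hence the bump is largest at its
    centre, and dividing by that value yields a function with values in [0, 1]. *)
Lemma flat1_sym (r t : R) : 0 < r -> flat 1 (r - t) * flat 1 (r + t) <= flat 1 r * flat 1 r.
Proof.
move=> r0; rewrite /flat r0 !hornerC !mul1r.
case: ifPn => [a|_]; last by rewrite mul0r mulr_ge0 ?expR_ge0.
case: ifPn => [b|_]; last by rewrite mulr0 mulr_ge0 ?expR_ge0.
rewrite -!expRD ler_expR -!opprD lerN2.
rewrite -subr_ge0.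
have -> : (r - t)^-1 + (r + t)^-1 - (r^-1 + r^-1) =
    2 * t ^+ 2 * ((r - t)^-1 * (r + t)^-1 * r^-1).
  by field; rewrite !gt_eqF.
apply: mulr_ge0; first by rewrite mulr_ge0 ?sqr_ge0.
by rewrite !mulr_ge0 ?invr_ge0// ltW.
Qed.

Lemma bump_le q r v : 0 < r -> bump q r v <= bump q r q.
Proof.
move=> r0; apply: ler_prod => i _; rewrite mulr_ge0 ?flat1_ge0//=.
by rewrite [X in _ <= flat _ (_ - X) * flat _ (_ + X)]coordB subrr subr0 addr0 flat1_sym.
Qed.

Lemma closed_cball q r : closed [set v : V | `|v - q| <= r].
Proof.
by apply: compact_closed; [exact: norm_hausdorff|exact: coord_compact].
Qed.

Definition nbump q r v := bump q r v / bump q r q.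

Lemma nbump_spec q r : 0 < r -> [/\ smooth (nbump q r),
  forall v, 0 <= nbump q r v <= 1, nbump q r q = 1,
  forall v, (0 < nbump q r v) = (`|v - q| < r) &
  tsupp (nbump q r) `<=` [set v | `|v - q| <= r]].
Proof.
move=> r0; have bq : 0 < bump q r q by rewrite bump_gt0// subrr normr0.
have gt v : (0 < nbump q r v) = (`|v - q| < r).
  by rewrite /nbump pmulr_lgt0 ?invr_gt0// bump_gt0.
have ge v : 0 <= nbump q r v by rewrite divr_ge0 ?bump_ge0.
split=> //.
- have := smoothZ (bump q r q)^-1 (smooth_bump q r).
  by congr smooth; apply/funext => x; rewrite mulrC.
- by move=> v; rewrite ge/= ler_pdivrMr// mul1r bump_le.
- by rewrite /nbump divff// gt_eqF.
- apply: tsupp_sub; first exact: closed_cball.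
  by move=> v bv; rewrite /= ltW// -gt lt_neqAle eq_sym bv ge.
Qed.

Lemma nbump_test E q r : 0 < r -> [set v | `|v - q| <= r] `<=` E ->
  test_on E (nbump q r).
Proof.
move=> r0 rE; have [sb _ _ _ tb] := nbump_spec q r0; split=> //.
  exact: (subclosed_compact (@closed_closure _ _) (coord_compact c q r) tb).
exact: subset_trans rE.
Qed.

Lemma nbhs_cball (x : V) N : nbhs x N -> exists2 r, 0 < r & [set v | `|v - x| <= r] `<=` N.
Proof.
move=> /nbhs_normP[e /= e0 eN]; exists (e / 2); first by rewrite divr_gt0.
move=> v /= ve; apply: eN => /=; rewrite distrC (le_lt_trans ve)//.
by rewrite ltr_pdivrMr// ltr_pMr// ltr1n.
Qed.

Lemma test_bump_at E (x : V) N : open E -> E x -> nbhs x N -> exists p,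
  [/\ test_on E p, forall v, 0 <= p v <= 1, p x = 1 & tsupp p `<=` N].
Proof.
move=> oE Ex xN; have xEN : nbhs x (E `&` N).
  by apply: filterI => //; exact: open_nbhs_nbhs.
have [r r0 rEN] := nbhs_cball xEN; exists (nbump x r).
have [_ b01 b1 _ tb] := nbump_spec x r0; split=> //.
  by apply: nbump_test => // v /rEN[].
by move=> v /tb /rEN[].
Qed.

(** The family consists of normalised bumps with centres in a dense sequence and radii 1/(k+1);
    those whose closed ball leaves [E] are replaced by 0. The sets where they are positive form a
    countable base of [E], on which the later measurability and compactness arguments rest. *)
Lemma test_base_exists E : open E -> exists b : nat -> V -> R,
  (forall n, test_on E (b n) /\ forall v, 0 <= b n v <= 1) /\
  (forall x N, E x -> nbhs x N ->
     exists n, 0 < b n x /\ tsupp (b n) `<=` N).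
Proof.
move=> oE; have [q qd] := coord_dense c.
pose rad k : R := k.+1%:R^-1.
have rad0 k : 0 < rad k by rewrite invr_gt0.
pose B (m : nat * nat) := [set v | `|v - q m.1| <= rad m.2].
pose b' (m : nat * nat) : V -> R :=
  if `[< B m `<=` E >] then nbump (q m.1) (rad m.2) else cst 0.
have b'P m : test_on E (b' m) /\ forall v, 0 <= b' m v <= 1.
  rewrite /b'; case: asboolP => [BE|_].
    have [_ b01 _ _ _] := nbump_spec (q m.1) (rad0 m.2).
    by split=> //; exact: nbump_test.
  by split; [exact: test_on0|move=> v; rewrite lexx ler01].
exists (fun n => if unpickle n is Some m then b' m else cst 0); split.
  move=> n; case: unpickle => [m|]; first exact: b'P.
  by split; [exact: test_on0|move=> v; rewrite lexx ler01].
move=> x N Ex xN; have xEN : nbhs x (E `&` N).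
  by apply: filterI => //; exact: open_nbhs_nbhs.
have [r r0 rEN] := nbhs_cball xEN.
(* With radius at most r/2, a ball whose centre is within that radius of x stays in the ball of
   radius r around x. *)
pose k := Num.trunc (2 / r).
have rk : rad k <= r / 2.
  rewrite -[leRHS]invrK lef_pV2 ?posrE ?invr_gt0 ?divr_gt0//.
  by rewrite invf_div ltW// truncnS_gt.
have [n xn] := qd x _ (rad0 k); exists (pickle (n, k)); rewrite pickleK.
have sub : B (n, k) `<=` E `&` N.
  move=> v; rewrite /B/= => vn; apply: rEN => /=.
  have := ler_distD (q n) v x; rewrite (distrC (q n) x); lra.
rewrite /b'; case: asboolP => [BE|]; last by case=> v /sub[].
have [_ _ _ gt tb] := nbump_spec (q n) (rad0 k).
by split; [rewrite gt|move=> v /tb /sub[]].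
Qed.

(** By compactness a finite sum of base functions is positive on [K]; it is divided by its minimum
    over [K]. *)
Lemma test_majorant E (K : set V) : open E -> compact K -> K `<=` E ->
  exists eta, [/\ test_on E eta, forall v, 0 <= eta v & forall v, K v -> 1 <= eta v].
Proof.
move=> oE cK KE; have [b [bP bB]] := test_base_exists oE.
have bo n : open [set v | 0 < b n v].
  have [/test_on_continuous cb _] := bP n.
  by apply: (open_comp (D := [set y : R | 0 < y])) => [v _|]; [exact: cb|exact: open_gt].
have [v Kv|D KD] := compact_cover_seq cK bo.
  by have [n [bn _]] := bB v setT (KE _ Kv) filterT; exists n.
pose s v : R := \sum_(n <- D) b n v.
have ts : test_on E s by apply: test_on_sum => n; exact: (bP n).1.
have s0 v : 0 <= s v.
  by apply: sumr_ge0 => n _; have [_ /(_ v)/andP[]] := bP n.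
have sK v : K v -> 0 < s v.
  move=> /KD[n nD bn]; rewrite /s (big_rem n)//= ltr_pwDl//.
  by apply: sumr_ge0 => m _; have [_ /(_ v)/andP[]] := bP m.
have [[x0 Kx0]|K0] := pselect (exists x, K x); last first.
  by exists s; split=> // v Kv; exfalso; apply: K0; exists v.
have [||m Km mK] := @compact_EVT_min V R s K _ cK.
- by exists x0.
- by apply: continuous_subspaceT; exact: test_on_continuous ts.
exists (fun v => (s m)^-1 * s v); split; first exact: test_onZ.
  by move=> v; rewrite mulr_ge0// invr_ge0.
move=> v Kv; rewrite ler_pdivlMl ?mulr1.
  by apply: mK; exact: mem_set.
by apply: sK; exact: set_mem Km.
Qed.

End Bumps.

Section CoordinateInstances.
Context {R : realType}.

Lemma seg_compact (q r : R) : compact [set v : R | `|v - q| <= r].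
Proof.
have -> : [set v : R | `|v - q| <= r] = `[q - r, q + r]%classic.
  apply/seteqP; split => v /=; rewrite in_itv/= ler_norml; lra.
exact: segment_compact.
Qed.

Definition real_coordinates : coordinates (R : normedModType R).
Proof.
apply: (@Coordinates R R unit (fun _ v => v)).
- by move=> _ x.
- by [].
- by move=> v r r0; split=> [//|/(_ tt)].
- exact: seg_compact.
- exists (fun n => if unpickle n is Some a then ratr a else 0) => v e e0.
  have [a] := @rat_in_itvoo R (v - e) (v + e) ltac:(lra).
  rewrite in_itv/= => a1; exists (pickle a); rewrite pickleK ltr_norml; lra.
Defined.

Definition row_coordinates (d : nat) : coordinates 'rV[R]_d.
Proof.
apply: (@Coordinates R 'rV[R]_d 'I_d (fun i (v : 'rV[R]_d) => v ord0 i)).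
- by move=> i; exact: matrix_normedtype.coord_continuous.
- by move=> i x v h; rewrite !mxE.
- move=> v r r0; rewrite /Num.norm/= mx_normrE; split.
    move=> + i; apply: le_trans.
    exact: (le_bigmax _ (fun i : 'I_1 * 'I_d => `|v i.1 i.2|) (ord0, i)).
  by move=> vr; apply/bigmax_leP; split=> // -[i j] _ /=; rewrite ord1; exact: vr.
- move=> q r; have := @rV_compact R d (fun i => [set y : R | `|y - q ord0 i| <= r])
    (fun i => @seg_compact (q ord0 i) r).
  have [r0|r0] := leP 0 r.
    congr compact; apply/seteqP; split=> v /=.
      move=> vr; rewrite /Num.norm/= mx_normrE; apply/bigmax_leP; split=> //.
      by move=> [i j] _ /=; rewrite ord1 !mxE.
    rewrite /Num.norm/= mx_normrE => /bigmax_leP[_ vr] i.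
    by have := vr (ord0, i) isT; rewrite /= !mxE.
  move=> _; rewrite (_ : [set v | _] = set0); first exact: compact0.
  by apply/seteqP; split=> v //=; rewrite leNgt (lt_le_trans r0).
- exists (fun n => if unpickle n is Some a then map_mx ratr (a : 'rV[rat]_d) else 0) => v e e0.
  have /choice[a av] : forall i, exists a : rat, `|v ord0 i - ratr a| < e / 2.
    move=> i; have [a] := @rat_in_itvoo R (v ord0 i - e / 2) (v ord0 i + e / 2) ltac:(lra).
    by rewrite in_itv/= => a1; exists a; rewrite ltr_norml; lra.
  exists (pickle (\row_i a i)); rewrite pickleK.
  apply: (@le_lt_trans _ _ (e / 2)); last by lra.
  rewrite /Num.norm/= mx_normrE; apply/bigmax_leP; split; first lra.
  by move=> [i j] _ /=; rewrite ord1 !mxE ltW.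
Defined.

Definition prod_coordinates (U W : normedModType R) (cU : coordinates U)
  (cW : coordinates W) : coordinates (U * W)%type.
Proof.
apply: (@Coordinates R _ (coord_index cU + coord_index cW)%type
  (fun i z => match i with inl i => coord cU i z.1 | inr i => coord cW i z.2 end)).
- move=> [] i x.
    by apply: (@continuous_comp _ _ _ fst); [exact: cvg_fst|exact: coord_continuous].
  by apply: (@continuous_comp _ _ _ snd); [exact: cvg_snd|exact: coord_continuous].
- by move=> [] i x v h; rewrite coord_linear.
- move=> v r r0; rewrite prod_normE ge_max; split.
    by move=> /andP[/(coord_norm cU _ _ r0) v1 /(coord_norm cW _ _ r0) v2] [] i.
  move=> vr; apply/andP; split.
    by apply/(coord_norm cU _ _ r0) => i; exact: (vr (inl i)).
  by apply/(coord_norm cW _ _ r0) => i; exact: (vr (inr i)).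
- move=> q r; have := compact_setX (coord_compact cU q.1 r) (coord_compact cW q.2 r).
  congr compact; apply/seteqP; split=> v /=.
    by move=> [v1 v2]; rewrite prod_normE ge_max v1 v2.
  by rewrite prod_normE ge_max => /andP[].
- have [q1 d1] := coord_dense cU; have [q2 d2] := coord_dense cW.
  exists (fun n => if unpickle n is Some m then (q1 m.1, q2 m.2) else 0) => v e e0.
  have [n1 v1] := d1 v.1 e e0; have [n2 v2] := d2 v.2 e e0.
  by exists (pickle (n1, n2)); rewrite pickleK prod_normE gt_max v1 v2.
Defined.

End CoordinateInstances.

(** * Sums over configurations and the monotone class theorem *)

Section ThresholdPolynomials.
Context {R : realType}.
Implicit Types (t y : R) (m n : nat).

Lemma bernoulli_ge t m : 0 <= t <= 1 -> 1 - m%:R * t <= (1 - t) ^+ m.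
Proof.
move=> /andP[t0 t1]; elim: m => [|m IH]; first by rewrite mul0r subr0 expr0.
rewrite exprS -[m.+1]addn1 natrD.
have : (1 - t) * (1 - m%:R * t) <= (1 - t) * (1 - t) ^+ m by rewrite ler_wpM2l// subr_ge0.
apply: le_trans; have : 0 <= m%:R * t * t :> R by rewrite !mulr_ge0.
lra.
Qed.

Lemma bernoulli_le t m : 0 <= t <= 1 -> (1 - t) ^+ m * (1 + m%:R * t) <= 1.
Proof.
move=> /andP[t0 t1]; elim: m => [|m IH]; first by rewrite expr0 mul1r mul0r addr0.
rewrite exprS -[m.+1]addn1 natrD mulrAC mulrC.
apply: le_trans IH; rewrite ler_wpM2l ?exprn_ge0 ?subr_ge0//.
have : 0 <= m%:R * t * t :> R by rewrite !mulr_ge0.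
have : 0 <= t * t by rewrite mulr_ge0.
lra.
Qed.

(** On [0, 1] these polynomials converge boundedly to the indicator of y < 1/2, as in elementary
    proofs of the Stone-Weierstrass theorem. Indicators are thus reached without first approximating
    continuous functions. *)
Definition threshold n y : R := (1 - y ^+ n.*2) ^+ (n * 4 ^ n).

Lemma threshold_itv n y : 0 <= y <= 1 -> 0 <= threshold n y <= 1.
Proof.
move=> /andP[y0 y1]; have yn : 0 <= 1 - y ^+ n.*2 by rewrite subr_ge0 exprn_ile1.
by rewrite exprn_ge0//= exprn_ile1// gerBl exprn_ge0.
Qed.

(* The exponents are tuned so that n 4^n y^(2n) = n (2y)^(2n) tends to 0 for
   y < 1/2 and to infinity for y >= 1/2. *)
Lemma threshold_cvg y : 0 <= y <= 1 ->
  threshold n y @[n --> \oo] --> ((y < 2^-1)%R%:R : R).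
Proof.
move=> /andP[y0 y1]; have yn01 n : 0 <= y ^+ n.*2 <= 1.
  by rewrite exprn_ge0//= exprn_ile1.
have E n : (n * 4 ^ n)%:R * y ^+ n.*2 = n%:R * (2 * y) ^+ n.*2 :> R.
  rewrite natrM -mulrA exprMn natrX; congr (_ * (_ * _)).
  by rewrite -mul2n exprM; congr (_ ^+ _); rewrite -natrX.
case: ltP => y2.
- set x := 2 * y in E.
  have x0 : 0 <= x by rewrite mulr_ge0.
  have x1 : x < 1 by rewrite /x; lra.
  (* The bound n x^n <= C comes from [bernoulli_le] at 1 - x; of the factor x^(2n), one x^n is left
     over and tends to 0. *)
  pose C : R := (1 - x)^-1.
  have nx n : n%:R * x ^+ n <= C.
    rewrite -[leRHS]div1r ler_pdivlMr ?subr_gt0//.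
    have := @bernoulli_le (1 - x) n; rewrite (_ : 1 - (1 - x) = x); last by ring.
    move=> /(_ ltac:(lra)); have : 0 <= x ^+ n by rewrite exprn_ge0.
    rewrite mulrDr mulr1 mulrCA mulrA; lra.
  have cv : (fun n => 1 - C * x ^+ n) @ \oo --> (1 : R).
    rewrite -[X in _ --> X]subr0 -[X in _ --> _ - X](mulr0 C).
    apply: cvgB; first exact: cvg_cst.
    by apply: cvgM; [exact: cvg_cst|apply: cvg_expr; rewrite ger0_norm].
  apply: (@squeeze_cvgr _ _ _ _ (fun n => 1 - C * x ^+ n) (cst 1)); last 2 first.
  - exact: cv.
  - exact: cvg_cst.
  near=> n; have /andP[_ ->] := @threshold_itv n y (introT andP (conj y0 y1)).
  rewrite andbT; apply: le_trans (bernoulli_ge _ (yn01 n)).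
  rewrite E lerD2l lerN2 -addnn exprD mulrA.
  by rewrite ler_wpM2r ?exprn_ge0.
- apply: (@squeeze_cvgr _ _ _ _ (cst 0) (fun n => n.+1%:R^-1)).
  + near=> n; have /andP[-> _] := @threshold_itv n y (introT andP (conj y0 y1)).
    rewrite /= -[leRHS]div1r ler_pdivlMr ?ltr0n//.
    apply: le_trans (bernoulli_le (n * 4 ^ n) (yn01 n)).
    rewrite ler_wpM2l//; first by have /andP[] := @threshold_itv n y (introT andP (conj y0 y1)).
    rewrite E -addn1 natrD addrC lerD2l ler_peMr// exprn_ege1//; lra.
  + exact: cvg_cst.
  + exact: cvg_harmonic.
Unshelve. all: by end_near. Qed.

End ThresholdPolynomials.

Lemma indic_pred {R : pzRingType} {T : Type} (P : T -> bool) x :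
  \1_[set x | P x] x = (P x)%:R :> R.
Proof.
rewrite indicE; have [Px|/negP Px] := boolP (P x); first by rewrite mem_set.
by rewrite memNset.
Qed.

Section FunctionalMonotoneClass.
Context {R : realType} {T : Type}.
Variables (H S : set (T -> R)).
Hypothesis H_lin : forall a f g, H f -> H g -> H (fun x => a * f x + g x).
Hypothesis H_lim : forall (f_ : nat -> T -> R) f (M : R), (forall n, H (f_ n)) ->
  (forall n x, `|f_ n x| <= M) -> (forall x, f_ n x @[n --> \oo] --> f x) -> H f.
Hypothesis S_sub : S `<=` H.
Hypothesis S1 : S (cst 1).
Hypothesis S_bounded : forall s, S s -> exists M : R, forall x, `|s x| <= M.
(** This form covers the product formula of cosines as well as exponentials, for which s1 = s2 and c
    = 1/2. *)
Hypothesis S_mul : forall s s', S s -> S s' -> exists (c : R) s1 s2,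
  [/\ S s1, S s2 & forall x, s x * s' x = c * (s1 x + s2 x)].

(** [H] is a vector space but not an algebra. Asking that all products with members of [S] lie in
    [H] gives a space that can itself be multiplied by [S], hence by polynomials in a member of
    [S]. *)
Let H' : set (T -> R) := [set f | (exists M, forall x, `|f x| <= M) /\
  forall s, S s -> H (fun x => s x * f x)].

Let H'_lin a f g : H' f -> H' g -> H' (fun x => a * f x + g x).
Proof.
move=> [[M fM] Hf] [[N gN] Hg]; split.
  exists (`|a| * M + N) => x; rewrite (le_trans (ler_normD _ _))//.
  by rewrite normrM lerD// ler_wpM2l.
move=> s Ss; have := H_lin a (Hf _ Ss) (Hg _ Ss).
by congr H; apply/funext => x; ring.
Qed.

Let H'0 : H' (cst 0).
Proof.
split; first by exists 0 => x; rewrite normr0.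
move=> s Ss; have := H_lin (-1) (S_sub Ss) (S_sub Ss).
by congr H; apply/funext => x /=; ring.
Qed.

Let H'_lim (f_ : nat -> T -> R) f M : (forall n, H' (f_ n)) ->
  (forall n x, `|f_ n x| <= M) -> (forall x, f_ n x @[n --> \oo] --> f x) -> H' f.
Proof.
move=> Hf fM ff; split.
  exists M => x; have nf : `|f_ n x| @[n --> \oo] --> `|f x|.
    by apply: cvg_norm; exact: ff.
  by rewrite -(cvg_lim _ nf)//; apply: limr_le; [apply/cvg_ex; eexists; exact: nf|exact: nearW].
move=> s Ss; have [N sN] := S_bounded Ss.
apply: (@H_lim (fun n x => s x * f_ n x) _ (N * M)).
- by move=> n; have [_] := Hf n; exact.
- by move=> n x; rewrite normrM ler_pM.
- by move=> x; apply: cvgM; [exact: cvg_cst|exact: ff].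
Qed.

Let H'_S s f : S s -> H' f -> H' (fun x => s x * f x).
Proof.
move=> Ss [[M fM] Hf]; split.
  have [N sN] := S_bounded Ss.
  by exists (N * M) => x; rewrite normrM ler_pM.
move=> s' Ss'; have [c [s1 [s2 [S1' S2' E]]]] := S_mul Ss' Ss.
have := H_lin c (H_lin 1 (Hf _ S1') (Hf _ S2')) (H'0.2 _ S1).
by congr H; apply/funext => x /=; rewrite mul1r mulr0 addr0 -mulrDl mulrA -E mulrA.
Qed.

Let H'_affine_pow s a b k f : S s -> H' f -> H' (fun x => (a * s x + b) ^+ k * f x).
Proof.
move=> Ss; elim: k f => [|k IH] f Hf.
  by move: Hf; congr H'; apply/funext => x; rewrite expr0 mul1r.
have := IH _ (H'_lin a (H'_S Ss Hf) (H'_lin b Hf H'0)).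
by congr H'; apply/funext => x /=; rewrite exprSr; ring.
Qed.

Let H'_threshold s a b n f : S s -> H' f ->
  H' (fun x => threshold n (a * s x + b) * f x).
Proof.
rewrite /threshold => Ss; elim: (n * 4 ^ n)%N f => [|k IH] f Hf.
  by move: Hf; congr H'; apply/funext => x; rewrite expr0 mul1r.
have := IH _ (H'_lin (-1) (H'_affine_pow a b n.*2 Ss Hf) Hf).
by congr H'; apply/funext => x /=; rewrite [_ ^+ k.+1]exprSr; ring.
Qed.

Let H'_half s a f : S s -> H' f -> H' (fun x => \1_[set x | s x < a] x * f x).
Proof.
move=> Ss Hf; have [M sM] := S_bounded Ss; have [[N fN] _] := Hf.
(* L bounds |s - a|, so that y = 1/2 + (s - a) / (2 L) takes values in [0, 1], and s < a means y <
   1/2. *)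
pose L := Num.max M 0 + `|a| + 1.
have M0 : 0 <= Num.max M 0 by rewrite le_max lexx orbT.
have L0 : 0 < L by rewrite /L; have := normr_ge0 a; lra.
pose al := (L *+ 2)^-1; pose be := 2^-1 - al * a.
have al0 : 0 < al by rewrite invr_gt0 mulrn_wgt0.
have alL : al * L = 2^-1 by rewrite /al -mulr_natr; field; rewrite gt_eqF.
have y01 x : 0 <= al * s x + be <= 1.
  have sx : `|al * (s x - a)| <= 2^-1.
    rewrite normrM (gtr0_norm al0) -alL ler_wpM2l ?(ltW al0)//.
    have := ler_normB (s x) a; have := sM x.
    have : M <= Num.max M 0 by rewrite le_max lexx.
    rewrite /L; lra.
  by rewrite /be; move: sx; rewrite ler_norml mulrBr; lra.
apply: (@H'_lim (fun n x => threshold n (al * s x + be) * f x) _ N).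
- by move=> n; exact: H'_threshold.
- move=> n x; rewrite normrM -[leRHS]mul1r ler_pM//.
  by have /andP[? ?] := threshold_itv n (y01 x); rewrite ger0_norm.
- move=> x; apply: cvgM; last exact: cvg_cst.
  rewrite indic_pred (_ : (s x < a) = (al * s x + be < 2^-1)).
    exact: threshold_cvg (y01 x).
  by rewrite /be addrCA gtrDl subr_lt0 ltr_pM2l.
Qed.

(** The sets whose indicator multiplies [H'] into itself form a full sigma-algebra, because two such
    indicators can be applied in turn; no separate argument on intersections is needed. *)
Lemma functional_monotone_class B :
  <<s [set B | exists s a, S s /\ B = [set x | s x < a]] >> B -> H (\1_B).
Proof.
pose A : set (set T) := [set B | forall f, H' f -> H' (fun x => \1_B x * f x)].
suff AB : <<s [set B | exists s a, S s /\ B = [set x | s x < a]] >> `<=` A.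
  have H'1 : H' (cst 1).
    split; first by exists 1 => x; rewrite normr1.
    by move=> s /S_sub; congr H; apply/funext => x /=; rewrite mulr1.
  move=> /AB /(_ _ H'1) [_ /(_ _ S1)].
  by congr H; apply/funext => x /=; rewrite mul1r mulr1.
apply: smallest_sub; last by move=> _ [s [a [Ss ->]]] f; exact: H'_half.
split.
- move=> f Hf; move: H'0; congr H'; apply/funext => x /=.
  by rewrite indicE in_set0 mul0r.
- move=> C AC f Hf; have := H'_lin (-1) (AC _ Hf) Hf.
  congr H'; apply/funext => x /=; rewrite setTD !indicE in_setC.
  by case: (x \in C) => /=; ring.
- move=> C AC f Hf; have [[N fN] _] := Hf.
  pose U n := \bigcup_(i in [set i | (i < n)%N]) C i.
  have AU n : A (U n).
    elim: n => [|n IH] g Hg.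
      move: H'0; congr H'; apply/funext => x /=.
      by rewrite indicE memNset ?mul0r// => -[].
    have HU := IH _ Hg; have HC := AC n _ Hg.
    have := H'_lin (-1) (AC n _ HU) (H'_lin 1 HU HC).
    congr H'; apply/funext => x /=; rewrite !indicE.
    have -> : (x \in U n.+1) = (x \in U n) || (x \in C n).
      apply/idP/orP => [/set_mem[i /= ]|[/set_mem[i /= ni Ci]|/set_mem Cn]].
      - rewrite ltnS leq_eqVlt => /orP[/eqP -> Cn|ni Ci].
          by right; exact: mem_set.
        by left; apply: mem_set; exists i.
      - by apply: mem_set; exists i => //=; exact: ltnW.
      - by apply: mem_set; exists n => /=.
    by case: (x \in U n); case: (x \in C n) => /=; ring.
  apply: (@H'_lim (fun n x => \1_(U n) x * f x) _ N).
  + by move=> n; exact: AU.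
  + move=> n x; rewrite normrM -[leRHS]mul1r ler_pM//.
    by rewrite indicE; case: (_ \in _); rewrite ?normr1 ?normr0.
  + move=> x; apply: cvgM; last exact: cvg_cst.
    rewrite indicE; have [/set_mem[i _ Ci]|xC] := boolP (x \in \bigcup_n C n).
      apply: (@cvg_trans _ (1%:R @[_ --> \oo])); last exact: cvg_cst.
      apply: near_eq_cvg; near=> n; rewrite indicE mem_set//.
      by exists i => //=; near: n; exact: nbhs_infty_gt.
    apply: (@cvg_trans _ (0%:R @[_ --> \oo])); last exact: cvg_cst.
    apply: near_eq_cvg; near=> n; rewrite indicE memNset//.
    by move=> [i _ Ci]; move/negP: xC; apply; apply: mem_set; exists i.
Unshelve. all: by end_near. Qed.

End FunctionalMonotoneClass.

Section SetSums.
Context {R : realType} {I : choiceType}.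
Implicit Types (A : set I) (f g u : I -> R) (s : seq I).

Lemma eq_norm_le (x y c : R) : (forall e, 0 < e -> `|x - y| <= c * e) -> x = y.
Proof.
move=> xy; apply/eqP; rewrite -subr_eq0 -normr_le0; apply/ler_addgt0Pl => e e0.
rewrite addr0; have c0 : 0 < `|c| + 1 by rewrite ltr_wpDl.
apply: le_trans (xy (e / (`|c| + 1)) _) _; first by rewrite divr_gt0.
rewrite mulrA ler_pdivrMr// mulrC ler_wpM2l// ?ltW//.
by rewrite (le_lt_trans (ler_norm c))// ltrDl.
Qed.

Lemma esum_seq A u s : uniq s -> (forall z, z \in s -> A z) ->
  (forall z, 0 <= u z) -> (forall z, A z -> z \notin s -> u z = 0) ->
  \esum_(z in A) (u z)%:E = (\sum_(z <- s) u z)%:E.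
Proof.
move=> us sA u0 Au; have -> : \esum_(z in A) (u z)%:E = \esum_(z in [set` s]) (u z)%:E.
  rewrite esum_mkcond [RHS]esum_mkcond; apply: eq_esum => z _.
  have [/set_mem zA|zA] := boolP (z \in A); case: ifPn => //.
    by move=> zs; rewrite Au//; apply: contra zs => zs; exact: mem_set.
  by move=> /set_mem /= /sA /mem_set; rewrite (negbTE zA).
rewrite esum_fset//; last by move=> z _; rewrite lee_fin.
by rewrite -fsbig_seq// sumEFin.
Qed.

Lemma set_sum_seq A f s : uniq s -> (forall z, z \in s -> A z) ->
  (forall z, A z -> z \notin s -> f z = 0) ->
  set_sum A f = \sum_(z <- s) f z.
Proof.
move=> us sA Af; rewrite /set_sum !(@esum_seq _ _ s)//=.
- rewrite -sumrB; apply: eq_bigr => z _; rewrite !maxEge; case: ifPn; case: ifPn; lra.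
- by move=> z; rewrite le_max lexx orbT.
- by move=> z Az zs; rewrite Af// oppr0 maxxx.
- by move=> z; rewrite le_max lexx orbT.
- by move=> z Az zs; rewrite Af// maxxx.
Qed.

Lemma abs_summable_fin A f : abs_summable A f <-> (\esum_(z in A) `|f z|%:E < +oo)%E.
Proof. by []. Qed.

Lemma abs_summable_le A f g : (forall z, A z -> `|g z| <= `|f z|) ->
  abs_summable A f -> abs_summable A g.
Proof.
move=> gf; apply: le_lt_trans; apply: le_esum => z Az /=.
by rewrite lee_fin gf.
Qed.

(** The finite set is chosen once, for |f|: the tail of any u dominated by |f| is no larger than
    that of |f|. This uniformity in u reduces identities and limits of [set_sum] to finite sums. *)
Lemma esum_approx A f e : abs_summable A f -> 0 < e ->
  exists s, [/\ uniq s, forall z, z \in s -> A z &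
    forall u, (forall z, 0 <= u z) -> (forall z, A z -> u z <= `|f z|) ->
      0 <= fine (\esum_(z in A) (u z)%:E) - \sum_(z <- s) u z <= e].
Proof.
move=> sf e0; set S := \esum_(z in A) `|(f z)%:E|%E.
have Sfin : S \is a fin_num by rewrite ge0_fin_numE// esum_ge0.
have [_ [F [finF FA] <-]] := ub_ereal_sup_adherent e0 Sfin.
have [s0 Fs0] := (finite_seqP F).1 finF.
pose s := undup s0; have us : uniq s := undup_uniq s0.
have sF z : (z \in s) = (z \in F) by rewrite mem_undup Fs0; apply/idP/idP => [?|/set_mem//]; exact: mem_set.
have sA z : z \in s -> A z by rewrite sF => /set_mem /FA.
have split u : (forall z, 0 <= u z) -> \esum_(z in A) (u z)%:E =
    ((\sum_(z <- s) u z)%:E + \esum_(z in A `&` ~` [set` s]) (u z)%:E)%E.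
  move=> u0; rewrite (esumID [set` s]); last by move=> z _; rewrite lee_fin.
  congr (_ + _)%E; apply: esum_seq => //.
    by move=> z zs; split=> //; exact: sA.
  by move=> z [_ /= ->].
have -> : (\sum_(z \in F) `|(f z)%:E| = (\sum_(z <- s) `|f z|)%:E)%E.
  have -> : F = [set` s].
    by apply/seteqP; split=> z /=; rewrite sF; [exact: mem_set|exact: set_mem].
  by rewrite -fsbig_seq// -sumEFin.
rewrite -/(esum _ _) -/S => Se.
have re : (\esum_(z in A `&` ~` [set` s]) `|f z|%:E <= e%:E)%E.
  move: Se; rewrite /S (split (fun z => `|f z|))//.
  set a := \sum_(_ <- _) _; set r := esum _ _.
  have r0 : (0 <= r)%E by apply: esum_ge0 => z _; rewrite lee_fin.
  case: r r0 => [r| |]//= r0.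
  by rewrite -!EFinD lte_fin lee_fin; lra.
exists s; split=> // u u0 uf; rewrite (split u u0).
set r := esum _ _.
have r0 : (0 <= r)%E by apply: esum_ge0 => z _; rewrite lee_fin.
have rle : (r <= e%:E)%E.
  by apply: le_trans re; apply: le_esum => z [Az _]; rewrite lee_fin uf.
by case: r r0 rle => [r| |]//=; rewrite !lee_fin => r0 re'; lra.
Qed.

Lemma set_sum_approx A f e : abs_summable A f -> 0 < e ->
  exists s, [/\ uniq s, forall z, z \in s -> A z &
    forall g, (forall z, A z -> `|g z| <= `|f z|) ->
      `|set_sum A g - \sum_(z <- s) g z| <= e].
Proof.
move=> sf e0; have [s [us sA sP]] := esum_approx sf e0.
exists s; split=> // g gf.
have /andP[p1 p2] := sP (fun z => Num.max (g z) 0) (fun z => ltac:(by rewrite le_max lexx orbT))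
   (fun z Az => ltac:(by rewrite ge_max normr_ge0 andbT (le_trans (ler_norm _))// gf)).
have /andP[q1 q2] := sP (fun z => Num.max (- g z) 0) (fun z => ltac:(by rewrite le_max lexx orbT))
   (fun z Az => ltac:(by rewrite ge_max normr_ge0 andbT (le_trans (ler_norm _))// normrN gf)).
have -> : \sum_(z <- s) g z = \sum_(z <- s) Num.max (g z) 0 - \sum_(z <- s) Num.max (- g z) 0.
  by rewrite -sumrB; apply: eq_bigr => z _; rewrite !maxEge; case: ifPn; case: ifPn; lra.
by rewrite /set_sum ler_norml; apply/andP; split; lra.
Qed.

Lemma abs_summableD A f g : abs_summable A f -> abs_summable A g ->
  abs_summable A (fun z => f z + g z).
Proof. exact: summableD. Qed.

Lemma abs_summable_norm A f : abs_summable A f -> abs_summable A (fun z => `|f z|).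
Proof. by apply: abs_summable_le => z _; rewrite normr_id. Qed.

Lemma abs_summableZ A a f : abs_summable A f -> abs_summable A (fun z => a * f z).
Proof.
move=> sf; have [n na] : exists n, `|a| <= n%:R.
  by exists (Num.trunc `|a|).+1; rewrite ltW// truncnS_gt.
have sn : abs_summable A (fun z => n%:R * f z).
  elim: n {na} => [|n IH].
    apply: abs_summable_le sf => z _; rewrite mul0r normr0//.
  have := abs_summableD sf IH.
  by congr abs_summable; apply/funext => z; rewrite -[n.+1]add1n natrD mulrDl mul1r.
apply: abs_summable_le sn => z _.
by rewrite !normrM ler_wpM2r// (le_trans na)// ler_norm.
Qed.

Lemma set_sum_lin A a f g : abs_summable A f -> abs_summable A g ->
  set_sum A (fun z => a * f z + g z) = a * set_sum A f + set_sum A g.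
Proof.
(* F dominates all three summands, so that one finite set approximates the three sums at once. *)
move=> sf sg; pose F z := `|a * f z| + `|f z| + `|g z|.
have sF : abs_summable A F.
  apply: abs_summableD; last exact: abs_summable_norm.
  by apply: abs_summableD; apply: abs_summable_norm => //; exact: abs_summableZ.
have F0 z : `|F z| = F z by rewrite ger0_norm// /F !addr_ge0.
apply: (@eq_norm_le _ _ (2 + `|a|)) => e e0.
have [s [us sA sP]] := set_sum_approx sF e0.
have Fs := sP (fun z => a * f z + g z) _.
have {Fs} := Fs (fun z _ => ltac:(rewrite F0 /F; have := ler_normD (a * f z) (g z);
   have := normr_ge0 (f z); lra)).
have := sP f (fun z _ => ltac:(rewrite F0 /F; have := normr_ge0 (a * f z); have := normr_ge0 (g z); lra)).
have := sP g (fun z _ => ltac:(rewrite F0 /F; have := normr_ge0 (a * f z); have := normr_ge0 (f z); lra)).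
rewrite big_split /= -mulr_sumr.
set x := set_sum A g; set y := set_sum A f; set w := set_sum A _.
set sg' := \sum_(_ <- _) _; set sf' := \sum_(_ <- _) _ => h1 h2 h3.
have -> : w - (a * y + x) = (w - (a * sf' + sg')) - a * (y - sf') - (x - sg') by ring.
have h4 : `|a * (y - sf')| <= `|a| * e by rewrite normrM ler_wpM2l.
have := ler_normB (w - (a * sf' + sg') - a * (y - sf')) (x - sg').
have := ler_normB (w - (a * sf' + sg')) (a * (y - sf')).
lra.
Qed.

Lemma abs_summable_0 A : abs_summable A (fun _ => 0 : R).
Proof. by rewrite /abs_summable /summable esum1// => z _; rewrite /= normr0. Qed.

Lemma set_sum0 A : set_sum A (fun _ => 0 : R) = 0.
Proof. by rewrite (@set_sum_seq _ _ [::])// big_nil. Qed.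

Lemma set_sumZ A a f : abs_summable A f -> set_sum A (fun z => a * f z) = a * set_sum A f.
Proof.
move=> sf; have := set_sum_lin a sf (abs_summable_0 A).
rewrite set_sum0 addr0 => <-; congr set_sum; apply/funext => z; by rewrite addr0.
Qed.

Lemma set_sumD A f g : abs_summable A f -> abs_summable A g ->
  set_sum A (fun z => f z + g z) = set_sum A f + set_sum A g.
Proof.
move=> sf sg; have := set_sum_lin 1 sf sg.
by rewrite mul1r => <-; congr set_sum; apply/funext => z; rewrite mul1r.
Qed.

Lemma set_sum_cvg A (f_ : nat -> I -> R) f F : abs_summable A F ->
  (forall n z, A z -> `|f_ n z| <= `|F z|) ->
  (forall z, A z -> f_ n z @[n --> \oo] --> f z) ->
  set_sum A (f_ n) @[n --> \oo] --> set_sum A f.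
Proof.
move=> sF fF ff; have fF' z : A z -> `|f z| <= `|F z|.
  move=> Az; have nf : `|f_ n z| @[n --> \oo] --> `|f z|.
    by apply: cvg_norm; exact: ff.
  rewrite -(cvg_lim _ nf)//; apply: limr_le; first by apply/cvg_ex; eexists; exact: nf.
  by apply: nearW => n; exact: fF.
apply/cvgrPdist_le => e e0; have e3 : 0 < e / 3 by rewrite divr_gt0.
have [s [us sA sP]] := set_sum_approx sF e3.
have cs : (fun n => \sum_(z <- s) f_ n z) @ \oo --> \sum_(z <- s) f z.
  have : forall z, z \in s -> f_ n z @[n --> \oo] --> f z by move=> z /sA; exact: ff.
  elim: (s) => [|z r IH] rf.
    by under eq_fun do rewrite big_nil; rewrite big_nil; exact: cvg_cst.
  under eq_fun do rewrite big_cons; rewrite big_cons.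
  apply: cvgD; first by apply: rf; rewrite inE eqxx.
  by apply: IH => y yr; apply: rf; rewrite inE yr orbT.
near=> n.
have h1 := sP f fF'; have h2 := sP (f_ n) (fF n).
have h3 : `|\sum_(z <- s) f z - \sum_(z <- s) f_ n z| <= e / 3.
  by near: n; move/cvgrPdist_le : cs => /(_ _ e3).
move: h1 h2 h3; set x := set_sum _ _; set y := set_sum _ _.
set x' := \sum_(_ <- _) f _; set y' := \sum_(_ <- _) f_ _ _ => h1 h2 h3.
have -> : x - y = (x - x') + (x' - y') - (y - y') by ring.
have := ler_normB (x - x' + (x' - y')) (y - y'); have := ler_normD (x - x') (x' - y').
lra.
Unshelve. all: by end_near. Qed.

Lemma eq_set_sum A f g : (forall z, A z -> f z = g z) -> set_sum A f = set_sum A g.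
Proof.
move=> fg; rewrite /set_sum; congr (fine _ - fine _);
  by apply: eq_esum => z Az; rewrite fg.
Qed.

Lemma abs_summable_subset A B f : A `<=` B -> abs_summable B f -> abs_summable A f.
Proof.
move=> AB; apply: le_lt_trans; rewrite esum_mkcond [leRHS]esum_mkcond.
apply: le_esum => z _; case: ifPn => [/set_mem/AB zB|_]; first by rewrite mem_set.
by case: ifP => // _; rewrite abse_ge0.
Qed.

Lemma set_sum_setD1 A f z : A z -> abs_summable A f ->
  set_sum (A `\ z) f = set_sum A f - f z.
Proof.
move=> Az sf; pose g y := if y == z then 0 else f y.
have sg : abs_summable A g.
  by apply: abs_summable_le sf => y _; rewrite /g; case: ifP; rewrite ?normr0.
have -> : set_sum (A `\ z) f = set_sum A g.
  rewrite /set_sum; congr (fine _ - fine _); rewrite esum_mkcond [RHS]esum_mkcond;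
    apply: eq_esum => y _; rewrite /g;
    (have [yAz|nyAz] := pselect ((A `\ z) y);
     [rewrite (mem_set yAz) (mem_set yAz.1) ifF//; apply/eqP; exact: yAz.2
     |rewrite (memNset nyAz); case: ifPn => // /set_mem Ay; rewrite ifT ?oppr0 ?maxxx//;
      apply/eqP; apply: contrapT => yz; apply: nyAz; by split]).
pose h y := if y == z then f z else 0.
have sh : abs_summable A h.
  apply: abs_summable_le sf => y _; rewrite /h; case: ifP => [/eqP ->//|_].
  by rewrite normr0.
have -> : set_sum A f = set_sum A g + set_sum A h.
  rewrite -set_sumD//; apply: eq_set_sum => y _; rewrite /g /h.
  by case: eqVneq => [->|]; rewrite ?add0r ?addr0.
rewrite (@set_sum_seq A h [:: z])//=.
- by rewrite big_seq1 /h eqxx addrK.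
- by move=> y; rewrite inE => /eqP ->.
- by move=> y _; rewrite inE /h => /negbTE ->.
Qed.

Lemma abs_summable_seq A f s : (forall z, z \in s -> A z) ->
  (forall z, A z -> z \notin s -> f z = 0) -> abs_summable A f.
Proof.
move=> sA Af; apply/abs_summable_fin.
rewrite (@esum_seq _ _ (undup s)) ?ltry ?undup_uniq//.
- by move=> z; rewrite mem_undup; exact: sA.
- by move=> z Az; rewrite mem_undup => zs; rewrite Af// normr0.
Qed.

End SetSums.

Section ConfigurationPoints.
Context {R : realType} {d : nat} (E : set (R * 'rV[R]_d)%type).
Local Notation Z := (R * 'rV[R]_d)%type.
Implicit Types (gam : config E) (K : set Z) (f psi : Z -> R).

Definition points gam K : seq Z := finmap.enum_fset (fset_set (config_set gam `&` K)).

Lemma points_uniq gam K : uniq (points gam K).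
Proof. exact: finmap.fset_uniq. Qed.

Lemma mem_points gam K z : compact K -> K `<=` E ->
  (z \in points gam K) <-> (config_set gam z /\ K z).
Proof.
move=> cK KE; have fK := config_locally_finite gam KE cK.
rewrite /points; have := in_fset_set fK z; rewrite /finmap.pred_of_finset => ->.
by split=> [/set_mem|/mem_set].
Qed.

Lemma set_sum_points gam K f : compact K -> K `<=` E ->
  (forall z, ~ K z -> f z = 0) -> set_sum gam f = \sum_(z <- points gam K) f z.
Proof.
move=> cK KE fK; apply: set_sum_seq; first exact: points_uniq.
  by move=> z /(mem_points _ _ cK KE)[].
move=> z gz zp; apply: fK => Kz; move/negP: zp; apply.
exact/(mem_points _ _ cK KE).
Qed.

Lemma summable_compact gam K f : compact K -> K `<=` E ->
  (forall z, ~ K z -> f z = 0) -> abs_summable gam f.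
Proof.
move=> cK KE fK; apply: (@abs_summable_seq _ _ _ _ (points gam K)).
  by move=> z /(mem_points _ _ cK KE)[].
move=> z gz zp; apply: fK => Kz; move/negP: zp; apply.
exact/(mem_points _ _ cK KE).
Qed.

Lemma summable_test gam psi : test_on E psi -> abs_summable gam psi.
Proof. by move=> [_ cK KE]; apply: (summable_compact _ cK KE) => z; exact: notin_tsupp. Qed.

Lemma set_sum_testD gam psi psi' : test_on E psi -> test_on E psi' ->
  set_sum gam (fun z => psi z + psi' z) = set_sum gam psi + set_sum gam psi'.
Proof. by move=> t t'; apply: set_sumD; exact: summable_test. Qed.

Lemma set_sum_testZ gam a psi : test_on E psi ->
  set_sum gam (fun z => a * psi z) = a * set_sum gam psi.
Proof. by move=> t; apply: set_sumZ; exact: summable_test. Qed.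

Lemma config_rem_sub gam z : config_set gam `\ z `<=` E.
Proof. by move=> y [] /config_sub. Qed.

Lemma config_rem_lf gam z K : K `<=` E -> compact K ->
  finite_set ((config_set gam `\ z) `&` K).
Proof.
move=> KE cK; apply: sub_finite_set (config_locally_finite gam KE cK).
by move=> y [[? _] ?].
Qed.

Definition config_rem gam z : config E := Config (@config_rem_sub gam z) (@config_rem_lf gam z).

Lemma set_sum_rem gam z f : config_set gam z -> abs_summable gam f ->
  set_sum (config_rem gam z) f = set_sum gam f - f z.
Proof. exact: set_sum_setD1. Qed.

Lemma config_eq gam gam' : config_set gam = config_set gam' -> gam = gam'.
Proof.
case: gam gam' => [A A1 A2] [B B1 B2] /= AB; subst B.
by congr Config; exact: Prop_irrelevance.
Qed.

End ConfigurationPoints.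

Section BoundedMonotoneClass.
Context {R : realType} {disp : measure_display} {T : measurableType disp}.

Lemma sum_ltn_minn n k : (\sum_(j < n) (j < k) = minn n k)%N.
Proof.
elim: n => [|n IH]; first by rewrite big_ord0 min0n.
rewrite big_ord_recr /= IH; case: (ltnP n k) => nk.
  by rewrite (minn_idPl nk) addn1.
by rewrite (minn_idPr (leqW nk)) addn0.
Qed.

(** A function f with values in [0, 1] is the uniform limit of floor((n+1) f) / (n+1), which is an
    average of indicators of level sets of f. An affine change reduces bounded functions to this
    case. *)
Lemma unit_bounded_approx (H : set (T -> R)) :
  (forall a f g, H f -> H g -> H (fun x => a * f x + g x)) ->
  (forall (f_ : nat -> T -> R) f (M : R), (forall n, H (f_ n)) ->
     (forall n x, `|f_ n x| <= M) -> (forall x, f_ n x @[n --> \oo] --> f x) -> H f) ->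
  (forall B, measurable B -> H (\1_B)) ->
  forall (f : T -> R) (M : R), measurable_fun setT f -> (forall x, `|f x| <= M) -> H f.
Proof.
move=> H_lin H_lim HB.
have H0 : H (cst 0).
  by have := HB set0 measurable0; congr H; apply/funext => x; rewrite indic0.
have H1 : H (cst 1).
  by have := HB setT measurableT; congr H; apply/funext => x; rewrite indicT.
have unit (f : T -> R) : measurable_fun setT f -> (forall x, 0 <= f x <= 1) -> H f.
  move=> mf f01.
  pose f_ n x : R := n.+1%:R^-1 * \sum_(j < n.+1) \1_[set x | j.+1%:R <= n.+1%:R * f x] x.
  have fE n x : f_ n x = n.+1%:R^-1 * (Num.trunc (n.+1%:R * f x))%:R.
    have /andP[f0 f1] := f01 x; have nf0 : 0 <= n.+1%:R * f x by rewrite mulr_ge0.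
    congr (_ * _); rewrite (eq_bigr (fun j : 'I_n.+1 =>
      ((j < Num.trunc (n.+1%:R * f x))%N : nat)%:R)); last first.
      by move=> j _; rewrite indic_pred -truncn_ge_nat.
    rewrite -natr_sum sum_ltn_minn; congr (_%:R); apply/minn_idPr.
    rewrite truncn_le_nat; apply: (@le_lt_trans _ _ n.+1%:R); last by rewrite ltr_nat.
    by rewrite -[leRHS]mulr1 ler_wpM2l.
  have near_f n x : `|f x - f_ n x| <= n.+1%:R^-1.
    have /andP[f0 f1] := f01 x; have nf0 : 0 <= n.+1%:R * f x by rewrite mulr_ge0.
    have /andP[t1 t2] := truncn_itv nf0; rewrite fE.
    have -> : f x - n.+1%:R^-1 * (Num.trunc (n.+1%:R * f x))%:R =
       n.+1%:R^-1 * (n.+1%:R * f x - (Num.trunc (n.+1%:R * f x))%:R).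
      by rewrite mulrBr mulrA mulVf// mul1r.
    rewrite normrM gtr0_norm ?invr_gt0// -[leRHS]mulr1 ler_wpM2l ?invr_ge0//.
    by rewrite ger0_norm ?subr_ge0// lerBlDr addrC natr1 ltW.
  apply: (H_lim f_ _ 2).
  - move=> n; have Hs : H (fun x => \sum_(j < n.+1) \1_[set x | j.+1%:R <= n.+1%:R * f x] x).
      have : forall j : nat, H (\1_[set x | j.+1%:R <= n.+1%:R * f x]).
        move=> j; apply: HB; rewrite -[X in measurable X]setTI.
        have := measurable_funM (@measurable_cst _ _ _ _ setT (n.+1%:R : R)) mf.
        move=> /(_ measurableT `[j.+1%:R, +oo[%classic (measurable_itv _)).
        by congr measurable; apply/seteqP; split => x /=; rewrite in_itv/= andbT.
      move=> HI; suff: forall m, H (fun x => \sum_(j < m) \1_[set x | j.+1%:R <= n.+1%:R * f x] x) by exact.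
      elim=> [|m IH].
        by under eq_fun do rewrite big_ord0.
      under eq_fun do rewrite big_ord_recr /=.
      have := H_lin 1 _ _ IH (HI m).
      by congr H; apply/funext => x; rewrite mul1r.
    have := H_lin n.+1%:R^-1 _ _ Hs H0.
    by congr H; apply/funext => x; rewrite addr0.
  - move=> n x; have /andP[f0 f1] := f01 x.
    have n1 : n.+1%:R^-1 <= 1 :> R by rewrite invf_le1// ler1n.
    rewrite -(subKr (f x) (f_ n x)); apply: le_trans (ler_normB _ _) _.
    rewrite -[leRHS]/(1 + 1) lerD//; first by rewrite ger0_norm.
    exact: le_trans (near_f n x) n1.
  - move=> x; apply/cvgrPdist_le => e e0; near=> n.
    apply: le_trans (near_f n x) _.
    near: n; have := @cvg_harmonic R; move/cvgrPdist_le => /(_ _ e0).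
    apply: filterS => n; rewrite /harmonic sub0r normrN gtr0_norm ?invr_gt0//.
move=> f M mf fM; pose L := `|M| + 1; have L0 : 0 < L by rewrite ltr_wpDl.
have Hg : H (fun x => (2 * L)^-1 * (f x + L)).
  apply: unit.
    by apply: measurable_funM => //; apply: measurable_funD.
  move=> x; have := fM x; have := ler_norm M; rewrite ler_norml => ? ?.
  by rewrite mulr_ge0 ?invr_ge0 /L ?ler_pdivrMl ?mulr_gt0//; lra.
have := H_lin (- L) _ _ H1 (H_lin (2 * L) _ _ Hg H0).
congr H; apply/funext => x; rewrite /= addr0 mulrA divff ?mul1r ?gt_eqF ?mulr_gt0//; ring.
Unshelve. all: by end_near. Qed.

End BoundedMonotoneClass.

Section MeasurabilityOfStateSpace.
Context {R : realType} {d : nat}.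
Local Notation V := 'rV[R]_d.
Local Notation Z := (R * V)%type.

Definition state_coordinates : coordinates (Z : normedModType R) :=
  prod_coordinates real_coordinates (row_coordinates d).

Lemma open_measurable_rV (O : set V) : open O -> measurable O.
Proof. exact: sub_sigma_algebra. Qed.

(** [Z] carries the product sigma-algebra. Separability is what puts open sets in it: each is a
    countable union of products of balls with centres in a dense sequence. *)
Lemma open_measurableZ (O : set Z) : open O -> measurable O.
Proof.
move=> oO; have [q qd] := coord_dense state_coordinates.
pose rad k : R := k.+1%:R^-1; have rad0 k : 0 < rad k by rewrite invr_gt0.
pose B (m : nat * nat) : set Z := ball (q m.1).1 (rad m.2) `*` ball (q m.1).2 (rad m.2).
have BE m : B m = ball (q m.1) (rad m.2).
  by apply/seteqP; split => -[x y] [].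
have -> : O = \bigcup_(m in [set m | B m `<=` O]) B m.
  apply/seteqP; split=> [z Oz|z [m /= mO]]; last exact: mO.
  have /nbhs_ballP[e /= e0 eO] : nbhs z O by exact: open_nbhs_nbhs.
  pose k := Num.trunc (2 / e).
  have rk : rad k <= e / 2.
    rewrite -[leRHS]invrK lef_pV2 ?posrE ?invr_gt0 ?divr_gt0//.
    by rewrite invf_div ltW// truncnS_gt.
  have [n zn] := qd z _ (rad0 k).
  have bz : ball (q n) (rad k) z by rewrite -ball_normE/= distrC.
  exists (n, k) => /=; last by rewrite BE.
  rewrite BE /= => y yn; apply: eO.
  apply: (le_ball (e1 := rad k + rad k)); first by lra.
  by apply: (ball_triangle (y := q n)); [exact: ball_sym|].
rewrite bigcup_mkcond; apply: countable_bigcupT_measurable.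
  exact: countableP.
move=> m; case: ifP => // _; apply: measurableX; first exact: measurable_ball.
by apply: open_measurable_rV; exact: ball_open.
Qed.

Lemma continuous_measurableZ (f : Z -> R) : continuous f -> measurable_fun setT f.
Proof.
move=> cf; apply: (measurability _ (RGenOpens.measurableE R)).
move=> _ [_ [a [b ->] <-]]; rewrite setTI; apply: open_measurableZ.
by apply: open_comp => [x _|]; [exact: cf|exact: interval_open].
Qed.

Lemma measurable_test E (psi : Z -> R) : test_on E psi -> measurable_fun setT psi.
Proof. by move=> /test_on_continuous /continuous_measurableZ. Qed.

(** The preimage of an open set is a countable union of sets where some b_n o f is positive. The
    criterion serves to show that a class of functions generates the sigma-algebra. *)
Lemma measurable_to_state {disp} {T : measurableType disp} (f : T -> Z) :
  (forall zeta : Z -> R, test_on setT zeta -> (forall z, 0 <= zeta z) ->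
     measurable_fun setT (zeta \o f)) ->
  measurable_fun setT f.
Proof.
move=> mf; have mU (U : set Z) : open U -> measurable (f @^-1` U).
  move=> oU; have [b [bP bB]] := test_base_exists state_coordinates oU.
  have -> : f @^-1` U = \bigcup_n (f @^-1` [set z | 0 < b n z]).
    apply/seteqP; split=> [t /= Uft|t [n _ /=]].
      have [n [bn _]] := bB (f t) setT Uft filterT; by exists n.
    move=> bn; have [[_ _ sub] _] := bP n; apply: sub.
    by apply: subset_closure => /=; rewrite gt_eqF.
  apply: bigcupT_measurable => n; have [tb b01] := bP n.
  have := mf (b n) (test_onS (@subsetT _ _) tb) (fun z => (andP (b01 z)).1).
  move=> /(_ measurableT `]0, +oo[%classic (measurable_itv _)).
  by rewrite setTI; congr measurable; apply/seteqP; split => x /=; rewrite in_itv/= andbT.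
have mf1 : measurable_fun setT (fst \o f).
  apply: (measurability _ (RGenOpens.measurableE R)).
  move=> _ [_ [a [b ->] <-]]; rewrite setTI comp_preimage; apply: mU.
  by apply: open_comp => [x _|]; [exact: cvg_fst|exact: interval_open].
have mf2 : measurable_fun setT (snd \o f).
  apply: (@measurability _ _ _ V setT (snd \o f) (@open V)) => //.
  move=> _ [U oU <-]; rewrite setTI comp_preimage; apply: mU.
  by apply: open_comp => [x _|//]; exact: cvg_snd.
by apply/measurable_fun_pairP.
Qed.

End MeasurabilityOfStateSpace.

Section MeasurabilityOfConfigurations.
Context {R : realType} {d : nat} (E : set (R * 'rV[R]_d)%type).
Local Notation Z := (R * 'rV[R]_d)%type.
Hypothesis oE : open E.

Lemma measurable_set_sum (psi : Z -> R) : test_on E psi ->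
  measurable_fun setT (fun gam : config_space E => set_sum gam psi).
Proof.
move=> tpsi _ B mB; rewrite setTI; apply: sub_sigma_algebra.
by exists psi, B.
Qed.

(** Nonnegative test functions suffice, since psi = (psi + M eta) - M eta with eta >= 1 on the
    support of psi and M >= |psi|. *)
Lemma measurable_to_config {disp} {T : measurableType disp} (f : T -> config_space E) :
  (forall chi : Z -> R, test_on E chi -> (forall z, 0 <= chi z) ->
     measurable_fun setT (fun t => set_sum (f t) chi)) ->
  measurable_fun setT f.
Proof.
move=> mf; have mfs psi : test_on E psi -> measurable_fun setT (fun t => set_sum (f t) psi).
  move=> tpsi; have [M M0 psiM] := test_on_bounded tpsi; have [_ cK KE] := tpsi.
  have [eta [teta eta0 eta1]] := test_majorant state_coordinates oE cK KE.
  have tMeta := test_onZ M teta.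
  have t1 := test_onD tpsi tMeta.
  have -> : (fun t => set_sum (f t) psi) =
      (fun t => set_sum (f t) (fun z => psi z + M * eta z) - set_sum (f t) (fun z => M * eta z)).
    by apply/funext => t; rewrite set_sum_testD// addrK.
  apply: measurable_funB; apply: mf => // z; last exact: mulr_ge0.
  have [/eta1 e1|/notin_tsupp ->] := pselect (tsupp psi z); last by rewrite add0r mulr_ge0.
  have := psiM z; rewrite ler_norml => /andP[p1 _].
  have := ler_wpM2l M0 e1; lra.
apply: (@measurability _ _ T (config_space E) setT f (@config_cylinders R d E)) => //.
move=> _ [_ [psi [B [tpsi mB ->]]] <-]; rewrite setTI.
have := mfs psi tpsi measurableT B mB; by rewrite setTI.
Qed.

End MeasurabilityOfConfigurations.

Section RealIntegrals.
Context {R : realType} {disp : measure_display} {T : measurableType disp}.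
Variable mu : {measure set T -> \bar R}.
Implicit Types (f g : T -> R).

Definition rintegrable f : Prop := mu.-integrable setT (EFin \o f).

Lemma rintegrable_measurable f : rintegrable f -> measurable_fun setT f.
Proof. by move=> /measurable_int /measurable_EFinP. Qed.

Lemma rintegrable_le f g : measurable_fun setT f -> rintegrable g ->
  (forall t, `|f t| <= `|g t|) -> rintegrable f.
Proof.
move=> mf ig fg; apply: (le_integrable measurableT _ _ ig).
  exact/measurable_EFinP.
by move=> t _ /=; rewrite lee_fin.
Qed.

Lemma rintegrable_lin a f g : rintegrable f -> rintegrable g ->
  rintegrable (fun t => a * f t + g t).
Proof.
move=> fi gi; have := integrableD measurableT (integrableZl measurableT a fi) gi.
by apply: eq_integrable.
Qed.

Lemma Rintegral_lin a f g : rintegrable f -> rintegrable g ->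
  (\int[mu]_t (a * f t + g t) = a * \int[mu]_t f t + \int[mu]_t g t)%R.
Proof.
move=> fi gi; have af : rintegrable (fun t => a * f t).
  by have := integrableZl measurableT a fi; apply: eq_integrable.
by rewrite RintegralD// RintegralZl.
Qed.

Lemma rintegrableZ a f : rintegrable f -> rintegrable (fun t => a * f t).
Proof.
by move=> fi; have := integrableZl measurableT a fi; apply: eq_integrable.
Qed.

Lemma rintegrableD f g : rintegrable f -> rintegrable g -> rintegrable (fun t => f t + g t).
Proof.
move=> fi gi; have := rintegrable_lin 1 fi gi.
by congr rintegrable; apply/funext => t; rewrite mul1r.
Qed.

Lemma rintegrableB f g : rintegrable f -> rintegrable g -> rintegrable (fun t => f t - g t).
Proof.
move=> fi gi; have := rintegrable_lin (-1) gi fi.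
by congr rintegrable; apply/funext => t; rewrite mulN1r addrC.
Qed.

Lemma rintegrable_norm f : rintegrable f -> rintegrable (fun t => `|f t|).
Proof.
move=> fi; apply: (rintegrable_le _ fi) => [|t]; last by rewrite normr_id.
by apply: measurableT_comp => //; exact: rintegrable_measurable.
Qed.

Lemma rintegrableM f g (M : R) : measurable_fun setT f -> (forall t, `|f t| <= M) ->
  rintegrable g -> rintegrable (fun t => f t * g t).
Proof.
move=> mf fM gi; apply: (rintegrable_le _ (rintegrableZ M gi)).
  by apply: measurable_funM => //; exact: rintegrable_measurable.
move=> t; rewrite !normrM ler_wpM2r// (le_trans (fM t))// ler_norm//.
Qed.

Lemma Rintegral_EFin f : rintegrable f ->
  ((\int[mu]_t f t)%R%:E = \int[mu]_t (f t)%:E)%E.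
Proof. by move=> fi; rewrite fineK//; exact: integrable_fin_num. Qed.

Lemma rintegrable_nonneg f : measurable_fun setT f -> (forall t, 0 <= f t) ->
  (\int[mu]_t (f t)%:E < +oo)%E -> rintegrable f.
Proof.
move=> mf f0 fi; apply/integrableP; split; first exact/measurable_EFinP.
by under eq_integral do rewrite /= ger0_norm//.
Qed.

Lemma Rdominated_convergence (f_ : nat -> T -> R) f g :
  (forall n, measurable_fun setT (f_ n)) -> rintegrable g ->
  (forall n t, `|f_ n t| <= g t) -> (forall t, f_ n t @[n --> \oo] --> f t) ->
  rintegrable f /\ (\int[mu]_t f_ n t)%R @[n --> \oo] --> (\int[mu]_t f t)%R.
Proof.
move=> mf_ gi fg ff; have mf : measurable_fun setT f.
  apply: (measurable_fun_cvg mf_) => t _; exact: ff.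
have [|||||fi _ cv] := @dominated_convergence _ T R mu setT measurableT
  (fun n => EFin \o f_ n) (EFin \o f) (EFin \o g).
- by move=> n; exact/measurable_EFinP.
- exact/measurable_EFinP.
- by apply/aeW => t _; apply/cvg_EFin; [exact: nearW|exact: ff].
- exact: gi.
- by apply/aeW => t n _ /=; rewrite lee_fin.
split=> //; apply: fine_cvg; move: cv.
by rewrite -Rintegral_EFin.
Qed.

Lemma Rintegral_ext f g : (forall t, f t = g t) -> (\int[mu]_t f t = \int[mu]_t g t)%R.
Proof. by move=> fg; congr Rintegral; exact/funext. Qed.

Lemma rintegrable_ext f g : (forall t, f t = g t) -> rintegrable f -> rintegrable g.
Proof. by move=> /funext ->. Qed.

Lemma rintegrable_ae f g : measurable_fun setT g -> {ae mu, forall t, f t = g t} ->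
  rintegrable f -> rintegrable g /\ (\int[mu]_t f t = \int[mu]_t g t)%R.
Proof.
move=> mg fg fi; have mf := rintegrable_measurable fi.
have E : ae_eq mu setT (EFin \o f) (EFin \o g).
  by apply: filterS fg => t ft _ /=; rewrite ft.
split; last by congr fine; apply: ae_eq_integral => //; exact/measurable_EFinP.
apply/integrableP; split; first exact/measurable_EFinP.
rewrite (_ : (\int[mu]_x `|(EFin \o g) x|)%E = (\int[mu]_x `|(EFin \o f) x|)%E).
  by have /integrableP[] := fi.
apply: ae_eq_integral => //.
- by apply/measurable_EFinP; exact: measurableT_comp.
- by apply/measurable_EFinP; exact: measurableT_comp.
- by apply: filterS fg => t /= ->.
Qed.

End RealIntegrals.

Section RealFubini.
Context {R : realType} {d1 d2 : measure_display}.
Context {T1 : measurableType d1} {T2 : measurableType d2}.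
Variables (m1 : {sigma_finite_measure set T1 -> \bar R}).
Variables (m2 : {sigma_finite_measure set T2 -> \bar R}).

Lemma rintegrable_prod (f : T1 -> R) (g : T2 -> R) : rintegrable m1 f -> rintegrable m2 g ->
  rintegrable (m1 \x m2)%E (fun p => f p.1 * g p.2).
Proof.
move=> fi gi; have mf := rintegrable_measurable fi; have mg := rintegrable_measurable gi.
apply/integrable12ltyP.
  by apply/measurable_EFinP; apply: measurable_funM; apply: measurableT_comp.
have fi' := rintegrable_norm fi; have gi' := rintegrable_norm gi.
have E x : (\int[m2]_y `|(f x * g y)%:E| = (`|f x| * (\int[m2]_y `|g y|)%R)%:E)%E.
  under eq_integral do rewrite /= normrM EFinM.
  rewrite ge0_integralZl ?lee_fin//; first by rewrite EFinM Rintegral_EFin.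
  by apply/measurable_EFinP; exact: (rintegrable_measurable gi').
under eq_integral do rewrite E.
rewrite -[X in (X < _)%E](@Rintegral_EFin _ _ _ m1 (fun x => `|f x| * (\int[m2]_y `|g y|)%R)).
  by rewrite ltry.
have := rintegrableZ (\int[m2]_y `|g y|)%R fi'.
by apply: rintegrable_ext => t; rewrite mulrC.
Qed.

Lemma Rintegral_fubini (h : T1 * T2 -> R) : rintegrable (m1 \x m2)%E h ->
  (\int[(m1 \x m2)%E]_p h p = fine (\int[m1]_x \int[m2]_y (h (x, y))%:E)%E)%R.
Proof. by move=> hi; rewrite /Rintegral -integral12_prod_meas1. Qed.

Lemma Rintegral_prod (f : T1 -> R) (g : T2 -> R) : rintegrable m1 f -> rintegrable m2 g ->
  (\int[(m1 \x m2)%E]_p (f p.1 * g p.2) = \int[m1]_x f x * \int[m2]_y g y)%R.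
Proof.
move=> fi gi; rewrite Rintegral_fubini; last exact: rintegrable_prod.
have E x : (\int[m2]_y (f (x, y).1 * g (x, y).2)%:E = (f x * (\int[m2]_y g y)%R)%:E)%E.
  rewrite /=; under eq_integral do rewrite EFinM.
  by rewrite integralZl// EFinM Rintegral_EFin.
under eq_integral do rewrite E.
rewrite -[X in fine X](@Rintegral_EFin _ _ _ m1 (fun x => f x * (\int[m2]_y g y)%R))/=.
  by rewrite RintegralZr.
have := rintegrableZ (\int[m2]_y g y)%R fi.
by apply: rintegrable_ext => t; rewrite mulrC.
Qed.

End RealFubini.

Section MonotoneClassMeasurable.
Context {R : realType} {disp : measure_display} {T : measurableType disp}.

Lemma generated_measurable_fun (S : set (T -> R)) (s : T -> R) : S s ->
  measurable_fun (setT : set (g_sigma_algebraType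
    [set B | exists s a, S s /\ B = [set x | s x < a]])) s.
Proof.
move=> Ss; apply: (measurability _ (RGenInftyO.measurableE R)).
move=> _ [_ [a ->] <-]; rewrite setTI; apply: sub_sigma_algebra.
by exists s, a; split=> //; apply/seteqP; split=> x /=; rewrite in_itv.
Qed.

End MonotoneClassMeasurable.

(** * The Mecke formula *)

Section ExponentialQuotient.
Context {R : realType}.

Lemma expR_le1 (x : R) : 0 <= x -> 1 - expR (- x) <= x.
Proof. by have := expR_ge1Dx (- x); lra. Qed.

(** Both bounds follow from e^x >= 1 + x. The upper one dominates the quotient uniformly in t; the
    lower one gives the limit as t tends to 0, even when b varies at the same time. *)
Lemma expR_quotient_itv (t b : R) : 0 < t -> 0 <= b ->
  b / (1 + t * b) <= (1 - expR (- (t * b))) / t <= b.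
Proof.
move=> t0 b0; have tb0 : 0 <= t * b by rewrite mulr_ge0// ltW.
rewrite ler_pdivlMr// ler_pdivrMr//; apply/andP; split; last first.
  by rewrite [leRHS]mulrC expR_le1.
have tb1 : 0 < 1 + t * b by lra.
have : expR (- (t * b)) <= (1 + t * b)^-1.
  by rewrite expRN lef_pV2 ?posrE ?expR_gt0// expR_ge1Dx.
have -> : b / (1 + t * b) * t = 1 - (1 + t * b)^-1 by field; rewrite gt_eqF.
lra.
Qed.

Lemma expR_quotient_cvg (b_ : nat -> R) (b : R) : (forall n, 0 <= b_ n) ->
  b_ @ \oo --> b ->
  (fun n => (1 - expR (- (n.+1%:R^-1 * b_ n))) / n.+1%:R^-1) @ \oo --> b.
Proof.
move=> b0 cb; apply: (@squeeze_cvgr _ _ _ _ (fun n => b_ n / (1 + n.+1%:R^-1 * b_ n)) b_).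
- by near=> n; apply: expR_quotient_itv; rewrite ?invr_gt0.
- have : (fun n => b_ n / (1 + n.+1%:R^-1 * b_ n)) @ \oo --> b / (1 + 0 * b).
    apply: cvgM => //; apply: cvgV; first by rewrite mul0r addr0.
    by apply: cvgD; [exact: cvg_cst|apply: cvgM => //; exact: cvg_harmonic].
  by rewrite mul0r addr0 divr1.
- exact: cb.
Unshelve. all: by end_near. Qed.

End ExponentialQuotient.

Section Mecke.
Context {R : realType} {d : nat} (E : set (R * 'rV[R]_d)%type).
Local Notation Z := (R * 'rV[R]_d)%type.
Variable mu : {sigma_finite_measure set Z -> \bar R}.
Variable pi : probability (config_space E) R.
Hypothesis oE : open E.
Hypothesis muK : forall K : set Z, compact K -> K `<=` E -> (mu K < +oo)%E.
Hypothesis pi_poisson : is_poisson mu pi.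
Implicit Types (psi chi eta zeta : Z -> R).

Lemma integrable_compact_support (K : set Z) (f : Z -> R) (M : R) :
  compact K -> K `<=` E -> measurable_fun setT f -> (forall z, ~ K z -> f z = 0) ->
  (forall z, `|f z| <= M) -> rintegrable mu f.
Proof.
move=> cK KE mf fK fM.
have mK : measurable K.
  have cl : closed K by apply: compact_closed => //; exact: norm_hausdorff.
  by rewrite -[K]setCK; apply: measurableC; apply: open_measurableZ; exact: closed_openC.
have := @measurable_bounded_integrable _ _ _ mu f K mK (muK cK KE).
move=> /(_ (measurable_funTS mf)) iK.
have {}iK : mu.-integrable K (EFin \o f).
  apply: iK; exists M; split; first exact: num_real.
  by move=> x Mx z _ /=; exact: le_trans (fM z) (ltW Mx).
move/(integrable_mkcond _ mK) : iK; apply: eq_integrable => // z _ /=.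
rewrite patchE; case: ifPn => // zK; rewrite fK// => Kz.
by move/negP: zK; apply; exact: mem_set.
Qed.

Lemma integrable_test psi : test_on E psi -> rintegrable mu psi.
Proof.
move=> tpsi; have [M _ psiM] := test_on_bounded tpsi; have [_ cK KE] := tpsi.
apply: (integrable_compact_support cK KE (measurable_test tpsi) _ psiM).
by move=> z; exact: notin_tsupp.
Qed.

Lemma integrable_exp_sum psi : test_on E psi ->
  rintegrable pi (fun gam : config_space E => expR (set_sum gam psi)).
Proof.
move=> tpsi; apply: rintegrable_nonneg.
- by apply: measurableT_comp => //; exact: measurable_set_sum.
- by move=> t; exact: expR_ge0.
- by rewrite pi_poisson// ltry.
Qed.

Lemma laplace psi : test_on E psi ->
  (\int[pi]_gam expR (set_sum gam psi) = expR (\int[mu]_z (expR (psi z) - 1)))%R.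
Proof. by move=> tpsi; rewrite /Rintegral (pi_poisson tpsi). Qed.

Lemma set_sum_test_ge0 (gam : config_space E) psi : test_on E psi ->
  (forall z, 0 <= psi z) -> 0 <= set_sum gam psi.
Proof.
move=> [_ cK KE] psi0; rewrite (set_sum_points _ cK KE); last exact: notin_tsupp.
exact: sumr_ge0.
Qed.

(** This is minus the derivative at t = 0 of the Laplace transform at -chi - t eta, taken along t =
    1/(n+1). The quotients are dominated by <gam, eta>, hence by e^{<gam, eta>}, which is
    integrable. *)
Lemma laplace_derivative chi eta : test_on E chi -> (forall z, 0 <= chi z) ->
  test_on E eta -> (forall z, 0 <= eta z) ->
  rintegrable pi (fun gam : config_space E => expR (- set_sum gam chi) * set_sum gam eta) /\
  (\int[pi]_gam (expR (- set_sum gam chi) * set_sum gam eta) =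
   (\int[pi]_gam expR (- set_sum gam chi)) * (\int[mu]_z (expR (- chi z) * eta z)))%R.
Proof.
move=> tchi chi0 teta eta0; have tNchi := test_onN tchi.
have chiN (gam : config_space E) : - set_sum gam chi = set_sum gam (fun z => - chi z).
  have := set_sum_testZ gam (-1) tchi; rewrite mulN1r => <-.
  by congr set_sum; apply/funext => z; rewrite mulN1r.
pose psi n z := - chi z - n.+1%:R^-1 * eta z.
have tpsi n : test_on E (psi n) by apply: test_onB => //; exact: test_onZ.
have psiE (gam : config_space E) n : set_sum gam (psi n) =
    - set_sum gam chi - n.+1%:R^-1 * set_sum gam eta.
  rewrite chiN /psi.
  have := set_sum_testD gam tNchi (test_onZ (- n.+1%:R^-1) teta).
  rewrite set_sum_testZ// mulNr => <-.
  by congr set_sum; apply/funext => z; rewrite mulNr.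
pose A := (\int[mu]_z (expR (- chi z) - 1))%R.
pose A_ n := (\int[mu]_z (expR (psi n z) - 1))%R.
(* The difference quotient e^{-x} (1 - e^{-ty}) / t at t = 1/(n+1). It serves twice: with the sums
   over a configuration for x and y, and with the values of chi and eta at a point. *)
pose q n (x y : R) : R := expR (- x) * ((1 - expR (- (n.+1%:R^-1 * y))) / n.+1%:R^-1).
have q_itv n x y : 0 <= x -> 0 <= y -> 0 <= q n x y <= y.
  move=> x0 y0; have n0 : 0 < n.+1%:R^-1 :> R by rewrite invr_gt0.
  have /andP[q1 q2] := expR_quotient_itv n0 y0.
  have q0 : 0 <= (1 - expR (- (n.+1%:R^-1 * y))) / n.+1%:R^-1.
    apply: le_trans q1; rewrite divr_ge0// addr_ge0// mulr_ge0// ltW//.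
  rewrite /q mulr_ge0 ?expR_ge0//= -[leRHS]mul1r ler_pM ?expR_ge0//.
  by rewrite -[leRHS]expR0 ler_expR oppr_le0.
have qE n x y : q n x y = n.+1%:R * expR (- x) + (- n.+1%:R) * expR (- x - n.+1%:R^-1 * y).
  by rewrite /q expRD invrK; ring.
have mX psi' : test_on E psi' -> measurable_fun setT (fun gam : config_space E => set_sum gam psi').
  by move=> tpsi'; exact: measurable_set_sum.
have mq n : measurable_fun setT (fun gam : config_space E => q n (set_sum gam chi) (set_sum gam eta)).
  under eq_fun do rewrite qE.
  apply: measurable_funD; apply: measurable_funM => //; apply: measurableT_comp => //.
    by apply: measurableT_comp => //; exact: mX.
  apply: measurable_funB; first by apply: measurableT_comp => //; exact: mX.
  by apply: measurable_funM => //; exact: mX.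
have q_cvg x y : 0 <= y -> q n x y @[n --> \oo] --> expR (- x) * y.
  move=> y0; apply: cvgM; first exact: cvg_cst.
  apply: (@expR_quotient_cvg _ (fun=> y)) => //; exact: cvg_cst.
have Y0 (gam : config_space E) : 0 <= set_sum gam eta by exact: set_sum_test_ge0.
have X0 (gam : config_space E) : 0 <= set_sum gam chi by exact: set_sum_test_ge0.
have [iL cL] := @Rdominated_convergence _ _ _ pi
  (fun n gam => q n (set_sum gam chi) (set_sum gam eta))
  (fun gam => expR (- set_sum gam chi) * set_sum gam eta)
  (fun gam => expR (set_sum gam eta)) mq (integrable_exp_sum teta)
  (fun n gam => ltac:(have /andP[q0 q1] := q_itv n _ _ (X0 gam) (Y0 gam);
     rewrite ger0_norm// (le_trans q1)// (le_trans _ (expR_ge1Dx _))// lerDr//))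
  (fun gam => q_cvg _ _ (Y0 gam)).
split=> //.
have iexp psi' : test_on E psi' -> rintegrable mu (fun z => expR (psi' z) - 1).
  by move=> /test_on_expR1 /integrable_test.
pose b_ n := (\int[mu]_z q n (chi z) (eta z))%R.
have b_E n : A - A_ n = n.+1%:R^-1 * b_ n.
  rewrite /A /A_ /b_.
  have i1 := iexp _ tNchi; have i2 := iexp _ (tpsi n).
  have -> : (\int[mu]_z q n (chi z) (eta z) = \int[mu]_z (n.+1%:R * ((expR (- chi z) - 1)
       + (-1) * (expR (psi n z) - 1))))%R.
    by apply: Rintegral_ext => z; rewrite qE /psi; ring.
  have i3 := rintegrableD i1 (rintegrableZ (-1) i2).
  have := RintegralZl n.+1%:R measurableT i3 => ->.
  rewrite mulrA mulVf// mul1r.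
  have := Rintegral_lin (-1) i2 i1; rewrite mulN1r addrC => <-.
  by apply: Rintegral_ext => z; rewrite addrC.
have b_0 n : 0 <= b_ n.
  by apply: Rintegral_ge0 => z _; have /andP[] := q_itv n _ _ (chi0 z) (eta0 z).
have [_ cb] := @Rdominated_convergence _ _ _ mu
  (fun n z => q n (chi z) (eta z)) (fun z => expR (- chi z) * eta z) eta
  (fun n => ltac:(have mc := measurable_test tchi; have me := measurable_test teta;
     have mp := measurable_test (tpsi n);
     rewrite (_ : (fun z => _) = (fun z => n.+1%:R * expR (- chi z) + (- n.+1%:R) * expR (psi n z)));
     [apply: measurable_funD; apply: measurable_funM => //; apply: measurableT_comp => //;
      apply: measurableT_comp => //
     |by apply/funext => z; rewrite qE]))
  (integrable_test teta)
  (fun n z => ltac:(by have /andP[q0 q1] := q_itv n _ _ (chi0 z) (eta0 z); rewrite ger0_norm))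
  (fun z => q_cvg _ _ (eta0 z)).
have LE n : (\int[pi]_gam q n (set_sum gam chi) (set_sum gam eta) =
    expR A * ((1 - expR (- (n.+1%:R^-1 * b_ n))) / n.+1%:R^-1))%R.
  have i1 := integrable_exp_sum tNchi; have i2 := integrable_exp_sum (tpsi n).
  have -> : (\int[pi]_gam q n (set_sum gam chi) (set_sum gam eta) =
     \int[pi]_gam ((- n.+1%:R) * expR (set_sum gam (psi n)) + n.+1%:R * expR (set_sum gam (fun z => (- chi z)%R))))%R.
    by apply: Rintegral_ext => gam; rewrite qE psiE chiN addrC.
  rewrite Rintegral_lin//; last exact: rintegrableZ.
  rewrite RintegralZl// !laplace// -/A -/(A_ n) -b_E.
  have -> : expR (A_ n) = expR A * expR (- (A - A_ n)) by rewrite -expRD subKr.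
  by rewrite invrK; ring.
have -> : (\int[pi]_gam expR (- set_sum gam chi))%R = expR A.
  by rewrite /A -laplace//; apply: Rintegral_ext => gam; rewrite chiN.
have cR : (fun n => expR A * ((1 - expR (- (n.+1%:R^-1 * b_ n))) / n.+1%:R^-1)) @ \oo -->
   expR A * (\int[mu]_z (expR (- chi z) * eta z))%R.
  by apply: cvgM; [exact: cvg_cst|exact: expR_quotient_cvg].
rewrite -(funext LE) in cR.
exact: (cvg_unique _ cL cR).
Qed.

(** [zeta] is a test function on the whole space because the second coordinate is an arbitrary point
    of [Z], possibly outside [E]. *)
Definition pair_class : set (config_space E * Z -> R) := [set s | exists chi zeta,
  [/\ test_on E chi, forall z, 0 <= chi z, test_on setT zeta, forall z, 0 <= zeta z &
      s = fun p : config_space E * Z => expR (- set_sum p.1 chi) * expR (- zeta p.2)]].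

Lemma pair_class_generates (B : set (config_space E * Z)) : measurable B ->
  <<s [set B | exists s a, pair_class s /\ B = [set x | s x < a]] >> B.
Proof.
move=> mB; set G := [set B | _].
have mS s : pair_class s -> measurable_fun (setT : set (g_sigma_algebraType G)) s.
  exact: generated_measurable_fun.
have t0E := @test_on0 R _ E; have t0 := @test_on0 R (Z : normedModType R) setT.
pose X : g_sigma_algebraType G -> config_space E * Z := id.
have mX1 : measurable_fun setT (fst \o X).
  apply: measurable_to_config => // chi tchi chi0.
  have : pair_class (fun p : config_space E * Z => expR (- set_sum p.1 chi) * expR (- cst 0 p.2)).
    by exists chi, (cst 0); split.
  move=> /mS /(measurableT_comp (@measurable_ln R)) /measurable_funN.
  by congr measurable_fun; apply/funext => p /=; rewrite oppr0 expR0 mulr1 expRK opprK.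
have mX2 : measurable_fun setT (snd \o X).
  apply: measurable_to_state => zeta tzeta zeta0.
  have : pair_class (fun p : config_space E * Z => expR (- set_sum p.1 (cst 0)) * expR (- zeta p.2)).
    by exists (cst 0), zeta; split.
  move=> /mS /(measurableT_comp (@measurable_ln R)) /measurable_funN.
  by congr measurable_fun; apply/funext => p /=; rewrite set_sum0 oppr0 expR0 mul1r expRK opprK.
have mX : measurable_fun setT X by apply/measurable_fun_pairP.
by have := mX measurableT B mB; rewrite setTI.
Qed.

Lemma integrable_snd eta : rintegrable mu eta ->
  rintegrable (pi \x mu)%E (fun p => eta p.2).
Proof.
move=> ie; have i1 : rintegrable pi (cst 1).
  by apply: finite_measure_integrable_cst.
by have := rintegrable_prod i1 ie; apply: rintegrable_ext => p; rewrite mul1r.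
Qed.

(* The weight eta makes all the sums over configurations finite. *)
Lemma mecke_bounded eta (H : config_space E * Z -> R) M :
  test_on E eta -> (forall z, 0 <= eta z) ->
  measurable_fun setT H -> (forall p, `|H p| <= M) ->
  measurable_fun setT (fun gam : config_space E =>
     set_sum gam (fun z => H (config_rem gam z : config_space E, z) * eta z)) /\
  (\int[pi]_gam set_sum gam (fun z => H (config_rem gam z : config_space E, z) * eta z) =
   \int[(pi \x mu)%E]_p (H p * eta p.2))%R.
Proof.
move=> teta eta0 mH HM; have [_ cK KE] := teta.
have ieta := integrable_test teta; have ieta2 := integrable_snd ieta.
pose Sg (H : config_space E * Z -> R) (gam : config_space E) :=
  set_sum gam (fun z => H (config_rem gam z : config_space E, z) * eta z).
have smbl (h : config_space E * Z -> R) (gam : config_space E) :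
    abs_summable gam (fun z => h (config_rem gam z : config_space E, z) * eta z).
  by apply: (summable_compact _ cK KE) => z /notin_tsupp ->; rewrite mulr0.
have Sle (h : config_space E * Z -> R) (N : R) gam : (forall p, `|h p| <= N) ->
    `|Sg h gam| <= N * set_sum gam eta.
  move=> HN; rewrite /Sg !(set_sum_points _ cK KE); last 2 first.
  - exact: notin_tsupp.
  - by move=> z /notin_tsupp ->; rewrite mulr0.
  rewrite mulr_sumr (le_trans (ler_norm_sum _ _ _))//; apply: ler_sum => z _.
  by rewrite normrM (ger0_norm (eta0 z)) ler_wpM2r.
have isum : rintegrable pi (fun gam : config_space E => set_sum gam eta).
  apply: (rintegrable_le _ (integrable_exp_sum teta)); first exact: measurable_set_sum.
  move=> gam; rewrite !ger0_norm ?expR_ge0 ?(set_sum_test_ge0 _ teta)//.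
  by rewrite (le_trans _ (expR_ge1Dx _))// lerDr.
pose HH : set (config_space E * Z -> R) := [set H : config_space E * Z -> R |
  [/\ measurable_fun setT H, exists N : R, forall p, `|H p| <= N, measurable_fun setT (Sg H) &
  (\int[pi]_gam Sg H gam = \int[(pi \x mu)%E]_p (H p * eta p.2))%R]].
suff [_ _ ? ?] : HH H by [].
have iS (h : config_space E * Z -> R) : HH h -> rintegrable pi (Sg h).
  move=> [_ [N HN] mSH _]; apply: (rintegrable_le mSH (rintegrableZ N isum)) => gam.
  by rewrite (le_trans (Sle _ _ _ HN))// ler_norm.
have iH (h : config_space E * Z -> R) : HH h ->
    rintegrable (pi \x mu)%E (fun p => h p * eta p.2).
  by move=> [mH' [N HN] _ _]; exact: (rintegrableM mH' HN ieta2).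
have HH_lin a f g : HH f -> HH g -> HH (fun x => a * f x + g x).
  move=> Hf Hg; have [mf [N fN] mSf ef] := Hf; have [mg [N' gN'] mSg eg] := Hg.
  have SE gam : Sg (fun x => a * f x + g x) gam = a * Sg f gam + Sg g gam.
    rewrite /Sg -set_sum_lin//; apply: eq_set_sum => z _; ring.
  split.
  - by apply: measurable_funD => //; apply: measurable_funM.
  - exists (`|a| * N + N') => p; rewrite (le_trans (ler_normD _ _))//.
    by rewrite normrM lerD// ler_wpM2l.
  - by rewrite (funext SE); apply: measurable_funD => //; apply: measurable_funM.
  - rewrite (Rintegral_ext _ SE) Rintegral_lin; [|exact: iS..].
    rewrite ef eg -Rintegral_lin; [|exact: iH..].
    by apply: Rintegral_ext => p; ring.
have HH_lim (f_ : nat -> config_space E * Z -> R) f (N : R) : (forall n, HH (f_ n)) ->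
    (forall n x, `|f_ n x| <= N) -> (forall x, f_ n x @[n --> \oo] --> f x) -> HH f.
  move=> Hf_ fN ff.
  have mf : measurable_fun setT f.
    by apply: (@measurable_fun_cvg _ _ _ _ f_) => [n|p _]; [have [] := Hf_ n|exact: ff].
  have fN' p : `|f p| <= N.
    have nf : `|f_ n p| @[n --> \oo] --> `|f p| by apply: cvg_norm; exact: ff.
    by rewrite -(cvg_lim _ nf)//; apply: limr_le; [apply/cvg_ex; eexists; exact: nf|exact: nearW].
  have Sff gam : Sg (f_ n) gam @[n --> \oo] --> Sg f gam.
    apply: (@set_sum_cvg _ _ _ _ _ (fun z => N * eta z)).
    - by apply: abs_summableZ; exact: summable_test.
    - move=> n z _; rewrite !normrM ler_wpM2r// (le_trans (fN _ _))// ler_norm//.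
    - by move=> z _; apply: cvgM; [exact: ff|exact: cvg_cst].
  have mS_ n : measurable_fun setT (Sg (f_ n)) by have [] := Hf_ n.
  have [_ c1] := @Rdominated_convergence _ _ _ pi (fun n => Sg (f_ n)) (Sg f) _ mS_
    (rintegrableZ N isum) (fun n gam => Sle _ _ _ (fN n)) Sff.
  have [_ c2] := @Rdominated_convergence _ _ _ (pi \x mu)%E
    (fun n p => f_ n p * eta p.2) (fun p => f p * eta p.2) _
    (fun n => rintegrable_measurable (iH _ (Hf_ n)))
    (rintegrableZ N ieta2)
    (fun n p => ltac:(by rewrite normrM (ger0_norm (eta0 _)) ler_wpM2r))
    (fun p => ltac:(by apply: cvgM; [exact: ff|exact: cvg_cst])).
  split=> //.
  - by exists N.
  - by apply: (measurable_fun_cvg mS_) => gam _; exact: Sff.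
  - have E12 n : (\int[pi]_gam Sg (f_ n) gam = \int[(pi \x mu)%E]_p (f_ n p * eta p.2))%R.
      by have [] := Hf_ n.
    by rewrite (funext E12) in c1; exact: (cvg_unique _ c1 c2).
apply: (unit_bounded_approx HH_lin HH_lim _ mH HM) => B mB.
apply: (@functional_monotone_class R _ HH pair_class) => //; last exact: pair_class_generates.
- move=> _ [chi [zeta [tchi chi0 tzeta zeta0 ->]]].
  have eb (x : R) : 0 <= x -> `|expR (- x)| <= 1.
    by move=> x0; rewrite ger0_norm ?expR_ge0// -[leRHS]expR0 ler_expR oppr_le0.
  have [sc _ _] := tchi; have [sz _ _] := tzeta.
  have mchi := measurable_test tchi; have mzeta := measurable_test tzeta.
  (* For z in gam the sum of chi over gam \ z is <gam, chi> - chi z. The missing term is moved into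
     the weight, which leaves e^{-<gam, chi>} as a factor free of z. *)
  pose eta' z := eta z * expR (chi z - zeta z).
  have teta' : test_on E eta' := test_onMr teta (smooth_exp (smoothB sc sz)).
  have eta'0 z : 0 <= eta' z by rewrite mulr_ge0 ?expR_ge0.
  have [iL eL] := laplace_derivative tchi chi0 teta' eta'0.
  have SE gam : Sg (fun p : config_space E * Z => expR (- set_sum p.1 chi) * expR (- zeta p.2)) gam =
      expR (- set_sum gam chi) * set_sum gam eta'.
    rewrite -set_sum_testZ//; apply: eq_set_sum => z gz /=.
    rewrite (set_sum_rem gz (summable_test _ tchi)) /eta' opprB !expRD; ring.
  split.
  + apply: measurable_funM; apply: measurableT_comp => //; apply: measurableT_comp => //.
      by apply: (measurableT_comp (measurable_set_sum tchi)).
    by apply: (measurableT_comp mzeta).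
  + exists 1 => p; rewrite normrM -[leRHS]mul1r ler_pM//; apply: eb => //.
    exact: set_sum_test_ge0.
  + rewrite (funext SE); exact: rintegrable_measurable iL.
  + rewrite (Rintegral_ext _ SE) eL.
    have i1 : rintegrable pi (fun gam : config_space E => expR (- set_sum gam chi)).
      have := integrable_exp_sum (test_onN tchi); apply: rintegrable_ext => gam.
      have := set_sum_testZ gam (-1) tchi; rewrite mulN1r => <-.
      by congr (expR (set_sum _ _)); apply/funext => z; rewrite mulN1r.
    have i2 : rintegrable mu (fun z => expR (- zeta z) * eta z).
      apply: (@rintegrableM _ _ _ _ _ _ 1) => //; last by move=> z; exact: eb.
      by apply: measurableT_comp => //; apply: measurableT_comp.
    have -> : (\int[mu]_z (expR (- chi z) * eta' z) = \int[mu]_z (expR (- zeta z) * eta z))%R.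
      apply: Rintegral_ext => z; rewrite /eta' mulrCA mulrC -expRD.
      by congr (expR _ * _); ring.
    by rewrite -Rintegral_prod//; apply: Rintegral_ext => p; rewrite mulrA.
- exists (cst 0), (cst 0); split=> //; [exact: test_on0|exact: test_on0|].
  by apply/funext => p /=; rewrite set_sum0 oppr0 expR0 mulr1.
- move=> _ [chi [zeta [tchi chi0 tzeta zeta0 ->]]]; exists 1 => p.
  rewrite -expRD ger0_norm ?expR_ge0// -[leRHS]expR0 ler_expR.
  by rewrite -opprD oppr_le0 addr_ge0// set_sum_test_ge0.
- move=> _ _ [chi [zeta [tchi chi0 tzeta zeta0 ->]]] [chi' [zeta' [tchi' chi'0 tzeta' zeta'0 ->]]].
  pose s (p : config_space E * Z) := expR (- set_sum p.1 (fun z => chi z + chi' z)) * expR (- (zeta p.2 + zeta' p.2)).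
  have Ss : pair_class s.
    exists (fun z => chi z + chi' z), (fun z => zeta z + zeta' z); split=> //.
    - exact: test_onD.
    - by move=> z; rewrite addr_ge0.
    - exact: test_onD.
    - by move=> z; rewrite addr_ge0.
  exists 2^-1, s, s; split=> // p.
  rewrite /s set_sum_testD// (opprD (set_sum p.1 chi)) (opprD (zeta p.2)) !expRD.
  by field.
Qed.

End Mecke.

Section MonotoneSums.
Context {R : realType} {I : choiceType}.
Local Open Scope ereal_scope.

Lemma esum_monotone_cvg (A : set I) (u_ : nat -> I -> \bar R) (u : I -> \bar R) :
  (forall n z, A z -> 0 <= u_ n z) -> (forall z, A z -> nondecreasing_seq (u_ ^~ z)) ->
  (forall z, A z -> u_ n z @[n --> \oo] --> u z) ->
  \esum_(z in A) u_ n z @[n --> \oo] --> \esum_(z in A) u z.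
Proof.
move=> u0 nd cu.
have sup z : A z -> u z = ereal_sup (range (u_ ^~ z)).
  move=> Az; apply: (cvg_unique _ (cu z Az)) => //.
  exact: ereal_nondecreasing_cvgn (nd z Az).
have ule n z : A z -> u_ n z <= u z.
  by move=> Az; rewrite sup//; apply: ereal_sup_ubound; exists n.
have ndS : nondecreasing_seq (fun n => \esum_(z in A) u_ n z).
  by move=> m n mn; apply: le_esum => z Az; exact: nd.
have := ereal_nondecreasing_cvgn ndS; congr (_ --> _).
apply/eqP; rewrite eq_le; apply/andP; split.
  apply: ge_ereal_sup => _ [n _ <-]; apply: le_esum => z Az; exact: ule.
apply: ge_ereal_sup => _ [F [finF FA] <-].
have cF : (fun n => \sum_(z \in F) u_ n z) @ \oo --> \sum_(z \in F) u z.
  have [s0 Fs0] := (finite_seqP F).1 finF.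
  have FE (v : I -> \bar R) : \sum_(z \in F) v z = \sum_(z <- undup s0) v z.
    rewrite (_ : F = [set` undup s0]); first by rewrite -fsbig_seq ?undup_uniq.
    by rewrite Fs0; apply/seteqP; split=> z /=; rewrite mem_undup.
  have sA z : z \in undup s0 -> A z by rewrite mem_undup => zs; apply: FA; rewrite Fs0.
  rewrite FE; under eq_fun do rewrite FE.
  suff: forall r, (forall y, y \in r -> A y) ->
      (fun n => \sum_(y <- r) u_ n y) @ \oo --> \sum_(y <- r) u y by exact.
  elim=> [rA|z r IH rA].
    by under eq_fun do rewrite big_nil; rewrite big_nil; exact: cvg_cst.
  under eq_fun do rewrite big_cons; rewrite big_cons.
  have Az : A z by apply: rA; rewrite inE eqxx.
  have rA' y : y \in r -> A y by move=> yr; apply: rA; rewrite inE yr orbT.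
  apply: cvgeD; [|exact: cu|exact: IH].
  apply: ge0_adde_def; rewrite inE.
    by rewrite (le_trans (u0 0%N z Az)) ?ule.
  rewrite big_seq_cond; apply: sume_ge0 => y /andP[/rA' Ay _].
  by rewrite (le_trans (u0 0%N y Ay)) ?ule.
rewrite -(cvg_lim _ cF)//; apply: lime_le; first by apply/cvg_ex; eexists; exact: cF.
apply: nearW => n; apply: (@le_trans _ _ (\esum_(z in A) u_ n z)).
  by apply: ereal_sup_ubound; exists F.
by apply: ereal_sup_ubound; exists n.
Qed.

End MonotoneSums.

Lemma norm_maxr0 {R : realDomainType} (x : R) : `|x| = Num.max x 0 + Num.max (- x) 0.
Proof.
have [x0|x0] := leP 0 x; first by rewrite ger0_norm// max_r ?oppr_le0// addr0.
by rewrite ltr0_norm// max_l ?add0r// oppr_ge0 ltW.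
Qed.

Lemma maxr0B {R : realDomainType} (x : R) : x = Num.max x 0 - Num.max (- x) 0.
Proof.
have [x0|x0] := leP 0 x; first by rewrite max_r ?oppr_le0// subr0.
by rewrite max_l ?sub0r ?opprK// oppr_ge0 ltW.
Qed.

Section MeckeFormula.
Context {R : realType} {d : nat} (E : set (R * 'rV[R]_d)%type).
Local Notation Z := (R * 'rV[R]_d)%type.
Variable mu : {sigma_finite_measure set Z -> \bar R}.
Variable pi : probability (config_space E) R.
Hypothesis oE : open E.
Hypothesis muK : forall K : set Z, compact K -> K `<=` E -> (mu K < +oo)%E.
Hypothesis muE : mu (~` E) = 0%E.
Hypothesis pi_poisson : is_poisson mu pi.

Definition palm (T : Type) (H : config_space E * Z -> T) (gam : config_space E) : Z -> T :=
  fun z => H (config_rem gam z : config_space E, z).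

(** The function H is approached from below by H_j, which is min(H, j) on O_j and 0 elsewhere, where
    eta_j is a partial sum of the base functions and O_j is the set where eta_j > 1/(j+1). These
    sets increase to [E], and H_j / eta_j is bounded by j (j+1), so that [mecke_bounded] applies
    with weight eta_j. *)
Lemma mecke_ge0 (H : config_space E * Z -> \bar R) :
  measurable_fun setT H -> (forall p, 0 <= H p)%E ->
  measurable_fun setT (fun gam : config_space E => \esum_(z in gam) palm H gam z) /\
  (\int[pi]_gam (\esum_(z in config_set gam) palm H gam z) = \int[(pi \x mu)%E]_p H p)%E.
Proof.
move=> mH H0; have [b [bP bB]] := test_base_exists state_coordinates oE.
pose eta j z := \sum_(i < j.+1) b i z.
have teta j : test_on E (eta j) by apply: test_on_sum => i; exact: (bP i).1.
have b0 i z : 0 <= b i z by have [_ /(_ z)/andP[]] := bP i.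
have eta0 j z : 0 <= eta j z by apply: sumr_ge0.
pose O j z := 1 < j.+1%:R * eta j z.
have eta_nd i j z : (i <= j)%N -> eta i z <= eta j z.
  move=> ij; rewrite /eta -!(big_mkord xpredT (fun k => b k z)).
  by rewrite [leRHS](big_cat_nat (n := i.+1))//= lerDl sumr_ge0.
have O_nd i j z : (i <= j)%N -> O i z -> O j z.
  move=> ij /lt_le_trans; apply; rewrite ler_pM// ?eta_nd//.
  by rewrite ler_nat.
have OE z : E z -> exists j, O j z.
  move=> Ez; have [i [bi _]] := bB z setT Ez filterT.
  have [k kb] : exists k, 1 < k.+1%:R * b i z.
    exists (Num.trunc (b i z)^-1); rewrite -ltr_pdivrMr// div1r.
    exact: truncnS_gt.
  exists (maxn i k); rewrite /O (lt_le_trans kb)// ler_pM ?b0// ?ler_nat ?ltnS ?leq_maxr//.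
  apply: (@le_trans _ _ (eta i z)); last by rewrite eta_nd// leq_maxl.
  by rewrite /eta big_ord_recr /= lerDr sumr_ge0.
have O_E j z : O j z -> E z.
  move=> Ojz; apply: contrapT => nEz; move: Ojz; rewrite /O.
  have -> : eta j z = 0.
    apply: notin_tsupp => ez; apply: nEz; have [_ _ sub] := teta j; exact: sub.
  by rewrite mulr0 ltNge ler01.
pose Hj j p : \bar R := if O j p.2 then mine (H p) j%:R%:E else 0%E.
have Hj0 j p : (0 <= Hj j p)%E.
  by rewrite /Hj; case: ifP => // _; rewrite le_min H0/= lee_fin.
have Hjle j p : (Hj j p <= j%:R%:E)%E.
  by rewrite /Hj; case: ifP => _; rewrite ?ge_min ?lexx ?orbT// lee_fin.
have Hjfin j p : Hj j p \is a fin_num.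
  by rewrite ge0_fin_numE// (le_lt_trans (Hjle j p))// ltry.
have mO j : measurable [set z | O j z].
  have mc : measurable_fun setT (fun z => j.+1%:R * eta j z).
    by apply: measurable_funM => //; exact: measurable_test (teta j).
  have := mc measurableT `]1, +oo[%classic (measurable_itv _).
  by rewrite setTI; congr measurable; apply/seteqP; split => x /=; rewrite in_itv/= andbT.
have mO2 j : measurable [set p : config_space E * Z | O j p.2].
  by have := @measurable_snd _ _ (config_space E) Z measurableT _ (mO j); rewrite setTI.
have mHj j : measurable_fun setT (Hj j).
  apply: measurable_fun_ifT => //; last exact: measurable_mine.
  by apply: (measurable_fun_bool true); rewrite setTI; exact: mO2.
have eta_gt0 j p : O j p -> 0 < eta j p.
  by rewrite lt_neqAle eta0 andbT eq_sym; apply: contraTneq => e0;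
    rewrite /O e0 mulr0 -leNgt ler01.
(* The inverse of eta is written with exp and ln for the sake of measurability. *)
pose K j p : R := fine (Hj j p) * expR (- ln (eta j p.2)).
have KE j p : K j p = fine (Hj j p) / eta j p.2.
  rewrite /K /Hj; case: ifPn => [Op|_]; last by rewrite !mul0r.
  by rewrite expRN lnK// posrE eta_gt0.
have mK j : measurable_fun setT (K j).
  apply: measurable_funM; first by apply: measurableT_comp (mHj j).
  apply: measurableT_comp => //; apply: measurableT_comp => //.
  apply: (measurableT_comp (@measurable_ln R)).
  exact: (measurableT_comp (measurable_test (teta j))).
have KHj j p : K j p * eta j p.2 = fine (Hj j p).
  rewrite KE /Hj; case: ifPn => [Op|_]; last by rewrite !mul0r.
  by rewrite divfK// gt_eqF// eta_gt0.
have Kb j p : `|K j p| <= j%:R * j.+1%:R.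
  rewrite KE /Hj; case: ifPn => [Op|_]; last by rewrite mul0r normr0 mulr_ge0.
  have e0 := eta_gt0 _ _ Op.
  rewrite normrM; apply: ler_pM => //.
    have := Hj0 j p; have := Hjle j p; have := Hjfin j p; rewrite /Hj Op.
    by case: (mine _ _) => // r _; rewrite !lee_fin => ? ?; rewrite /= ger0_norm.
  rewrite gtr0_norm ?invr_gt0// -[leRHS]invrK lef_pV2 ?posrE ?invr_gt0//.
  by rewrite -[leLHS]div1r ler_pdivrMr// mulrC ltW.
have MB j := @mecke_bounded R d E mu pi oE muK pi_poisson (eta j) (K j) _ (teta j) (eta0 j) (mK j) (Kb j).
have SE j (gam : config_space E) : \esum_(z in gam) palm (Hj j) gam z =
    (set_sum gam (fun z => K j (config_rem gam z : config_space E, z) * eta j z))%:E.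
  have [_ cT TE] := teta j; set f := fun z => _ * _.
  have f0 z : 0 <= f z.
    by rewrite /f (KHj j (config_rem gam z : config_space E, z)) fine_ge0.
  have fT z : ~ tsupp (eta j) z -> f z = 0 by move=> /notin_tsupp; rewrite /f => ->; rewrite mulr0.
  rewrite (set_sum_points _ cT TE fT) -(@esum_seq _ _ gam).
  - apply: eq_esum => z _; rewrite /f (KHj j (config_rem gam z : config_space E, z)).
    by rewrite fineK.
  - exact: points_uniq.
  - by move=> z /(mem_points _ _ cT TE)[].
  - exact: f0.
  - move=> z gz zp; apply: fT => Tz; move/negP: zp; apply.
    exact/(mem_points _ _ cT TE).
have Hnd p : nondecreasing_seq (Hj ^~ p).
  move=> i j ij; rewrite /Hj; case: ifPn => [Oi|_]; last by case: ifP => // _; rewrite le_min H0 lee_fin/=.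
  rewrite (O_nd _ _ _ ij Oi) le_min ge_min lexx/= ge_min lee_fin ler_nat ij orbT//.
have Hcv p : E p.2 -> Hj j p @[j --> \oo] --> H p.
  move=> Ep; have [j0 O0] := OE _ Ep.
  have c1 : mine (H p) j%:R%:E @[j --> \oo] --> H p.
    case: (H p) (H0 p) => [r| |]// r0.
      apply: (@cvg_trans _ (r%:E @[_ --> \oo])); last exact: cvg_cst.
      apply: near_eq_cvg; near=> j; rewrite min_l// lee_fin.
      by near: j; exact: nbhs_infty_ger.
    rewrite (_ : (fun j => mine +oo%E j%:R%:E) = (fun j : nat => j%:R%:E : \bar R)).
      by apply/cvgeryP; exact: cvgr_idn.
    by apply/funext => j; rewrite min_r// leey.
  apply: cvg_trans c1; apply: near_eq_cvg; near=> j.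
  by rewrite /Hj (O_nd _ _ _ _ O0)//; near: j; exact: nbhs_infty_ge.
have cS (gam : config_space E) :
    \esum_(z in gam) palm (Hj j) gam z @[j --> \oo] --> \esum_(z in gam) palm H gam z.
  apply: esum_monotone_cvg.
  - by move=> j z _; exact: Hj0.
  - by move=> z _; exact: Hnd.
  - by move=> z gz; apply: Hcv; exact: config_sub gz.
have mSj j : measurable_fun setT (fun gam : config_space E => \esum_(z in gam) palm (Hj j) gam z).
  by rewrite (funext (SE j)); apply/measurable_EFinP; exact: (MB j).1.
have mS : measurable_fun setT (fun gam : config_space E => \esum_(z in gam) palm H gam z).
  apply: (@emeasurable_fun_cvg _ _ _ _ (fun j (gam : config_space E) => \esum_(z in gam) palm (Hj j) gam z)) => // gam _; exact: cS.
split=> //.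
have ndS (gam : config_space E) : nondecreasing_seq (fun j => \esum_(z in gam) palm (Hj j) gam z).
  by move=> i j ij; apply: le_esum => z _; exact: Hnd.
have L1 := @cvg_monotone_convergence _ _ _ pi setT measurableT
  (fun j gam => \esum_(z in config_set gam) palm (Hj j) gam z)
  (fun j => mSj j) (fun j gam _ => esum_ge0 (fun z _ => Hj0 j _)) (fun gam _ => ndS gam).
have L2 := @cvg_monotone_convergence _ _ _ (pi \x mu)%E setT measurableT
  Hj mHj (fun j p _ => Hj0 j p) (fun p _ => Hnd p).
have E12 j : (\int[pi]_gam (\esum_(z in config_set gam) palm (Hj j) gam z) =
    \int[(pi \x mu)%E]_p Hj j p)%E.
  under eq_integral do rewrite SE.
  have [_ cT TE] := teta j.
  have ieta := integrable_test muK (teta j).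
  have i2 : rintegrable (pi \x mu)%E (fun p => K j p * eta j p.2).
    exact: (rintegrableM (mK j) (Kb j) (integrable_snd pi ieta)).
  have isum : rintegrable pi (fun gam : config_space E =>
      set_sum gam (fun z => K j (config_rem gam z : config_space E, z) * eta j z)).
    have isum : rintegrable pi (fun gam : config_space E => set_sum gam (eta j)).
      apply: (rintegrable_le _ (integrable_exp_sum pi_poisson (teta j))); first exact: measurable_set_sum.
      move=> gam; rewrite !ger0_norm ?expR_ge0 ?(set_sum_test_ge0 _ (teta j))//.
      by rewrite (le_trans _ (expR_ge1Dx _))// lerDr.
    apply: (rintegrable_le (MB j).1 (rintegrableZ (j%:R * j.+1%:R) isum)) => gam.
    rewrite !(set_sum_points _ cT TE); last 2 first.
    - exact: notin_tsupp.
    - by move=> z /notin_tsupp ->; rewrite mulr0.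
    rewrite mulr_sumr (le_trans (ler_norm_sum _ _ _))// (le_trans _ (ler_norm _))//.
    by apply: ler_sum => z _; rewrite normrM (ger0_norm (eta0 j z)) ler_wpM2r.
  rewrite -Rintegral_EFin// (MB j).2 Rintegral_EFin//.
  by apply: eq_integral => p _; rewrite KHj fineK.
rewrite (funext E12) in L1.
have limS : (\int[pi]_gam limn (fun j => \esum_(z in config_set gam) palm (Hj j) gam z) =
    \int[pi]_gam (\esum_(z in config_set gam) palm H gam z))%E.
  by apply: eq_integral => gam _; apply/cvg_lim => //; exact: cS.
(* H_j tends to H only over [E]; the points outside form a null set. On the configuration side
   nothing is lost, since configurations are contained in [E]. *)
have limH : (\int[(pi \x mu)%E]_p limn (Hj ^~ p) = \int[(pi \x mu)%E]_p H p)%E.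
  have mlim : measurable_fun setT (fun p => limn (Hj ^~ p)).
    apply: (@emeasurable_fun_cvg _ _ _ _ Hj) => // p _; apply: ereal_nondecreasing_is_cvgn; exact: Hnd.
  apply: ge0_ae_eq_integral => //.
  - by move=> p _; apply: lime_ge; [exact: ereal_nondecreasing_is_cvgn|exact: nearW].
  - exists (setT `*` ~` E); split.
    + by apply: measurableX => //; apply: measurableC; exact: open_measurableZ.
    + have mE : measurable (~` E) by apply: measurableC; exact: open_measurableZ.
      apply: eq_trans (@product_measure1E _ _ _ _ _ pi mu setT (~` E) measurableT mE) _.
      by rewrite muE mule0.
    + move=> p /=; apply: contra_notP => /= nE _; apply/cvg_lim => //; apply: Hcv.
      by apply: contrapT => nEp; apply: nE; split.
rewrite -limS -limH; exact: (cvg_unique _ L1 L2).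
Unshelve. all: by end_near. Qed.

Lemma palm_set_sumE (H : config_space E * Z -> R) (gam : config_space E) :
  set_sum gam (palm H gam) =
  fine (\esum_(z in gam) palm (fun p => (Num.max (H p) 0)%:E) gam z) -
  fine (\esum_(z in gam) palm (fun p => (Num.max (- H p) 0)%:E) gam z).
Proof. by []. Qed.

(** Positive and negative parts are treated apart. Their sums have finite integral, so they are
    finite almost surely, and there [fine] in [set_sum] takes no default value. *)
Lemma mecke (H : config_space E * Z -> R) : rintegrable (pi \x mu)%E H ->
  [/\ {ae pi, forall gam : config_space E, abs_summable gam (palm H gam)},
      rintegrable pi (fun gam : config_space E => set_sum gam (palm H gam)) &
      (\int[pi]_gam set_sum gam (palm H gam) = \int[(pi \x mu)%E]_p H p)%R].
Proof.
move=> iH; have mH := rintegrable_measurable iH.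
have part (h : config_space E * Z -> R) : measurable_fun setT h -> (forall p, 0 <= h p) ->
    (forall p, h p <= `|H p|) ->
  [/\ rintegrable (pi \x mu)%E h,
    {ae pi, forall gam : config_space E, \esum_(z in gam) palm (EFin \o h) gam z \is a fin_num},
    rintegrable pi (fun gam : config_space E => fine (\esum_(z in gam) palm (EFin \o h) gam z)) &
    (\int[pi]_gam fine (\esum_(z in config_set gam) palm (EFin \o h) gam z) =
      \int[(pi \x mu)%E]_p h p)%R].
  move=> mh h0 hH.
  have ih : rintegrable (pi \x mu)%E h.
    by apply: (rintegrable_le mh iH) => p; rewrite ger0_norm.
  have [] := @mecke_ge0 (EFin \o h).
  - exact/measurable_EFinP.
  - by move=> p; rewrite lee_fin.
  move=> mS eS.
  have iS : pi.-integrable setT (fun gam : config_space E => \esum_(z in gam) palm (EFin \o h) gam z).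
    apply/integrableP; split=> //.
    rewrite (_ : (\int[pi]_x _)%E = (\int[pi]_(gam in setT) (\esum_(z in config_set gam) palm (EFin \o h) gam z))%E).
      by rewrite eS -Rintegral_EFin// ltry.
    apply: eq_integral => gam _; rewrite gee0_abs// esum_ge0// => z _.
    by rewrite lee_fin.
  have aeS := integrable_ae measurableT iS.
  have aeS' : {ae pi, forall gam : config_space E, \esum_(z in gam) palm (EFin \o h) gam z \is a fin_num}.
    by apply: filterS aeS => gam; exact.
  have mf : measurable_fun setT (fun gam : config_space E => fine (\esum_(z in gam) palm (EFin \o h) gam z)).
    exact: measurableT_comp.
  have eE : (\int[pi]_gam (fine (\esum_(z in config_set gam) palm (EFin \o h) gam z))%:E =
     \int[pi]_gam (\esum_(z in config_set gam) palm (EFin \o h) gam z))%E.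
    apply: ae_eq_integral => //; first exact/measurable_EFinP.
    by apply: filterS aeS' => gam gf _; rewrite fineK.
  have iR : rintegrable pi (fun gam : config_space E => fine (\esum_(z in gam) palm (EFin \o h) gam z)).
    apply: rintegrable_nonneg => //.
      by move=> gam; apply/fine_ge0/esum_ge0 => z _; rewrite lee_fin.
    by rewrite eE eS -Rintegral_EFin// ltry.
  split=> //.
  by rewrite /Rintegral eE eS.
have [||| ip aep irp ep] := part (fun p => Num.max (H p) 0).
- exact: measurable_maxr.
- by move=> p; rewrite le_max lexx orbT.
- by move=> p; rewrite ge_max normr_ge0 andbT ler_norm.
have [||| im aem irm em] := part (fun p => Num.max (- H p) 0).
- by apply: measurable_maxr => //; exact: measurable_funN.
- by move=> p; rewrite le_max lexx orbT.
- by move=> p; rewrite ge_max normr_ge0 andbT -normrN ler_norm.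
split.
- apply: filterS2 aep aem => gam gp gm; rewrite /abs_summable /summable.
  have -> : (\esum_(z in gam) `|(EFin \o palm H gam) z| =
     \esum_(z in gam) palm (EFin \o (fun p => Num.max (H p) 0%R)) gam z +
     \esum_(z in gam) palm (EFin \o (fun p => Num.max (- H p)%R 0%R)) gam z)%E.
    rewrite -esumD; last 2 first.
    - by move=> z _; rewrite lee_fin le_max lexx orbT.
    - by move=> z _; rewrite lee_fin le_max lexx orbT.
    apply: eq_esum => z _; rewrite /palm /= -EFinD; congr EFin.
    exact: norm_maxr0.
  by rewrite -(fineK gp) -(fineK gm) -EFinD ltry.
- by have := rintegrableB irp irm.
- have := RintegralB measurableT irp irm; rewrite ep em => ->.
  have := RintegralB measurableT ip im => <-.
  by apply: Rintegral_ext => p; rewrite -maxr0B.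
Qed.

Lemma measurable_palm_sum (H : config_space E * Z -> R) : measurable_fun setT H ->
  measurable_fun setT (fun gam : config_space E => set_sum gam (palm H gam)).
Proof.
move=> mH; rewrite (funext (palm_set_sumE H)).
apply: measurable_funB; apply: measurableT_comp => //;
  (apply: (proj1 (mecke_ge0 _ _)); [|by move=> p; rewrite lee_fin le_max lexx orbT]).
  by apply/measurable_EFinP; exact: measurable_maxr.
by apply/measurable_EFinP; apply: measurable_maxr => //; exact: measurable_funN.
Qed.

End MeckeFormula.

(** * Charlier kernels and coherent states *)

Section CharlierNumbers.
Context {R : realType}.
Implicit Types (c x : R) (s : seq R) (p : {poly R}) (n : nat).

(* (p e^(-ct))' = (twisted_deriv c p) e^(-ct) *)
Definition twisted_deriv c p := p^`() - c *: p.

Definition gen_poly s : {poly R} := \prod_(x <- s) (1 + x *: 'X).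

(** The n-th derivative at t = 0 of e^{-ct} times the product of the 1 + t x, x in s. With s the
    nonzero values of psi on a configuration and c = <psi>, it is the Charlier kernel. *)
Definition chl c s n : R := (iter n (twisted_deriv c) (gen_poly s)).[0].

(** The Leibniz rule with a factor of degree one has only two terms. It yields the recursion
    [chl_cons], by which every property of these numbers is proved by induction on the list. *)
Lemma twisted_derivM c x p n :
  iter n.+1 (twisted_deriv c) ((1 + x *: 'X) * p) =
  (1 + x *: 'X) * iter n.+1 (twisted_deriv c) p +
  (n.+1%:R * x) *: iter n (twisted_deriv c) p.
Proof.
have T1 q : twisted_deriv c ((1 + x *: 'X) * q) =
    (1 + x *: 'X) * twisted_deriv c q + x *: q.
  rewrite /twisted_deriv derivM derivD derivZ derivX -polyC1 derivC add0r.
  by rewrite mulrBr -!scalerAr -scalerAl mul1r; ring.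
have TD a b q r : twisted_deriv c (a *: q + b *: r) =
    a *: twisted_deriv c q + b *: twisted_deriv c r.
  rewrite /twisted_deriv derivD !derivZ !scalerBr scalerDr !scalerA.
  by rewrite (mulrC c a) (mulrC c b); ring.
elim: n => [|n IH]; first by rewrite /= T1 mul1r.
rewrite [LHS]iterS IH.
have := TD 1 (n.+1%:R * x) ((1 + x *: 'X) * iter n.+1 (twisted_deriv c) p) (iter n (twisted_deriv c) p).
rewrite !scale1r => ->; rewrite T1 -addrA; congr (_ + _).
by rewrite -scalerDl -[n.+2]addn1 natrD; congr (_ *: _); ring.
Qed.

Lemma chl0 c s : chl c s 0 = 1.
Proof.
rewrite /chl /= /gen_poly; elim: s => [|x s IH]; first by rewrite big_nil hornerC.
by rewrite big_cons hornerM IH hornerD hornerC hornerZ hornerX mulr0 addr0 mulr1.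
Qed.

Lemma chl_nil c n : chl c [::] n = (- c) ^+ n.
Proof.
rewrite /chl /gen_poly big_nil; have -> : iter n (twisted_deriv c) 1 = ((- c) ^+ n)%:P.
  elim: n => [|n IH]; first by rewrite expr0 polyC1.
  by rewrite iterS IH /twisted_deriv derivC sub0r -mul_polyC -polyCM -polyCN exprS mulNr.
by rewrite hornerC.
Qed.

Lemma chl_cons c x s n : chl c (x :: s) n = chl c s n + n%:R * x * chl c s n.-1.
Proof.
case: n => [|n]; first by rewrite !chl0 mul0r mul0r addr0.
rewrite /chl /gen_poly big_cons twisted_derivM hornerD hornerM hornerZ.
by rewrite hornerD hornerC hornerZ hornerX mulr0 addr0 mul1r.
Qed.

(** Differentiating the generating function once drops the factor 1 + t f(z) for one z at a time,
    with coefficient f(z), and multiplies the exponential by -c. *)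
Lemma chl_creation (T : eqType) (f : T -> R) c (r : seq T) n : uniq r ->
  chl c (map f r) n.+1 =
  \sum_(z <- r) f z * chl c (map f (rem z r)) n - c * chl c (map f r) n.
Proof.
elim: r n => [n _|x r IH n] /=.
  by rewrite big_nil !chl_nil exprS; ring.
move=> /andP[xr ur]; rewrite big_cons eqxx !chl_cons IH//.
have -> : \sum_(z <- r) f z * chl c (map f (if x == z then r else x :: rem z r)) n =
    \sum_(z <- r) f z * chl c (map f (rem z r)) n +
    n%:R * f x * \sum_(z <- r) f z * chl c (map f (rem z r)) n.-1.
  rewrite mulr_sumr -big_split /= big_seq [RHS]big_seq; apply: eq_bigr => z zr.
  rewrite ifF; last by apply: contraNF xr => /eqP ->.
  by rewrite /= chl_cons; ring.
case: n => [|n] /=; first by rewrite !mul0r !chl0; ring.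
by rewrite IH// -[n.+2]addn1 -[n.+1]addn1 !natrD; ring.
Qed.

Lemma cancel_factor (a f x k : R) : a != 0 -> f != 0 -> a * x * k / (a * f) = x * (k / f).
Proof. by move=> a0 f0; field; rewrite ?a0 ?f0. Qed.

Lemma chl_cons_sum c x s N :
  \sum_(n < N.+1) chl c (x :: s) n / n`!%:R =
  \sum_(n < N.+1) chl c s n / n`!%:R + x * \sum_(n < N) chl c s n / n`!%:R.
Proof.
under eq_bigr do rewrite chl_cons mulrDl.
rewrite big_split /=; congr (_ + _); rewrite big_ord_recl /= !mul0r add0r mulr_sumr.
apply: eq_bigr => i _; rewrite /fintype.bump leq0n add1n /= factS natrM add0n.
by apply: cancel_factor; rewrite pnatr_eq0 -lt0n ?fact_gt0.
Qed.

Lemma chl_cons_norm_sum c x s N :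
  \sum_(n < N.+1) `|chl c (x :: s) n| / n`!%:R <=
  \sum_(n < N.+1) `|chl c s n| / n`!%:R + `|x| * \sum_(n < N) `|chl c s n| / n`!%:R.
Proof.
apply: (@le_trans _ _ (\sum_(n < N.+1) (`|chl c s n| / n`!%:R + n%:R * `|x| * `|chl c s n.-1| / n`!%:R))).
  apply: ler_sum => n _; rewrite -mulrDl ler_wpM2r ?invr_ge0//.
  by rewrite chl_cons (le_trans (ler_normD _ _))// !normrM normr_nat.
rewrite big_split /= lerD2l big_ord_recl /= !mul0r add0r mulr_sumr.
apply: ler_sum => i _; rewrite /fintype.bump leq0n add1n /= factS natrM add0n le_eqVlt.
by rewrite cancel_factor ?eqxx// pnatr_eq0 -lt0n ?fact_gt0.
Qed.

Lemma exp_series_cvg x : \sum_(n < N) x ^+ n / n`!%:R @[N --> \oo] --> expR x.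
Proof.
rewrite (_ : (fun N : nat => _) = series (exp_coeff x)); first exact: is_cvg_series_exp_coeff.
by apply/funext => N; rewrite /series /= big_mkord.
Qed.

(** The sum is the Taylor series at t = 1 of a polynomial times an exponential. In the induction a
    new value x multiplies the limit by 1 + x, the x-term being shifted by one index. *)
Lemma chl_sum_cvg c s :
  \sum_(n < N) chl c s n / n`!%:R @[N --> \oo] --> \prod_(x <- s) (1 + x) * expR (- c).
Proof.
elim: s => [|x s IH].
  rewrite big_nil mul1r; under eq_fun do under eq_bigr do rewrite chl_nil.
  exact: exp_series_cvg.
rewrite big_cons -mulrA mulrDl mul1r -cvg_shiftS.
rewrite (funext (chl_cons_sum c x s)).
have IH' := IH; rewrite -cvg_shiftS in IH'.
exact: (cvgD IH' (cvgM (cvg_cst x) IH)).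
Qed.

(** The bound does not depend on N: it is what dominates the partial sums of the coherent series. *)
Lemma chl_norm_sum_le c s N :
  \sum_(n < N) `|chl c s n| / n`!%:R <= \prod_(x <- s) (1 + `|x|) * expR `|c|.
Proof.
elim: s N => [|x s IH] N.
  rewrite big_nil mul1r; under eq_bigr do rewrite chl_nil normrX normrN.
  have nd : nondecreasing_seq (fun N => \sum_(n < N) `|c| ^+ n / n`!%:R).
    apply/nondecreasing_seqP => n; rewrite big_ord_recr /= lerDl.
    by rewrite divr_ge0// exprn_ge0.
  rewrite -(cvg_lim _ (@exp_series_cvg `|c|))//.
  apply: (nondecreasing_cvgn_le nd); apply/cvg_ex; exists (expR `|c|); exact: exp_series_cvg.
case: N => [|N].
  by rewrite big_ord0 mulr_ge0 ?expR_ge0// prodr_ge0.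
apply: le_trans (chl_cons_norm_sum _ _ _ _) _; rewrite big_cons -mulrA mulrDl mul1r.
by rewrite lerD// ler_wpM2l.
Qed.

Lemma chl_norm_le c s n : `|chl c s n| <= n`!%:R * (\prod_(x <- s) (1 + `|x|) * expR `|c|).
Proof.
rewrite mulrC -ler_pdivrMr ?ltr0n ?fact_gt0//.
apply: le_trans (chl_norm_sum_le c s n.+1); rewrite big_ord_recr /= lerDr.
by apply: sumr_ge0 => i _; rewrite divr_ge0.
Qed.

Lemma near_eq_derive1n (f g : R -> R) (a : R) n :
  (\near a, f a = g a) -> derive1n n f a = derive1n n g a.
Proof.
move=> fg; have : \near a, derive1n n f a = derive1n n g a.
  elim: n => [|n IH]; first exact: fg.
  have := near_join IH; apply: filterS => t ft.
  by rewrite !derive1nS !derive1E; apply: near_eq_derive.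
exact: nbhs_singleton.
Qed.

Lemma derive1n_poly_exp c p n :
  derive1n n (fun t => p.[t] * expR (- (t * c))) =
  (fun t => (iter n (twisted_deriv c) p).[t] * expR (- (t * c))).
Proof.
elim: n => [//|n IH]; rewrite derive1nS IH; apply/funext => t.
set q := iter n _ p; rewrite derive1E iterS -/q.
have dq : is_derive t 1 (horner q) (q^`()).[t].
  by rewrite derivE derive1E; exact/derivableP/derivable_horner.
have dl : is_derive t (1 : R) (fun t : R => - (t * c)) (- c).
  have := @is_deriveN _ _ _ _ t (1 : R) _ (@is_deriveZ _ _ _ id c t (1 : R) _ (is_derive_id t 1)).
  rewrite /GRing.scale /= mulr1; congr is_derive; apply/funext => u /=.
  by rewrite mulrC.
have de := is_derive1_comp (is_derive_expR _) dl.
have [_ ->] := is_deriveM dq de.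
by rewrite /GRing.scale /= /twisted_deriv hornerD hornerN hornerZ; ring.
Qed.

Lemma gen_polyE s t : (gen_poly s).[t] = \prod_(x <- s) (1 + t * x).
Proof.
rewrite /gen_poly horner_prod; apply: eq_bigr => x _.
by rewrite hornerD hornerC hornerZ hornerX mulrC.
Qed.

End CharlierNumbers.

Lemma near_all_seq {T : Type} {I : eqType} (F : set_system T) {FF : Filter F}
    (r : seq I) (P : I -> set T) : (forall i, i \in r -> F (P i)) ->
  F [set t | forall i, i \in r -> P i t].
Proof.
elim: r => [_|x r IH rP]; first by apply: filterS filterT => t _ i; rewrite in_nil.
have Px : F (P x) by apply: rP; rewrite inE eqxx.
have Pr : F [set t | forall i, i \in r -> P i t].
  by apply: IH => i ir; apply: rP; rewrite inE ir orbT.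
by apply: filterS2 Px Pr => t Pxt Prt i; rewrite inE => /orP[/eqP ->|/Prt].
Qed.

Section CharlierKernels.
Context {R : realType} {d : nat} (E : set (R * 'rV[R]_d)%type).
Local Notation Z := (R * 'rV[R]_d)%type.
Variable mu : {sigma_finite_measure set Z -> \bar R}.
Implicit Types (psi : Z -> R) (s : seq Z).

Lemma charlierE n psi (gam : config_space E) s : uniq s ->
  (forall z, z \in s -> config_set gam z) ->
  (forall z, config_set gam z -> z \notin s -> psi z = 0) ->
  charlier mu n psi gam = chl (\int[mu]_z psi z)%R (map psi s) n.
Proof.
move=> us sg gs; set c := (\int[mu]_z psi z)%R.
rewrite /charlier -/c.
rewrite (near_eq_derive1n (g := fun t => (gen_poly (map psi s)).[t] * expR (- (t * c)))).
  by rewrite derive1n_poly_exp mul0r oppr0 expR0 mulr1.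
have pos : \forall t \near (0 : R), forall z, z \in s -> 0 < 1 + t * psi z.
  apply: near_all_seq => x _.
  have cx : (fun t : R => 1 + t * psi x) @ 0 --> 1 + 0 * psi x.
    apply: cvgD; first exact: cvg_cst.
    by apply: cvgM; [exact: cvg_id|exact: cvg_cst].
  by move: cx; rewrite mul0r addr0 => /cvgr_gt; apply; exact: ltr01.
apply: filterS pos => t pos.
rewrite (@set_sum_seq _ _ _ _ s)//; last by move=> z gz zs; rewrite (gs z gz zs) mulr0 addr0 ln1.
rewrite expRD; congr (_ * _); rewrite gen_polyE big_map.
elim: (s) pos => [|x r IH] pos; first by rewrite !big_nil expR0.
rewrite !big_cons expRD lnK ?posrE; last by apply: pos; rewrite inE eqxx.
by rewrite IH// => z zr; apply: pos; rewrite inE zr orbT.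
Qed.

End CharlierKernels.

Section SquareIntegrable.
Context {R : realType} {disp : measure_display} {T : measurableType disp}.
Variable mu : {measure set T -> \bar R}.
Implicit Types (f g w x : T -> R).

Definition sqintegrable f : Prop :=
  measurable_fun setT f /\ rintegrable mu (fun t => f t ^+ 2).

(** A weighted Young inequality, with constants that are not optimal. Letting the weight vary makes
    it do the work of the Cauchy-Schwarz inequality. *)
Lemma norm_mul_le (a b e : R) : 0 < e -> `|a * b| <= e * a ^+ 2 + e^-1 * b ^+ 2.
Proof.
move=> e0; rewrite normrM -(real_normK (num_real a)) -(real_normK (num_real b)).
have e10 : 0 < e^-1 by rewrite invr_gt0.
set u := `|a|; set v := `|b|; have u0 : 0 <= u := normr_ge0 a; have v0 : 0 <= v := normr_ge0 b.
have h : 0 <= e * (u - e^-1 * v) ^+ 2 by rewrite mulr_ge0 ?sqr_ge0// ltW.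
have h2 : 0 <= e * u ^+ 2 by rewrite mulr_ge0 ?sqr_ge0// ltW.
have h3 : 0 <= e^-1 * v ^+ 2 by rewrite mulr_ge0 ?sqr_ge0// ltW.
have E : e * (u - e^-1 * v) ^+ 2 = e * u ^+ 2 - 2 * (u * v) + e^-1 * v ^+ 2.
  by field; rewrite gt_eqF.
have : 0 <= u * v by rewrite mulr_ge0.
lra.
Qed.

Lemma sqintegrableM f g : sqintegrable f -> sqintegrable g ->
  rintegrable mu (fun t => f t * g t).
Proof.
move=> [mf f2] [mg g2]; apply: (rintegrable_le _ (rintegrableD f2 g2)).
  exact: measurable_funM.
move=> t; have := @norm_mul_le (f t) (g t) 1 ltr01; rewrite invr1 !mul1r => /le_trans; apply.
by rewrite ler_norm.
Qed.

Lemma sqintegrable_lin a f g : sqintegrable f -> sqintegrable g ->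
  sqintegrable (fun t => a * f t + g t).
Proof.
move=> sf sg; have [mf f2] := sf; have [mg g2] := sg; split.
  by apply: measurable_funD => //; apply: measurable_funM.
have := rintegrable_lin (a ^+ 2) f2 (rintegrable_lin (2 * a) (sqintegrableM sf sg) g2).
by apply: rintegrable_ext => t; ring.
Qed.

Lemma sqintegrable_le f g : measurable_fun setT f -> sqintegrable g ->
  (forall t, `|f t| <= `|g t|) -> sqintegrable f.
Proof.
move=> mf [mg g2] fg; split=> //.
apply: (rintegrable_le _ g2); first exact: measurable_funX.
by move=> t; rewrite !normrX lerXn2r ?nnegrE.
Qed.

Lemma sqintegrable0 : sqintegrable (cst 0).
Proof.
split=> //; have := @integrable0 _ _ R mu setT.
by apply: rintegrable_ext => t; rewrite /= expr0n.
Qed.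

Lemma sqintegrableZ a f : sqintegrable f -> sqintegrable (fun t => a * f t).
Proof.
move=> sf; have := sqintegrable_lin a sf sqintegrable0.
by congr sqintegrable; apply/funext => t; rewrite addr0.
Qed.

Lemma sqintegrableD f g : sqintegrable f -> sqintegrable g -> sqintegrable (fun t => f t + g t).
Proof.
move=> sf sg; have := sqintegrable_lin 1 sf sg.
by congr sqintegrable; apply/funext => t; rewrite mul1r.
Qed.

Lemma sqintegrableB f g : sqintegrable f -> sqintegrable g -> sqintegrable (fun t => f t - g t).
Proof.
move=> sf sg; have := sqintegrable_lin (-1) sg sf.
by congr sqintegrable; apply/funext => t; rewrite mulN1r addrC.
Qed.

Lemma sqintegrable_sum (I : Type) (r : seq I) (F : I -> T -> R) :
  (forall i, sqintegrable (F i)) -> sqintegrable (fun t => \sum_(i <- r) F i t).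
Proof.
move=> sF; elim: r => [|i r IH].
  by under eq_fun do rewrite big_nil; exact: sqintegrable0.
by under eq_fun do rewrite big_cons; exact: sqintegrableD.
Qed.

Lemma Rintegral_pair_sum (I : Type) (r : seq I) (a : I -> R) w (F : I -> T -> R) :
  sqintegrable w -> (forall i, sqintegrable (F i)) ->
  (\int[mu]_t (w t * \sum_(i <- r) a i * F i t) = \sum_(i <- r) a i * \int[mu]_t (w t * F i t))%R.
Proof.
move=> sw sF; elim: r => [|i r IH].
  rewrite big_nil; under Rintegral_ext do rewrite big_nil mulr0.
  by rewrite /Rintegral integral0.
rewrite big_cons -IH -Rintegral_lin.
- by apply: Rintegral_ext => t; rewrite big_cons; ring.
- exact: sqintegrableM.
- apply: sqintegrableM => //; apply: sqintegrable_sum => j; exact: sqintegrableZ.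
Qed.

Lemma Rintegral_pair_cvg w x (x_ : nat -> T -> R) : sqintegrable w -> sqintegrable x ->
  (forall j, sqintegrable (x_ j)) ->
  (\int[mu]_t (x_ j t - x t) ^+ 2)%R @[j --> \oo] --> (0 : R) ->
  (\int[mu]_t (w t * x_ j t))%R @[j --> \oo] --> (\int[mu]_t (w t * x t))%R.
Proof.
move=> sw sx sx_ x0; apply/cvgrPdist_le => e e0.
set W := (\int[mu]_t w t ^+ 2)%R.
have W0 : 0 <= W by apply: Rintegral_ge0 => t _; exact: sqr_ge0.
(* This weight makes the w-part of Young's inequality at most e/2, whatever j; the other part, with
   factor 1/de, tends to 0. *)
pose de := e / 2 / (W + 1).
have d0 : 0 < de by rewrite !divr_gt0// ltr_wpDl.
have ed0 : 0 < e / 2 * de by rewrite mulr_gt0// divr_gt0.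
near=> j.
have iw := (sqintegrableM sw sx); have iwj := (sqintegrableM sw (sx_ j)).
have sd := sqintegrableB (sx_ j) sx; have [md d2] := sd; have [mw w2] := sw.
rewrite distrC -RintegralB//.
have id := sqintegrableM sw sd.
have -> : (\int[mu]_t (w t * x_ j t - w t * x t) = \int[mu]_t (w t * (x_ j t - x t)))%R.
  by apply: Rintegral_ext => t; rewrite mulrBr.
apply: le_trans (le_normr_Rintegral _ id) _ => //.
apply: (@le_trans _ _ (\int[mu]_t (de * w t ^+ 2 + de^-1 * (x_ j t - x t) ^+ 2))%R).
  apply: le_Rintegral => //; first exact: rintegrable_norm id.
    by apply: rintegrable_lin => //; exact: rintegrableZ.
  by move=> t _; exact: norm_mul_le.
rewrite Rintegral_lin//; last exact: rintegrableZ.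
rewrite RintegralZl// -/W.
have h1 : de * W <= e / 2.
  rewrite /de mulrAC ler_pdivrMr ?ltr_wpDl// ler_wpM2l// ?divr_ge0 ?ltW//.
  by rewrite ltrDl.
have h2 : de^-1 * (\int[mu]_t (x_ j t - x t) ^+ 2)%R <= e / 2.
  rewrite ler_pdivrMl// mulrC (le_trans (ler_norm _))//.
  rewrite -normrN -sub0r; near: j.
  by move/cvgrPdist_le : x0 => /(_ _ ed0).
by rewrite [leRHS](splitr e) lerD.
Unshelve. all: by end_near. Qed.

End SquareIntegrable.

Section PoissonCharlier.
Context {R : realType} {d : nat} (E : set (R * 'rV[R]_d)%type).
Local Notation Z := (R * 'rV[R]_d)%type.
Variable mu : {sigma_finite_measure set Z -> \bar R}.
Variable pi : probability (config_space E) R.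
Hypothesis oE : open E.
Hypothesis muK : forall K : set Z, compact K -> K `<=` E -> (mu K < +oo)%E.
Hypothesis muE : mu (~` E) = 0%E.
Hypothesis pi_poisson : is_poisson mu pi.
Implicit Types (psi chi phi eta : Z -> R) (gam : config_space E).

Local Notation C := (charlier (E := E) mu).

Lemma charlier_points n psi gam : test_on E psi ->
  C n psi gam = chl (\int[mu]_z psi z)%R (map psi (points gam (tsupp psi))) n.
Proof.
move=> [_ cK KE]; apply: charlierE; first exact: points_uniq.
  by move=> z /(mem_points _ _ cK KE)[].
move=> z gz zp; apply: notin_tsupp => Kz; move/negP: zp; apply.
exact/(mem_points _ _ cK KE).
Qed.

Lemma charlier0 psi gam : test_on E psi -> C 0 psi gam = 1.
Proof. by move=> tpsi; rewrite charlier_points// chl0. Qed.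

(** The point z is listed even when it lies outside the support of psi, which spares [charlier_rem]
    a case distinction. *)
Lemma points_rem psi gam z : test_on E psi -> config_set gam z ->
  let s := z :: points (config_rem gam z) (tsupp psi) in
  [/\ uniq s, forall y, y \in s -> config_set gam y &
      forall y, config_set gam y -> y \notin s -> psi y = 0].
Proof.
move=> [_ cK KE] gz /=; have mp := mem_points (config_rem gam z) _ cK KE; split.
- rewrite points_uniq andbT; apply/negP => /mp[[_ zz] _]; exact: zz.
- by move=> y; rewrite inE => /orP[/eqP ->//|/mp[[]]].
- move=> y gy; rewrite inE negb_or => /andP[yz yp].
  apply: notin_tsupp => Ky; move/negP: yp; apply; apply/mp; split=> //; split=> //.
  exact/eqP.
Qed.

Lemma charlier_rem n psi gam z : test_on E psi -> config_set gam z ->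
  C n psi gam = C n psi (config_rem gam z : config_space E) +
    n%:R * psi z * C n.-1 psi (config_rem gam z : config_space E).
Proof.
move=> tpsi gz; have [us sg gs] := points_rem tpsi gz.
by rewrite (charlierE _ _ us sg gs) /= chl_cons !charlier_points.
Qed.

Lemma charlier_creation n psi gam : test_on E psi ->
  C n.+1 psi gam = set_sum gam (palm (fun p => psi p.2 * C n psi p.1) gam) -
    (\int[mu]_z psi z)%R * C n psi gam.
Proof.
move=> tpsi; have [_ cK KE] := tpsi; have mp := mem_points gam _ cK KE.
rewrite !charlier_points// chl_creation ?points_uniq//; congr (_ - _).
rewrite (set_sum_points _ cK KE); last by move=> z /notin_tsupp psi0; rewrite /palm/= psi0 mul0r.
rewrite big_seq [RHS]big_seq; apply: eq_bigr => z zp; rewrite /palm /=; congr (_ * _).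
have [gz Kz] := (mp z).1 zp; apply/esym/charlierE.
- exact/rem_uniq/points_uniq.
- move=> y; rewrite mem_rem_uniq ?points_uniq// inE => /andP[yz /mp[gy _]].
  by split=> //; exact/eqP.
- move=> y [gy yz]; rewrite mem_rem_uniq ?points_uniq// inE negb_and => /orP[|yp].
    by rewrite negbK => /eqP.
  by apply: notin_tsupp => Ky; move/negP: yp; apply; exact/mp.
Qed.

Lemma measurable_charlier n psi : test_on E psi ->
  measurable_fun setT (fun gam : config_space E => C n psi gam).
Proof.
move=> tpsi; elim: n => [|n IH].
  by rewrite (funext (fun gam => charlier0 gam tpsi)).
rewrite (funext (fun gam => charlier_creation n gam tpsi)).
apply: measurable_funB; last exact: measurable_funM.
apply: (measurable_palm_sum oE muK muE pi_poisson); apply: measurable_funM.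
  exact: (measurableT_comp (measurable_test tpsi)).
exact: (measurableT_comp IH).
Qed.

(** The normalised exponential exp(<gam, log(1 + psi)> - <psi>), written as a finite product so as
    to make sense whatever the sign of 1 + psi. *)
Definition coherent psi gam : R :=
  \prod_(z <- points gam (tsupp psi)) (1 + psi z) * expR (- (\int[mu]_z psi z)%R).

Lemma coherent_series psi gam : test_on E psi ->
  \sum_(n < N) C n psi gam / n`!%:R @[N --> \oo] --> coherent psi gam.
Proof.
move=> tpsi; under eq_fun do under eq_bigr do rewrite charlier_points//.
by have := @chl_sum_cvg R (\int[mu]_z psi z)%R (map psi (points gam (tsupp psi)));
  rewrite big_map.
Qed.

Lemma coherentE psi gam s : test_on E psi -> uniq s ->
  (forall z, z \in s -> config_set gam z) ->
  (forall z, config_set gam z -> z \notin s -> psi z = 0) ->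
  coherent psi gam = \prod_(z <- s) (1 + psi z) * expR (- (\int[mu]_z psi z)%R).
Proof.
move=> tpsi us sg gs; have := @coherent_series psi gam tpsi.
under eq_fun do under eq_bigr do rewrite (charlierE _ _ us sg gs).
have := @chl_sum_cvg R (\int[mu]_z psi z)%R (map psi s); rewrite big_map.
by move=> c1 c2; exact: (cvg_unique _ c2 c1).
Qed.

Definition charlier_majorant eta (c : R) gam : R := expR (set_sum gam eta) * c.

(** With M eta >= |psi| on the support of psi, the product of the 1 + |psi z| is at most e^{<gam, M
    eta>}. One exponential thus dominates all partial sums of the coherent series, and it is square
    integrable because its square is again an exponential. *)
Lemma charlier_bounded psi : test_on E psi -> exists eta c,
  [/\ test_on E eta, 0 <= c,
    forall N gam, \sum_(n < N) `|C n psi gam| / n`!%:R <= charlier_majorant eta c gam &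
    forall n gam, `|C n psi gam| <= n`!%:R * charlier_majorant eta c gam].
Proof.
move=> tpsi; have [M M0 psiM] := test_on_bounded tpsi; have [_ cK KE] := tpsi.
have [eta [teta eta0 eta1]] := test_majorant state_coordinates oE cK KE.
have tM := test_onZ M teta.
exists (fun z => M * eta z), (expR `|(\int[mu]_z psi z)%R|).
have bd gam : \prod_(x <- map psi (points gam (tsupp psi))) (1 + `|x|) <=
    expR (set_sum gam (fun z => M * eta z)).
  have [_ cK' KE'] := teta.
  rewrite big_map; apply: (@le_trans _ _ (\prod_(z <- points gam (tsupp psi)) expR (M * eta z))).
    rewrite big_seq [leRHS]big_seq; apply: ler_prod => z /(mem_points _ _ cK KE)[_ Kz].
    rewrite addr_ge0//=; apply: le_trans (expR_ge1Dx _); rewrite lerD2l.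
    by rewrite (le_trans (psiM z))// ler_peMr// eta1.
  rewrite -expR_sum ler_expR.
  set s := points _ _; have us : uniq s := points_uniq _ _.
  have -> : \sum_(z <- s) M * eta z = set_sum gam (fun z => if z \in s then M * eta z else 0).
    rewrite (@set_sum_seq _ _ _ _ s)//.
    - by rewrite big_seq [RHS]big_seq; apply: eq_bigr => z ->.
    - by move=> z /(mem_points _ _ cK KE)[].
    - by move=> z _ /negbTE ->.
  have sm : abs_summable gam (fun z => if z \in s then M * eta z else 0).
    apply: abs_summable_le (summable_test gam tM) => z _.
    by case: ifP => //; rewrite normr0.
  rewrite -subr_ge0; have := set_sum_lin (-1) sm (summable_test gam tM).
  rewrite mulN1r addrC => <-; rewrite (set_sum_points _ cK' KE').
    apply: sumr_ge0 => z _; case: ifP => _; rewrite ?mulr0 ?add0r ?mulr_ge0//.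
    by rewrite mulN1r addNr.
  by move=> z /notin_tsupp ->; rewrite mulr0 if_same mulr0 addr0.
split=> //.
  move=> N gam; under eq_bigr do rewrite charlier_points//.
  apply: le_trans (chl_norm_sum_le _ _ _) _.
  by rewrite ler_wpM2r ?expR_ge0.
move=> n gam; rewrite charlier_points//.
apply: le_trans (chl_norm_le _ _ _) _; rewrite ler_wpM2l//.
by rewrite ler_wpM2r ?expR_ge0.
Qed.

Lemma sqintegrable_exp eta c : test_on E eta ->
  sqintegrable pi (fun gam => charlier_majorant eta c gam).
Proof.
move=> teta; split.
  apply: measurable_funM => //; apply: measurableT_comp => //; exact: measurable_set_sum.
have := rintegrableZ (c ^+ 2) (integrable_exp_sum pi_poisson (test_onZ 2 teta)).
apply: rintegrable_ext => gam; rewrite set_sum_testZ// /charlier_majorant exprMn mulrC.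
by rewrite -expRM_natl.
Qed.

Lemma sqintegrable_charlier n psi : test_on E psi -> sqintegrable pi (fun gam => C n psi gam).
Proof.
move=> tpsi; have [eta [c [teta c0 _ B]]] := charlier_bounded tpsi.
apply: (sqintegrable_le _ (sqintegrableZ n`!%:R (sqintegrable_exp c teta))).
  exact: measurable_charlier.
by move=> gam; rewrite (le_trans (B n gam))// ler_norm.
Qed.

Lemma sqintegrable_rintegrable f : sqintegrable pi f -> rintegrable pi f.
Proof.
move=> sf; have s1 : sqintegrable pi (cst 1).
  split=> //; have : rintegrable pi (cst 1) by apply: finite_measure_integrable_cst.
  by apply: rintegrable_ext => t; rewrite /= expr1n.
by have := sqintegrableM sf s1; apply: rintegrable_ext => t; rewrite mulr1.
Qed.

(** For z in gam the factor [u gam] can be read off from gam \ z and z, so it may be moved inside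
    the sum, where the Mecke formula applies. The move is legitimate only where the sum converges
    absolutely, hence almost everywhere. *)
Lemma mecke_duality phi (u : config_space E -> R) (v : config_space E * Z -> R)
    (a : config_space E -> R) :
  measurable_fun setT u ->
  (forall gam z, config_set gam z -> u gam = v (config_rem gam z : config_space E, z)) ->
  rintegrable (pi \x mu)%E (fun p => v p * (phi p.2 * a p.1)) ->
  rintegrable (pi \x mu)%E (fun p => phi p.2 * a p.1) ->
  let S gam := set_sum gam (palm (fun p => phi p.2 * a p.1) gam) in
  rintegrable pi (fun gam => u gam * S gam) /\
  (\int[pi]_gam (u gam * S gam) = \int[(pi \x mu)%E]_p (v p * (phi p.2 * a p.1)))%R.
Proof.
move=> mu_ uv iv ia S.
have [_ iS eS] := mecke oE muK muE pi_poisson iv.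
have [aeS iSa _] := mecke oE muK muE pi_poisson ia.
have mS := rintegrable_measurable iSa.
rewrite -eS; have [] := @rintegrable_ae _ _ _ pi
  (fun gam => set_sum gam (palm (fun p => v p * (phi p.2 * a p.1)) gam))
  (fun gam => u gam * S gam) _ _ iS.
- exact: measurable_funM.
- apply: filterS aeS => gam sm; rewrite /S -set_sumZ//; apply: eq_set_sum => z gz.
  by rewrite /palm /= (uv gam z gz).
- by move=> ? ->.
Qed.

(** The creation identity lowers the degree of the left factor, and by duality the right factor is
    then evaluated with one point added, where [charlier_rem] lowers its degree too. The terms with
    <psi> cancel, leaving m <psi chi> times the same integral one degree lower. *)
Lemma charlier_isometry n m psi chi : test_on E psi -> test_on E chi ->
  (\int[pi]_gam (C n psi gam * C m chi gam) =
   (n == m)%:R * n`!%:R * (\int[mu]_z (psi z * chi z)) ^+ n)%R.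
Proof.
have step n' m' psi' chi' : test_on E psi' -> test_on E chi' ->
    (\int[pi]_gam (C n'.+1 psi' gam * C m' chi' gam) =
     m'%:R * (\int[mu]_z (psi' z * chi' z)) * \int[pi]_gam (C n' psi' gam * C m'.-1 chi' gam))%R.
  move=> tpsi tchi.
  have sn := sqintegrable_charlier n' tpsi; have sm := sqintegrable_charlier m' tchi.
  have sm1 := sqintegrable_charlier m'.-1 tchi.
  have ipsi := integrable_test muK tpsi.
  have tpc : test_on E (fun z => psi' z * chi' z).
    by have [sc _ _] := tchi; exact: test_onMr.
  have ipc := integrable_test muK tpc.
  have i1 := rintegrable_prod (sqintegrableM sm sn) ipsi.
  have i2 := rintegrable_prod (sqintegrableM sm1 sn) ipc.
  pose v (p : config_space E * Z) := C m' chi' p.1 + m'%:R * chi' p.2 * C m'.-1 chi' p.1.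
  have vE (p : config_space E * Z) : v p * (psi' p.2 * C n' psi' p.1) =
    m'%:R * (C m'.-1 chi' p.1 * C n' psi' p.1 * (psi' p.2 * chi' p.2)) +
    C m' chi' p.1 * C n' psi' p.1 * psi' p.2 by rewrite /v; ring.
  have [] := @mecke_duality psi' (C m' chi') v (C n' psi').
  - exact: measurable_charlier.
  - by move=> gam z gz; rewrite /v /= (charlier_rem _ tchi gz).
  - by rewrite (funext vE); exact: rintegrable_lin.
  - have := rintegrable_prod (sqintegrable_rintegrable sn) ipsi.
    by apply: rintegrable_ext => p; rewrite mulrC.
  move=> iS; rewrite (Rintegral_ext _ vE) (Rintegral_lin _ i2 i1).
  have /= -> := Rintegral_prod (sqintegrableM sm1 sn) ipc.
  have /= -> := Rintegral_prod (sqintegrableM sm sn) ipsi.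
  move=> eS.
  have -> : (\int[pi]_gam (C n'.+1 psi' gam * C m' chi' gam) =
     \int[pi]_gam ((- \int[mu]_z psi' z) * (C m' chi' gam * C n' psi' gam) +
       C m' chi' gam * set_sum gam (palm (fun p => psi' p.2 * C n' psi' p.1) gam)))%R.
    by apply: Rintegral_ext => gam; rewrite charlier_creation//; ring.
  rewrite Rintegral_lin//; last exact: sqintegrableM.
  rewrite eS.
  have -> : (\int[pi]_gam (C n' psi' gam * C m'.-1 chi' gam) =
             \int[pi]_gam (C m'.-1 chi' gam * C n' psi' gam))%R.
    by apply: Rintegral_ext => gam; rewrite mulrC.
  by ring.
move=> tpsi tchi; elim: n m => [|n IH] m.
  have C0 gam : C 0 psi gam = 1 by rewrite charlier0.
  case: m => [|m] /=.
    rewrite (Rintegral_ext _ (g := cst 1)); last by move=> gam; rewrite !charlier0// mulr1.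
    rewrite Rintegral_cst//; have -> : fine (pi setT) = 1 by have := probability_setT pi => ->.
    by rewrite !mul1r expr0.
  rewrite !mul0r; have := step m 0%N chi psi tchi tpsi; rewrite !mul0r => <-.
  by apply: Rintegral_ext => gam; rewrite mulrC.
rewrite step//; case: m => [|m] /=; first by rewrite !mul0r.
rewrite IH eqSS; have [->|_] := eqVneq n m; last by rewrite !(mul0r, mulr0).
by rewrite !mul1r factS natrM exprS; ring.
Qed.

End PoissonCharlier.

Section ComplexParts.
Context {R : realType}.

Definition cpart (b : bool) (z : R[i]) : R := if b then complex.Re z else complex.Im z.

Lemma cpartD b x y : cpart b (x + y) = cpart b x + cpart b y.
Proof. by case: b x y => -[? ?] [? ?]. Qed.

Lemma cpartN b x : cpart b (- x) = - cpart b x.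
Proof. by case: b x => -[? ?]. Qed.

Lemma cpartB b x y : cpart b (x - y) = cpart b x - cpart b y.
Proof. by rewrite cpartD cpartN. Qed.

Lemma cpart_sum b (I : Type) (r : seq I) (F : I -> R[i]) :
  cpart b (\sum_(i <- r) F i) = \sum_(i <- r) cpart b (F i).
Proof.
elim: r => [|i r IH]; first by rewrite !big_nil; case: b.
by rewrite !big_cons cpartD IH.
Qed.

Lemma cpartMr b (c : R[i]) (x : R) : cpart b (c * x%:C) = cpart b c * x.
Proof. by case: c => c1 c2; case: b => /=; rewrite mulr0 ?subr0 ?add0r. Qed.

Lemma cpartMl b (c : R[i]) (x : R) : cpart b (x%:C * c) = x * cpart b c.
Proof. by rewrite mulrC cpartMr mulrC. Qed.

Lemma cpart_le b (z : R[i]) : cpart b z ^+ 2 <= sqnormc z.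
Proof. by case: z => x y; case: b; rewrite /sqnormc /= ?lerDl ?lerDr ?sqr_ge0. Qed.

Lemma cpart_eq (x y : R[i]) : (forall b, cpart b x = cpart b y) -> x = y.
Proof.
move=> xy; apply/eqP; rewrite eq_complex.
by have /= -> := xy true; have /= -> := xy false; rewrite !eqxx.
Qed.

Context {disp : measure_display} {T : measurableType disp}.
Variable mu : {measure set T -> \bar R}.
Implicit Types f g h : T -> R[i].

Lemma inL2P f : inL2 mu f <-> forall b, sqintegrable mu (fun t => cpart b (f t)).
Proof.
split=> [[[mr mi] fi] b|sf].
  have mp : measurable_fun setT (fun t => cpart b (f t)) by case: b.
  split=> //; apply: (@rintegrable_le _ _ _ mu _ (fun t => sqnormc (f t))).
  - exact: measurable_funX.
  - apply: rintegrable_nonneg => //.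
      by apply: measurable_funD; exact: measurable_funX.
    by move=> t; rewrite addr_ge0 ?sqr_ge0.
  - by move=> t; rewrite !ger0_norm ?sqr_ge0 ?cpart_le// addr_ge0 ?sqr_ge0.
have [mr ir] := sf true; have [mi ii] := sf false; split; first by split.
have ri := rintegrableD ir ii.
have -> : sqnormL2 mu f = (\int[mu]_t (cpart true (f t) ^+ 2 + cpart false (f t) ^+ 2))%R%:E.
  by rewrite Rintegral_EFin.
by rewrite ltry.
Qed.

Lemma cvgL2_part b (u : nat -> T -> R[i]) f : (forall j, inL2 mu (u j)) -> inL2 mu f ->
  cvgL2 mu u f ->
  (\int[mu]_t (cpart b (u j t) - cpart b (f t)) ^+ 2)%R @[j --> \oo] --> (0 : R).
Proof.
move=> su sf uf.
have s2 c j : sqintegrable mu (fun t => cpart c (u j t) - cpart c (f t)).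
  by apply: sqintegrableB; [exact: (inL2P _).1 (su j) c|exact: (inL2P _).1 sf c].
pose q j : R := (\int[mu]_t sqnormc (u j t - f t))%R.
have iq j : rintegrable mu (fun t => sqnormc (u j t - f t)).
  have [_ i1] := s2 true j; have [_ i2] := s2 false j.
  by apply: rintegrable_ext (rintegrableD i1 i2) => t; rewrite -(cpartB true) -(cpartB false).
have q0 : q j @[j --> \oo] --> (0 : R).
  by have /fine_cvgP[_] := uf.
apply: (@squeeze_cvgr _ _ _ _ (cst 0) q) => //; last exact: cvg_cst.
apply: nearW => j; have [_ i1] := s2 b j; apply/andP; split.
  by apply: Rintegral_ge0 => t _; exact: sqr_ge0.
by apply: (le_Rintegral measurableT i1 (iq j)) => t _; rewrite -cpartB cpart_le.
Unshelve. all: by end_near. Qed.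

Lemma dotL2_real (w : T -> R) f : sqintegrable mu w -> inL2 mu f ->
  dotL2 mu (fun t => (w t)%:C) f =
  (\int[mu]_t (w t * cpart true (f t)))%R +i* (- (\int[mu]_t (w t * cpart false (f t))))%R.
Proof.
move=> sw /inL2P sf; have i1 := sqintegrableM sw (sf false).
rewrite /dotL2 /cint; congr (_ +i* _).
  by apply: Rintegral_ext => t; case: (f t) => a b /=; rewrite mul0r subr0.
have -> : (- (\int[mu]_t (w t * cpart false (f t))) = \int[mu]_t (-1 * (w t * cpart false (f t))))%R.
  by rewrite RintegralZl// mulN1r.
by apply: Rintegral_ext => t; case: (f t) => a b /=; rewrite mul0r addr0 mulN1r mulrN.
Qed.

End ComplexParts.

(** * Pairings with tensor powers, on Fock space and on Poisson space *)

Section TensorPowers.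
Context {R : realType} {disp : measure_display} {T : measurableType disp}.
Variable mu : {sigma_finite_measure set T -> \bar R}.
Implicit Types w psi phi : T -> R.

Definition tens w n (t : n.-tuple T) : R := \prod_(i < n) w (tnth t i).

Lemma tens_cons w n p : tens w (tcons p : n.+1.-tuple T) = w p.1 * tens w p.2.
Proof.
rewrite /tens big_ord_recl tnth0; congr (_ * _).
by apply: eq_bigr => i _; rewrite tnthS.
Qed.

Lemma tens_mul w w' n (t : n.-tuple T) : tens (fun z => w z * w' z) t = tens w t * tens w' t.
Proof. by rewrite /tens big_split. Qed.

Lemma tens_integral w n : rintegrable mu w ->
  rintegrable (power_measure mu n) (@tens w n) /\
  (\int[power_measure mu n]_t tens w t = (\int[mu]_z w z) ^+ n)%R.
Proof.
move=> iw; elim: n => [|n [IH1 IH2]].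
  have t1 (t : 0.-tuple T) : tens w t = 1 by rewrite /tens big_ord0.
  split.
    have : rintegrable (power_measure mu 0) (cst 1).
      by apply: finite_measure_integrable_cst.
    by apply: rintegrable_ext => t; rewrite t1.
  rewrite expr0 (Rintegral_ext _ t1) /Rintegral /=.
  rewrite integral_dirac//=.
  by rewrite mulr1 indicT.
have mt : measurable_fun setT (@tens w n.+1).
  apply: measurable_prod => i _; apply: measurableT_comp; last exact: measurable_tnth.
  exact: (rintegrable_measurable iw).
have mtE : measurable_fun setT (EFin \o (@tens w n.+1)) by exact/measurable_EFinP.
have ic : (sprod mu (power_measure mu n)).-integrable ((@tcons _ T n) @^-1` setT)
    ((EFin \o @tens w n.+1) \o (@tcons _ T n)).
  rewrite preimage_setT; apply: eq_integrable (rintegrable_prod iw IH1) => // p _.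
  by rewrite /= tens_cons.
split; first exact: (integrable_pushforward (@measurable_tcons _ T n) mtE ic measurableT).
rewrite /Rintegral (integral_pushforward (@measurable_tcons _ T n) mtE ic measurableT).
have /= := Rintegral_prod iw IH1; rewrite IH2 exprS => <-.
rewrite preimage_setT; congr fine; apply: eq_integral => p _ /=.
by rewrite tens_cons.
Qed.

Lemma fock_dot_single (u v : fock_seq) n : (forall k (t : k.-tuple T), k != n -> u k t = 0) ->
  fock_dot mu u v = n`!%:R * dotL2 (power_measure mu n) (u n) (v n).
Proof.
move=> u0; set a := fun n => n`!%:R * dotL2 (power_measure mu n) (u n) (v n).
have a0 k : k != n -> a k = 0.
  move=> kn; rewrite /a /dotL2 /cint.
  have z t : u k t * (v k t)^*%C = 0 by rewrite u0// mul0r.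
  rewrite !(@Rintegral_ext _ _ _ _ _ (cst 0)) => [|t|t]; rewrite ?z//.
  by rewrite /Rintegral integral0 mulr0.
have lim_a b : limn (series (fun k => cpart b (a k))) = cpart b (a n).
  apply: lim_near_cst => //; near=> N.
  have nN : (n < N)%N by near: N; exact: nbhs_infty_gt.
  rewrite seriesEord /= (bigD1 (Ordinal nN))//= big1 ?addr0// => k kn.
  by rewrite a0 //; case: b.
apply: cpart_eq => b; rewrite -[RHS]lim_a /fock_dot.
by case: b.
Unshelve. all: by end_near. Qed.

Lemma real_natc (n : nat) : n%:R = (n%:R : R)%:C :> R[i].
Proof. by rewrite rmorph_nat. Qed.

Lemma cint_real (w : T -> R) : cint mu (fun t => (w t)%:C) = (\int[mu]_t w t)%R%:C.
Proof. by rewrite /cint /= /Rintegral integral0. Qed.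

Lemma nneseries_single_lty (a : nat -> \bar R) n : (forall k, k != n -> a k = 0%E) ->
  (a n < +oo)%E -> (\sum_(0 <= k <oo) a k < +oo)%E.
Proof.
move=> a0 an; rewrite (_ : limn _ = a n)//.
apply: lim_near_cst => //; near=> N.
have nN : (n < N)%N by near: N; exact: nbhs_infty_gt.
by rewrite big_mkord (bigD1 (Ordinal nN))//= big1 ?adde0// => k kn; exact: a0.
Unshelve. all: by end_near. Qed.

Definition fock_tens psi n : fock_seq :=
  fun k t => if k == n then (tens psi t)%:C else 0.

Lemma in_fock_tens psi n : sqintegrable (power_measure mu n) (fun t => @tens psi n t) ->
  in_fock mu (fock_tens psi n).
Proof.
move=> st; have L2 k : inL2 (power_measure mu k) (@fock_tens psi n k).
  rewrite /fock_tens; case: eqP => [->|_]; apply/inL2P => b /=; last first.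
    by case: b; exact: sqintegrable0.
  by case: b => /=; [exact: st|exact: sqintegrable0].
split=> [k|].
  split=> // p t; rewrite /fock_tens; case: eqP => // _; congr (_%:C).
  rewrite /tens [RHS](reindex_inj (@perm_inj _ p)); apply: eq_bigr => i _.
  by rewrite tnth_mktuple.
apply: (@nneseries_single_lty _ n) => [k kn|].
  rewrite /sqnormL2 /fock_tens (negPf kn) integral0_eq ?mule0// => t _.
  by rewrite /sqnormc /= expr0n addr0.
by rewrite lte_mul_pinfty//; have [] := L2 n.
Qed.

Lemma annihilation_tens phi psi n : rintegrable mu (fun z => phi z * psi z) ->
  forall k t, fock_annihilation mu phi (fock_tens psi n) t =
  if k.+1 == n then (k.+1%:R * (\int[mu]_z (phi z * psi z))%R * @tens psi k t)%:C else 0.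
Proof.
move=> ipp k t; rewrite /fock_annihilation /annihilation /fock_tens; case: eqP => _.
  under eq_fun do rewrite tens_cons -rmorphM mulrA.
  rewrite cint_real (_ : (\int[mu]_y (phi y * psi y * tens psi t) =
     (\int[mu]_z (phi z * psi z)) * tens psi t)%R).
    by rewrite real_natc -rmorphM mulrA.
  by rewrite -RintegralZr.
under eq_fun do rewrite mulr0.
by rewrite (_ : (fun=> 0 : R[i]) = fun=> 0%:C)// cint_real /Rintegral integral0 mulr0.
Qed.

(** The defining relation of the adjoint is tested on the n-th power of psi placed at a single
    level. The factor (n+1) of annihilation and the weight n! make up the weight (n+1)! of the next
    level, and all three cancel. *)
Lemma fock_creation_pairing phi psi (f f' : fock_seq) b :
  rintegrable mu (fun z => phi z * psi z) ->
  (forall n, sqintegrable (power_measure mu n) (fun t => @tens psi n t)) ->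
  fock_creation mu phi f f' ->
  (\int[power_measure mu 0]_t (tens psi t * cpart b (f' 0 t)) = 0)%R /\
  forall n, (\int[power_measure mu n.+1]_t (tens psi t * cpart b (f' n.+1 t)) =
    (\int[mu]_z (phi z * psi z)) * \int[power_measure mu n]_t (tens psi t * cpart b (f n t)))%R.
Proof.
move=> ipp st [[ff _] [ff' _] cr].
have D n : fock_dot mu (fock_annihilation mu phi (fock_tens psi n)) f =
    n`!%:R * dotL2 (power_measure mu n) (fun t => (tens psi t)%:C) (f' n).
  rewrite cr; [|exact: in_fock_tens|exists n.+1 => k t nk].
    rewrite (@fock_dot_single _ _ n) /fock_tens ?eqxx// => k t kn.
    by rewrite (negPf kn).
  by rewrite /fock_tens gtn_eqF.
(* [dotL2] conjugates its second argument, so the imaginary part comes out with a minus sign. *)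
have L2R n (x : R[i]) : x = n`!%:R * dotL2 (power_measure mu n) (fun t => (tens psi t)%:C) (f' n) ->
  (\int[power_measure mu n]_t (tens psi t * cpart b (f' n t)))%R =
    (if b then 1 else -1) * cpart b x / n`!%:R.
  move=> ->; rewrite dotL2_real//; last by have [] := ff' n.
  rewrite real_natc cpartMl; case: b => /=; first by rewrite mul1r mulrC mulKf ?pnatr_eq0 -?lt0n ?fact_gt0.
  by rewrite mulN1r mulrN opprK mulrC mulKf ?pnatr_eq0 -?lt0n ?fact_gt0.
split.
  rewrite (L2R 0%N _ (D 0%N)) (@fock_dot_single _ _ 0).
    rewrite (_ : dotL2 _ _ _ = 0) ?mulr0; last first.
      rewrite /dotL2 (_ : (fun t => _) = fun=> 0%:C).
        by rewrite /cint /= /Rintegral integral0.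
      by apply/funext => t; rewrite (annihilation_tens _ ipp) mul0r.
    by case: b {L2R}; rewrite /= mulr0 mul0r.
  by move=> k t _; rewrite (annihilation_tens _ ipp).
move=> n; rewrite (L2R n.+1 _ (D n.+1)) (@fock_dot_single _ _ n); last first.
  by move=> k t kn; rewrite (annihilation_tens _ ipp) eqSS (negPf kn).
rewrite (_ : @fock_annihilation _ _ _ mu phi (fock_tens psi n.+1) n =
   fun t => (n.+1%:R * (\int[mu]_z (phi z * psi z))%R * tens psi t)%:C); last first.
  by apply/funext => t; rewrite (annihilation_tens _ ipp) eqxx.
rewrite dotL2_real; [|exact: sqintegrableZ|by have [] := ff n].
have sf c : sqintegrable (power_measure mu n) (fun t => cpart c (f n t)).
  by have [_ L2] := ff n; exact: (inL2P _ _).1 L2 c.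
have E c : (\int[power_measure mu n]_t (n.+1%:R * (\int[mu]_z (phi z * psi z)) * tens psi t * cpart c (f n t)) =
    n.+1%:R * (\int[mu]_z (phi z * psi z)) * \int[power_measure mu n]_t (tens psi t * cpart c (f n t)))%R.
  have ic := sqintegrableM (st n) (sf c); move: (n.+1%:R * _) => q; rewrite -RintegralZl//.
  by apply: Rintegral_ext => t; rewrite mulrA.
rewrite !E real_natc cpartMl factS natrM.
have n0 : n.+1%:R != 0 :> R by rewrite pnatr_eq0.
have nf : n`!%:R != 0 :> R by rewrite pnatr_eq0 -lt0n fact_gt0.
move: (n.+1%:R : R) (n`!%:R : R) n0 nf => A B A0 B0.
by case: b {L2R} => /=; field; rewrite A0 B0.
Qed.

End TensorPowers.

Section ChaosPairing.
Context {R : realType} {d : nat} (E : set (R * 'rV[R]_d)%type).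
Local Notation Z := (R * 'rV[R]_d)%type.
Variable mu : {sigma_finite_measure set Z -> \bar R}.
Variable pi : probability (config_space E) R.
Hypothesis oE : open E.
Hypothesis muK : forall K : set Z, compact K -> K `<=` E -> (mu K < +oo)%E.
Hypothesis muE : mu (~` E) = 0%E.
Hypothesis pi_poisson : is_poisson mu pi.
Implicit Types (psi chi phi : Z -> R) (gam : config_space E).

Local Notation C := (charlier (E := E) mu).
Local Notation P := (power_measure mu).

Lemma sqintegrable_tens psi n : test_on E psi -> sqintegrable (P n) (fun t => @tens R _ _ psi n t).
Proof.
move=> tpsi; have [s _ _] := tpsi; split.
  by have [/rintegrable_measurable] := @tens_integral R _ _ mu psi n (integrable_test muK tpsi).
have [h _] := @tens_integral R _ _ mu (fun z => psi z * psi z) n (integrable_test muK (test_onMr tpsi s)).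
by apply: rintegrable_ext h => t; rewrite tens_mul expr2.
Qed.

(** Elementary chaoses are combinations of powers, so pairing them with the kernel of one power psi
    needs the isometry for two powers only, without polarisation. *)
Lemma chaos_elementary_pairing m psi n (f : n.-tuple Z -> R[i])
    (H : config_space E -> R[i]) b :
  test_on E psi -> chaos_elementary mu f H ->
  [/\ inL2 (P n) f, inL2 pi H &
  (\int[pi]_gam (C m psi gam * cpart b (H gam)) =
    (n == m)%:R * m`!%:R * \int[P n]_t (tens psi t * cpart b (f t)))%R].
Proof.
move=> tpsi [N [c [chi [tchi fE HE]]]]; have [spsi _ _] := tpsi.
have cf a t : cpart a (f t) = \sum_(j < N) cpart a (c j) * tens (chi j) t.
  by rewrite fE cpart_sum; apply: eq_bigr => j _; rewrite cpartMr.
have cH a gam : cpart a (H gam) = \sum_(j < N) cpart a (c j) * C n (chi j) gam.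
  by rewrite HE cpart_sum; apply: eq_bigr => j _; rewrite cpartMr.
have sC k chi' : test_on E chi' -> sqintegrable pi (fun gam => C k chi' gam).
  by move=> t; exact: (sqintegrable_charlier oE muK muE pi_poisson).
split.
- apply/inL2P => a; rewrite (funext (cf a)).
  by apply: sqintegrable_sum => j; apply: sqintegrableZ; exact: sqintegrable_tens.
- apply/inL2P => a; rewrite (funext (cH a)).
  by apply: sqintegrable_sum => j; apply: sqintegrableZ; exact: sC.
rewrite (Rintegral_ext _ (fun t => congr1 ( *%R (tens psi t)) (cf b t))).
rewrite (Rintegral_ext _ (fun gam => congr1 ( *%R (C m psi gam)) (cH b gam))).
rewrite !Rintegral_pair_sum//; [|exact: sqintegrable_tens|by move=> j; exact: sqintegrable_tens|exact: sC|by move=> j; exact: sC].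
rewrite mulr_sumr; apply: eq_bigr => j _.
rewrite (charlier_isometry oE muK muE pi_poisson)// eq_sym.
have [<-|_] := eqVneq n m; last by rewrite !mul0r mulr0.
have [_ <-] := @tens_integral R _ _ mu (fun z => psi z * chi j z) n
  (integrable_test muK (test_onMr tpsi (let: And3 s _ _ := tchi j in s))).
rewrite (Rintegral_ext _ (fun t => tens_mul psi (chi j) t)).
by ring.
Qed.

Lemma chaos_pairing m psi n (f : n.-tuple Z -> R[i]) (H : config_space E -> R[i]) b :
  test_on E psi -> inL2 (P n) f -> chaos mu pi f H ->
  (\int[pi]_gam (C m psi gam * cpart b (H gam)) =
    (n == m)%:R * m`!%:R * \int[P n]_t (tens psi t * cpart b (f t)))%R.
Proof.
move=> tpsi sf [sH [u [v [uv uf vH]]]].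
have su j : inL2 (P n) (u j) by have [] := chaos_elementary_pairing m b tpsi (uv j).
have sv j : inL2 pi (v j) by have [] := chaos_elementary_pairing m b tpsi (uv j).
have sC : sqintegrable pi (fun gam => C m psi gam).
  exact: (sqintegrable_charlier oE muK muE pi_poisson).
have sT := sqintegrable_tens n tpsi.
have c1 := Rintegral_pair_cvg sC ((inL2P _ _).1 sH b) (fun j => (inL2P _ _).1 (sv j) b)
  (cvgL2_part b sv sH vH).
have c2 := Rintegral_pair_cvg sT ((inL2P _ _).1 sf b) (fun j => (inL2P _ _).1 (su j) b)
  (cvgL2_part b su sf uf).
have c3 := cvgM (cvg_cst ((n == m)%:R * m`!%:R : R)) c2.
suff c4 : (\int[pi]_t (C m psi t * cpart b (v j t)))%R @[j --> \oo] -->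
    ((n == m)%:R * m`!%:R * \int[P n]_t (tens psi t * cpart b (f t)))%R.
  exact: (cvg_unique _ c1 c4).
under eq_fun => j do rewrite (let: And3 _ _ e := chaos_elementary_pairing m b tpsi (uv j) in e).
exact: c3.
Qed.

(** By orthogonality the pairing with the partial sums of the expansion is constant once they
    include the m-th chaos. *)
Lemma chaos_iso_pairing m psi (f : fock_seq) (h : config_space E -> R[i]) b :
  test_on E psi -> chaos_iso mu pi f h ->
  (\int[pi]_gam (C m psi gam * cpart b (h gam)) =
    m`!%:R * \int[P m]_t (tens psi t * cpart b (f m t)))%R.
Proof.
move=> tpsi [[sf _] sh [H [fH Hh]]].
have sH n : inL2 pi (H n) by have [] := fH n.
have sHN N : inL2 pi (fun gam => \sum_(n < N) H n gam).
  apply/inL2P => a; under eq_fun do rewrite cpart_sum.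
  by apply: sqintegrable_sum => n; exact: (inL2P _ _).1 (sH n) a.
have sC : sqintegrable pi (fun gam => C m psi gam).
  exact: (sqintegrable_charlier oE muK muE pi_poisson).
have c1 := Rintegral_pair_cvg sC ((inL2P _ _).1 sh b) (fun N => (inL2P _ _).1 (sHN N) b)
  (cvgL2_part b sHN sh Hh).
suff c2 : (\int[pi]_t (C m psi t * cpart b (\sum_(n < N) H n t)))%R @[N --> \oo] -->
    (m`!%:R * \int[P m]_t (tens psi t * cpart b (f m t)))%R.
  exact: (cvg_unique _ c1 c2).
apply: cvg_near_cst; near=> N.
have mN : (m < N)%N by near: N; exact: nbhs_infty_gt.
have -> : (\int[pi]_gam (C m psi gam * cpart b (\sum_(n < N) H n gam)) =
    \int[pi]_gam (C m psi gam * \sum_(n < N) 1 * cpart b (H n gam)))%R.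
  apply: Rintegral_ext => gam; rewrite cpart_sum; congr (_ * _).
  by apply: eq_bigr => n _; rewrite mul1r.
rewrite Rintegral_pair_sum//; last by move=> n; exact: (inL2P _ _).1 (sH n) b.
rewrite (bigD1 (Ordinal mN))//= big1 ?addr0.
  by rewrite mul1r (chaos_pairing _ _ tpsi (sf m).2 (fH m)) eqxx mul1r.
move=> n nm; rewrite mul1r (chaos_pairing _ _ tpsi (sf n).2 (fH n)).
by rewrite (negPf (_ : nat_of_ord n != m)) ?mul0r//; apply: contra nm => /eqP <-; apply/eqP/val_inj.
Unshelve. all: by end_near. Qed.

(** On coherent states creation becomes multiplication by <phi psi>. In the series, 1/m! cancels the
    weight m!, level m+1 of f' pairs to <phi psi> times level m of f, and level 0 of f' pairs to 0;
    the shift by one index disappears in the limit. *)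
Lemma creation_coherent phi psi (f f' : fock_seq) (h k : config_space E -> R[i]) b :
  test_on E psi -> rintegrable mu (fun z => phi z * psi z) ->
  chaos_iso mu pi f h -> fock_creation mu phi f f' -> chaos_iso mu pi f' k ->
  (\int[pi]_gam (coherent mu psi gam * cpart b (k gam)) =
    (\int[mu]_z (phi z * psi z)) * \int[pi]_gam (coherent mu psi gam * cpart b (h gam)))%R.
Proof.
move=> tpsi ipp fh cr fk; have [_ sh _] := fh; have [_ sk _] := fk.
have [T0 TS] := fock_creation_pairing b ipp (fun n => sqintegrable_tens n tpsi) cr.
have [eta [c [teta c0 bd _]]] := charlier_bounded mu oE tpsi.
have sC n : sqintegrable pi (fun gam => C n psi gam).
  exact: (sqintegrable_charlier oE muK muE pi_poisson).
have lim (g : config_space E -> R[i]) : inL2 pi g ->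
    (\sum_(m < N) m`!%:R^-1 * \int[pi]_gam (C m psi gam * cpart b (g gam)))%R @[N --> \oo] -->
    (\int[pi]_gam (coherent mu psi gam * cpart b (g gam)))%R.
  move=> /inL2P sg; have sgb := sg b; have mg := sgb.1.
  have [||||_] := @Rdominated_convergence R _ _ pi
    (fun N gam => (\sum_(m < N) C m psi gam / m`!%:R) * cpart b (g gam))
    (fun gam => coherent mu psi gam * cpart b (g gam))
    (fun gam => `|charlier_majorant eta c gam * cpart b (g gam)|).
  - move=> N; apply: measurable_funM => //; apply: measurable_sum => m.
    by apply: measurable_funM => //; exact: (sC m).1.
  - apply: rintegrable_norm; apply: sqintegrableM => //.
    exact: (sqintegrable_exp pi_poisson c teta).
  - move=> N gam; rewrite !normrM ler_wpM2r//.
    apply: le_trans (ler_norm_sum _ _ _) _.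
    rewrite [X in _ <= X * _]ger0_norm ?expR_ge0// [X in _ <= _ * X]ger0_norm//; apply: le_trans (bd N gam).
    by apply: ler_sum => m _; rewrite normrM [`|m`!%:R^-1|]ger0_norm ?invr_ge0.
  - move=> gam; apply: cvgMl; exact: coherent_series.
  move=> cv; apply: cvg_trans cv; apply: near_eq_cvg; apply: nearW => N.
  have e := @Rintegral_pair_sum R _ _ pi _ (index_enum 'I_N) (fun m => m`!%:R^-1)
    (fun gam => cpart b (g gam)) (fun m gam => C m psi gam) sgb (fun m => sC m).
  transitivity (\sum_(m < N) m`!%:R^-1 * \int[pi]_gam (cpart b (g gam) * C m psi gam))%R.
    rewrite -e; apply: Rintegral_ext => gam; rewrite mulrC; congr (_ * _).
    by apply: eq_bigr => m _; rewrite mulrC.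
  by apply: eq_bigr => m _; congr (_ * _); apply: Rintegral_ext => gam; rewrite mulrC.
have limk := lim k sk; have limh := lim h sh.
have limk' : (\sum_(m < N.+1) m`!%:R^-1 * \int[pi]_gam (C m psi gam * cpart b (k gam)))%R @[N --> \oo] -->
    (\int[pi]_gam (coherent mu psi gam * cpart b (k gam)))%R.
  by rewrite (cvg_shiftS (fun N => \sum_(m < N) m`!%:R^-1 * \int[pi]_gam (C m psi gam * cpart b (k gam)))%R).
suff shift N : (\sum_(m < N.+1) m`!%:R^-1 * \int[pi]_gam (C m psi gam * cpart b (k gam)))%R =
    ((\int[mu]_z (phi z * psi z)) * \sum_(m < N) m`!%:R^-1 * \int[pi]_gam (C m psi gam * cpart b (h gam)))%R.
  move: limk'; under eq_fun do rewrite shift; move=> limk'.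
  exact: (cvg_unique _ limk' (cvgM (cvg_cst (\int[mu]_z (phi z * psi z))%R) limh)).
have nf m : m`!%:R != 0 :> R by rewrite pnatr_eq0 -lt0n fact_gt0.
rewrite big_ord_recl (chaos_iso_pairing _ _ tpsi fk) T0 !mulr0 add0r mulr_sumr.
apply: eq_bigr => m _; rewrite (chaos_iso_pairing _ _ tpsi fk) (chaos_iso_pairing _ _ tpsi fh).
by rewrite lift0 TS !mulKf.
Qed.

End ChaosPairing.

(** * Classes of functions that determine integrable functions *)

Section Orthogonality.
Context {R : realType} {disp : measure_display} {T : measurableType disp}.
Variables (P : probability T R) (S : set (T -> R)).
Hypothesis S1 : S (cst 1).
Hypothesis S_measurable : forall s, S s -> measurable_fun setT s.
Hypothesis S_bounded : forall s, S s -> exists M : R, forall x, `|s x| <= M.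
Hypothesis S_mul : forall s s', S s -> S s' -> exists (c : R) s1 s2,
  [/\ S s1, S s2 & forall x, s x * s' x = c * (s1 x + s2 x)].
Hypothesis S_generates : forall B : set T, measurable B ->
  <<s [set B | exists s a, S s /\ B = [set x | s x < a]] >> B.

(** The bounded functions orthogonal to f are closed under the operations of the monotone class
    theorem. They therefore include the indicators of f > 0 and of f < 0, so the integral of |f|
    vanishes. *)
Lemma orthogonal_ae0 f : rintegrable P f ->
  (forall s, S s -> (\int[P]_t (s t * f t))%R = 0) -> {ae P, forall t, f t = 0}.
Proof.
move=> fi Sf; have mf := rintegrable_measurable fi.
pose H := [set s : T -> R | measurable_fun setT s /\ (exists M : R, forall x, `|s x| <= M) /\
  (\int[P]_t (s t * f t))%R = 0].
have Hi s : H s -> rintegrable P (fun t => s t * f t).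
  by move=> [ms [[M sM] _]]; exact: (rintegrableM ms sM fi).
have HB (B : set T) : measurable B -> H (\1_B).
  move=> mB; apply: (@functional_monotone_class R T H S) => //; last exact: S_generates.
  - move=> a s s' Hs Hs'; have [ms [[M sM] s0]] := Hs; have [ms' [[M' sM'] s'0]] := Hs'.
    split; first by apply: measurable_funD => //; exact: measurable_funM.
    split; first exists (`|a| * M + M') => x.
      rewrite (le_trans (ler_normD _ _))// lerD// normrM ler_wpM2l//.
    rewrite (Rintegral_ext _ (g := fun t => a * (s t * f t) + s' t * f t)); last by move=> t; ring.
    by rewrite Rintegral_lin ?s0 ?s'0 ?mulr0 ?addr0//; exact: Hi.
  - move=> s_ s M Hs sM ss.
    have ms : measurable_fun setT s.
      by apply: (@measurable_fun_cvg _ _ _ _ s_) => [n|t _]; [have [] := Hs n|exact: ss].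
    split=> //; split.
      exists M => x; apply: (ler_cvg_to (cvg_norm (ss x)) (cvg_cst M)).
      by apply: nearW => n; exact: sM.
    have [||||_ cv] := @Rdominated_convergence R _ _ P (fun n t => s_ n t * f t)
      (fun t => s t * f t) (fun t => `|M| * `|f t|).
    + by move=> n; apply: measurable_funM => //; have [] := Hs n.
    + exact/rintegrableZ/rintegrable_norm.
    + by move=> n t; rewrite normrM ler_wpM2r// (le_trans (sM n t))// ler_norm.
    + by move=> t; exact: cvgMl.
    move: cv; under eq_fun do rewrite (let: conj _ (conj _ e) := Hs _ in e).
    by move=> cv; exact: (cvg_unique _ cv (cvg_cst 0)).
  - move=> s Ss; split; first exact: S_measurable.
    by split; [exact: S_bounded|exact: Sf].
have mp : measurable [set t | 0 < f t].
  have := mf measurableT _ (measurable_itv `]0, +oo[%R); rewrite setTI.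
  by congr measurable; apply/funext => t; rewrite /= in_itv/= andbT.
have mn : measurable [set t | f t < 0].
  have := mf measurableT _ (measurable_itv `]-oo, 0[%R); rewrite setTI.
  by congr measurable; apply/funext => t; rewrite /= in_itv.
have /Hi ip := HB _ mp; have /Hi iN := HB _ mn.
have abs0 : (\int[P]_t `|f t|)%R = 0.
  rewrite (Rintegral_ext _ (g := fun t => (-1) * (\1_[set t | f t < 0] t * f t) +
    \1_[set t | 0 < f t] t * f t)).
    by rewrite Rintegral_lin// (HB _ mp).2.2 (HB _ mn).2.2 mulr0 addr0.
  move=> t; rewrite !indic_pred; case: (ltrgtP (f t) 0) => [n|p|->].
  - by rewrite ltr0_norm// mul1r mul0r mulN1r addr0.
  - by rewrite gtr0_norm// mul1r mul0r mulr0 add0r.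
  - by rewrite normr0 !mulr0 addr0.
have : (\int[P]_t `|(f t)%:E| = 0)%E.
  by have := Rintegral_EFin (rintegrable_norm fi); rewrite abs0 => <-.
move/(ae_eq_integral_abs P measurableT ((measurable_EFinP _ _).2 mf)).
by apply: filterS => t /(_ I)/= [].
Qed.

End Orthogonality.

Lemma cos_mul {R : realType} (u v : R) : cos u * cos v = 2^-1 * (cos (u + v) + cos (u - v)).
Proof. by rewrite cosD cosB; field. Qed.

Section ConfigClasses.
Context {R : realType} {d : nat} (E : set (R * 'rV[R]_d)%type).
Local Notation Z := (R * 'rV[R]_d)%type.
Hypothesis oE : open E.
Variable pi : probability (config_space E) R.

Definition laplace_class : set (config_space E -> R) := [set s | exists chi,
  [/\ test_on E chi, forall z, 0 <= chi z & s = fun gam : config_space E => expR (- set_sum gam chi)]].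

(** The phase [theta] brings in the sines, from which the pairing itself is recovered as the limit
    of n sin(x / n). *)
Definition cosine_class : set (config_space E -> R) := [set s | exists chi theta,
  test_on E chi /\ s = fun gam : config_space E => cos (set_sum gam chi + theta)].

Lemma measurable_generated (S : set (config_space E -> R)) :
  (forall chi : Z -> R, test_on E chi -> (forall z, 0 <= chi z) ->
    measurable_fun (setT : set (g_sigma_algebraType
      [set B | exists s a, S s /\ B = [set x | s x < a]])) (fun gam : config_space E => set_sum gam chi)) ->
  forall B : set (config_space E), measurable B ->
  <<s [set B | exists s a, S s /\ B = [set x | s x < a]] >> B.
Proof.
move=> mS B mB; pose X : g_sigma_algebraType
  [set B | exists s a, S s /\ B = [set x | s x < a]] -> config_space E := id.
have mX : measurable_fun setT X by apply: measurable_to_config.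
by have := mX measurableT B mB; rewrite setTI.
Qed.

Implicit Types (chi : Z -> R) (f : config_space E -> R).

Lemma laplace_determines f : rintegrable pi f ->
  (forall chi, test_on E chi -> (forall z, 0 <= chi z) ->
    (\int[pi]_gam (expR (- set_sum gam chi) * f gam))%R = 0) ->
  {ae pi, forall gam, f gam = 0}.
Proof.
move=> fi f0; apply: (@orthogonal_ae0 R _ _ pi laplace_class) => //.
- exists (cst 0); split=> //; first exact: test_on0.
  by apply/funext => gam; rewrite set_sum0 oppr0 expR0.
- move=> _ [chi [tchi _ ->]]; apply: measurableT_comp => //; apply: measurable_funN.
  exact: measurable_set_sum.
- move=> _ [chi [tchi chi0 ->]]; exists 1 => gam; rewrite ger0_norm ?expR_ge0//.
  by rewrite -expR0 ler_expR oppr_le0; exact: set_sum_test_ge0.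
- move=> _ _ [chi [tchi chi0 ->]] [chi' [tchi' chi'0 ->]].
  have tD := test_onD tchi tchi'.
  have S12 : laplace_class (fun gam : config_space E => expR (- set_sum gam (fun z => chi z + chi' z))).
    by exists (fun z => chi z + chi' z); split=> // z; exact: addr_ge0.
  exists 2^-1, (fun gam : config_space E => expR (- set_sum gam (fun z => chi z + chi' z))),
    (fun gam : config_space E => expR (- set_sum gam (fun z => chi z + chi' z))); split=> // gam.
  have half (y : R) : y = 2^-1 * (y + y) by field.
  by rewrite -expRD -opprD -set_sum_testD//; exact: half.
- apply: measurable_generated => chi tchi chi0.
  have /generated_measurable_fun : laplace_class (fun gam : config_space E => expR (- set_sum gam chi)).
    by exists chi.
  move=> /(measurableT_comp (@measurable_ln R)) /measurable_funN.
  by congr measurable_fun; apply/funext => gam /=; rewrite expRK opprK.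
- by move=> _ [chi [tchi chi0 ->]]; exact: f0.
Qed.

Lemma sin_quotient (x : R) : n.+1%:R * sin (n.+1%:R^-1 * x) @[n --> \oo] --> x.
Proof.
have D : is_derive (0 : R) (1 : R) (fun t => sin (t * x)) x.
  apply: is_derive_eq; rewrite /= mul0r cos0 scaler1.
  by rewrite scaler0 add0r mul1r.
have [der val] := D.
have : h^-1 *: (sin ((h *: 1 + 0) * x) - sin (0 * x)) @[h --> (0 : R)^'] --> x.
  by rewrite -[X in _ --> X]val; exact: der.
move=> /cvg_dnbhs_at_right /cvg_at_rightP /(_ (fun n => n.+1%:R^-1)).
have h0 : n.+1%:R^-1 @[n --> \oo] --> (0 : R) by exact: cvg_harmonic.
move=> /(_ (conj (fun n => _) h0)) c; apply: cvg_trans (c _) => [|n]; last by rewrite invr_gt0.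
apply: near_eq_cvg; apply: nearW => n.
by rewrite invrK mul0r sin0 subr0 addr0; congr (_ * sin (_ * x)); rewrite /GRing.scale/= mulr1.
Qed.

Lemma cosine_determines f : rintegrable pi f ->
  (forall chi theta, test_on E chi ->
    (\int[pi]_gam (cos (set_sum gam chi + theta) * f gam))%R = 0) ->
  {ae pi, forall gam, f gam = 0}.
Proof.
move=> fi f0; apply: (@orthogonal_ae0 R _ _ pi cosine_class) => //.
- exists (cst 0), 0; split; first exact: test_on0.
  by apply/funext => gam; rewrite set_sum0 addr0 cos0.
- move=> _ [chi [theta [tchi ->]]]; apply: measurableT_comp; first exact: (continuous_measurable_fun (@continuous_cos R)).
  by apply: measurable_funD => //; exact: measurable_set_sum.
- by move=> _ [chi [theta [tchi ->]]]; exists 1 => gam; rewrite cos_max.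
- move=> _ _ [chi [theta [tchi ->]]] [chi' [theta' [tchi' ->]]].
  have tD := test_onD tchi tchi'; have tB := test_onB tchi tchi'.
  exists 2^-1, (fun gam : config_space E => cos (set_sum gam (fun z => chi z + chi' z) + (theta + theta'))),
    (fun gam : config_space E => cos (set_sum gam (fun z => chi z - chi' z) + (theta - theta'))); split.
  + by exists (fun z => chi z + chi' z), (theta + theta').
  + by exists (fun z => chi z - chi' z), (theta - theta').
  move=> gam; have -> : (fun z => chi z - chi' z) = (fun z => chi z + -1 * chi' z).
    by apply/funext => z; rewrite mulN1r.
  rewrite !set_sum_testD//; last exact: test_onZ.
  rewrite set_sum_testZ// mulN1r [X in cos X + _]addrACA [X in _ + cos X]addrACA -opprD.
  exact: cos_mul.
- apply: measurable_generated => chi tchi chi0.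
  (* The phase -pi/2 turns the cosine into a sine, so h n tends to <gam, chi>. Hence the pairings
     are measurable for the sigma-algebra generated by the cosines. *)
  pose h n (gam : config_space E) : R :=
    n.+1%:R * cos (set_sum gam (fun z => n.+1%:R^-1 * chi z) - trigo.pi / 2).
  have mh n : measurable_fun (setT : set (g_sigma_algebraType
      [set B | exists s a, cosine_class s /\ B = [set x | s x < a]])) (h n).
    apply: measurable_funM => //; apply: generated_measurable_fun.
    by exists (fun z => n.+1%:R^-1 * chi z), (- (trigo.pi / 2)); split=> //; exact: test_onZ.
  apply: (measurable_fun_cvg mh).
  move=> gam _; rewrite /h; under eq_fun do rewrite set_sum_testZ// cosBpihalf.
  exact: sin_quotient.
- by move=> _ [chi [theta [tchi ->]]]; exact: f0.
Qed.

End ConfigClasses.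

(** * The adjoint of the gradient *)

Section Lipschitz.
Context {R : realType}.

Lemma is_derive_along {V : normedModType R} (F : V -> R) (x v : V) (h : R) : smooth F ->
  is_derive h 1 (fun t : R => F (t *: v + x)) ('D_v F (h *: v + x)).
Proof.
move=> sF; have E : (fun k : R => k^-1 *: (F ((k *: (1 : R) + h) *: v + x) - F (h *: v + x))) =
    (fun k : R => k^-1 *: (F (k *: v + (h *: v + x)) - F (h *: v + x))).
  by apply/funext => k; rewrite scalerDl -addrA /GRing.scale /= mulr1.
split; first by have := @smooth_derivable _ _ F (h *: v + x) v sF; rewrite /derivable -E.
by rewrite /derive -E.
Qed.

Lemma mvt_along {V : normedModType R} (f : V -> R) v (t : R) x : smooth f ->
  exists th, `|th| <= `|t| /\ f (t *: v + x) - f x = t * 'D_v f (th *: v + x).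
Proof.
move=> sf; have pos (s : R) y : 0 <= s ->
    exists2 c, 0 <= c <= s & f (s *: v + y) - f y = s * 'D_v f (c *: v + y).
  move=> s0; have D h := is_derive_along y v h sf.
  have [|c] := @MVT_segment R _ _ _ _ s0 (fun h _ => D h).
    apply: continuous_subspaceT => h; apply: differentiable_continuous.
    by apply/derivable1_diffP; have [] := D h.
  rewrite in_itv/= => cs e; exists c => //.
  by move: e; rewrite scale0r add0r subr0 mulrC => ->.
have [t0|t0] := leP 0 t.
  have [c /andP[c0 ct] e] := pos t x t0; exists c; split=> //.
  by rewrite !ger0_norm.
(* For negative t the segment is run through backwards, starting from the point t v + x. *)
have [|c /andP[c0 ct] e] := pos (- t) (t *: v + x); first by rewrite oppr_ge0 ltW.
exists (c + t); split.
  by rewrite (ltr0_norm t0) ler_norml; apply/andP; split; lra.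
move: e; rewrite !addrA -scalerDl addNr scale0r add0r -scalerDl => e.
by rewrite -opprB e mulNr opprK.
Qed.

Lemma derive_bound_lipschitz {V : normedModType R} (F : V -> R) (v : V) (M : R) : smooth F ->
  (forall x, `|'D_v F x| <= M) -> forall (t : R) x, `|F (t *: v + x) - F x| <= M * `|t|.
Proof.
move=> sF FM t x; have [th [_ ->]] := mvt_along v t x sF.
by rewrite normrM mulrC ler_wpM2r.
Qed.

Lemma lipschitz_rV N (F : 'rV[R]_N -> R) : smooth_bounded_derivatives F ->
  exists2 M, 0 <= M & forall x y, `|F (x + y) - F x| <= M * \sum_i `|y 0 i|.
Proof.
move=> [sF bF]; have /choice[M FM] : forall i : 'I_N, exists M : R, forall x,
    `|'D_(delta_mx 0 i) F x| <= M.
  by move=> i; have [M FM] := bF [:: delta_mx 0 i] isT; exists M.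
have MS i : M i <= \sum_j `|M j|.
  by rewrite (bigD1 i)//= ler_wpDr ?sumr_ge0// ler_norm.
exists (\sum_j `|M j|) => [|x y]; first exact: sumr_ge0.
have step r : `|F (x + \sum_(i <- r) y 0 i *: delta_mx 0 i) - F x| <=
    (\sum_j `|M j|) * \sum_(i <- r) `|y 0 i|.
  elim: r => [|i r IH]; first by rewrite !big_nil addr0 subrr normr0 mulr0.
  rewrite !big_cons addrCA mulrDr.
  set z := x + _ in IH *; rewrite -(subrK (F z) (F (_ + z))) -addrA.
  rewrite (le_trans (ler_normD _ _))// lerD//.
  apply: (derive_bound_lipschitz sF) => w; apply: le_trans (FM i w) _; exact: MS.
by have := step (index_enum _); rewrite -row_sum_delta.
Qed.

End Lipschitz.

Section MeasurableCoordinates.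
Context {R : realType} {V : normedModType R} (c : coordinates V).
Context {disp : measure_display} {T : measurableType disp}.

Lemma measurable_preimage_open (f : T -> V) (U : set V) :
  (forall i, measurable_fun setT (fun t => coord c i (f t))) -> open U ->
  measurable (f @^-1` U).
Proof.
move=> mf oU; have [q qd] := coord_dense c.
pose rad k : R := k.+1%:R^-1; have rad0 k : 0 < rad k by rewrite invr_gt0.
pose B (m : nat * nat) := [set v | `|v - q m.1| < rad m.2].
have -> : f @^-1` U = \bigcup_(m in [set m | B m `<=` U]) f @^-1` B m.
  apply/seteqP; split=> [t /= Uft|t [m /= mU]]; last exact: mU.
  have [r r0 rU] := nbhs_cball (open_nbhs_nbhs (conj oU Uft)).
  pose k := Num.trunc (2 / r).
  have rk : rad k <= r / 2.
    rewrite -[leRHS]invrK lef_pV2 ?posrE ?invr_gt0 ?divr_gt0//.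
    by rewrite invf_div ltW// truncnS_gt.
  have [n zn] := qd (f t) _ (rad0 k).
  exists (n, k) => //= y yn; apply: rU => /=.
  rewrite (le_trans (ler_distD (q n) _ _))// (splitr r).
  by rewrite lerD// (le_trans (ltW _) rk)// distrC.
rewrite bigcup_mkcond; apply: countable_bigcupT_measurable; first exact: countableP.
move=> [n k]; case: ifP => // _.
have -> : f @^-1` B (n, k) = \bigcap_(i in [set: coord_index c])
    [set t | `|coord c i (f t) - coord c i (q n)| < rad k].
  apply/seteqP; split=> t /=; rewrite /B /= (coord_norm_lt c _ (rad0 k)).
    by move=> h i _; rewrite /= -coordB.
  by move=> h i; rewrite coordB; exact: h.
apply: fin_bigcap_measurable => // i _.
have := measurableT_comp (@normr_measurable R setT) (measurable_funB (mf i) (measurable_cst (coord c i (q n)))).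
move=> /(_ measurableT _ (measurable_itv `]-oo, (rad k)[%R)); rewrite setTI.
by congr measurable; apply/funext => t; rewrite /= in_itv.
Qed.

Lemma measurable_comp_continuous (f : T -> V) (F : V -> R) :
  (forall i, measurable_fun setT (fun t => coord c i (f t))) -> continuous F ->
  measurable_fun setT (F \o f).
Proof.
move=> mf cF; apply: (measurability _ (RGenOpens.measurableE R)).
move=> _ [_ [a [b ->] <-]]; rewrite setTI comp_preimage; apply: measurable_preimage_open => //.
by apply: open_comp => [x _|]; [exact: cF|exact: interval_open].
Qed.

End MeasurableCoordinates.

Section RintegralSections.
Context {R : realType} {d1 d2 : measure_display}.
Context {T1 : measurableType d1} {T2 : measurableType d2}.
Variables (m1 : {sigma_finite_measure set T1 -> \bar R}).
Variables (m2 : {sigma_finite_measure set T2 -> \bar R}).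

Lemma Rintegral_section (h : T1 * T2 -> R) : rintegrable (m1 \x m2)%E h ->
  (forall x, rintegrable m2 (fun y => h (x, y))) ->
  rintegrable m1 (fun x => (\int[m2]_y h (x, y))%R) /\
  (\int[(m1 \x m2)%E]_p h p = \int[m1]_x \int[m2]_y h (x, y))%R.
Proof.
move=> hi hx; have E x : ((\int[m2]_y h (x, y))%R%:E = \int[m2]_y (h (x, y))%:E)%E.
  exact: Rintegral_EFin.
have := integrable_fubini_F hi.
rewrite (_ : fubini_F m2 (EFin \o h) = EFin \o (fun x => (\int[m2]_y h (x, y))%R)); last first.
  by apply/funext => x; rewrite /= E.
move=> iF; split=> //; rewrite Rintegral_fubini//.
by congr fine; apply: eq_integral => x _; rewrite E.
Qed.

End RintegralSections.

Section MeckeCreation.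
Context {R : realType} {d : nat} (E : set (R * 'rV[R]_d)%type).
Local Notation Z := (R * 'rV[R]_d)%type.
Variable mu : {sigma_finite_measure set Z -> \bar R}.
Variable pi : probability (config_space E) R.
Hypothesis oE : open E.
Hypothesis muK : forall K : set Z, compact K -> K `<=` E -> (mu K < +oo)%E.
Hypothesis muE : mu (~` E) = 0%E.
Hypothesis pi_poisson : is_poisson mu pi.
Variable phi : Z -> R.
Hypothesis iphi : rintegrable mu phi.
Implicit Types (psi chi : Z -> R) (gam : config_space E) (a : config_space E -> R).

(* The right-hand side of the theorem, for real-valued functions on the
   Poisson space. *)
Definition mecke_creation a gam : R :=
  set_sum gam (palm (fun p => phi p.2 * a p.1) gam) - (\int[mu]_z phi z)%R * a gam.

Lemma integrable_weight a : rintegrable pi a ->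
  rintegrable (pi \x mu)%E (fun p => phi p.2 * a p.1).
Proof. by move=> ia; have := rintegrable_prod ia iphi; apply: rintegrable_ext => p; rewrite mulrC. Qed.

Lemma integrable_mecke_creation a : rintegrable pi a -> rintegrable pi (mecke_creation a).
Proof.
move=> ia; have [_ i1 _] := mecke oE muK muE pi_poisson (integrable_weight ia).
by apply: rintegrableB => //; exact: rintegrableZ.
Qed.

(** By the Mecke formula the sum over gam contributes v phi a, and the term with <phi> subtracts u
    phi a, which produces the difference in the gradient. Boundedness is asked of v - u only: a
    cylinder function may grow, but adding one point changes it by a bounded amount. *)
Lemma mecke_creation_duality (u : config_space E -> R) (v : config_space E * Z -> R) a (M : R) :
  measurable_fun setT u -> measurable_fun setT v ->
  (forall gam z, config_set gam z -> u gam = v (config_rem gam z : config_space E, z)) ->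
  (forall p, `|v p - u p.1| <= M) ->
  rintegrable pi a -> rintegrable pi (fun gam => u gam * a gam) ->
  let w gam := (\int[mu]_z ((v (gam, z) - u gam) * phi z))%R in
  [/\ rintegrable pi (fun gam => w gam * a gam),
      rintegrable pi (fun gam => u gam * mecke_creation a gam) &
      (\int[pi]_gam (u gam * mecke_creation a gam) = \int[pi]_gam (w gam * a gam))%R].
Proof.
move=> mmu mv uv vM ia iua w.
have i1 := rintegrable_prod iua iphi.
have mw : measurable_fun setT (fun p : config_space E * Z => phi p.2 * a p.1).
  exact: (rintegrable_measurable (integrable_weight ia)).
have mD : measurable_fun setT (fun p : config_space E * Z => (v p - u p.1) * (phi p.2 * a p.1)).
  apply: measurable_funM => //; apply: measurable_funB => //; exact: measurableT_comp.
have iD : rintegrable (pi \x mu)%E (fun p => (v p - u p.1) * (phi p.2 * a p.1)).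
  apply: (rintegrable_le mD (rintegrableZ M (integrable_weight ia))) => p.
  by rewrite [leLHS]normrM [leRHS]normrM ler_wpM2r// (le_trans (vM p))// ler_norm.
have sec gam : rintegrable mu (fun z => (v (gam, z) - u gam) * phi z).
  apply: (@rintegrableM _ _ _ mu _ phi M) => [|z|//]; last exact: vM (gam, z).
  apply: measurable_funB => //; apply: (measurableT_comp mv); exact: measurable_pair1.
have iv : rintegrable (pi \x mu)%E (fun p => v p * (phi p.2 * a p.1)).
  by apply: rintegrable_ext (rintegrableD iD i1) => p; rewrite /=; ring.
have [iS eS] := mecke_duality oE muK muE pi_poisson mmu uv iv (integrable_weight ia).
have E1 gam : u gam * mecke_creation a gam = (- (\int[mu]_z phi z)%R) * (u gam * a gam) +
    u gam * set_sum gam (palm (fun p => phi p.2 * a p.1) gam).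
  by rewrite /mecke_creation; ring.
have wE gam : (\int[mu]_z ((v (gam, z) - u gam) * (phi z * a gam)) = w gam * a gam)%R.
  have e := RintegralZr (a gam) measurableT (sec gam); rewrite -e.
  by apply: Rintegral_ext => z; ring.
have [gam|iw ew] := Rintegral_section iD.
  by apply: rintegrable_ext (rintegrableZ (a gam) (sec gam)) => z; ring.
split.
- by apply: rintegrable_ext iw => gam; rewrite wE.
- by rewrite (funext E1); exact: rintegrable_lin.
rewrite (Rintegral_ext _ E1) Rintegral_lin// eS.
have -> : (\int[(pi \x mu)%E]_p (v p * (phi p.2 * a p.1)) =
  \int[(pi \x mu)%E]_p (1 * ((v p - u p.1) * (phi p.2 * a p.1)) + u p.1 * a p.1 * phi p.2))%R.
  by apply: Rintegral_ext => p; ring.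
rewrite Rintegral_lin// mul1r ew.
have /= -> := Rintegral_prod iua iphi.
rewrite (Rintegral_ext _ wE); ring.
Qed.

(** Since 1 + psi = e^{-chi}, the functions e^{-<gam, chi>} are coherent states up to a constant.
    This links the Fock space computation with the class used in [laplace_determines]. *)
Lemma coherent_laplace chi gam : test_on E chi ->
  coherent mu (fun z => expR (- chi z) - 1) gam =
  expR (- set_sum gam chi) * expR (- (\int[mu]_z (expR (- chi z) - 1))%R).
Proof.
move=> tchi; have [_ cK KE] := tchi; have mp := mem_points gam _ cK KE.
rewrite (coherentE (s := points gam (tsupp chi)) _ (test_on_expR1 (test_onN tchi))).
- congr (_ * _); rewrite (set_sum_points _ cK KE); last by move=> z /notin_tsupp.
  by rewrite -sumrN expR_sum; apply: eq_bigr => z _; rewrite addrCA subrr addr0.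
- exact: points_uniq.
- by move=> z /mp[].
- move=> z gz zp; have -> : chi z = 0.
    by apply: notin_tsupp => Kz; move/negP: zp; apply; exact/mp.
  by rewrite oppr0 expR0 subrr.
Qed.

Lemma laplace_mecke_creation chi a : test_on E chi -> (forall z, 0 <= chi z) ->
  rintegrable pi a ->
  rintegrable pi (fun gam => expR (- set_sum gam chi) * mecke_creation a gam) /\
  (\int[pi]_gam (expR (- set_sum gam chi) * mecke_creation a gam) =
   (\int[mu]_z (phi z * (expR (- chi z) - 1))) *
     \int[pi]_gam (expR (- set_sum gam chi) * a gam))%R.
Proof.
move=> tchi chi0 ia; have mS := measurable_set_sum tchi.
have mX : measurable_fun setT (fun gam : config_space E => expR (- set_sum gam chi)).
  by apply: measurableT_comp => //; exact: measurable_funN.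
have X1 gam : `|expR (- set_sum gam chi)| <= 1.
  rewrite ger0_norm ?expR_ge0// -expR0 ler_expR oppr_le0; exact: set_sum_test_ge0.
have iXa := rintegrableM mX X1 ia.
have [] := @mecke_creation_duality (fun gam => expR (- set_sum gam chi))
  (fun p => expR (- set_sum p.1 chi) * expR (- chi p.2)) a 1 mX _ _ _ ia iXa.
- apply: measurable_funM; first exact: (measurableT_comp mX).
  apply: measurableT_comp => //; apply: measurable_funN.
  exact: (measurableT_comp (measurable_test tchi)).
- move=> gam z gz /=; rewrite (set_sum_rem gz (summable_test gam tchi)) -expRD.
  by rewrite -opprD subrK.
- move=> p; rewrite -[X in _ - X]mulr1 -mulrBr normrM mulr_ile1//.
  have := expR_ge0 (- chi p.2); have : expR (- chi p.2) <= 1.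
    by rewrite -expR0 ler_expR oppr_le0.
  by move=> *; rewrite ler_norml; lra.
move=> /= _ i1 e1; split=> //; rewrite e1.
rewrite -RintegralZl//; apply: Rintegral_ext => gam.
have tpsi := test_on_expR1 (test_onN tchi).
have ip : rintegrable mu (fun z => phi z * (expR (- chi z) - 1)).
  have [M M0 psiM] := test_on_bounded tpsi.
  have := rintegrableM (measurable_test tpsi) psiM iphi.
  by apply: rintegrable_ext => z; rewrite mulrC.
have e := RintegralZl (expR (- set_sum gam chi)) measurableT ip.
rewrite mulrCA mulrA -e.
by congr (_ * _); apply: Rintegral_ext => z; ring.
Qed.

(** Against e^{-<gam, chi>} both k and the Mecke expression give the factor <phi (e^{-chi} - 1)>
    times the integral of h; the constant c between Laplace functions and coherent states is
    positive and cancels. *)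
Lemma chaos_creation_ae (f f' : fock_seq) (h k : config_space E -> R[i]) b :
  chaos_iso mu pi f h -> fock_creation mu phi f f' -> chaos_iso mu pi f' k ->
  {ae pi, forall gam, cpart b (k gam) = mecke_creation (fun gam => cpart b (h gam)) gam}.
Proof.
move=> fh cr fk; have [_ sh _] := fh; have [_ sk _] := fk.
have ih := sqintegrable_rintegrable ((inL2P _ _).1 sh b).
have ik := sqintegrable_rintegrable ((inL2P _ _).1 sk b).
have ic := integrable_mecke_creation ih.
have iB := rintegrableB ik ic.
apply: filterS (laplace_determines oE iB _) => [gam /eqP|chi tchi chi0].
  by rewrite subr_eq0 => /eqP.
have tpsi := test_on_expR1 (test_onN tchi).
have ip : rintegrable mu (fun z => phi z * (expR (- chi z) - 1)).
  have [M M0 psiM] := test_on_bounded tpsi.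
  have := rintegrableM (measurable_test tpsi) psiM iphi.
  by apply: rintegrable_ext => z; rewrite mulrC.
have := creation_coherent oE muK muE pi_poisson b tpsi ip fh cr fk.
have [iXc eXc] := laplace_mecke_creation tchi chi0 ih.
set c := expR (- (\int[mu]_z (expR (- chi z) - 1))%R).
have mX : measurable_fun setT (fun gam : config_space E => expR (- set_sum gam chi)).
  by apply: measurableT_comp => //; apply: measurable_funN; exact: measurable_set_sum.
have X1 gam : `|expR (- set_sum gam chi)| <= 1.
  rewrite ger0_norm ?expR_ge0// -expR0 ler_expR oppr_le0; exact: set_sum_test_ge0.
have pull a : rintegrable pi a -> (\int[pi]_gam (coherent mu (fun z => expR (- chi z) - 1) gam * a gam) =
    c * \int[pi]_gam (expR (- set_sum gam chi) * a gam))%R.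
  move=> ia; have iXa := rintegrableM mX X1 ia; rewrite -RintegralZl//.
  by apply: Rintegral_ext => gam; rewrite coherent_laplace// -/c; ring.
rewrite (pull _ ik) (pull _ ih) mulrCA => /mulfI e.
have iXk := rintegrableM mX X1 ik.
rewrite (Rintegral_ext _ (g := fun gam => (-1) * (expR (- set_sum gam chi) *
   mecke_creation (fun gam => cpart b (h gam)) gam) + expR (- set_sum gam chi) * cpart b (k gam))).
  by rewrite Rintegral_lin// e ?gt_eqF ?expR_gt0// eXc; ring.
by move=> gam; ring.
Qed.

Section Cylinders.
Variables (N : nat) (psi : 'I_N -> Z -> R).
Hypothesis tpsi : forall i, test_on E (psi i).

Definition pairings gam : 'rV[R]_N := \row_i set_sum gam (psi i).

Lemma sqintegrable_set_sum chi : test_on E chi -> sqintegrable pi (fun gam => set_sum gam chi).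
Proof.
move=> tchi; have ip := sqintegrable_exp pi_poisson 1 tchi.
have iN := sqintegrable_exp pi_poisson 1 (test_onN tchi).
apply: (sqintegrable_le _ (sqintegrableD ip iN)); first exact: measurable_set_sum.
move=> gam; rewrite /charlier_majorant !mulr1 [leRHS]ger0_norm ?addr_ge0 ?expR_ge0//.
have -> : (fun x => - chi x) = (fun x => -1 * chi x) by apply/funext => z; rewrite mulN1r.
rewrite set_sum_testZ// mulN1r.
have := expR_ge1Dx (set_sum gam chi); have := expR_ge1Dx (- set_sum gam chi).
have := expR_ge0 (set_sum gam chi); have := expR_ge0 (- set_sum gam chi).
by move=> *; rewrite ler_norml; apply/andP; split; lra.
Qed.

Lemma measurable_pairings_comp {disp} {T : measurableType disp} (F : 'rV[R]_N -> R)
    (f : T -> 'rV[R]_N) :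
  continuous F -> (forall i, measurable_fun setT (fun t => f t 0 i)) ->
  measurable_fun setT (F \o f).
Proof.
move=> cF mf; have mf' : forall i : coord_index (row_coordinates N),
    measurable_fun setT (fun t => coord (row_coordinates N) i (f t)) := mf.
exact: measurable_comp_continuous mf' cF.
Qed.

(** Bounded derivatives make F Lipschitz. Linear growth puts F of the pairings in L^2, and adding a
    point moves F by at most M times the sum of the bounds of the psi_i, as the duality requires. *)
Lemma cylinder_duality (F : 'rV[R]_N -> R) a : smooth_bounded_derivatives F ->
  sqintegrable pi a ->
  let w gam := (\int[mu]_z ((F (\row_i (set_sum gam (psi i) + psi i z)) - F (pairings gam)) * phi z))%R in
  [/\ sqintegrable pi (F \o pairings),
      rintegrable pi (fun gam => w gam * a gam),
      rintegrable pi (fun gam => F (pairings gam) * mecke_creation a gam) &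
      (\int[pi]_gam (F (pairings gam) * mecke_creation a gam) = \int[pi]_gam (w gam * a gam))%R].
Proof.
move=> bF sa w; have [sF _] := bF; have cF := smooth_continuous sF.
have [M M0 FM] := lipschitz_rV bF.
have mX i : measurable_fun setT (fun gam : config_space E => set_sum gam (psi i)).
  exact: measurable_set_sum.
have mF : measurable_fun setT (F \o pairings).
  by apply: measurable_pairings_comp => // i; under eq_fun do rewrite mxE; exact: mX.
have sFX : sqintegrable pi (F \o pairings).
  have sS : sqintegrable pi (fun gam => M * (\sum_i `|set_sum gam (psi i)|) + `|F 0|).
    apply: sqintegrable_lin; last first.
      by split=> //; apply: finite_measure_integrable_cst.
    apply: sqintegrable_sum => i; have [m1 i1] := sqintegrable_set_sum (tpsi i).
    split; first exact: measurableT_comp.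
    by apply: rintegrable_ext i1 => gam; rewrite real_normK ?num_real.
  apply: (sqintegrable_le mF sS) => gam.
  rewrite [leRHS]ger0_norm ?addr_ge0 ?mulr_ge0 ?sumr_ge0//.
  rewrite /= -[F (pairings gam)](subrK (F 0)) (le_trans (ler_normD _ _))// lerD2r.
  have := FM 0 (pairings gam); rewrite add0r => /le_trans; apply.
  by rewrite ler_wpM2l//; apply: ler_sum => i _; rewrite mxE.
have /choice[B psiB] : forall i, exists B : R, forall z, `|psi i z| <= B.
  by move=> i; have [B _ psiB] := test_on_bounded (tpsi i); exists B.
pose v (p : config_space E * Z) : R := F (\row_i (set_sum p.1 (psi i) + psi i p.2)).
have [|||iw iu e] := @mecke_creation_duality (F \o pairings) v a (M * \sum_i `|B i|) mF _ _ _
    (sqintegrable_rintegrable sa) (sqintegrableM sFX sa).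
- apply: measurable_pairings_comp => // i; under eq_fun do rewrite mxE.
  apply: measurable_funD; first exact: (measurableT_comp (mX i)).
  exact: (measurableT_comp (measurable_test (tpsi i))).
- move=> gam z gz; rewrite /v /=; congr F; apply/rowP => i; rewrite !mxE.
  by rewrite (set_sum_rem gz (summable_test gam (tpsi i))) subrK.
- move=> p; rewrite /v /=.
  have -> : \row_i (set_sum p.1 (psi i) + psi i p.2) = pairings p.1 + \row_i psi i p.2.
    by apply/rowP => i; rewrite !mxE.
  apply: le_trans (FM _ _) _; rewrite ler_wpM2l//; apply: ler_sum => i _.
  by rewrite mxE (le_trans (psiB i _))// ler_norm.
by split.
Qed.

End Cylinders.

End MeckeCreation.

Section CosineCylinder.
Context {R : realType} {N : nat}.
Local Notation V := 'rV[R]_N.+1.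

(** A derivative of c cos(x_0 + theta) is of the same form with phase theta + pi/2 and another c, so
    this family carries all iterated derivatives and their bounds. *)
Definition cosine_wave (c theta : R) (x : V) : R := c * cos (x 0 0 + theta).

Lemma is_derive_cosine_wave (c theta : R) x v :
  is_derive x v (cosine_wave c theta) (cosine_wave (v 0 0 * c) (theta + trigo.pi / 2) x).
Proof.
rewrite /cosine_wave addrA cosDpihalf -mulrA.
apply: (@is_derive_line _ _ (fun t => c * cos t) (fun x : V => x 0 0 + theta)).
by move=> h; rewrite !mxE addrA.
Qed.

Lemma continuous_cosine_wave (c theta : R) : continuous (cosine_wave c theta).
Proof.
move=> x; have h1 : (fun y : V => y 0 0 + theta) @ x --> x 0 0 + theta.
  have hc : continuous (fun y : V => y 0 0) by exact: matrix_normedtype.coord_continuous.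
  exact: (cvgD (hc x) (cvg_cst theta)).
have h2 : (fun y : V => cos (y 0 0 + theta)) @ x --> cos (x 0 0 + theta).
  exact: (cvg_comp _ _ h1 (@continuous_cos R _)).
exact: (cvgM (cvg_cst c) h2).
Qed.

Lemma iterD_cosine_wave vs (c theta : R) :
  exists c' theta', iterD vs (cosine_wave c theta) = cosine_wave c' theta'.
Proof.
elim: vs => [|v vs [c' [theta' /= ->]]]; first by exists c, theta.
exists (v 0 0 * c'), (theta' + trigo.pi / 2); apply/funext => x.
by have [_ ->] := is_derive_cosine_wave c' theta' x v.
Qed.

Lemma smooth_bounded_cosine (theta : R) :
  smooth_bounded_derivatives (fun x : V => cos (x 0 0 + theta)).
Proof.
rewrite (_ : (fun x => _) = cosine_wave 1 theta); last first.
  by apply/funext => x; rewrite /cosine_wave mul1r.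
split=> [vs|vs _]; have [c' [theta' ->]] := iterD_cosine_wave vs 1 theta.
  split; first exact: continuous_cosine_wave.
  by move=> x v; have [] := is_derive_cosine_wave c' theta' x v.
by exists `|c'| => x; rewrite normrM ler_piMr// cos_max.
Qed.

End CosineCylinder.

Lemma smooth_bounded_cst {R : realType} {V : normedModType R} (c : R) :
  smooth_bounded_derivatives (fun _ : V => c).
Proof.
split; first exact: smooth_cst.
have D0 vs : exists a : R, iterD vs (fun _ : V => c) = cst a /\ ((0 < size vs)%N -> a = 0).
  elim: vs => [|v vs [a [IH _]]]; first by exists c.
  by exists 0; split=> //=; rewrite IH; apply/funext => x; rewrite derive_cst.
by move=> vs vs0; have [a [-> /(_ vs0) ->]] := D0 vs; exists 0 => x; rewrite normr0.
Qed.

Section DotParts.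
Context {R : realType} {disp : measure_display} {T : measurableType disp}.
Variable mu : {measure set T -> \bar R}.
Implicit Types f g : T -> R[i].

Definition part_dot f g b c : R := (\int[mu]_t (cpart b (f t) * cpart c (g t)))%R.

Lemma dotL2_parts f g : (forall b c, rintegrable mu (fun t => cpart b (f t) * cpart c (g t))) ->
  dotL2 mu f g = (part_dot f g true true + part_dot f g false false) +i*
                 (part_dot f g false true - part_dot f g true false).
Proof.
move=> fg; rewrite /dotL2 /cint /part_dot; congr (_ +i* _).
  rewrite -[X in X + _]mul1r -Rintegral_lin//; apply: Rintegral_ext => t.
  by case: (f t) (g t) => a b [c e] /=; ring.
rewrite addrC -mulN1r -Rintegral_lin//; apply: Rintegral_ext => t.
by case: (f t) (g t) => a b [c e] /=; ring.
Qed.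

End DotParts.

Section PoissonCreation.
Context {R : realType} {d : nat} (E : set (R * 'rV[R]_d)%type).
Local Notation Z := (R * 'rV[R]_d)%type.
Variable mu : {sigma_finite_measure set Z -> \bar R}.
Variable pi : probability (config_space E) R.
Hypothesis oE : open E.
Hypothesis muK : forall K : set Z, compact K -> K `<=` E -> (mu K < +oo)%E.
Hypothesis muE : mu (~` E) = 0%E.
Hypothesis pi_poisson : is_poisson mu pi.
Variable phi : Z -> R.
Hypothesis iphi : rintegrable mu phi.
Implicit Types (h k : config_space E -> R[i]).

Definition mecke_value h k : Prop := forall b,
  {ae pi, forall gam, cpart b (k gam) = mecke_creation mu phi (fun gam => cpart b (h gam)) gam}.

Lemma cpart_poisson_grad N (psi : 'I_N -> Z -> R) (F : 'rV[R]_N -> R[i]) b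
    (gam : config_space E) :
  cpart b (poisson_grad mu psi F phi gam) =
  (\int[mu]_z ((cpart b (F (\row_i (set_sum gam (psi i) + psi i z))) -
     cpart b (F (pairings psi gam))) * phi z))%R.
Proof.
rewrite /poisson_grad /cint; case: b => /=; apply: Rintegral_ext => z.
  by rewrite -(cpartB true) -(cpartMr true).
by rewrite -(cpartB false) -(cpartMr false).
Qed.

Lemma cylinder_parts N (psi : 'I_N -> Z -> R) (F : 'rV[R]_N -> R[i]) h k b c :
  is_cylinder E psi F -> inL2 pi h -> inL2 pi k ->
  [/\ rintegrable pi (fun gam => cpart b (poisson_grad mu psi F phi gam) * cpart c (h gam)),
      rintegrable pi (fun gam => cpart b (cylinder psi F gam) * cpart c (k gam)) &
      part_dot pi (poisson_grad mu psi F phi) h b c =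
      (\int[pi]_gam (cpart b (cylinder psi F gam) *
         mecke_creation mu phi (fun gam => cpart c (h gam)) gam))%R].
Proof.
move=> [tpsi sFr sFi] sh sk.
have bF : smooth_bounded_derivatives (fun x => cpart b (F x)) by case: b.
have [sX iw _ e] := cylinder_duality oE muK muE pi_poisson iphi tpsi bF ((inL2P _ _).1 sh c).
split.
- by apply: rintegrable_ext iw => gam; rewrite cpart_poisson_grad.
- exact: (sqintegrableM sX ((inL2P _ _).1 sk c)).
- by rewrite /part_dot e; apply: Rintegral_ext => gam; rewrite cpart_poisson_grad.
Qed.

Lemma mecke_value_creation h k : inL2 pi h -> inL2 pi k -> mecke_value h k ->
  poisson_creation mu pi phi h k.
Proof.
move=> sh sk hk; split=> // N psi F cF.
have P b c := cylinder_parts b c cF sh sk.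
rewrite !dotL2_parts; [|by move=> b c; have [] := P b c|by move=> b c; have [] := P b c].
have e b c : part_dot pi (poisson_grad mu psi F phi) h b c = part_dot pi (cylinder psi F) k b c.
  have [_ i1 ->] := P b c; rewrite /part_dot; apply/esym.
  have [tpsi sFr sFi] := cF.
  have bF : smooth_bounded_derivatives (fun x => cpart b (F x)) by case: b {i1}.
  have [_ _ i2 _] := cylinder_duality oE muK muE pi_poisson iphi tpsi bF ((inL2P _ _).1 sh c).
  have [] := @rintegrable_ae _ _ _ pi _ _ (@rintegrable_measurable _ _ _ pi _ i2) _ i1.
    by apply: filterS (hk c) => gam ->.
  by [].
by rewrite !e.
Qed.

(** The adjoint relation is used only for cylinder functions of one pairing with F real, a cosine.
    The imaginary part of F contributes 0, so the relation splits into separate ones for the real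
    and imaginary parts of k. *)
Lemma creation_mecke_value h k : poisson_creation mu pi phi h k -> mecke_value h k.
Proof.
move=> [sh sk hk] b.
have ih := sqintegrable_rintegrable ((inL2P _ _).1 sh b).
have ik := sqintegrable_rintegrable ((inL2P _ _).1 sk b).
have ic := integrable_mecke_creation oE muK muE pi_poisson iphi ih.
have iB := rintegrableB ik ic.
apply: filterS (cosine_determines oE iB _) => [gam /eqP|chi theta tchi].
  by rewrite subr_eq0 => /eqP.
pose psi (_ : 'I_1) := chi; pose F (x : 'rV[R]_1) : R[i] := (cos (x 0 0 + theta))%:C.
have cF : is_cylinder E psi F.
  by split=> // [|]; [exact: smooth_bounded_cosine|exact: smooth_bounded_cst].
have P a c := cylinder_parts a c cF sh sk.
have := hk _ psi F cF.
rewrite !dotL2_parts; [|by move=> a c; have [] := P a c|by move=> a c; have [] := P a c].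
have F0 c : part_dot pi (cylinder psi F) k false c = 0.
  rewrite /part_dot (Rintegral_ext _ (g := cst 0)); last by move=> gam; rewrite /= mul0r.
  by rewrite /Rintegral integral0.
have G0 c : part_dot pi (poisson_grad mu psi F phi) h false c = 0.
  have [_ _ ->] := P false c; rewrite (Rintegral_ext _ (g := cst 0)); last by move=> gam; rewrite /= mul0r.
  by rewrite /Rintegral integral0.
rewrite !F0 !G0 !addr0 !sub0r => -[e1 /oppr_inj e2].
have {e1 e2} : part_dot pi (poisson_grad mu psi F phi) h true b = part_dot pi (cylinder psi F) k true b.
  by case: b {ih ik ic iB}.
have [_ i1 ->] := P true b; rewrite /part_dot => e.
have cE gam : cpart true (cylinder psi F gam) = cos (set_sum gam chi + theta).
  by rewrite /cylinder /= mxE.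
have [tpsi sFr sFi] := cF.
have [_ _ i2 _] := cylinder_duality oE muK muE pi_poisson iphi tpsi sFr ((inL2P _ _).1 sh b).
rewrite (Rintegral_ext _ (g := fun gam => (-1) * (cpart true (cylinder psi F gam) *
    mecke_creation mu phi (fun gam => cpart b (h gam)) gam) + cpart true (cylinder psi F gam) * cpart b (k gam))).
  by rewrite Rintegral_lin// e mulN1r addNr.
by move=> gam; rewrite cE; ring.
Qed.

(** The domain hypothesis supplies a square integrable function equal to the Mecke expression almost
    everywhere, and this function is a value of the adjoint. *)
Lemma creation_exists h : dom_chaos_creation mu pi phi h -> exists k,
  poisson_creation mu pi phi h k.
Proof.
move=> [f [f' [k [fh cr fk]]]]; exists k; have [_ sh _] := fh; have [_ sk _] := fk.
apply: mecke_value_creation => // b.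
exact: (chaos_creation_ae oE muK muE pi_poisson iphi b fh cr fk).
Qed.

End PoissonCreation.

(** * The map Sigma *)

Section StateSpace.
Context {R : realType} {d : nat}.
Local Notation V := 'rV[R]_d.
Local Notation Z := (R * V)%type.
Variable rho : {sigma_finite_measure set R -> \bar R}.
Hypothesis rho_moments : finite_moments rho.
Hypothesis rho0 : rho [set 0] = 0%E.
Variable sigma : {sigma_finite_measure set V -> \bar R}.
Hypothesis sigma_radon : radon sigma.
Hypothesis sigma_nonatomic : nonatomic sigma.

Local Notation E := (state_space (d := d) rho).
Local Notation mu := (sprod rho sigma).

Definition cbox m : set V := [set x | `|x| <= m%:R].

Lemma cbox_compact m : compact (cbox m).
Proof.
have := coord_compact (row_coordinates d) 0 (m%:R : R).
by congr compact; apply/funext => x; rewrite /cbox /= subr0.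
Qed.

Lemma measurable_cbox m : measurable (cbox m).
Proof.
rewrite -(setCK (cbox m)); apply: measurableC; apply: open_measurable_rV.
by apply: closed_openC; apply: compact_closed; [exact: norm_hausdorff|exact: cbox_compact].
Qed.

Lemma compact_sub_cbox (K : set Z) : compact K -> exists m, forall z, K z -> cbox m z.2.
Proof.
move=> cK; have [M [_ KM]] := @compact_bounded R (Z : normedModType R) K cK.
have M1 : M < `|M| + 1 by rewrite ltr_pwDr// ler_norm.
have [m mM] : exists m, `|M| + 1 <= m%:R.
  by exists (Num.trunc (`|M| + 1)).+1; rewrite ltW// truncnS_gt.
exists m => z Kz; have := KM _ M1 z Kz; rewrite /cbox /= => /le_trans; move/(_ _ mM).
by apply: le_trans; case: z {Kz} => s x; rewrite /Num.norm /= le_max lexx orbT.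
Qed.

Lemma sigma_cbox m : (sigma (cbox m) < +oo)%E.
Proof. by have [h _] := sigma_radon; apply: h; exact: cbox_compact. Qed.

Lemma first_moment : (\int[rho]_s `|s|%:E < +oo)%E.
Proof.
by have := rho_moments (leqnn 1); under eq_integral do rewrite expr1.
Qed.

(** Markov's inequality with the first moment. *)
Lemma rho_tail (e : R) : 0 < e -> (rho [set s | (e <= `|s|)%R] < +oo)%E.
Proof.
move=> e0; have mA : measurable [set s : R | e <= `|s|].
  have := @normr_measurable R setT measurableT _ (measurable_itv `[e, +oo[%R).
  by rewrite setTI; congr measurable; apply/funext => s; rewrite /= in_itv/= andbT.
have mN : measurable_fun setT (fun s : R => `|s|%:E).
  by apply/measurable_EFinP; exact: normr_measurable.
have h : (e%:E * rho [set s | e <= `|s|]%R <= \int[rho]_s `|s|%:E)%E.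
  rewrite -integral_cst//; apply: (@le_trans _ _ (\int[rho]_(s in [set s | (e <= `|s|)%R]) `|s|%:E)%E).
    by apply: ge0_le_integral => //; [move=> s _; rewrite lee_fin ltW|exact: measurable_funTS].
  by apply: ge0_subset_integral => // s _; rewrite lee_fin.
have fin := le_lt_trans h first_moment; rewrite ltey; apply/eqP => rI.
by move: fin; rewrite rI gt0_muley ?lte_fin// ltxx.
Qed.

Lemma open_state_space : open E.
Proof.
have [rI|rF] := pselect (rho setT = +oo%E); last first.
  rewrite (_ : E = [set: Z]); first exact: openT.
  by apply/funext => z; apply/propext; split=> // _ /rF.
rewrite (_ : E = (fun z : Z => z.1) @^-1` [set s | s != 0]); last first.
  by apply/funext => z; apply/propext; split=> [/(_ rI)|h _].
apply: open_comp => [z _|]; first exact: cvg_fst.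
rewrite (_ : [set s : R | s != 0] = ~` [set 0]); last first.
  by apply/seteqP; split=> s /= => [/eqP|/eqP].
apply: closed_openC; apply: accessible_closed_set1; apply: hausdorff_accessible.
exact: norm_hausdorff.
Qed.

Lemma mu_rect_lty (A : set R) (B : set V) : measurable A -> measurable B ->
  (rho A < +oo)%E -> (sigma B < +oo)%E -> (mu (A `*` B) < +oo)%E.
Proof.
move=> mA mB rA sB; rewrite /sprod product_measure1E//.
by rewrite lte_mul_pinfty// ge0_fin_numE.
Qed.

(** If rho is infinite, a compact subset of the state space stays away from s = 0, so its marks lie
    in a set |s| >= e of finite rho-measure. Otherwise all of the line has finite measure and serves
    as the set [A]. *)
Lemma state_compact_finite (K : set Z) : compact K -> K `<=` E -> (mu K < +oo)%E.
Proof.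
move=> cK KE; have [m Km] := compact_sub_cbox cK.
have mK : measurable K.
  rewrite -(setCK K); apply: measurableC; apply: open_measurableZ.
  apply: closed_openC; apply: compact_closed cK; exact: norm_hausdorff.
have [A [mA rA KA]] : exists A : set R, [/\ measurable A, (rho A < +oo)%E & forall z, K z -> A z.1].
  have [rI|/eqP rF] := pselect (rho setT = +oo%E); last first.
    by exists setT; split=> //; rewrite ltey.
  have cK1 : compact [set z.1 | z in K].
    by apply: continuous_compact cK; apply: continuous_subspaceT => z; exact: cvg_fst.
  have : nbhs (0 : R) (~` [set z.1 | z in K]).
    apply: open_nbhs_nbhs; split.
      by apply: closed_openC; apply: compact_closed cK1; exact: norm_hausdorff.
    by move=> [z Kz z0]; have := KE _ Kz rI; rewrite z0 eqxx.
  move=> /nbhs_ballP[e /= e0 eK]; exists [set s | e <= `|s|]; split.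
  - have := @normr_measurable R setT measurableT _ (measurable_itv `[e, +oo[%R).
    by rewrite setTI; congr measurable; apply/funext => s; rewrite /= in_itv/= andbT.
  - exact: rho_tail.
  - move=> z Kz /=; rewrite leNgt; apply/negP => ze; apply: (eK z.1); last by exists z.
    by rewrite -ball_normE /= sub0r normrN.
apply: (@le_lt_trans _ _ (mu (A `*` cbox m))).
  apply: le_measure; rewrite ?inE//; first by apply: measurableX => //; exact: measurable_cbox.
  by move=> z Kz; split; [exact: KA|exact: Km].
by apply: mu_rect_lty => //; [exact: measurable_cbox|exact: sigma_cbox].
Qed.

Lemma mu_zero_slice : mu ([set (0 : R)] `*` setT) = 0%E.
Proof. transitivity (rho [set 0%R] * sigma setT)%E; last by rewrite rho0 mul0e.
exact: product_measure1E. Qed.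

Lemma state_complement_null : mu (~` E) = 0%E.
Proof.
have mE : measurable (~` E) by apply: measurableC; apply: open_measurableZ; exact: open_state_space.
apply/eqP; rewrite eq_le measure_ge0 andbT -mu_zero_slice.
apply: le_measure; rewrite ?inE//; first exact: measurableX.
move=> [s x] /= h; split=> //=; apply/eqP; apply: contrapT => /eqP s0.
by apply: h; rewrite /state_space /= => _; case: (s == 0) s0.
Qed.

Lemma sigma_singleton (x : V) : sigma [set x] = 0%E.
Proof.
have mx : measurable [set x].
  rewrite -(setCK [set x]); apply: measurableC; apply: open_measurable_rV.
  apply: closed_openC; apply: accessible_closed_set1; apply: hausdorff_accessible.
  exact: norm_hausdorff.
apply/eqP; rewrite eq_le measure_ge0 andbT leNgt; apply/negP => s0.
have [B [mB Bx /andP[B0 Bs]]] := sigma_nonatomic mx s0.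
have [xB|xB] := pselect (B x).
  by move: Bs; rewrite (_ : B = [set x]) ?ltxx//; apply/seteqP; split=> // y ->.
move: B0; rewrite (_ : B = set0) ?measure0 ?ltxx//; apply/seteqP; split=> // y By.
by apply: xB; rewrite -(Bx _ By).
Qed.

Lemma state_test_integrable (phi : Z -> R) : test_on setT phi ->
  (rho setT = +oo%E -> mu.-integrable setT (EFin \o phi)) -> rintegrable mu phi.
Proof.
move=> tphi iphi; have [rI|rF] := pselect (rho setT = +oo%E); first exact: iphi.
apply: (integrable_test (E := E) state_compact_finite).
by apply: test_onS tphi => z _.
Qed.

End StateSpace.

(** * Separability of the space of test functions *)

Lemma seq_separated {R : realType} {V : normedModType R} (s : seq V) (x : V) :
  (forall y, y \in s -> y != x) ->
  exists2 e : R, 0 < e & forall y, y \in s -> e <= `|y - x|.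
Proof.
elim: s => [|a s IH] h; first by exists 1.
have [|e e0 es] := IH; first by move=> y ys; apply: h; rewrite inE ys orbT.
have a0 : 0 < `|a - x| by rewrite normr_gt0 subr_eq0 h// inE eqxx.
exists (Num.min e `|a - x|); first by rewrite lt_min e0.
move=> y; rewrite inE => /orP[/eqP ->|ys]; first by rewrite ge_min lexx orbT.
by rewrite ge_min es.
Qed.

Section SetSumOrder.
Context {R : realType} {I : choiceType}.
Implicit Types (A : set I) (f g : I -> R).

Lemma set_sum_ge0 A f : (forall z, A z -> 0 <= f z) -> 0 <= set_sum A f.
Proof.
move=> f0; rewrite /set_sum [X in _ - fine X]esum1 ?subr0.
  by apply/fine_ge0/esum_ge0 => z _; rewrite lee_fin le_max lexx orbT.
by move=> z Az; rewrite max_r// oppr_le0 f0.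
Qed.

Lemma set_sum_dominated A f g : abs_summable A g -> (forall z, A z -> `|f z| <= g z) ->
  `|set_sum A f| <= set_sum A g.
Proof.
move=> sg fg; have sf : abs_summable A f.
  by apply: (abs_summable_le _ sg) => z Az; rewrite (le_trans (fg z Az))// ler_norm.
have pm (a : R) : a = 1 \/ a = -1 -> 0 <= a * set_sum A f + set_sum A g.
  move=> a1; rewrite -set_sum_lin//; apply: set_sum_ge0 => z Az.
  by have := fg z Az; rewrite ler_norml => /andP[]; case: a1 => ->; lra.
have := pm 1 (or_introl erefl); have := pm (-1) (or_intror erefl).
by rewrite ler_norml; lra.
Qed.

End SetSumOrder.

Section NullPoints.
Context {R : realType} {d : nat} (E : set (R * 'rV[R]_d)%type).
Local Notation Z := (R * 'rV[R]_d)%type.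
Variable mu : {sigma_finite_measure set Z -> \bar R}.
Variable pi : probability (config_space E) R.
Hypothesis oE : open E.
Hypothesis muK : forall K : set Z, compact K -> K `<=` E -> (mu K < +oo)%E.
Hypothesis muE : mu (~` E) = 0%E.
Hypothesis pi_poisson : is_poisson mu pi.
Implicit Types gam : config_space E.

(** The Mecke formula for the indicator of [B]: the expected number of points z with (gam \ z, z) in
    [B] is the measure of [B]. *)
Lemma null_pairs (B : set (config_space E * Z)) : measurable B ->
  (pi \x mu)%E B = 0%E ->
  {ae pi, forall gam : config_space E, forall z, config_set gam z ->
     ~ B (config_rem gam z : config_space E, z)}.
Proof.
move=> mB B0; have mH : measurable_fun setT (fun p : config_space E * Z => (\1_B p : R)%:E).
  by apply/measurable_EFinP; exact: measurable_indic.
have H0 (p : config_space E * Z) : (0 <= (\1_B p : R)%:E)%E by rewrite lee_fin.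
have [mS eS] := mecke_ge0 oE muK muE pi_poisson mH H0.
have S0 (gam : config_space E) : (0 <= \esum_(z in config_set gam) palm (fun p => (\1_B p : R)%:E) gam z)%E.
  by apply: esum_ge0 => z _; exact: H0.
have : (\int[pi]_gam `|\esum_(z in config_set gam) palm (fun p => (\1_B p : R)%:E) gam z| = 0)%E.
  under eq_integral do rewrite gee0_abs//.
  rewrite eS; transitivity ((pi \x mu)%E (B `&` setT)); last by rewrite setIT.
  exact: integral_indic.
move/(ae_eq_integral_abs pi measurableT mS); apply: filterS => gam /(_ I) /= e0 z gz Bz.
have : (1 <= \esum_(z in config_set gam) palm (fun p => (\1_B p : R)%:E) gam z)%E.
  apply: esum_ge; exists [set z]; last by rewrite fsbig_set1 /palm /= indicE mem_set.
  by split=> // y ->.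
by rewrite e0 leNgt lte_fin ltr01.
Qed.

Lemma null_points (N : set Z) : measurable N -> mu N = 0%E ->
  {ae pi, forall gam : config_space E, forall z, config_set gam z -> ~ N z}.
Proof.
move=> mN N0; have := @null_pairs (setT `*` N).
have -> : (pi \x mu)%E (setT `*` N) = 0%E.
  by rewrite product_measure1E//; apply/eqP; rewrite mule_eq0; apply/orP; right; exact/eqP.
move=> /(_ (measurableX measurableT mN) erefl); apply: filterS => gam h z gz Nz.
by apply: (h z gz).
Qed.

End NullPoints.

Section AlmostSure.
Context {R : realType} {d : nat} (E : set (R * 'rV[R]_d)%type).
Local Notation V := 'rV[R]_d.
Local Notation Z := (R * V)%type.
Variables (rho : {sigma_finite_measure set R -> \bar R})
  (sigma : {sigma_finite_measure set V -> \bar R}).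
Local Notation mu := (sprod rho sigma).
Variable pi : probability (config_space E) R.
Hypothesis oE : open E.
Hypothesis muK : forall K : set Z, compact K -> K `<=` E -> (mu K < +oo)%E.
Hypothesis muE : mu (~` E) = 0%E.
Hypothesis pi_poisson : is_poisson mu pi.
Implicit Types gam : config_space E.

Lemma ae_summable : (forall m, (sigma (cbox m) < +oo)%E) ->
  (\int[rho]_s `|s|%:E < +oo)%E ->
  {ae pi, forall gam : config_space E, forall m, abs_summable gam (fun z => z.1 * \1_(cbox m) z.2)}.
Proof.
move=> sm r1; apply: ae_foralln => n.
have i1 : rintegrable rho (fun s : R => s).
  by apply/integrableP; split; [exact/measurable_EFinP|].
have i2 : rintegrable sigma (\1_(cbox n)).
  apply: rintegrable_nonneg => //.
    by apply: measurable_indic; exact: measurable_cbox.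
  by rewrite integral_indic ?setIT//; [exact: sm|exact: measurable_cbox].
have i3 : rintegrable mu (fun z => z.1 * \1_(cbox n) z.2) := rintegrable_prod i1 i2.
by have [] := mecke oE muK muE pi_poisson (integrable_snd pi i3).
Qed.

Definition same_position : set (config_space E * Z) :=
  [set p | exists z, config_set p.1 z /\ z.2 = p.2.2].

Definition slot (q : V) (r : R) (x : V) : R := nbump (row_coordinates d) q r x.

Lemma smooth_slot q r : 0 < r -> smooth (fun z : Z => slot q r z.2).
Proof.
move=> r0; have [s _ _ _ _] := nbump_spec (row_coordinates d) q r0.
apply: (smooth_comp_linear s); first by move=> z; exact: cvg_snd.
by [].
Qed.

(** Equality of positions is expressed by countably many approximate coincidences, each through a
    point of the dense sequence. The index i comes before the scale k: only finitely many points of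
    gam lie in the support of b_i, so coincidence at all scales forces one of them to have exactly
    the position of z. *)
Lemma measurable_same_position : measurable same_position.
Proof.
have [b [bP bB]] := test_base_exists state_coordinates oE.
have [q qd] := coord_dense (row_coordinates d : coordinates V).
pose rad k : R := k.+1%:R^-1; have rad0 k : 0 < rad k by rewrite invr_gt0.
pose D i k n : set (config_space E * Z) := [set p : config_space E * Z | 0 < slot (q n) (rad k) p.2.2] `&`
  [set p : config_space E * Z | 0 < set_sum p.1 (fun z : Z => b i z * slot (q n) (rad k) z.2)].
have tD i k n : test_on E (fun z : Z => b i z * slot (q n) (rad k) z.2).
  exact: test_onMr (bP i).1 (smooth_slot (q n) (rad0 k)).
have slot_gt n k x : (0 < slot (q n) (rad k) x) = (`|x - q n| < rad k).
  by have [_ _ _ h _] := nbump_spec (row_coordinates d) (q n) (rad0 k); exact: h.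
have slot_ge n k x : 0 <= slot (q n) (rad k) x.
  by have [_ /(_ x) /andP[]] := nbump_spec (row_coordinates d) (q n) (rad0 k).
have D0 i k n z : 0 <= b i z * slot (q n) (rad k) z.2.
  by rewrite mulr_ge0//; have [_ /(_ z) /andP[]] := bP i.
have -> : same_position = \bigcup_i \bigcap_k \bigcup_n D i k n.
  apply/seteqP; split=> [[gam z] /= [y [gy yz]]|[gam z] /= [i _ h]].
    have [i [bi _]] := bB y setT (config_sub gy) filterT.
    exists i => // k _; have [n zn] := qd z.2 _ (rad0 k); exists n => //.
    have py : 0 < slot (q n) (rad k) z.2 by rewrite slot_gt.
    split => //=; have [_ cK KE] := tD i k n.
    rewrite (set_sum_points _ cK KE); last by move=> w /notin_tsupp.
    have yK : y \in points gam (tsupp (fun z : Z => b i z * slot (q n) (rad k) z.2)).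
      apply/(mem_points _ _ cK KE); split=> //; apply: subset_closure => /=.
      by rewrite yz mulf_neq0 ?gt_eqF.
    rewrite (big_rem y yK)/= ltr_pwDl//; first by rewrite yz mulr_gt0.
    by rewrite sumr_ge0.
  have [_ cK KE] := (bP i).1; have mp := mem_points gam _ cK KE.
  apply: contrapT => nz.
  have sep (y : V) : y \in [seq w.2 | w <- points gam (tsupp (b i))] -> y != z.2.
    by move=> /mapP[w /mp[gw _] ->]; apply/eqP => wz; apply: nz; exists w.
  have [e e0 es] := seq_separated sep.
  pose k := Num.trunc (2 / e).
  have rk : rad k <= e / 2.
    rewrite -[leRHS]invrK lef_pV2 ?posrE ?invr_gt0 ?divr_gt0//.
    by rewrite invf_div ltW// truncnS_gt.
  have [n _ [/= zn]] := h k I; rewrite ltNge => /negP; apply.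
  rewrite (eq_set_sum (g := fun=> 0)) ?set_sum0// => w gw.
  have [bw|bw] := eqVneq (b i w) 0; first by rewrite bw mul0r.
  have [sw|/(negPf)] := eqVneq (slot (q n) (rad k) w.2) 0; first by rewrite sw mulr0.
  move=> sw; have : 0 < slot (q n) (rad k) w.2 by rewrite lt_neqAle eq_sym sw slot_ge.
  rewrite slot_gt => wn; rewrite slot_gt in zn.
  have /es : w.2 \in [seq w.2 | w <- points gam (tsupp (b i))].
    by apply: map_f; apply/mp; split=> //; apply: subset_closure.
  have := ler_distD (q n) w.2 z.2; rewrite [`|q n - _|]distrC; lra.
apply: bigcupT_measurable => i; apply: bigcapT_measurable => k.
apply: bigcupT_measurable => n; apply: measurableI.
  have ms : measurable_fun setT (fun p : config_space E * Z => slot (q n) (rad k) p.2.2).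
    apply: (@measurableT_comp _ _ _ _ _ _ (fun z : Z => slot (q n) (rad k) z.2)) => //.
    by apply: continuous_measurableZ; exact: smooth_continuous (smooth_slot _ (rad0 k)).
  have := ms measurableT _ (measurable_itv `]0, +oo[%R); rewrite setTI.
  by congr measurable; apply/funext => t; rewrite /= in_itv/= andbT.
have ms : measurable_fun setT (fun p : config_space E * Z =>
    set_sum p.1 (fun z : Z => b i z * slot (q n) (rad k) z.2)).
  exact: (measurableT_comp (measurable_set_sum (tD i k n))).
have := ms measurableT _ (measurable_itv `]0, +oo[%R); rewrite setTI.
by congr measurable; apply/funext => t; rewrite /= in_itv/= andbT.
Qed.

(** For fixed gam the bad positions are those of its points, a countable set, which sigma does not
    charge since it has no point masses. *)
Lemma null_same_position : (forall x, sigma [set x] = 0%E) ->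
  (pi \x mu)%E same_position = 0%E.
Proof.
move=> s0; rewrite /product_measure1 /= integral0_eq// => gam _ /=.
have [b [bP bB]] := test_base_exists state_coordinates oE.
pose C n : set V := [set` [seq z.2 | z <- points gam (tsupp (b n))]].
have mC n : measurable (C n).
  apply: countable_measurable; last exact/finite_set_countable/finite_seq.
  move=> x; rewrite -(setCK [set x]); apply: measurableC; apply: open_measurable_rV.
  apply: closed_openC; apply: accessible_closed_set1; apply: hausdorff_accessible.
  exact: norm_hausdorff.
have C0 n : sigma (C n) = 0%E.
  apply/negligibleP => //; rewrite /C; elim: [seq _ | _ <- _] => [|x s IH].
    by rewrite set_nil; exact: negligible_set0.
  rewrite (_ : [set` x :: s] = [set x] `|` [set` s]); last first.
    apply/seteqP; split=> y /=; first by rewrite inE => /orP[/eqP ->|]; [left|right].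
    by case=> [->|ys]; rewrite inE ?eqxx// ys orbT.
  apply: negligibleU => //.
  exists [set x]; split=> //; last exact: s0.
  rewrite -(setCK [set x]); apply: measurableC; apply: open_measurable_rV.
  apply: closed_openC; apply: accessible_closed_set1; apply: hausdorff_accessible.
  exact: norm_hausdorff.
have -> : xsection same_position gam = setT `*` \bigcup_n C n.
  apply/seteqP; split=> [z /xsectionP[y [gy yz]]|z [_ [n _]]].
    have [i [bi _]] := bB y setT (config_sub gy) filterT.
    split=> //; exists i => //=; rewrite -yz; apply: map_f.
    have [_ cK KE] := (bP i).1; apply/(mem_points _ _ cK KE); split=> //.
    by apply: subset_closure => /=; rewrite gt_eqF.
  move=> /mapP[y yp yz]; apply/xsectionP; exists y; split=> //.
  by have [_ cK KE] := (bP n).1; have [] := (mem_points _ _ cK KE).1 yp.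
have mU : measurable (\bigcup_n C n) by exact: bigcupT_measurable.
have U0 : sigma (\bigcup_n C n) = 0%E.
  apply/negligibleP => //; apply: negligible_bigcup => n.
  by apply/negligibleP; [exact: mC|exact: C0].
rewrite /sprod product_measure1E//.
by apply/eqP; rewrite mule_eq0; apply/orP; right; exact/eqP.
Qed.

Lemma ae_config_hat : rho [set 0] = 0%E -> (forall x, sigma [set x] = 0%E) ->
  {ae pi, forall gam : config_space E, config_hat gam}.
Proof.
move=> r0 s0; have m0 : mu ([set (0 : R)] `*` setT) = 0%E := mu_zero_slice r0 sigma.
have h1 := null_points oE muK muE pi_poisson (measurableX (measurable_set1 (0 : R)) measurableT) m0.
have h2 := null_pairs oE muK muE pi_poisson measurable_same_position (null_same_position s0).
apply: filterS2 h1 h2 => gam h1 h2; split=> [z z' gz gz' zz'|z gz]; last first.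
  by apply/eqP => z0; apply: (h1 z gz); split.
apply: contrapT => nzz; apply: (h2 z gz); exists z'; split=> //; split=> // zz.
exact: nzz.
Qed.

End AlmostSure.

Section SigmaMap.
Context {R : realType} {d : nat} (E : set (R * 'rV[R]_d)%type).
Local Notation V := 'rV[R]_d.
Local Notation Z := (R * V)%type.
Implicit Types (gam : config E) (w : distribution V) (p : testfun V).

Lemma distribution_eq w w' : (forall p, w p = w' p) -> w = w'.
Proof.
case: w w' => [f fl fc] [f' fl' fc'] /= h.
have ff : f = f' by apply/funext.
by case: _ / ff fl' fc' {h} => fl' fc'; congr Distribution; exact: Prop_irrelevance.
Qed.

Lemma is_Sigma_inj gam w w' : is_Sigma gam w -> is_Sigma gam w' -> w = w'.
Proof. by move=> h h'; apply: distribution_eq => p; rewrite (h p).2 (h' p).2. Qed.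

Lemma SigmaE (gam : config_space E) w : is_Sigma gam w -> Sigma gam = w.
Proof.
move=> gw; rewrite /Sigma; case: xgetP => [w' _ gw'|/(_ w) //].
exact: is_Sigma_inj gw' gw.
Qed.

Lemma test_cbox p : exists m M, [/\ 0 <= M, tsupp p `<=` cbox m &
  forall z : Z, `|z.1 * p z.2| <= `|M * (z.1 * \1_(cbox m) z.2)|].
Proof.
have [M M0 pM] := test_on_bounded (testfun_test p); have [_ cK _] := testfun_test p.
have [B [_ KB]] := @compact_bounded R V _ cK.
have M1 : B < `|B| + 1 by rewrite ltr_pwDr// ler_norm.
exists (Num.trunc (`|B| + 1)).+1, M.
have sub : tsupp p `<=` cbox (Num.trunc (`|B| + 1)).+1.
  by move=> x Kx; rewrite /cbox /= (le_trans (KB _ M1 x Kx))// ltW// truncnS_gt.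
split=> // z; rewrite !normrM mulrCA ler_wpM2l// (ger0_norm M0).
have [Kz|/notin_tsupp ->] := pselect (tsupp p z.2); last by rewrite normr0 mulr_ge0.
by rewrite indicE mem_set ?normr1 ?mulr1//; exact: sub.
Qed.

Lemma Sigma_exists gam : (forall m, abs_summable gam (fun z => z.1 * \1_(cbox m) z.2)) ->
  exists w, is_Sigma gam w.
Proof.
move=> gs; have sm p : abs_summable gam (fun z => z.1 * p z.2).
  have [m [M [M0 _ pM]]] := test_cbox p.
  by apply: (abs_summable_le _ (abs_summableZ M (gs m))) => z _; exact: pM.
pose w p := set_sum gam (fun z : Z => z.1 * p z.2).
have wl : distr_linear w.
  move=> a p q r rE; rewrite /w -(set_sum_lin a (sm p) (sm q)).
  by apply: eq_set_sum => z _; rewrite rE; ring.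
have wc : distr_continuous w.
  move=> K cK; have [B [_ KB]] := @compact_bounded R V _ cK.
  have M1 : B < `|B| + 1 by rewrite ltr_pwDr// ler_norm.
  pose m := (Num.trunc (`|B| + 1)).+1.
  have sub : K `<=` cbox m.
    by move=> x Kx; rewrite /cbox /= (le_trans (KB _ M1 x Kx))// ltW// truncnS_gt.
  (* The sum is a distribution of order 0: the single derivative [[::]], that is the sup norm,
     suffices, with the total mass over the box as constant. *)
  exists (set_sum gam (fun z => `|z.1 * \1_(cbox m) z.2|)), [:: [::]] => p M pK pM.
  have pM' x : `|p x| <= M by apply: (pM [::]); rewrite inE.
  have M0 : 0 <= M by apply: le_trans (pM' 0).
  have bd z : `|z.1 * p z.2| <= `|M * (z.1 * \1_(cbox m) z.2)|.
    rewrite !normrM mulrCA ler_wpM2l// (ger0_norm M0).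
    have [Kz|/notin_tsupp ->] := pselect (tsupp p z.2); last by rewrite normr0 mulr_ge0.
    by rewrite indicE mem_set ?normr1 ?mulr1//; apply: sub; exact: pK.
  have sN := abs_summable_norm (gs m).
  rewrite mulrC -set_sumZ//; apply: set_sum_dominated => [|z _]; first exact: abs_summableZ.
  by rewrite (le_trans (bd z))// normrM ger0_norm.
by exists (Distribution wl wc) => p; split; [exact: sm|].
Qed.

Lemma is_Sigma_rem gam w z : config_set gam z -> is_Sigma gam w ->
  is_Sigma (config_rem gam z) (subdirac w z.1 z.2).
Proof.
move=> gz gw p; have [sp wp] := gw p; split.
  by apply: abs_summable_subset sp => y [].
by rewrite set_sum_rem// /= wp.
Qed.

Definition atom gam (x : V) : R := set_sum gam (fun z : Z => z.1 * \1_[set x] z.2).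

(** A finite set carries the mass over a box up to e, and the neighbourhood is small enough to avoid
    its points with position other than x. It also has radius at most 1, which keeps it in the box.
    The mass at x is thus a limit of pairings of w, so it depends on w only. *)
Lemma atom_limit gam w x e : (forall m, abs_summable gam (fun z => z.1 * \1_(cbox m) z.2)) ->
  is_Sigma gam w -> 0 < e -> exists2 N : set V, nbhs x N &
  forall p : testfun V, p x = 1 -> (forall y, 0 <= p y <= 1) -> tsupp p `<=` N ->
    `|w p - atom gam x| <= e.
Proof.
move=> gs gw e0; pose m := (Num.trunc (`|x| + 1)).+1.
have [s [us sg sa]] := set_sum_approx (gs m) e0.
have sep y : y \in [seq z.2 | z <- s & z.2 != x] -> y != x.
  by move=> /mapP[z]; rewrite mem_filter => /andP[zx _] ->.
have [de de0 sde] := seq_separated sep.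
have m0 : 0 < Num.min 1 de by rewrite lt_min ltr01.
exists (ball x (Num.min 1 de)); first exact: nbhsx_ballx.
move=> p px p01 pN.
have out y : p y != 0 -> `|y - x| < Num.min 1 de.
  move=> py; have : ball x (Num.min 1 de) y by apply/pN/subset_closure.
  by rewrite -ball_normE /= distrC.
pose g (z : Z) := z.1 * (p z.2 - \1_[set x] z.2).
have gf z : `|g z| <= `|z.1 * \1_(cbox m) z.2|.
  rewrite !normrM ler_wpM2l//.
  have [zx|zx] := eqVneq z.2 x.
    by rewrite zx px indicE mem_set// subrr normr0.
  rewrite [\1_[set x] _]indicE memNset ?subr0; last by move=> /= /eqP; apply/negP.
  have [->|pz] := eqVneq (p z.2) 0; first by rewrite normr0.
  have /andP[p0 p1] := p01 z.2; rewrite (ger0_norm p0) (le_trans p1)//.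
  rewrite indicE mem_set ?normr1//= /cbox /= -(subrK x z.2) (le_trans (ler_normD _ _))//.
  have := out _ pz; rewrite lt_min => /andP[zx1 _].
  by rewrite (@le_trans _ _ (`|x| + 1))// ?(addrC `|x|) ?lerD2r ltW// addrC truncnS_gt.
have := sa g (fun z _ => gf z); rewrite big_seq big1 ?subr0.
  have [sp wp] := gw p; have sat : abs_summable gam (fun z : Z => z.1 * \1_[set x] z.2).
    apply: (abs_summable_le _ (gs m)) => z _; rewrite !normrM ler_wpM2l//.
    rewrite !indicE; have [zx|zx] := eqVneq z.2 x; last first.
      by rewrite memNset ?normr0//= => /eqP; apply/negP.
    rewrite zx !mem_set// /cbox /= ltW//; apply: lt_trans (truncnS_gt _).
    by rewrite ltrDl.
  have -> : set_sum gam g = w p - atom gam x.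
    rewrite wp /atom addrC -mulN1r -set_sum_lin//; apply: eq_set_sum => z _.
    by rewrite /g; ring.
  by [].
move=> z zs; rewrite /g; have [zx|zx] := eqVneq z.2 x.
  by rewrite zx px indicE mem_set// subrr mulr0.
rewrite [\1_[set x] _]indicE memNset ?subr0; last by move=> /= /eqP; apply/negP.
have [->|pz] := eqVneq (p z.2) 0; first by rewrite mulr0.
have := out _ pz; rewrite lt_min => /andP[_]; rewrite ltNge sde//.
by apply: map_f; rewrite mem_filter zx.
Qed.

Lemma atomE (gam : config_space E) z : config_hat gam -> config_set gam z -> atom gam z.2 = z.1.
Proof.
move=> [hat _] gz; rewrite /atom (set_sum_seq (s := [:: z])) ?big_seq1//.
- by rewrite indicE mem_set// mulr1.
- by move=> y; rewrite inE => /eqP ->.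
move=> y gy; rewrite inE => yz; rewrite indicE memNset ?mulr0//= => zy.
by move/eqP: yz; apply; exact: hat.
Qed.

(** Masses at single positions are determined by w, and distinct positions make the mass at the
    position of a point equal to its mark. Marks are nonzero, so every position of gam carries mass
    and must occur in gam'. *)
Lemma Sigma_config_sub (gam gam' : config_space E) w :
  (forall m, abs_summable gam (fun z => z.1 * \1_(cbox m) z.2)) ->
  (forall m, abs_summable gam' (fun z => z.1 * \1_(cbox m) z.2)) ->
  config_hat gam -> config_hat gam' ->
  is_Sigma gam w -> is_Sigma gam' w -> config_set gam `<=` config_set gam'.
Proof.
move=> gs gs' hg hg' gw gw' z gz.
have at_eq : atom gam z.2 = atom gam' z.2.
  apply: (@eq_norm_le _ _ _ 2) => e e0.
  have [N xN hN] := atom_limit z.2 gs gw e0; have [N' xN' hN'] := atom_limit z.2 gs' gw' e0.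
  have [p [tp p01 px pN]] := test_bump_at (row_coordinates d) (@openT V) I (filterI xN xN').
  pose q := Testfun tp.
  have h1 := hN q px p01 (fun y yp => (pN y yp).1).
  have h2 := hN' q px p01 (fun y yp => (pN y yp).2).
  rewrite (_ : _ - _ = (w q - atom gam' z.2) - (w q - atom gam z.2)); last by ring.
  by rewrite (le_trans (ler_normB _ _))// (_ : 2 * e = e + e) ?lerD//; ring.
have [z' [gz' zz']] : exists z', config_set gam' z' /\ z'.2 = z.2.
  apply: contrapT => nz; have := hg.2 z gz; rewrite -(atomE hg gz) at_eq.
  rewrite /atom (eq_set_sum (g := fun=> 0)) ?set_sum0 ?eqxx// => y gy.
  by rewrite indicE memNset ?mulr0//= => yz; apply: nz; exists y.
have e1 : z'.1 = z.1 by rewrite -(atomE hg' gz') zz' -at_eq (atomE hg gz).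
by have -> : z = z' by case: z z' e1 zz' {gz gz' at_eq} => s x [s' x'] /= -> ->.
Qed.

End SigmaMap.

Section DirectionalDerivatives.
Context {R : realType} {V : normedModType R}.
Implicit Types (f : V -> R) (x v w : V).

(** [smooth] provides directional derivatives only. Additivity in the direction follows from the
    mean value theorem along v and the continuity of D_v f. *)
Lemma derive_add_dir f v w x : smooth f -> 'D_(v + w) f x = 'D_v f x + 'D_w f x.
Proof.
move=> sf; have /choice[th hth] : forall h : R, exists th : R, `|th| <= `|h| /\
    f (h *: v + (h *: w + x)) - f (h *: w + x) = h * 'D_v f (th *: v + (h *: w + x)).
  by move=> h; exact: mvt_along.
have cv := smooth_continuous (smooth_derive v sf).
have id0 : h @[h --> (0 : R)^'] --> (0 : R) by exact: cvg_within.
have th0 : th h @[h --> (0 : R)^'] --> (0 : R).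
  apply/cvgr0Pnorm_le => e e0; move/cvgr0Pnorm_le : id0 => /(_ e e0).
  by apply: filterS => h; apply: le_trans; have [] := hth h.
have lin : th h *: v + (h *: w + x) @[h --> (0 : R)^'] --> x.
  have := cvgD (@cvgZr_tmp R V R _ _ _ _ v th0) (cvgD (@cvgZr_tmp R V R _ _ _ _ w id0) (cvg_cst x)).
  by rewrite !scale0r !add0r => cv'; exact: cv'.
have c1 : 'D_v f (th h *: v + (h *: w + x)) @[h --> (0 : R)^'] --> 'D_v f x.
  exact: (cvg_comp _ _ lin (cv x)).
have c2 : h^-1 *: (f (h *: w + x) - f x) @[h --> (0 : R)^'] --> 'D_w f x.
  exact: smooth_derivable.
apply: cvg_lim => //; apply: cvg_trans (cvgD c1 c2); apply: near_eq_cvg.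
have : \forall h \near (0 : R)^', h != 0 by exact: nbhs_dnbhs_neq.
apply: filterS => h h0.
have [_ e] := hth h.
transitivity (h^-1 * (h * 'D_v f (th h *: v + (h *: w + x)) + (f (h *: w + x) - f x))).
  by rewrite mulrDr mulKf.
by rewrite -e addrA subrK addrA -scalerDr.
Qed.

Lemma derive_scale_dir f (c : R) v x : smooth f -> 'D_(c *: v) f x = c * 'D_v f x.
Proof.
move=> sf; have /choice[th hth] : forall h : R, exists th : R, `|th| <= `|h * c| /\
    f ((h * c) *: v + x) - f x = h * c * 'D_v f (th *: v + x).
  by move=> h; exact: mvt_along.
have cv := smooth_continuous (smooth_derive v sf).
have id0 : h @[h --> (0 : R)^'] --> (0 : R) by exact: cvg_within.
have hc0 : h * c @[h --> (0 : R)^'] --> (0 : R).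
  by rewrite -[X in _ --> X](mul0r c); exact: (cvgM id0 (cvg_cst c)).
have th0 : th h @[h --> (0 : R)^'] --> (0 : R).
  apply/cvgr0Pnorm_le => e e0; move/cvgr0Pnorm_le : hc0 => /(_ e e0).
  by apply: filterS => h; apply: le_trans; have [] := hth h.
have lin : th h *: v + x @[h --> (0 : R)^'] --> x.
  have := cvgD (@cvgZr_tmp R V R _ _ _ _ v th0) (cvg_cst x).
  by rewrite scale0r add0r => cv'; exact: cv'.
have c1 : 'D_v f (th h *: v + x) @[h --> (0 : R)^'] --> 'D_v f x.
  exact: (cvg_comp _ _ lin (cv x)).
apply: cvg_lim => //; apply: cvg_trans (cvgM (cvg_cst c) c1); apply: near_eq_cvg.
have : \forall h \near (0 : R)^', h != 0 by exact: nbhs_dnbhs_neq.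
apply: filterS => h h0.
have [_ e] := hth h; rewrite /= scalerA e /GRing.scale /= -mulrA.
by rewrite mulKf.
Qed.

Lemma derive_sum_smooth (I : Type) (r : seq I) (c : I -> R) (F : I -> V -> R) v :
  (forall i, smooth (F i)) ->
  'D_v (fun x => \sum_(i <- r) c i * F i x) = (fun x => \sum_(i <- r) c i * 'D_v (F i) x).
Proof.
move=> sF; elim: r => [|i r IH].
  rewrite (_ : (fun x => \sum_(i <- [::]) c i * F i x) = cst 0); last first.
    by apply/funext => x; rewrite big_nil.
  by apply/funext => x; rewrite derive_cst big_nil.
rewrite (_ : (fun x => \sum_(j <- i :: r) c j * F j x) =
    (fun x => c i * F i x + \sum_(j <- r) c j * F j x)); last first.
  by apply/funext => x; rewrite big_cons.
rewrite deriveDE; [|exact: smoothZ|by apply: smooth_sum => j; exact: smoothZ].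
apply/funext => x; rewrite big_cons; congr (_ + _); last exact: (congr1 (fun h => h x) IH).
have := deriveME (f := cst (c i)) v (smooth_cst (c i)) (sF i).
by move=> /(congr1 (fun h => h x)) /= ->; rewrite derive_cst mul0r addr0.
Qed.

End DirectionalDerivatives.

Section TestDerivatives.
Context {R : realType} {V : normedModType R}.
Implicit Types (f : V -> R) (E : set V).

Lemma tsupp_derive f v : smooth f -> tsupp ('D_v f) `<=` tsupp f.
Proof.
move=> sf; apply: tsupp_sub => [|x]; first exact: closed_closure.
apply: contraNP => fx; apply/eqP.
have : nbhs x (~` tsupp f).
  by apply: open_nbhs_nbhs; split=> //; apply: closed_openC; exact: closed_closure.
move=> /nbhs_ballP[e /= e0 eN].
have id0 : h @[h --> (0 : R)^'] --> (0 : R) by exact: cvg_within.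
have lin : h *: v + x @[h --> (0 : R)^'] --> x.
  have := cvgD (@cvgZr_tmp R V R _ _ _ _ v id0) (cvg_cst x).
  by rewrite scale0r add0r => cv'; exact: cv'.
apply: cvg_lim => //; apply: cvg_near_cst.
have near_x : \forall h \near (0 : R)^', ball x e (h *: v + x) := lin _ (nbhsx_ballx x _ e0).
apply: filterS near_x => h /eN /notin_tsupp fh.
by rewrite /= fh (notin_tsupp fx) subrr scaler0.
Qed.

Lemma test_on_derive E f v : test_on E f -> test_on E ('D_v f).
Proof.
move=> [sf cK KE]; have sub := tsupp_derive (v := v) sf; split.
- exact: smooth_derive.
- by apply: subclosed_compact sub => //; exact: closed_closure.
- exact: subset_trans sub KE.
Qed.

Lemma test_on_iterD E f vs : test_on E f -> test_on E (iterD vs f).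
Proof. by move=> tf; elim: vs => //= v vs; exact: test_on_derive. Qed.

Lemma tsupp_iterD f vs : smooth f -> tsupp (iterD vs f) `<=` tsupp f.
Proof.
move=> sf; elim: vs => //= v vs IH; apply: subset_trans IH.
exact: tsupp_derive (smooth_iterD vs sf).
Qed.

Lemma test_bounded_derivatives E f : test_on E f -> smooth_bounded_derivatives f.
Proof.
move=> tf; split; first by have [] := tf.
by move=> vs _; have [M _ fM] := test_on_bounded (test_on_iterD vs tf); exists M.
Qed.

End TestDerivatives.

Section BasisDerivatives.
Context {R : realType} {d : nat}.
Local Notation V := 'rV[R]_d.
Implicit Types (f : V -> R) (js : seq 'I_d).

Definition basisD js f : V -> R := iterD (map (delta_mx 0) js) f.

Lemma derive_coord f v x : smooth f ->
  'D_v f x = \sum_i v 0 i * 'D_(delta_mx 0 i) f x.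
Proof.
move=> sf; rewrite [in LHS](row_sum_delta v).
elim: (index_enum _) => [|i r IH].
  rewrite !big_nil; have := derive_scale_dir 0 0 x sf.
  by rewrite scale0r mul0r.
by rewrite !big_cons derive_add_dir// derive_scale_dir// IH.
Qed.

(** Continuity of a distribution is stated with derivatives in arbitrary directions. Reducing them
    to basis directions, with coefficients independent of f, makes finite lists of derivatives range
    over a countable set. *)
Lemma iterD_basis vs : exists L : seq (R * seq 'I_d), forall f, smooth f ->
  iterD vs f = fun x => \sum_(l <- L) l.1 * basisD l.2 f x.
Proof.
elim: vs => [|v vs [L IH]].
  exists [:: (1, [::])] => f sf; apply/funext => x.
  by rewrite big_seq1 mul1r.
exists [seq (v 0 i * l.1, i :: l.2) | i <- index_enum 'I_d, l <- L] => f sf.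
apply/funext => x; rewrite big_allpairs_dep /= derive_coord; last exact: smooth_iterD.
apply: eq_bigr => i _; have sL (l : R * seq 'I_d) : smooth (basisD l.2 f) by exact: smooth_iterD.
have -> : 'D_(delta_mx 0 i) (iterD vs f) x = \sum_(l <- L) l.1 * 'D_(delta_mx 0 i) (basisD l.2 f) x.
  rewrite IH//.
  exact: (congr1 (fun h => h x) (derive_sum_smooth L (fun l => l.1) (delta_mx 0 i) sL)).
by rewrite mulr_sumr; apply: eq_bigr => l _; rewrite mulrA.
Qed.

Lemma basisDB js f g : smooth f -> smooth g ->
  basisD js (fun x => f x - g x) = fun x => basisD js f x - basisD js g x.
Proof.
move=> sf sg; elim: js => [//|i js IH]; rewrite /basisD /= -!/(basisD _ _) IH.
apply/funext => x; apply: (@deriveB R V R (basisD js f) (basisD js g) x (delta_mx 0 i)).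
  exact: smooth_derivable (smooth_iterD _ sf).
exact: smooth_derivable (smooth_iterD _ sg).
Qed.

End BasisDerivatives.

Section Separability.
Context {R : realType} {d : nat}.
Local Notation V := 'rV[R]_d.
Implicit Types (p q : testfun V) (S : seq (seq 'I_d)) (js : seq 'I_d).

Lemma test_lipschitz p js : exists2 M, 0 <= M &
  forall x y, `|basisD js p x - basisD js p y| <= M * `|x - y|.
Proof.
have tp := test_on_iterD (map (delta_mx 0) js) (testfun_test p).
have [M M0 pM] := lipschitz_rV (test_bounded_derivatives tp).
exists (M * d%:R) => [|x y]; first by rewrite mulr_ge0.
have := pM y (x - y); rewrite addrCA subrr addr0 => /le_trans; apply.
rewrite -mulrA ler_wpM2l//.
have h := (@coord_norm _ _ (row_coordinates d) (x - y) _ (normr_ge0 (x - y))).1 (lexx _).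
apply: (@le_trans _ _ (\sum_(i < d) `|x - y|)); first by apply: ler_sum => i _; exact: h.
by rewrite sumr_const card_ord mulr_natl.
Qed.

(* The data c range over a countable set, and two test functions with the same
   data are close to each other, see sketch_close. *)
Definition sketch (u : nat -> V) (c : nat * seq (seq 'I_d) * (nat * nat) * (nat * seq (seq rat))) p :=
  let: (m, jss, (e, N), (J, a)) := c in
  [/\ tsupp p `<=` cbox m,
      forall js, js \in jss -> forall x y, `|x - y| < N.+1%:R^-1 ->
        `|basisD js p x - basisD js p y| <= e.+1%:R^-1 &
      forall k j, (k < size jss)%N -> (j < J)%N ->
        `|basisD (nth [::] jss k) p (u j) - ratr (nth 0 (nth [::] a k) j)| <= e.+1%:R^-1].

Lemma basisD_out p js m x : tsupp p `<=` cbox m -> ~ cbox m x -> basisD js p x = 0.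
Proof.
move=> pm mx; have [sp _ _] := testfun_test p.
by apply: notin_tsupp => /(tsupp_iterD sp)/pm.
Qed.

(** Moving from x to a net point and from its value to the rational costs one error 1/(e+1) each,
    for p and for q, hence the factor 4. *)
Lemma sketch_close u m S e N J a p q :
  (forall x, cbox m x -> exists2 j, (j < J)%N & `|x - u j| < N.+1%:R^-1) ->
  sketch u (m, S, (e, N), (J, a)) p -> sketch u (m, S, (e, N), (J, a)) q ->
  forall js, js \in S -> forall x, `|basisD js p x - basisD js q x| <= 4 * e.+1%:R^-1.
Proof.
move=> net [pm pN pa] [qm qN qa] js jS x.
have [mx|mx] := pselect (cbox m x); last first.
  by rewrite (basisD_out js pm mx) (basisD_out js qm mx) subrr normr0 mulr_ge0.
have [j jJ xj] := net x mx.
have kS : (index js S < size S)%N by rewrite index_mem.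
have := pN js jS x (u j) xj; have := qN js jS x (u j) xj.
have := pa _ j kS jJ; have := qa _ j kS jJ; rewrite nth_index//.
rewrite !ler_norml; move: (e.+1%:R^-1 : R) => r.
by move=> /andP[? ?] /andP[? ?] /andP[? ?] /andP[? ?]; apply/andP; split; lra.
Qed.

Lemma sketch_exists u m S e p : (forall v (r : R), 0 < r -> exists n, `|v - u n| < r) ->
  tsupp p `<=` cbox m -> exists N J a,
  (forall x, cbox m x -> exists2 j, (j < J)%N & `|x - u j| < N.+1%:R^-1) /\
  sketch u (m, S, (e, N), (J, a)) p.
Proof.
move=> ud pm.
have [M M0 SM] : exists2 M, 0 <= M & forall js, js \in S -> forall x y,
    `|basisD js p x - basisD js p y| <= M * `|x - y|.
  elim: S => [|js S [M M0 IH]]; first by exists 0.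
  have [M' M'0 h] := test_lipschitz p js; exists (M + M') => [|js' + x y]; first exact: addr_ge0.
  rewrite mulrDl inE => /orP[/eqP ->|jS].
    by rewrite ler_wpDl ?mulr_ge0// h.
  by rewrite ler_wpDr ?mulr_ge0// IH.
(* A mesh 1/(N+1) small enough for the Lipschitz constant M to give oscillation at most 1/(e+1). *)
pose N := Num.trunc (M * e.+1%:R).
have MN : M * N.+1%:R^-1 <= e.+1%:R^-1.
  rewrite ler_pdivrMr// mulrC ler_pdivlMr// ltW// truncnS_gt//.
have N0 : 0 < N.+1%:R^-1 :> R by rewrite invr_gt0.
have [j|s su] := @compact_cover_seq V nat (cbox m) (fun j => [set x | `|x - u j| < N.+1%:R^-1])
  (@cbox_compact R d m) (fun j => _) (fun x _ => ud x _ N0).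
  rewrite (_ : [set x | _] = ball (u j) N.+1%:R^-1); first exact: ball_open.
  by apply/funext => x; rewrite /= -ball_normE /= distrC.
exists N, (\max_(j <- s) j).+1.
have /choice[v hv] : forall kj : nat * nat, exists a : rat,
    `|basisD (nth [::] S kj.1) p (u kj.2) - ratr a| <= e.+1%:R^-1.
  move=> [k j] /=; have e0 : 0 < e.+1%:R^-1 :> R by rewrite invr_gt0.
  move: (e.+1%:R^-1 : R) (basisD _ _ _) e0 => r y r0.
  have [a] := @rat_in_itvoo R (y - r) (y + r) ltac:(lra).
  by rewrite in_itv/= => a1; exists a; rewrite ler_norml; lra.
exists [seq [seq v (k, j) | j <- iota 0 (\max_(j <- s) j).+1] | k <- iota 0 (size S)]; split.
  move=> x /su[j js xj]; exists j => //.
  by rewrite ltnS; apply: (@leq_bigmax_seq _ _ _ (fun j => j)).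
split=> // [js jS x y xy|k j kS jJ].
  by rewrite (le_trans (SM js jS x y))// (le_trans _ MN)// ler_wpM2l// ltW.
rewrite (nth_map 0%N) ?size_iota// (nth_map 0%N) ?size_iota//.
by rewrite !nth_iota// !add0n; exact: (hv (k, j)).
Qed.

Lemma zero_test : test_on [set: V] (cst 0 : V -> R). Proof. exact: test_on0. Qed.

(** One representative is picked for each sketch that some test function has; there are countably
    many sketches. The approximants keep their support in the same box, without which continuity of
    a distribution could not be applied. *)
Lemma dense_tests_exist : exists P : nat -> testfun V, forall m S p (e : R), 0 < e ->
  tsupp p `<=` cbox m -> exists n, tsupp (P n) `<=` cbox m /\
    forall js, js \in S -> forall x, `|basisD js p x - basisD js (P n) x| <= e.
Proof.
have [u ud] := coord_dense (row_coordinates d : coordinates V).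
have /choice[rep repP] : forall c, exists q : testfun V, (exists p, sketch u c p) -> sketch u c q.
  move=> c; have [[p pc]|nc] := pselect (exists p, sketch u c p); first by exists p.
  by exists (Testfun zero_test).
exists (fun n => if unpickle n is Some c then rep c else Testfun zero_test).
move=> m S p e e0 pm; pose k := Num.trunc (4 / e).
have ke : 4 * k.+1%:R^-1 <= e.
  by rewrite ler_pdivrMr// mulrC -ler_pdivrMr// ltW// truncnS_gt.
have [N [J [a [net pc]]]] := sketch_exists S k ud pm.
exists (pickle (m, S, (k, N), (J, a))); rewrite pickleK.
have qc := repP (m, S, (k, N), (J, a)) (ex_intro _ p pc); split; first by have [] := qc.
by move=> js jS x; apply: le_trans ke; exact: (sketch_close net pc qc).
Qed.

(** On test functions supported in one box a distribution is controlled by finitely many seminorms,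
    so its values on the dense sequence determine it. The seminorms of both distributions are
    approximated together. *)
Lemma distribution_separating : exists P : nat -> testfun V,
  forall w w' : distribution V, (forall n, w (P n) = w' (P n)) -> w = w'.
Proof.
have [P hP] := dense_tests_exist; exists P => w w' ww; apply: distribution_eq => p.
have [m [_ [_ pm _]]] := test_cbox p.
have [C [S wS]] := distribution_continuous w (@cbox_compact R d m).
have [C' [S' wS']] := distribution_continuous w' (@cbox_compact R d m).
have /choice[L hL] := @iterD_basis R d.
pose A : R := \sum_(vs <- S ++ S') \sum_(l <- L vs) `|l.1|.
have A0 : 0 <= A by apply: sumr_ge0 => vs _; apply: sumr_ge0.
apply: (@eq_norm_le _ _ _ ((`|C| + `|C'|) * A)) => e e0.
have [n [nm near]] := hP m (flatten [seq map snd (L vs) | vs <- S ++ S']) p e e0 pm.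
have [sp _ _] := testfun_test p; have [sn _ _] := testfun_test (P n).
pose q := Testfun (test_onB (testfun_test p) (testfun_test (P n))).
have qm : tsupp q `<=` cbox m.
  apply: tsupp_sub => [|x]; first by apply: compact_closed; [exact: norm_hausdorff|exact: cbox_compact].
  apply: contraNP => mx; have px : p x = 0 by apply: notin_tsupp => /pm.
  by have nx : P n x = 0 by [apply: notin_tsupp => /nm]; rewrite /= px nx subrr.
have qA vs : vs \in S ++ S' -> forall x, `|iterD vs q x| <= A * e.
  move=> vsS x; rewrite hL; last by have [] := testfun_test q.
  apply: le_trans (ler_norm_sum _ _ _) _.
  apply: (@le_trans _ _ (\sum_(l <- L vs) `|l.1| * e)).
    rewrite big_seq [leRHS]big_seq; apply: ler_sum => l lL.
    rewrite normrM ler_wpM2l// basisDB//; apply: near.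
    by apply/flatten_mapP; exists vs => //; apply/mapP; exists l.
  rewrite -mulr_suml; apply: ler_wpM2r; first exact: ltW.
  rewrite /A (big_rem vs)//= lerDl.
  by apply: sumr_ge0 => vs' _; apply: sumr_ge0.
have lin (o : distribution V) : o q = o p - o (P n).
  have := distribution_linear o (a := -1) (p := P n) (q := p) (r := q).
  by rewrite mulN1r addrC; apply=> x /=; rewrite mulN1r addrC.
rewrite (_ : w p - w' p = w q - w' q); last by rewrite !lin ww; ring.
apply: le_trans (ler_normB _ _) _; rewrite -mulrA mulrDl; apply: lerD.
  apply: (@le_trans _ _ (C * (A * e))); last by rewrite ler_wpM2r ?mulr_ge0 ?ler_norm// ltW.
  by apply: wS => // vs vsS; apply: qA; rewrite mem_cat vsS.
apply: (@le_trans _ _ (C' * (A * e))); last by rewrite ler_wpM2r ?mulr_ge0 ?ler_norm// ltW.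
by apply: wS' => // vs vsS; apply: qA; rewrite mem_cat vsS orbT.
Qed.

End Separability.

(** * Vague limits of configurations along an ultrafilter *)

Lemma seq_pairwise_separated {R : realType} {V : normedModType R} (s : seq V) :
  exists2 e : R, 0 < e & forall y z, y \in s -> z \in s -> y != z -> e <= `|y - z|.
Proof.
elim: s => [|a s [e e0 es]]; first by exists 1.
have sep y : y \in [seq z <- s | z != a] -> y != a by rewrite mem_filter => /andP[].
have [de de0 sde] := seq_separated sep.
exists (Num.min e de); first by rewrite lt_min e0.
have da y : y \in s -> y != a -> de <= `|y - a| by move=> ys ya; apply: sde; rewrite mem_filter ya.
move=> y z; rewrite !inE => /orP[/eqP ->|ys] /orP[/eqP ->|zs]; rewrite ?eqxx// => yz.
- by rewrite distrC ge_min da ?orbT// eq_sym.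
- by rewrite ge_min da ?orbT.
- by rewrite ge_min es.
Qed.

Section UltraLimits.
Variable U : set_system nat.
Context {UU : UltraFilter U}.

Lemma ultra_or (A B : set nat) : U (A `|` B) -> U A \/ U B.
Proof.
move=> UAB; have [|UA] := in_ultra_setVsetC A UU; first by left.
right; have : U ((A `|` B) `&` ~` A) by exact: filterI.
by apply: filterS => k [[]].
Qed.

Lemma ultra_bounded_ex n (A : nat -> set nat) :
  U [set k | exists2 i, (i < n)%N & A i k] -> exists2 i, (i < n)%N & U (A i).
Proof.
elim: n => [|n IH] UA.
  by exfalso; apply: (@filter_not_empty _ U); apply: filterS UA => k [].
have : U ([set k | exists2 i, (i < n)%N & A i k] `|` A n).
  apply: filterS UA => k [i +]; rewrite ltnS leq_eqVlt => /orP[/eqP -> Ank|lt_in Aik].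
    by right.
  by left; exists i.
move=> /ultra_or[/IH[i lt_in UAi]|UAn]; first by exists i => //; exact: ltnW.
by exists n.
Qed.

Lemma ultra_all (T : eqType) (s : seq T) (A : T -> set nat) :
  (forall x, x \in s -> U (A x)) -> U [set k | forall x, x \in s -> A x k].
Proof.
elim: s => [|x s IH] h; first exact: filterE.
have h1 : U (A x) by apply: h; rewrite inE eqxx.
have h2 : U [set k | forall y, y \in s -> A y k].
  by apply: IH => y ys; apply: h; rewrite inE ys orbT.
apply: filterS2 h1 h2 => k Axk h2 y; rewrite inE => /orP[/eqP ->//|]; exact: h2.
Qed.

Context {R : realType} {d : nat} (E : set (R * 'rV[R]_d)%type).
Local Notation Z := (R * 'rV[R]_d)%type.
Hypothesis oE : open E.
Implicit Types (gam : config E) (g : nat -> config E).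

Variable b : nat -> Z -> R.
Hypothesis bP : forall n, test_on E (b n) /\ forall v, 0 <= b n v <= 1.
Hypothesis bB : forall x N, E x -> nbhs x N -> exists n, 0 < b n x /\ tsupp (b n) `<=` N.

Definition base_set i : set Z := [set z | 0 < b i z].

Lemma base_ge0 i z : 0 <= b i z. Proof. by have [_ /(_ z)/andP[]] := bP i. Qed.

Lemma base_subE i : base_set i `<=` E.
Proof.
move=> z bz; have [[_ _ h] _] := bP i; apply: h; apply: subset_closure => /=.
by rewrite gt_eqF.
Qed.

Lemma base_open i : open (base_set i).
Proof.
rewrite (_ : base_set i = b i @^-1` [set x | 0 < x]); last by apply/seteqP; split.
apply: open_comp; last exact: open_gt.
by move=> z _; exact: test_on_continuous (bP i).1 z.
Qed.

Lemma base_set_nbhs i z : base_set i z -> nbhs z (base_set i).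
Proof. by move=> iz; apply: open_nbhs_nbhs; split=> //; exact: base_open. Qed.

Lemma base_nbhs x N : E x -> nbhs x N -> exists i, base_set i x /\ base_set i `<=` N.
Proof.
move=> Ex xN; have [i [bi biN]] := bB Ex xN; exists i; split=> // z bz.
by apply/biN/subset_closure => /=; rewrite gt_eqF.
Qed.

Lemma base_hit gam i : (exists z, config_set gam z /\ base_set i z) <-> 0 < set_sum gam (b i).
Proof.
have [_ cK KE] := (bP i).1; have mp := mem_points gam _ cK KE; split.
  move=> [z [gz bz]]; rewrite (set_sum_points _ cK KE); last by move=> y /notin_tsupp.
  have zK : z \in points gam (tsupp (b i)).
    by apply/mp; split=> //; apply: subset_closure => /=; rewrite gt_eqF.
  rewrite (big_rem z zK)/= ltr_pwDl// sumr_ge0// => y _; exact: base_ge0.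
rewrite ltNge => /negP h; apply: contrapT => nz; apply: h.
rewrite (eq_set_sum (g := fun=> 0)) ?set_sum0// => z gz.
apply/eqP; rewrite eq_le base_ge0 andbT leNgt; apply/negP => bz.
by apply: nz; exists z.
Qed.

(* There is at most one point in the i-th base set, expressed through the
   pairings so as to be stable under vague limits. *)
Definition lonely i : set (config E) := [set gam | forall j k,
  base_set j `<=` base_set i -> base_set k `<=` base_set i ->
  base_set j `&` base_set k = set0 -> set_sum gam (b j) <= 0 \/ set_sum gam (b k) <= 0].

Lemma disjoint_base x y N : x <> y -> E x -> E y -> nbhs x N -> nbhs y N ->
  exists j k, [/\ base_set j x, base_set k y, base_set j `<=` N, base_set k `<=` N &
    base_set j `&` base_set k = set0].
Proof.
move=> xy Ex Ey xN yN; have e0 : 0 < `|x - y| / 2 by rewrite divr_gt0// normr_gt0 subr_eq0; exact/eqP.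
have [j [jx jN]] := base_nbhs Ex (filterI xN (nbhsx_ballx x _ e0)).
have [k [ky kN]] := base_nbhs Ey (filterI yN (nbhsx_ballx y _ e0)).
exists j, k; split=> // [z /jN[]|z /kN[]|]//.
apply/seteqP; split=> // z [/jN[_ zx] /kN[_ zy]].
move: zx zy; rewrite -ball_normE /= => zx zy.
have := ler_distD z x y; rewrite [`|z - y|]distrC leNgt [ltRHS](splitr `|x - y|).
by rewrite ltrD.
Qed.

Lemma lonelyP gam i : lonely i gam <->
  forall y z, config_set gam y -> config_set gam z -> base_set i y -> base_set i z -> y = z.
Proof.
split=> [lg y z gy gz iy iz|h j k ji ki jk].
  apply: contrapT => yz.
  have [j [k [jy kz ji ki jk]]] := disjoint_base yz (base_subE iy) (base_subE iz)
    (base_set_nbhs iy) (base_set_nbhs iz).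
  have [] := lg j k ji ki jk; rewrite leNgt => /negP; apply; apply/base_hit.
    by exists y.
  by exists z.
apply: contrapT => /not_orP[/negP + /negP]; rewrite -!ltNge => /base_hit[y [gy jy]] /base_hit[z [gz kz]].
have yz := h y z gy gz (ji _ jy) (ki _ kz).
suff : (base_set j `&` base_set k) y by rewrite jk.
by split=> //; rewrite yz.
Qed.

Definition vague_limit g gam : Prop := forall psi, test_on E psi ->
  set_sum (g n) psi @[n --> U] --> set_sum gam psi.

(** The points every base neighbourhood of which is hit by most of the configurations, in the sense
    of the ultrafilter. *)
Definition limit_set g : set Z :=
  [set z | E z /\ forall i, base_set i z -> U [set n | 0 < set_sum (g n) (b i)]].

Section Limit.
Variable g : nat -> config E.
(** This prevents two points of [g n] from merging: their limit would have a point of multiplicity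
    two, which a set cannot represent. *)
Hypothesis g_lonely : forall x, E x -> exists i, base_set i x /\ U [set n | lonely i (g n)].

Lemma limit_set_lonely i y z : U [set n | lonely i (g n)] -> limit_set g y -> limit_set g z ->
  base_set i y -> base_set i z -> y = z.
Proof.
move=> Ui [Ey hy] [Ez hz] iy iz; apply: contrapT => yz.
have [j [k [jy kz ji ki jk]]] := disjoint_base yz Ey Ez
  (base_set_nbhs iy) (base_set_nbhs iz).
have h : U ([set n | lonely i (g n)] `&` ([set n | 0 < set_sum (g n) (b j)] `&`
    [set n | 0 < set_sum (g n) (b k)])).
  by apply: filterI => //; apply: filterI; [exact: hy|exact: hz].
apply: (@filter_not_empty _ U); apply: filterS h => n [ln [/= gj gk]].
by have [] := ln j k ji ki jk; rewrite leNgt ?gj ?gk.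
Qed.

Lemma limit_set_finite K : K `<=` E -> compact K -> finite_set (limit_set g `&` K).
Proof.
move=> KE cK; pose good i := U [set n | lonely i (g n)].
pose O i : set Z := if `[< good i >] then base_set i else set0.
have [i|x Kx|s sK] := @compact_cover_seq (Z : normedModType R) nat K O cK.
- by rewrite /O; case: asboolP => _; [exact: base_open|exact: open0].
- by have [i [ix gi]] := g_lonely (KE _ Kx); exists i; rewrite /O asboolT.
apply: (@sub_finite_set _ _ (\bigcup_(i in [set` s]) (limit_set g `&` O i))).
  by move=> z [gz Kz]; have [i si Oi] := sK z Kz; exists i.
apply: bigcup_finite; first exact: finite_seq.
move=> i _; rewrite /O; case: asboolP => gi; last by rewrite setI0; exact: finite_set0.
have [[z [gz iz]]|nz] := pselect (exists z, (limit_set g `&` base_set i) z).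
  apply: (@sub_finite_set _ _ [set z]); last exact: finite_set1.
  by move=> y [gy iy] /=; exact: (limit_set_lonely gi).
apply: (@sub_finite_set _ _ set0); last exact: finite_set0.
by move=> z hz; apply: nz; exists z.
Qed.

Lemma limit_set_sub : limit_set g `<=` E. Proof. by move=> z []. Qed.

Definition limit_config : config E := Config limit_set_sub limit_set_finite.

(** For most n each limit point z in the support of psi has exactly one point of [g n] in a small
    neighbourhood, and the support contains no other points of [g n]. The two sums then have
    matching terms; neighbourhoods of radius e/2, with e the minimal distance, keep the matching
    injective. *)
Lemma vague_limit_config : vague_limit g limit_config.
Proof.
move=> psi tpsi; have [_ cK KE] := tpsi; set K := tsupp psi in cK KE.
pose zs := points limit_config K; have uz : uniq zs := points_uniq _ _.
have mz := mem_points limit_config _ cK KE.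
have [e e0 sep] := seq_pairwise_separated zs.
have e20 : 0 < e / 2 by rewrite divr_gt0.
apply/cvgrPdist_le => /= eps eps0.
pose de := eps / (size zs).+1%:R; have de0 : 0 < de by rewrite divr_gt0.
have /choice[i hi] : forall z, exists i, z \in zs ->
    [/\ base_set i z, base_set i `<=` ball z (e / 2),
        forall y, base_set i y -> `|psi z - psi y| <= de & U [set n | lonely i (g n)]].
  move=> z; have [zz|] := boolP (z \in zs); last by exists 0%N.
  have [[Ez hz] Kz] := (mz z).1 zz.
  have [j [jz Uj]] := g_lonely Ez.
  have cpsi : nbhs z [set y | `|psi z - psi y| <= de].
    have /cvgrPdist_le/(_ _ de0) := @test_on_continuous _ _ E psi tpsi z; exact.
  have [k [kz kN]] := base_nbhs Ez (filterI (nbhsx_ballx z _ e20)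
    (filterI cpsi (base_set_nbhs jz))).
  exists k => _; split=> // [y /kN[]//|y /kN[_ []]//|].
  apply: filterS Uj => n /lonelyP lj; apply/lonelyP => x y gx gy kx ky.
  by apply: lj => //; [have [_ [_ ?]] := kN _ kx|have [_ [_ ?]] := kN _ ky].
pose hit n := forall z, z \in zs -> exists2 y, config_set (g n) y & base_set (i z) y.
have Uhit : U hit.
  apply: ultra_all => z zz; have [iz _ _ _] := hi z zz; have [[Ez hz] _] := (mz z).1 zz.
  apply: filterS (hz _ iz) => n /base_hit[y [gy iy]]; by exists y.
have Ulon : U [set n | forall z, z \in zs -> lonely (i z) (g n)].
  by apply: ultra_all => z zz; have [] := hi z zz.
(* The support is covered by base sets that most [g n] miss and by the chosen neighbourhoods of
   limit points. A finite subcover lets finitely many such conditions hold simultaneously. *)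
have Uout : U [set n | forall x, config_set (g n) x -> K x -> exists2 z, z \in zs & base_set (i z) x].
  pose void j := U [set n | ~ 0 < set_sum (g n) (b j)].
  pose O j : set Z := if `[< void j \/ exists2 z, z \in zs & j = i z >] then base_set j else set0.
  have [j|x Kx|s sK] := @compact_cover_seq (Z : normedModType R) nat K O cK.
  - by rewrite /O; case: asboolP => _; [exact: base_open|exact: open0].
  - have Ex := KE _ Kx; have [gx|ngx] := pselect (limit_set g x).
      have xz : x \in zs by apply/mz.
      exists (i x); rewrite /O asboolT; first by have [] := hi x xz.
      by right; exists x.
    have [j [jx nUj]] : exists j, base_set j x /\ ~ U [set n | 0 < set_sum (g n) (b j)].
      apply: contrapT => h; apply: ngx; split=> // j jx; apply: contrapT => nU.
      by apply: h; exists j.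
    exists j; rewrite /O asboolT //; left.
    by have [/nUj|] := in_ultra_setVsetC [set n | 0 < set_sum (g n) (b j)] UU.
  have Us : U [set n | forall j, j \in s -> void j -> ~ 0 < set_sum (g n) (b j)].
    apply: ultra_all => j _; have [vj|nvj] := pselect (void j).
      by apply: filterS vj => n h _.
    by apply: filterE => n /nvj.
  apply: filterS Us => n hn x gx Kx; have [j js] := sK x Kx.
  rewrite /O; case: asboolP => // -[vj|[z zz ->]] jx; last by exists z.
  by exfalso; apply: (hn j js vj); apply/base_hit; exists x.
apply: filterS (filterI Uhit (filterI Ulon Uout)) => n [hn [ln on]].
have /choice[y hy] : forall z, exists y, z \in zs -> config_set (g n) y /\ base_set (i z) y.
  move=> z; have [zz|_] := boolP (z \in zs); last by exists z.
  by have [y gy iy] := hn z zz; exists y.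
have yb z : z \in zs -> ball z (e / 2) (y z).
  by move=> zz; have [_ h _ _] := hi z zz; apply: h; have [] := hy z zz.
have -> : set_sum limit_config psi = \sum_(z <- zs) psi z.
  by apply: (set_sum_points _ cK KE) => z /notin_tsupp.
have -> : set_sum (g n) psi = \sum_(z <- zs) psi (y z).
  rewrite (set_sum_seq (s := map y zs)) ?big_map//.
  - rewrite map_inj_in_uniq// => z z' zz zz' yy; apply/eqP; apply: contrapT => /negP zz'n.
    have := yb z zz; have := yb z' zz'; rewrite -yy -!ball_normE /= => h1 h2.
    have := ler_distD (y z) z z'; rewrite [`|y z - z'|]distrC leNgt.
    by rewrite (lt_le_trans (ltrD h2 h1))// -splitr sep.
  - by move=> x /mapP[z zz ->]; have [] := hy z zz.
  - move=> x gx xy; apply: notin_tsupp => Kx; have [z zz iz] := on x gx Kx.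
    move/negP: xy; apply; apply/mapP; exists z => //.
    have [gy iy] := hy z zz; exact: (lonelyP _ _).1 (ln z zz) _ _ gx gy iz iy.
rewrite -sumrB (le_trans (ler_norm_sum _ _ _))//.
apply: (@le_trans _ _ (\sum_(z <- zs) de)).
  rewrite big_seq [leRHS]big_seq; apply: ler_sum => z zz.
  by have [_ _ h _] := hi z zz; apply: h; have [] := hy z zz.
rewrite big_const_seq count_predT iter_addr_0 -[leLHS]mulr_natr /de -mulrA ger_pMr//.
by rewrite mulrC ler_pdivrMr// mul1r ler_nat.
Qed.

End Limit.

(** Closedness relative to the fixed ultrafilter only. It passes to arbitrary intersections and,
    because U decides every set, to finite unions. *)
Definition vague_closed (C : set (config E)) : Prop := forall g gam,
  U [set n | C (g n)] -> vague_limit g gam -> C gam.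

Lemma vague_closedI (I : Type) (C : I -> set (config E)) : (forall i, vague_closed (C i)) ->
  vague_closed (\bigcap_i C i).
Proof.
move=> cC g gam Ug lg i _; apply: cC lg; apply: filterS Ug => n; exact.
Qed.

Lemma vague_closedU (C C' : set (config E)) : vague_closed C -> vague_closed C' ->
  vague_closed (C `|` C').
Proof.
move=> cC cC' g gam Ug lg; have [Ug'|Ug'] := @ultra_or [set n | C (g n)] [set n | C' (g n)] Ug.
  by left; exact: cC lg.
by right; exact: cC' lg.
Qed.

Lemma vague_closed0 : vague_closed set0.
Proof. by move=> g gam Ug _; apply: (@filter_not_empty _ U); apply: filterS Ug. Qed.

Lemma vague_closed_le psi a : test_on E psi -> vague_closed [set gam | set_sum gam psi <= a].
Proof. by move=> tpsi g gam Ug lg; exact: cvgr_to_le (lg psi tpsi) Ug. Qed.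

Lemma vague_closed_ge psi a : test_on E psi -> vague_closed [set gam | a <= set_sum gam psi].
Proof. by move=> tpsi g gam Ug lg; exact: cvgr_to_ge (lg psi tpsi) Ug. Qed.

End UltraLimits.

(** * Inner regularity of a probability with respect to an abstract class of closed sets *)

Section InnerRegularity.
Context {R : realType} {disp : measure_display} {T : measurableType disp}.
Variable P : probability T R.
Variable closedC : set (set T).
Hypothesis closed0 : closedC set0.
Hypothesis closedT : closedC setT.
Hypothesis closedU : forall A B, closedC A -> closedC B -> closedC (A `|` B).
Hypothesis closedI : forall A_ : nat -> set T, (forall n, closedC (A_ n)) -> closedC (\bigcap_n A_ n).

Definition inner_approx (B : set T) : Prop := forall e : R, 0 < e ->
  exists C, [/\ measurable C, closedC C, C `<=` B & (P (B `\` C) <= e%:E)%E].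

Lemma measure_bigcup_eps (D : nat -> set T) (e : R) : 0 < e -> (forall n, measurable (D n)) ->
  (forall n, (P (D n) <= (e / (2 ^ n.+1)%:R)%:E)%E) -> (P (\bigcup_n D n) <= e%:E)%E.
Proof.
move=> e0 mD De.
apply: (le_trans (measure_sigma_subadditive P mD (bigcupT_measurable _ mD) (@subset_refl _ _))).
apply: le_trans (@epsilon_trick0 R e predT (ltW e0)).
apply: lee_nneseries => [n _ _|n _]; [exact: measure_ge0|exact: De].
Qed.

Lemma inner_approx_closed C : measurable C -> closedC C -> inner_approx C.
Proof. by move=> mC cC e e0; exists C; split=> //; rewrite setDv measure0 lee_fin ltW. Qed.

Lemma inner_approx_bigcap (B : nat -> set T) : (forall n, measurable (B n)) ->
  (forall n, inner_approx (B n)) -> inner_approx (\bigcap_n B n).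
Proof.
move=> mB aB e e0.
have /choice[C hC] : forall n, exists C, [/\ measurable C, closedC C, C `<=` B n &
    (P (B n `\` C) <= (e / (2 ^ n.+1)%:R)%:E)%E].
  by move=> n; apply: aB; rewrite divr_gt0// ltr0n expn_gt0.
have mC n : measurable (C n) by have [] := hC n.
exists (\bigcap_n C n); split.
- exact: bigcapT_measurable.
- by apply: closedI => n; have [] := hC n.
- by move=> t Ct n _; have [_ _ h _] := hC n; apply: h; exact: Ct.
have mD n : measurable (B n `\` C n) by exact: measurableD.
apply: (@le_trans _ _ (P (\bigcup_n (B n `\` C n)))).
  apply: le_measure; rewrite ?inE//.
  - by apply: measurableD; exact: bigcapT_measurable.
  - exact: bigcupT_measurable.
  move=> t [Bt nCt]; apply: contrapT => h; apply: nCt => n _; apply: contrapT => nC.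
  by apply: h; exists n => //; split=> //; exact: Bt.
by apply: measure_bigcup_eps => // n; have [] := hC n.
Qed.

Lemma closed_finite_union (C : nat -> set T) N : (forall n, measurable (C n) /\ closedC (C n)) ->
  measurable (\big[setU/set0]_(n < N) C n) /\ closedC (\big[setU/set0]_(n < N) C n).
Proof.
move=> hC; split; first by apply: bigsetU_measurable => n _; have [] := hC n.
elim: N => [|N IH]; first by rewrite big_ord0.
by rewrite big_ord_recr /=; apply: closedU => //; have [] := hC N.
Qed.

(** Closed sets are stable under finite unions only, so the union is cut at N: half of e pays for
    the remainder, half for the errors of the single sets. *)
Lemma inner_approx_bigcup (B : nat -> set T) : (forall n, measurable (B n)) ->
  (forall n, inner_approx (B n)) -> inner_approx (\bigcup_n B n).
Proof.
move=> mB aB e e0; have e20 : 0 < e / 2 by rewrite divr_gt0.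
have /choice[C hC] : forall n, exists C, [/\ measurable C, closedC C, C `<=` B n &
    (P (B n `\` C) <= (e / 2 / (2 ^ n.+1)%:R)%:E)%E].
  by move=> n; apply: aB; rewrite divr_gt0// ltr0n expn_gt0.
have mC n : measurable (C n) by have [] := hC n.
have mD n : measurable (B n `\` C n) by exact: measurableD.
pose F N := \bigcup_n B n `\` \big[setU/set0]_(n < N) B n.
have mU : measurable (\bigcup_n B n) by exact: bigcupT_measurable.
have mF N : measurable (F N) by apply: measurableD => //; apply: bigsetU_measurable => n _.
have F0 : P (F N) @[N --> \oo] --> 0%E.
  rewrite -(measure0 P).
  rewrite (_ : set0 = \bigcap_N F N); last first.
    apply/esym/seteqP; split=> // t Ft; have [[n _ Bt] _] := Ft 0%N I.
    by have [_] := Ft n.+1 I; apply; rewrite big_ord_recr; right.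
  apply: nonincreasing_cvg_mu => //.
  - exact: (le_lt_trans (probability_le1 P (mF 0%N)) (ltry 1)).
  - exact: bigcapT_measurable.
  move=> N M NM; apply/subsetPset => t [Ut nB]; split=> // h; apply: nB.
  by move: h; rewrite -!bigcup_mkord => -[n /= nN Bn]; exists n => //=; exact: leq_trans nN NM.
have [N PN] : exists N, (P (F N) <= (e / 2)%:E)%E.
  have /fine_cvgP[fin /cvgrPdist_le/(_ _ e20) h] := F0.
  have [N [PfN hN]] := @filter_ex _ \oo _ _ (filterI fin h).
  exists N; rewrite -(fineK PfN) lee_fin; move: hN; rewrite /= sub0r normrN.
  by apply: le_trans; exact: ler_norm.
have [mCN cCN] := closed_finite_union N (fun n => conj (mC n) (let: And4 _ c _ _ := hC n in c)).
exists (\big[setU/set0]_(n < N) C n); split=> //.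
  move=> t; rewrite -bigcup_mkord => -[n _ Ct]; exists n => //.
  by have [_ _ h _] := hC n; exact: h.
apply: (@le_trans _ _ (P (F N `|` \bigcup_n (B n `\` C n)))).
  have mDU : measurable (\bigcup_n (B n `\` C n)) by exact: bigcupT_measurable.
  apply: le_measure; rewrite ?inE//; [exact: measurableD|exact: measurableU|].
  move=> t [Ut nC]; have [Bt|nB] := pselect ((\big[setU/set0]_(n < N) B n) t); last by left.
  right; move: Bt nC; rewrite -!bigcup_mkord => -[n nN Bt] nC; exists n => //; split=> // Ct.
  by apply: nC; exists n.
have mDU : measurable (\bigcup_n (B n `\` C n)) by exact: bigcupT_measurable.
apply: (le_trans (measureU2 P (mF N) mDU)).
rewrite [leRHS](_ : _ = (e / 2)%:E + (e / 2)%:E)%E; last by rewrite -EFinD -splitr.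
apply: leeD => //.
by apply: measure_bigcup_eps => // n; have [] := hC n.
Qed.

(** Approximability does not pass to complements, so the sigma-algebra consists of the sets that are
    approximable together with their complement. *)
Lemma inner_regular (G : set (set T)) : (forall A, G A -> [/\ measurable A, inner_approx A & inner_approx (~` A)]) ->
  forall B, <<s G >> B -> inner_approx B.
Proof.
move=> hG B; suff h : <<s G >> `<=` [set B | [/\ measurable B, inner_approx B & inner_approx (~` B)]].
  by move=> /h[].
apply: (@smallest_sub _ _ G [set B | [/\ measurable B, inner_approx B & inner_approx (~` B)]]) => //; split.
- by split=> //; rewrite ?setC0; exact: inner_approx_closed.
- by move=> A [mA aA aCA]; rewrite /= setTD; split; [exact: measurableC|by []|rewrite setCK].
- move=> A hA; have mA n : measurable (A n) by have [] := hA n.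
  split; first exact: bigcupT_measurable.
    by apply: inner_approx_bigcup => // n; have [] := hA n.
  rewrite setC_bigcup; apply: inner_approx_bigcap => n; last by have [] := hA n.
  exact: measurableC.
Qed.

End InnerRegularity.

(** * Transfer to the compound Poisson space *)

Section Transfer.
Context {R : realType} {d : nat} (E : set (R * 'rV[R]_d)%type).
Local Notation V := 'rV[R]_d.
Local Notation Z := (R * V)%type.
Hypothesis oE : open E.
Variable pi : probability (config_space E) R.
Hypothesis mSigma : measurable_fun setT (@Sigma R d E).
Implicit Types (gam : config_space E) (psi : Z -> R).

Variable b : nat -> Z -> R.
Hypothesis bP : forall n, test_on E (b n) /\ forall v, 0 <= b n v <= 1.
Hypothesis bB : forall x N, E x -> nbhs x N -> exists n, 0 < b n x /\ tsupp (b n) `<=` N.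

Variable U : set_system nat.
Context {UU : UltraFilter U}.
Hypothesis U_oo : \oo `<=` U.

Local Notation lonely := (lonely (E := E) b).
Local Notation closedC := (vague_closed (E := E) U).

Lemma measurable_eval (p : testfun V) :
  measurable_fun setT (fun w : distr_space V => (w : distribution V) p).
Proof.
move=> _ B mB; rewrite setTI; apply: sub_sigma_algebra.
by exists p, B.
Qed.

Lemma measurable_Sigma_eval (p : testfun V) :
  measurable_fun setT (fun gam : config_space E => (Sigma gam : distribution V) p).
Proof. exact: (measurableT_comp (measurable_eval p) mSigma). Qed.

Lemma measurable_le_sum psi a : test_on E psi ->
  measurable [set gam : config_space E | set_sum gam psi <= a].
Proof.
move=> tpsi; have mf := measurable_set_sum tpsi; have := mf measurableT _ (measurable_itv `]-oo, a]%R).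
by rewrite setTI; congr measurable; apply/funext => gam; rewrite /= in_itv.
Qed.

Lemma measurable_lonely i : measurable (lonely i : set (config_space E)).
Proof.
rewrite (_ : lonely i = \bigcap_j \bigcap_k [set gam : config_space E |
    base_set b j `<=` base_set b i -> base_set b k `<=` base_set b i ->
    base_set b j `&` base_set b k = set0 -> set_sum gam (b j) <= 0 \/ set_sum gam (b k) <= 0]); last first.
  by apply/seteqP; split=> [gam h j _ k _|gam h j k]; [exact: h|exact: h].
apply: bigcapT_measurable => j; apply: bigcapT_measurable => k.
have [ji|nji] := pselect (base_set b j `<=` base_set b i); last first.
  by rewrite (_ : [set gam | _] = setT)//; apply/seteqP; split=> // gam _ /nji.
have [ki|nki] := pselect (base_set b k `<=` base_set b i); last first.
  by rewrite (_ : [set gam | _] = setT)//; apply/seteqP; split=> // gam _ _ /nki.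
have [jk|njk] := pselect (base_set b j `&` base_set b k = set0); last first.
  by rewrite (_ : [set gam | _] = setT)//; apply/seteqP; split=> // gam _ _ _ /njk.
rewrite (_ : [set gam | _] = [set gam : config_space E | set_sum gam (b j) <= 0] `|`
    [set gam : config_space E | set_sum gam (b k) <= 0]).
  by apply: measurableU; apply: measurable_le_sum; have [] := bP j; have [] := bP k.
by apply/seteqP; split=> gam /=; [exact|move=> h _ _ _].
Qed.

(** A quantitative form of having no double points on the support of b_l. On a set of configurations
    with one n for each l, the neighbourhoods come from a finite list, so the ultrafilter selects
    one of them and limits exist: the set behaves as if relatively compact. *)
Definition isolating l n : set (config_space E) := [set gam |
  forall x, tsupp (b l) x -> exists2 i, (i < n)%N & base_set b i x /\ lonely i gam].

(** Whether base sets with indices in J cover the support does not depend on gam, and there are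
    finitely many J below n. *)
Lemma measurable_isolating l n : measurable (isolating l n).
Proof.
pose cov (J : {set 'I_n}) := forall x, tsupp (b l) x -> exists2 i, i \in J & base_set b i x.
rewrite (_ : isolating l n = \bigcup_(J in [set J | cov J])
    \bigcap_(i in [set i | i \in J]) (lonely (nat_of_ord i) : set (config_space E))).
  apply: fin_bigcup_measurable => // J _; apply: fin_bigcap_measurable => // i _.
  exact: measurable_lonely.
apply/seteqP; split=> [gam h|gam [J cJ hJ] x lx].
  exists [set i : 'I_n | `[< lonely i gam >]]%SET => /= [x lx|i]; last first.
    by rewrite /= finset.in_set => /asboolP.
  have [i lt_in [ix li]] := h x lx.
  by exists (Ordinal lt_in) => //; rewrite finset.in_set; apply/asboolP.
by have [i iJ ix] := cJ x lx; exists i => //; split=> //; exact: hJ.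
Qed.

Lemma lonely_exists gam x : E x -> exists i, base_set b i x /\ lonely i gam.
Proof.
move=> Ex; have [i0 [i0x _]] := bB Ex filterT.
have [_ cK KE] := (bP i0).1; have mp := mem_points gam _ cK KE.
have sep y : y \in [seq z <- points gam (tsupp (b i0)) | z != x] -> y != x.
  by rewrite mem_filter => /andP[].
have [de de0 sde] := seq_separated sep.
have [i [ix iN]] := base_nbhs bB Ex (filterI (nbhsx_ballx x _ de0) (base_set_nbhs bP i0x)).
exists i; split=> //; apply/(lonelyP bP bB) => y z gy gz iy iz.
suff at_x w : config_set gam w -> base_set b i w -> w = x by rewrite (at_x y)// (at_x z).
move=> gw iw; have [xw i0w] := iN w iw; apply/eqP; apply: contrapT => /negP wx.
have wK : tsupp (b i0) w by apply: subset_closure => /=; rewrite gt_eqF.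
have := sde w; rewrite mem_filter wx => /(_ ((mp w).2 (conj gw wK))).
by move: xw; rewrite -ball_normE /= distrC ltNge => /negP.
Qed.

Lemma isolating_exists l gam : exists n, isolating l n gam.
Proof.
have [_ cK KE] := (bP l).1.
pose O i : set Z := if `[< lonely i gam >] then base_set b i else set0.
have [i|x Kx|s sK] := @compact_cover_seq (Z : normedModType R) nat _ O cK.
- by rewrite /O; case: asboolP => _; [exact: (base_open bP)|exact: open0].
- have [i [ix li]] := lonely_exists gam (KE _ Kx).
  by exists i; rewrite /O asboolT.
exists (\max_(j <- s) j).+1 => x lx; have [i si] := sK x lx.
rewrite /O; case: asboolP => // li ix; exists i => //.
by rewrite ltnS; apply: (@leq_bigmax_seq _ _ _ (fun j => j)).
Qed.

Lemma isolating_approx l (e : R) : 0 < e -> exists n, (pi (~` isolating l n) <= e%:E)%E.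
Proof.
move=> e0; have mI n : measurable (~` isolating l n) by apply: measurableC; exact: measurable_isolating.
have F0 : pi (~` isolating l n) @[n --> \oo] --> 0%E.
  rewrite -(measure0 pi) (_ : set0 = \bigcap_n (~` isolating l n)); last first.
    apply/esym/seteqP; split=> // gam h; have [n hn] := isolating_exists l gam.
    exact: (h n I).
  apply: nonincreasing_cvg_mu => //.
  - exact: (le_lt_trans (probability_le1 pi (mI 0%N)) (ltry 1)).
  - exact: bigcapT_measurable.
  move=> n m nm; apply/subsetPset; apply: subsetC => gam h x lx.
  by have [i lt_in hi] := h x lx; exists i => //; exact: leq_trans lt_in nm.
have /fine_cvgP[fin /cvgrPdist_le/(_ _ e0) h] := F0.
have [N [PfN hN]] := @filter_ex _ \oo _ _ (filterI fin h).
exists N; rewrite -(fineK PfN) lee_fin; move: hN; rewrite /= sub0r normrN.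
by apply: le_trans; exact: ler_norm.
Qed.

Lemma config_inner_approx (B : set (config_space E)) : measurable B -> inner_approx pi closedC B.
Proof.
move=> mB; pose S := [set s : config_space E -> R | exists2 psi, test_on E psi &
  s = fun gam => set_sum gam psi].
have gen := @measurable_generated R d E oE S _ B mB.
apply: (@inner_regular _ _ _ pi closedC _ _ _ _ [set B | exists s a, S s /\ B = [set x | s x < a]]).
- exact: vague_closed0.
- by [].
- exact: vague_closedU.
- by move=> A_ hA; apply: vague_closedI.
- move=> A [s [a [[psi tpsi ->] ->]]].
  have mle c := measurable_le_sum c tpsi.
  have mlt : measurable [set gam : config_space E | set_sum gam psi < a].
    have mf := measurable_set_sum tpsi; have := mf measurableT _ (measurable_itv `]-oo, a[%R).
    by rewrite setTI; congr measurable; apply/funext => gam; rewrite /= in_itv.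
  split=> //.
    rewrite (_ : [set gam | _] = \bigcup_n [set gam : config_space E | set_sum gam psi <= a - n.+1%:R^-1]).
      apply: inner_approx_bigcup => //; first exact: vague_closed0.
        exact: vague_closedU.
      move=> n; apply: inner_approx_closed => //; exact: vague_closed_le.
    apply/seteqP; split=> [gam /= h|gam [n _ /= h]]; last first.
      by rewrite (le_lt_trans h)// ltrBlDr ltrDl invr_gt0.
    pose n := Num.trunc (a - set_sum gam psi)^-1; exists n => //=.
    rewrite lerBrDl -lerBrDr -[leRHS]invrK lef_pV2 ?posrE ?invr_gt0 ?subr_gt0//.
    by rewrite ltW// truncnS_gt.
  rewrite (_ : ~` _ = [set gam : config_space E | a <= set_sum gam psi]); last first.
    by apply/seteqP; split=> gam /=; rewrite leNgt => /negP.
  apply: inner_approx_closed; last exact: vague_closed_ge.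
  have mf := measurable_set_sum tpsi; have := mf measurableT _ (measurable_itv `[a, +oo[%R).
  by rewrite setTI; congr measurable; apply/funext => gam; rewrite /= in_itv/= andbT.
- apply: gen => chi tchi chi0; apply: generated_measurable_fun.
  by exists chi.
Qed.

Variable P : nat -> testfun V.

Definition ev j gam : R := (Sigma (gam : config_space E) : distribution V) (P j).

Lemma measurable_ev j : measurable_fun setT (ev j : config_space E -> R).
Proof. exact: measurable_Sigma_eval. Qed.

(** A closed set on which the pairings of [Sigma gam] with the P_j are continuous. In general they
    are only measurable in gam, since z.1 p(z.2) need not be compactly supported in [E]. *)
Definition tame (C : set (config E)) : Prop := forall g gam, U [set n | C (g n)] ->
  vague_limit U g gam -> C gam /\ forall j, ev j (g n) @[n --> U] --> ev j gam.

Lemma below_measurable j (q : R) : measurable [set gam : config_space E | ev j gam < q].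
Proof.
have mf := measurable_ev j; have := mf measurableT _ (measurable_itv `]-oo, q[%R).
by rewrite setTI; congr measurable; apply/funext => gam; rewrite /= in_itv.
Qed.

(** On F_k both A_k and its complement are relatively closed, since each agrees there with a closed
    set. As the A_k are the sublevel sets of all [ev j] at rational heights, the [ev j] are
    continuous on the intersection of the F_k. *)
Lemma lusin (G : set (config_space E)) (e : R) : measurable G -> 0 < e ->
  exists C : set (config_space E),
    [/\ measurable C, tame C, C `<=` G & (pi (G `\` C) <= (e + e)%:E)%E].
Proof.
move=> mG e0; have [C0 [mC0 cC0 C0G pC0]] := config_inner_approx mG e0.
pose A (k : nat) : set (config_space E) :=
  if unpickle k is Some (j, q) then [set gam | ev j gam < ratr (q : rat)] else set0.
have mA k : measurable (A k).
  by rewrite /A; case: unpickle => [[j q]|]//; exact: below_measurable.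
(* The halving accounts for the two approximations made for each k, from inside A_k and from inside
   its complement. *)
pose de k := e / 2 / (2 ^ k.+1)%:R.
have de0 k : 0 < de k by rewrite !divr_gt0// ltr0n expn_gt0.
have /choice[C1 hC1] := fun k => config_inner_approx (mA k) (de0 k).
have /choice[C2 hC2] := fun k => config_inner_approx (measurableC (mA k)) (de0 k).
pose F k := C1 k `|` C2 k.
have mF k : measurable (F k).
  by apply: measurableU; [have [] := hC1 k|have [] := hC2 k].
have mFI : measurable (\bigcap_k F k) by exact: bigcapT_measurable.
exists (C0 `&` \bigcap_k F k); split.
- exact: measurableI.
- move=> g gam Ug lg.
  have UF k : U [set n | F k (g n)] by apply: filterS Ug => n [_]; exact.
  have U1 k : U [set n | A k (g n)] -> A k gam.
    move=> UA; have [_ cC1 sC1 _] := hC1 k; apply: sC1; apply: cC1 lg.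
    apply: filterS2 UA (UF k) => n An [//|C2n].
    by have [_ _ sC2 _] := hC2 k; have := sC2 _ C2n.
  have U2 k : U [set n | ~ A k (g n)] -> ~ A k gam.
    move=> UA; have [_ cC2 sC2 _] := hC2 k; apply: sC2; apply: cC2 lg.
    apply: filterS2 UA (UF k) => n An [C1n|//].
    by have [_ _ sC1 _] := hC1 k; have := sC1 _ C1n.
  split.
    split; first by apply: cC0 lg; apply: filterS Ug => n [].
    move=> k _; have [UA|UA] := in_ultra_setVsetC [set n | A k (g n)] UU.
      left; have [_ cC1 _ _] := hC1 k; apply: cC1 lg.
      apply: filterS2 UA (UF k) => n An [//|C2n].
      by have [_ _ sC2 _] := hC2 k; have := sC2 _ C2n.
    right; have [_ cC2 _ _] := hC2 k; apply: cC2 lg.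
    apply: filterS2 UA (UF k) => n An [C1n|//].
    by have [_ _ sC1 _] := hC1 k; have := sC1 _ C1n.
  move=> j; apply/cvgrPdist_le => /= r r0.
  have [q1] := @rat_in_itvoo R (ev j gam - r) (ev j gam) ltac:(lra).
  have [q2] := @rat_in_itvoo R (ev j gam) (ev j gam + r) ltac:(lra).
  rewrite !in_itv /= => /andP[q2a q2b] /andP[q1a q1b].
  have AE q gam' : A (pickle (j, q)) gam' = (ev j gam' < ratr q).
    by rewrite /A pickleK.
  have V1 : U [set n | ~ A (pickle (j, q1)) (g n)].
    have [UA|//] := in_ultra_setVsetC [set n | A (pickle (j, q1)) (g n)] UU.
    by have := U1 _ UA; rewrite AE ltNge ltW.
  have V2 : U [set n | A (pickle (j, q2)) (g n)].
    have [//|UA] := in_ultra_setVsetC [set n | A (pickle (j, q2)) (g n)] UU.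
    by have := U2 _ UA; rewrite AE.
  apply: filterS2 V1 V2 => n; rewrite /= !AE => /negP; rewrite -leNgt => h1 h2.
  by rewrite ler_norml; apply/andP; split; lra.
- by move=> gam [/C0G].
have mD k : measurable (~` F k) by exact: measurableC.
have mU : measurable (\bigcup_k ~` F k) by exact: bigcupT_measurable.
apply: (@le_trans _ _ (pi ((G `\` C0) `|` \bigcup_k ~` F k))).
  apply: le_measure; rewrite ?inE//.
  - by apply: measurableD => //; exact: measurableI.
  - by apply: measurableU => //; exact: measurableD.
  move=> gam [Gg nC]; have [C0g|nC0] := pselect (C0 gam); last by left.
  by right; rewrite -setC_bigcap => h; apply: nC.
apply: (le_trans (measureU2 pi (measurableD mG mC0) mU)); rewrite EFinD; apply: leeD => //.
apply: measure_bigcup_eps => // k.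
have [m1 _ _ p1] := hC1 k; have [m2 _ _ p2] := hC2 k.
apply: (@le_trans _ _ (pi ((A k `\` C1 k) `|` (~` A k `\` C2 k)))).
  apply: le_measure; rewrite ?inE//.
    by apply: measurableU; apply: measurableD => //; exact: measurableC.
  move=> gam nF; have [Ag|nAg] := pselect (A k gam); [left|right]; split=> // h; apply: nF.
    by left.
  by right.
apply: (le_trans (measureU2 pi (measurableD (mA k) m1) (measurableD (measurableC (mA k)) m2))).
apply: le_trans (leeD p1 p2) _; rewrite -EFinD lee_fin /de -mulrDl.
by rewrite -splitr.
Qed.

Variable mucp : probability (distr_space V) R.
Hypothesis mucp_Sigma : forall A, measurable A -> mucp A = pi (@Sigma R d E @^-1` A).
Hypothesis P_separating : forall w w' : distribution V, (forall n, w (P n) = w' (P n)) -> w = w'.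

Definition rational_near n (x : nat -> R) (q : seq rat) : Prop :=
  forall j, (j < n)%N -> `|x j - ratr (nth 0 q j)| < n.+1%:R^-1.

Lemma rational_near_exists n x : exists q, rational_near n x q.
Proof.
have /choice[a ha] : forall j, exists a : rat, `|x j - ratr a| < n.+1%:R^-1.
  move=> j; have r0 : 0 < n.+1%:R^-1 :> R by rewrite invr_gt0.
  move: (n.+1%:R^-1 : R) r0 => r r0.
  have [a] := @rat_in_itvoo R (x j - r) (x j + r) ltac:(lra).
  by rewrite in_itv/= => a1; exists a; rewrite ltr_norml; lra.
exists (map a (iota 0 n)) => j jn; rewrite (nth_map 0%N) ?size_iota//.
by rewrite nth_iota//.
Qed.

(** The distributions whose sequence of pairings with the P_j lies in the closure, in the product
    topology, of those of [Sigma gam] for gam in [C]. Rational approximations make the construction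
    countable, hence measurable even where the image of [C] might not be. *)
Definition shadow (C : set (config_space E)) : set (distr_space V) :=
  \bigcap_n \bigcup_(q in [set q | exists2 gam, C gam & rational_near n (ev^~ gam) q])
    [set w : distr_space V | rational_near n (fun j => (w : distribution V) (P j)) q].

Lemma measurable_shadow C : measurable (shadow C).
Proof.
apply: bigcapT_measurable => n; rewrite bigcup_mkcond.
apply: countable_bigcupT_measurable => [|q]; first exact: countableP.
case: ifP => // _; rewrite (_ : [set w | _] = \bigcap_(j in `I_n)
  [set w : distr_space V | `|(w : distribution V) (P j) - ratr (nth 0 q j)| < n.+1%:R^-1]); last first.
  by apply/seteqP; split=> w h j; exact: h.
apply: bigcap_measurableType => j _.
have m1 : measurable_fun setT (fun w : distr_space V => `|(w : distribution V) (P j) - ratr (nth 0 q j)|).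
  apply: measurableT_comp => //; apply: measurable_funB => //; exact: measurable_eval.
have := m1 measurableT _ (measurable_itv `]-oo, n.+1%:R^-1[%R); rewrite setTI.
by congr measurable; apply/funext => w; rewrite /= in_itv.
Qed.

Lemma sub_shadow C : C `<=` @Sigma R d E @^-1` shadow C.
Proof.
move=> gam Cg n _; have [q hq] := rational_near_exists n (ev^~ gam).
by exists q => //; exists gam.
Qed.

(** Configurations of C' whose pairings approach those of w have a vague limit by isolation;
    tameness places it in [C] and makes the pairings converge, and the separating sequence
    identifies its image with w. The limit is sought in [C] because C' need not be closed. *)
Lemma shadow_sub (C C' : set (config_space E)) : tame C -> C' `<=` C ->
  (forall l, exists n, C' `<=` isolating l n) ->
  forall w, shadow C' w -> exists2 gam, C gam & Sigma gam = w.
Proof.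
move=> tC sC /choice[N CN] w Aw.
have /choice[g hg] : forall n, exists gam, C' gam /\
    forall j, (j < n)%N -> `|ev j gam - (w : distribution V) (P j)| <= 2 * n.+1%:R^-1.
  move=> n; have [q [gam Cg gq] wq] := Aw n I; exists gam; split=> // j jn.
  have := gq j jn; have := wq j jn; rewrite /=.
  move: (n.+1%:R^-1 : R) => r; rewrite !ltr_norml => /andP[? ?] /andP[? ?].
  by rewrite ler_norml; apply/andP; split; lra.
have g_lonely x : E x -> exists i, base_set b i x /\ U [set n | lonely i (g n)].
  move=> Ex; have [l [lx _]] := bB Ex filterT.
  have lx' : tsupp (b l) x by apply: subset_closure => /=; rewrite gt_eqF.
  have h n : exists2 i, (i < N l)%N & base_set b i x /\ lonely i (g n).
    by apply: (CN l (g n)) => //; have [] := hg n.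
  have [|i _ Ui] := @ultra_bounded_ex U UU (N l) (fun i => [set n | base_set b i x /\ lonely i (g n)]).
    exact: filterE.
  exists i; split; last by apply: filterS Ui => n [].
  by have [n []] := @filter_ex _ U _ _ Ui.
have [gam lg] : exists gam, vague_limit U g gam.
  by exists (limit_config bP bB g_lonely); exact: vague_limit_config.
have UC : U [set n | C (g n)] by apply: filterE => n; exact: sC (hg n).1.
have [Cg evg] := tC g gam UC lg.
exists gam => //; apply: P_separating => j.
have h1 : ev j (g n) @[n --> U] --> (w : distribution V) (P j).
  apply/cvgrPdist_le => /= e e0; apply: U_oo.
  have : \forall n \near \oo, 2 * n.+1%:R^-1 <= e.
    exists (Num.trunc (2 / e)) => //= n ne.
    rewrite ler_pdivrMr// mulrC -ler_pdivrMr// ltW// (lt_le_trans (truncnS_gt _))//.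
    by rewrite ler_nat ltnS.
  move=> h; apply: filterS2 h (nbhs_infty_gt j) => n ne jn.
  by rewrite distrC (le_trans ((hg n).2 j jn)).
exact: (cvg_unique _ (evg j) h1).
Qed.

(** Measurable sets inside the image of [G] are found with complement of measure at most 3e: e + e
    lost in [lusin] and e in the isolation. The intersection of their complements is a measurable
    null set. *)
Lemma ae_image (G : set (config_space E)) : measurable G -> pi (~` G) = 0%E ->
  {ae mucp, forall w, exists2 gam, G gam & Sigma gam = w}.
Proof.
move=> mG G0.
have approx (e : R) : 0 < e -> exists A : set (distr_space V), [/\ measurable A,
    (mucp (~` A) <= (e + e + e)%:E)%E & forall w, A w -> exists2 gam, G gam & Sigma gam = w].
  move=> e0; have [C [mC tC CG pC]] := lusin mG e0.
  have /choice[N hN] : forall l, exists n, (pi (~` isolating l n) <= (e / (2 ^ l.+1)%:R)%:E)%E.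
    by move=> l; apply: isolating_approx; rewrite divr_gt0// ltr0n expn_gt0.
  have mI l : measurable (isolating l (N l)) by exact: measurable_isolating.
  have mIU : measurable (\bigcup_l ~` isolating l (N l)).
    by apply: bigcupT_measurable => l; exact: measurableC.
  pose C' := C `&` \bigcap_l isolating l (N l).
  have mC' : measurable C' by apply: measurableI => //; exact: bigcapT_measurable.
  exists (shadow C'); split; first exact: measurable_shadow.
    rewrite mucp_Sigma; last by apply: measurableC; exact: measurable_shadow.
    apply: (@le_trans _ _ (pi ((~` G `|` (G `\` C)) `|` \bigcup_l ~` isolating l (N l)))).
      apply: le_measure; rewrite ?inE//.
      - have := mSigma measurableT (measurableC (measurable_shadow C')).
        by rewrite setTI.
      - by apply: measurableU => //; apply: measurableU; [exact: measurableC|exact: measurableD].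
      move=> gam nA; have nC' : ~ C' gam by move=> /sub_shadow.
      have [Gg|] := pselect (G gam); last by left; left.
      have [Cg|nC] := pselect (C gam); last by left; right.
      by right; rewrite -setC_bigcap => h; apply: nC'.
    apply: (le_trans (measureU2 pi (measurableU _ _ (measurableC mG) (measurableD mG mC)) mIU)).
    rewrite [leRHS]EFinD; apply: leeD; last first.
      by apply: measure_bigcup_eps => // l; exact: measurableC.
    apply: (le_trans (measureU2 pi (measurableC mG) (measurableD mG mC))).
    have G0' : (pi (~` G) <= 0)%E by rewrite G0.
    by apply: (le_trans (leeD G0' pC)); rewrite add0e.
  move=> w /(shadow_sub tC) [//|l|gam Cg <-]; first by move=> gam [].
    by exists (N l) => gam [_ h]; exact: h.
  by exists gam => //; exact: CG.
have e0 n : 0 < n.+1%:R^-1 :> R by rewrite invr_gt0.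
have /choice[A hA] := fun n => approx _ (e0 n).
have mA n : measurable (A n) by have [] := hA n.
have mN : measurable (\bigcap_n ~` A n) by apply: bigcapT_measurable => n; exact: measurableC.
exists (\bigcap_n ~` A n); split=> //.
  apply/eqP; rewrite eq_le measure_ge0 andbT; apply/lee_addgt0Pr => e e_0; rewrite add0e.
  (* The factor 3 matches the three errors 1/(n+1) in the bound for A_n. *)
  pose n := Num.trunc (3 / e).
  have ne : n.+1%:R^-1 + n.+1%:R^-1 + n.+1%:R^-1 <= e.
    rewrite (_ : _ + _ = 3 * n.+1%:R^-1); last by ring.
    by rewrite ler_pdivrMr// mulrC -ler_pdivrMr// ltW// truncnS_gt.
  apply: (@le_trans _ _ (mucp (~` A n))).
    apply: le_measure; rewrite ?inE//; first exact: measurableC.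
    by move=> w h; exact: h.
  by have [_ h _] := hA n; apply: le_trans h _; rewrite lee_fin.
by move=> w nw n _ An; have [_ _ h] := hA n; apply: nw; exact: h.
Qed.

End Transfer.

(** * Inverting Sigma, and the representation formula *)

Section Inversion.
Context {R : realType} {d : nat} (E : set (R * 'rV[R]_d)%type).
Local Notation V := 'rV[R]_d.
Local Notation Z := (R * V)%type.

(** The indicator of the box is dominated by a test function that is at least 1 there, whose pairing
    converges absolutely by definition of [is_Sigma]. *)
Lemma is_Sigma_summable (gam : config E) (w : distribution V) m :
  is_Sigma gam w -> abs_summable gam (fun z : Z => z.1 * \1_(cbox m) z.2).
Proof.
move=> gw; have [p [tp p0 p1]] := test_majorant (row_coordinates d) (@openT V)
  (@cbox_compact R d m) (@subsetT _ _).
have [sp _] := gw (Testfun tp).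
apply: (abs_summable_le _ sp) => z _ /=; rewrite !normrM ler_wpM2l//.
rewrite (ger0_norm (p0 _)) indicE.
by have [/set_mem /p1|] := boolP (z.2 \in _); rewrite ?normr1// normr0.
Qed.

Lemma Sigma_invE (gam : config_space E) (w : distr_space V) : config_hat gam ->
  is_Sigma gam w -> Sigma_inv E w = gam.
Proof.
move=> hg gw; rewrite /Sigma_inv; case: xgetP => [gam' _ [hg' gw']|/(_ gam)]; last first.
  by move=> h; exfalso; exact: h.
have s m := is_Sigma_summable m gw; have s' m := is_Sigma_summable m gw'.
apply: config_eq; apply/seteqP; split.
  exact: (Sigma_config_sub s' s hg' hg gw' gw).
exact: (Sigma_config_sub s s' hg hg' gw gw').
Qed.

Lemma cpart_set_csum (A : set Z) (f : Z -> R[i]) b :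
  cpart b (set_csum A f) = set_sum A (fun z => cpart b (f z)).
Proof. by case: b. Qed.

End Inversion.

Unset Implicit Arguments.
Set Strict Implicit.

Theorem proposition3p13 (R : realType) (d : nat)
  (rho : {sigma_finite_measure set R -> \bar R})
  (rho_moments : finite_moments rho)
  (rho0 : rho [set 0] = 0%E)
  (sigma : {sigma_finite_measure set 'rV[R]_d -> \bar R})
  (sigma_radon : radon sigma)
  (sigma_nonatomic : nonatomic sigma)
  (pi : probability (config_space (state_space (d := d) rho)) R)
  (pi_poisson : is_poisson (sprod rho sigma) pi)
  (mucp : probability (distr_space 'rV[R]_d) R)
  (mucp_laplace : cp_laplace rho sigma mucp)
  (mucp_image : is_image_Sigma pi mucp)
  (phi : R * 'rV[R]_d -> R)
  (phi_test : test_on setT phi)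
  (phi_integrable : rho setT = +oo%E ->
     (sprod rho sigma).-integrable setT (EFin \o phi))
  (g : distr_space 'rV[R]_d -> R[i])
  (g_L2 : inL2 mucp g)
  (g_dom : dom_chaos_creation (sprod rho sigma) pi phi
             (U_Sigma (E := state_space rho) g)) :
  (exists k, poisson_creation (sprod rho sigma) pi phi (U_Sigma g) k) /\
  (forall k, poisson_creation (sprod rho sigma) pi phi (U_Sigma g) k ->
     {ae mucp, forall w : distr_space 'rV[R]_d,
        U_Sigma_inv k w =
        set_csum (Sigma_inv (state_space rho) w)
          (fun z => g (subdirac w z.1 z.2) * (phi z)%:C)
        - g w * (\int[sprod rho sigma]_z phi z)%R%:C}).
Proof.
have oE := @open_state_space R d rho.
have muK := state_compact_finite rho_moments sigma_radon.
have muE := state_complement_null rho0 sigma.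
have iphi := state_test_integrable rho_moments sigma_radon phi_test phi_integrable.
split; first exact: (creation_exists oE muK muE pi_poisson iphi g_dom).
move=> k hk.
have hkM := creation_mecke_value oE muK muE pi_poisson iphi hk.
have aeS := ae_summable oE muK muE pi_poisson (sigma_cbox sigma_radon) (first_moment rho_moments).
have aeH := ae_config_hat oE muK muE pi_poisson rho0 (sigma_singleton sigma_nonatomic).
(* All exceptional events are put into one measurable null set N, because [ae_image] needs a
   measurable set of full measure. *)
have [N [mN N0 NP]] : {ae pi, forall gam : config_space (state_space rho),
    [/\ forall b, cpart b (k gam) = mecke_creation (sprod rho sigma) phi (fun gam => cpart b (U_Sigma g gam)) gam,
      forall m, abs_summable gam (fun z => z.1 * \1_(cbox m) z.2) & config_hat gam]}.
  apply: filterS2 (filterI (hkM true) (hkM false)) (filterI aeS aeH) => gam [h1 h2] [h3 h4].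
  by split=> // -[].
have [b [bP bB]] := test_base_exists state_coordinates oE.
have [U [UU U_oo]] := @ultraFilterLemma nat \oo _.
have [P P_sep] := @distribution_separating R d.
have [mSigma imSigma] := mucp_image.
have G0 : pi (~` ~` N) = 0%E by rewrite setCK.
have := @ae_image R d _ oE pi mSigma b bP bB U UU U_oo P mucp imSigma P_sep _ (measurableC mN) G0.
apply: filterS => w [gam nN Sw].
have [kE sg hg] : [/\ forall b, cpart b (k gam) = mecke_creation (sprod rho sigma) phi (fun gam => cpart b (U_Sigma g gam)) gam,
    forall m, abs_summable gam (fun z => z.1 * \1_(cbox m) z.2) & config_hat gam].
  by apply: contrapT => h; apply: nN; exact: NP.
have [w0 gw0] := Sigma_exists sg.
(* Summability over boxes ensures that [Sigma gam] is the actual sum and not its default value. *)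
have gw : is_Sigma gam w by rewrite -Sw (SigmaE gw0).
rewrite /U_Sigma_inv /= (Sigma_invE hg gw); apply: cpart_eq => c.
rewrite kE /mecke_creation cpartB cpart_set_csum cpartMr mulrC /U_Sigma /= Sw; congr (_ - _).
apply: eq_set_sum => z gz; rewrite /palm /= cpartMr mulrC.
by rewrite (SigmaE (is_Sigma_rem gz gw)).
Qed.
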